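(* Consider a boundary controlled and observed (BCO) stochastic system $$d\varepsilon(t)=\mathcal{A}\varepsilon(t)dt+H\,dw(t),\quad\varepsilon(0)=\varepsilon_0,\qquad u(t)=\mathcal{B}\varepsilon(t),\qquad y(t)=\mathcal{C}\varepsilon(t),$$ as defined in the context. Then, for every input $u\in C^2_{\mathbb{F}}([0,T];\mathbb{K}^m)$ and every initial condition $\varepsilon_0\in D(\mathcal{A})$ with $u(0)=\mathcal{B}\varepsilon_0$, the stochastic differential equation $$dX(t)=AX(t)dt-B\dot u(t)dt+\mathcal{A}Bu(t)dt+H\,dw(t),\qquad X(0)=X_0:=\varepsilon_0-Bu(0),$$ admits a unique weak solution, given by $$X(t)=T(t)X_0+\int_0^tT(t-s)\big(\mathcal{A}Bu(s)-B\dot u(s)\big)ds+\int_0^tT(t-s)H\,dw(s).$$ In particular (this $X$ being almost surely integrable), the mild and weak solutions coincide.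
   Context: Let $\mathbb{K}\in\{\mathbb{R},\mathbb{C}\}$, $T>0$, and let $(\Omega,\mathcal{F},\mathbb{F}=(\mathcal{F}_t)_{t\ge0},\mathbb{P})$ be a complete filtered probability space with right-continuous filtration. The state space is $\mathcal{X}=L^2([a,b];\mathbb{K}^n)$ with inner product $\langle\varepsilon_1,\varepsilon_2\rangle_{\mathcal{X}}=\frac12\int_a^b\varepsilon_2^*(\zeta)\mathcal{H}(\zeta)\varepsilon_1(\zeta)d\zeta$, where $\mathcal{H}\in L^\infty([a,b];\mathbb{K}^{n\times n})$ is self-adjoint with $m_0I\le\mathcal{H}(\zeta)\le M_0I$ for constants $m_0,M_0>0$. A BCO stochastic system is given by unbounded linear operators $\mathcal{A}:D(\mathcal{A})\to\mathcal{X}$, $\mathcal{B}:D(\mathcal{B})\to\mathbb{K}^m$, $\mathcal{C}:D(\mathcal{C})\to\mathbb{K}^p$ with $D(\mathcal{A})\subset D(\mathcal{B})\subset\mathcal{X}$, such that: 1. $A:=\mathcal{A}|_{D(A)}$, $D(A)=D(\mathcal{A})\cap\ker\mathcal{B}$, generates a $C_0$-semigroup $(T(t))_{t\ge0}$ on $\mathcal{X}$; 2. there is $B\in\mathcal{L}(\mathbb{K}^m,\mathcal{X})$ with $Bu\in D(\mathcal{A})$ and $\mathcal{B}Bu=u$ for all $u\in\mathbb{K}^m$, and $\mathcal{A}B\in\mathcal{L}(\mathbb{K}^m,\mathcal{X})$; 3. $\mathcal{C}\in\mathcal{L}(D(A),\mathbb{K}^p)$, $D(A)$ with the graph norm of $A$;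 4. $w$ is a Wiener process on a separable Hilbert space $Z$ (adapted to $\mathbb{F}$, with increments $w(t)-w(s)$, $t\ge s$, independent of $\mathcal F_s$ and distributed as $\mathcal N(0,(t-s)Q)$), with symmetric, nonnegative covariance operator $Q\in\mathcal L(Z)$, $\mathrm{Tr}[Q]<\infty$, and $H\in\mathcal{L}(Z,\mathcal{X})$ satisfies $\|H\|^2_{L_2^0}:=\mathrm{Tr}[HQH^*]<\infty$. The initial condition $\varepsilon_0$ is an $\mathcal{F}_0$-measurable $\mathcal{X}$-valued Gaussian random variable independent of $w$; ''$\varepsilon_0\in D(\mathcal{A})$'' means it takes values in $D(\mathcal{A})$. $C^2_{\mathbb{F}}([0,T];\mathbb{K}^m)$ is the set of $\mathbb{F}$-adapted processes $u$ with time derivative $\dot u$ such that $s\mapsto\mathbb{E}\|u(s)\|^2$ and $s\mapsto\mathbb{E}\|\dot u(s)\|^2$ are continuous on $[0,T]$. Weak solution: an $\mathcal{X}$-valued process $(X(t))_{t\in[0,T]}$ whose trajectories are $\mathbb{P}$-a.s. Bochner integrable and such that for all $z\in D(A^* )$ and $t\in[0,T]$, $\mathbb{P}$-a.s., $$\langle X(t),z\rangle_{\mathcal{X}}=\langle X_0,z\rangle_{\mathcal{X}}+\int_0^t\big[\langle X(s),A^*z\rangle_{\mathcal{X}}+\langle\mathcal{A}Bu(s)-B\dot u(s),z\rangle_{\mathcal{X}}\big]ds+\langle Hw(t),z\rangle_{\mathcal{X}}.$$ Mild solution: an $\mathbb{F}$-adapted process $X\in C([0,T];L^2(\Omega;\mathcal{X}))$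 with $\int_0^T\|X(s)\|^2_{\mathcal{X}}ds<\infty$ $\mathbb{P}$-a.s. satisfying the displayed integral formula for $X(t)$ for all $t\in[0,T]$.
   Formalization: Weak and mild solutions are required to be jointly measurable processes on [0,T]×Ω (so uniqueness, up to modification, and the coincidence are among such processes); for arbitrary processes with a.s. Bochner integrable trajectories uniqueness fails. *)

(* Defs.v *)
From HB Require Import structures.
From mathcomp Require Import all_boot all_order all_algebra.
From mathcomp Require Import all_classical all_reals all_analysis measurable_realfun.
From mathcomp Require Import complex ring_quotient generic_quotient.
From mathcomp Require Import ring.

Set Implicit Arguments.
Unset Strict Implicit.
Unset Printing Implicit Defensive.

Import Order.TTheory GRing.Theory Num.Theory.
Import numFieldNormedType.Exports.

Local Open Scope classical_set_scope.
Local Open Scope ring_scope.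

Variant RorC := RealField | ComplexField.

Definition scal (R : realType) (k : RorC) : numFieldType :=
  match k with RealField => R | ComplexField => (R[i])%type end.

Section Scalars.
Variable R : realType.

Definition reK (k : RorC) : scal R k -> R :=
  match k return scal R k -> R with RealField => fun x => x | ComplexField => fun z => complex.Re z end.

Definition imK (k : RorC) : scal R k -> R :=
  match k return scal R k -> R with RealField => fun=> 0 | ComplexField => fun z => complex.Im z end.

Definition conjK (k : RorC) : scal R k -> scal R k :=
  match k return scal R k -> scal R k with RealField => fun x => x | ComplexField => fun z => conjc z end.

Definition ofR (k : RorC) : R -> scal R k :=
  match k return R -> scal R k with RealField => fun x => x | ComplexField => fun x => Complex x 0 end.

Definition intK (k : RorC) d (T : measurableType d)
    (mu : {measure set T -> \bar R}) (D : set T) (f : T -> scal R k) : scal R k :=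
  match k return (T -> scal R k) -> scal R k with
  | RealField => fun f => Rintegral mu D f
  | ComplexField => fun f =>
      Complex (Rintegral mu D (fun x => complex.Re (f x)))
              (Rintegral mu D (fun x => complex.Im (f x)))
  end f.

End Scalars.

Arguments ofR {R} k.
Arguments conjK {R k}.

(* A K-vector space with a K-valued form.  The axioms of an inner product,
   linear in its first argument, are imposed by [hilbert] below. *)
Record ipSpace (R : realType) (k : RorC) := IpSpace {
  ip_car :> lmodType (scal R k) ;
  ip : ip_car -> ip_car -> scal R k }.

Arguments ip {R k i} _ _.

Section InnerProduct.
Variables (R : realType) (k : RorC).
Implicit Types V W : ipSpace R k.

Definition sqnrm V (x : V) : R := reK (ip x x).

Definition nrm V (x : V) : R := Num.sqrt (sqnrm x).

Record hilbert V : Prop := {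
  hilbert_linear : forall (c : scal R k) (x y z : V),
    ip (c *: x + y) z = c * ip x z + ip y z ;
  hilbert_conj : forall x y : V, ip y x = conjK (ip x y) ;
  hilbert_ge0 : forall x : V, 0 <= reK (ip x x) ;
  hilbert_eq0 : forall x : V, ip x x = 0 -> x = 0 ;
  hilbert_complete : forall v : nat -> V,
    (forall e : R, 0 < e -> exists N, forall i j,
       (N <= i)%N -> (N <= j)%N -> nrm (v i - v j) < e) ->
    exists l : V, (fun i => nrm (v i - l)) @ \oo --> (0 : R) }.

Definition separable V : Prop :=
  exists v : nat -> V, forall (x : V) (e : R), 0 < e ->
    exists i, nrm (x - v i) < e.

Definition bounded_linear V W (f : V -> W) : Prop :=
  linear f /\ exists M : R, forall x, nrm (f x) <= M * nrm x.

(* The Hilbert-space adjoint, unique whenever it exists (in particular for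
   bounded f between Hilbert spaces). *)
Definition adjoint V W (f : V -> W) : W -> V :=
  xget (fun=> 0) [set g | forall x y, ip (f x) y = ip x (g y)].

Definition orthonormal_basis V (D : set nat) (e : nat -> V) : Prop :=
  (forall i j, D i -> D j -> ip (e i) (e j) = (i == j)%:R) /\
  (forall x : V, (forall i, D i -> ip x (e i) = 0) -> x = 0).

(* For self-adjoint nonnegative S the sum does not depend on the orthonormal
   basis; the supremum only selects this common value. *)
Definition trace V (S : V -> V) : \bar R :=
  ereal_sup [set (\esum_(i in De.1) (reK (ip (S (De.2 i)) (De.2 i)))%:E)%E
            | De in [set De : set nat * (nat -> V) | orthonormal_basis De.1 De.2]].

Definition ip_open V (U : set V) : Prop :=
  forall x, U x -> exists2 e : R, 0 < e & forall y, nrm (y - x) < e -> U y.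

Definition borel V : set (set V) := <<s [set U : set V | ip_open U] >>.

End InnerProduct.

Section EuclideanSpace.
Variables (R : realType) (k : RorC) (n : nat).

Definition euclid_ip (x y : 'cV[scal R k]_n) : scal R k :=
  \sum_(i < n) x i 0 * conjK (y i 0).

Definition euclid : ipSpace R k := IpSpace euclid_ip.

End EuclideanSpace.

Arguments euclid R k n : clear implicits.

Section ScalarFacts.
Variables (R : realType) (k : RorC).

Fact reKD (x y : scal R k) : reK (x + y) = reK x + reK y.
Proof. by case: k x y => //= -[x1 x2] [y1 y2]. Qed.

Fact imKD (x y : scal R k) : imK (x + y) = imK x + imK y.
Proof. by case: k x y => /= [x y|[x1 x2] [y1 y2]]; rewrite ?addr0. Qed.

Fact reKM (x y : scal R k) : reK (x * y) = reK x * reK y - imK x * imK y.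
Proof. by case: k x y => /= [x y|[x1 x2] [y1 y2]]; rewrite ?mul0r ?subr0. Qed.

Fact imKM (x y : scal R k) : imK (x * y) = reK x * imK y + imK x * reK y.
Proof. by case: k x y => /= [x y|[x1 x2] [y1 y2]]; rewrite ?mulr0 ?mul0r ?addr0. Qed.

Fact reK0 : reK (0 : scal R k) = 0. Proof. by case: k. Qed.

Fact imK0 : imK (0 : scal R k) = 0. Proof. by case: k. Qed.

Fact reK_conj (x : scal R k) : reK (conjK x) = reK x.
Proof. by case: k x => //= -[]. Qed.

Fact imK_conj (x : scal R k) : imK (conjK x) = - imK x.
Proof. by case: k x => /= [x|[]//]; rewrite oppr0. Qed.

Fact sqnrm_euclid n (x : euclid R k n) :
  sqnrm x = \sum_(i < n) (reK ((x : 'cV_n) i 0) ^+ 2 + imK ((x : 'cV_n) i 0) ^+ 2).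
Proof.
rewrite /sqnrm /= /euclid_ip.
rewrite (big_morph (@reK R k) reKD reK0); apply: eq_bigr => i _.
by rewrite reKM reK_conj imK_conj mulrN opprK !expr2.
Qed.

End ScalarFacts.

(* The weighted space L^2([a, b]; K^n): classes, modulo equality almost
   everywhere on [a, b], of functions on the line that are measurable and square
   integrable on [a, b]. *)
Section SquareIntegrable.
Variables (R : realType) (k : RorC) (a b : R) (n : nat).
Local Notation K := (scal R k).
Local Notation I := (`[a, b]%classic : set R).
Local Notation mu := (@lebesgue_measure R).

Definition square_integrable (f : R -> 'cV[K]_n) : Prop :=
  (forall i, measurable_fun I (fun x => reK (f x i 0)) /\
             measurable_fun I (fun x => imK (f x i 0))) /\
  (\int[mu]_(x in I) (sqnrm (f x : euclid R k n))%:E < +oo)%E.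

Definition L2fun_pred : {pred R -> 'cV[K]_n} := fun f => `[< square_integrable f >].

Fact L2fun_submod_closed : submod_closed L2fun_pred.
Proof.
have mI : measurable I by exact: measurable_itv.
have msq (f : R -> 'cV[K]_n) :
    (forall i, measurable_fun I (fun x => reK (f x i 0)) /\
               measurable_fun I (fun x => imK (f x i 0))) ->
    measurable_fun I (fun x => (sqnrm (f x : euclid R k n))%:E).
  move=> mf; apply/measurable_EFinP.
  apply: (eq_measurable_fun (fun x => \sum_(i < n)
    (reK (f x i 0) ^+ 2 + imK (f x i 0) ^+ 2))).
    by move=> x _; rewrite sqnrm_euclid.
  apply: measurable_sum => i; apply: measurable_funD; apply: measurable_funX;
    by case: (mf i).
have sq0 (v : 'cV[K]_n) : (0%R <= (sqnrm (v : euclid R k n))%:E)%E.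
  by rewrite lee_fin sqnrm_euclid sumr_ge0// => i _; rewrite addr_ge0// sqr_ge0.
split.
  apply/asboolP; split.
    move=> i; split.
      rewrite [X in measurable_fun _ X](_ : _ = cst 0)//.
      by apply/funext => x; rewrite fctE mxE reK0.
    rewrite [X in measurable_fun _ X](_ : _ = cst 0)//.
    by apply/funext => x; rewrite fctE mxE imK0.
  rewrite (eq_integral (cst 0%E)) ?integral0// => x _.
  by rewrite sqnrm_euclid big1// => i _; rewrite mxE reK0 imK0 expr0n addr0.
move=> c f g /asboolP[mf If] /asboolP[mg Ig]; apply/asboolP.
have mh i : measurable_fun I (fun x => reK ((c *: f + g) x i 0)) /\
            measurable_fun I (fun x => imK ((c *: f + g) x i 0)).
  have [mrf mif] := mf i; have [mrg mig] := mg i.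
  split.
    apply: (eq_measurable_fun
      (fun x => reK c * reK (f x i 0) - imK c * imK (f x i 0) + reK (g x i 0))).
      by move=> x _; rewrite !fctE !mxE reKD reKM.
    apply: measurable_funD => //; apply: measurable_funB; exact: measurable_funM.
  apply: (eq_measurable_fun
    (fun x => reK c * imK (f x i 0) + imK c * reK (f x i 0) + imK (g x i 0))).
    by move=> x _; rewrite !fctE !mxE imKD imKM.
  apply: measurable_funD => //; apply: measurable_funD; exact: measurable_funM.
split => //.
pose C := 2 * (reK c ^+ 2 + imK c ^+ 2).
have C0 : 0 <= C by rewrite mulr_ge0// addr_ge0// sqr_ge0.
have bnd x : ((sqnrm ((c *: f + g) x : euclid R k n))%:E <=
    C%:E * (sqnrm (f x : euclid R k n))%:E + 2%:E * (sqnrm (g x : euclid R k n))%:E)%E.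
  rewrite -!EFinM -EFinD lee_fin !sqnrm_euclid !mulr_sumr -big_split/=.
  apply: ler_sum => i _; rewrite !fctE !mxE reKD imKD reKM imKM.
  set A := reK c; set B := imK c; set p := reK _; set q := imK _.
  set r := reK _; set s := imK _; rewrite /C -/A -/B.
  rewrite -subr_ge0.
  have -> : 2 * (A ^+ 2 + B ^+ 2) * (p ^+ 2 + q ^+ 2) + 2 * (r ^+ 2 + s ^+ 2) -
    ((A * p - B * q + r) ^+ 2 + (A * q + B * p + s) ^+ 2) =
    (A * p - B * q - r) ^+ 2 + (A * q + B * p - s) ^+ 2 by ring.
  by rewrite addr_ge0// sqr_ge0.
apply: (@le_lt_trans _ _ (\int[mu]_(x in I) (C%:E * (sqnrm (f x : euclid R k n))%:E
    + 2%:E * (sqnrm (g x : euclid R k n))%:E))%E).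
  apply: ge0_le_integral => //.
  - exact: (msq _ mh).
  - by apply: emeasurable_funD; apply: measurable_funeM; [exact: (msq _ mf)|exact: (msq _ mg)].
rewrite ge0_integralD//; last 4 first.
- by move=> x _; apply: mule_ge0.
- apply: measurable_funeM; exact: (msq _ mf).
- by move=> x _; apply: mule_ge0.
- apply: measurable_funeM; exact: (msq _ mg).
rewrite !ge0_integralZl//; [|exact: (msq _ mg)|exact: (msq _ mf)].
by rewrite lte_add_pinfty// lte_mul_pinfty.
Qed.

HB.instance Definition _ :=
  GRing.isSubmodClosed.Build K (R -> 'cV[K]_n) L2fun_pred L2fun_submod_closed.

Record L2fun := MkL2fun { L2fun_val :> R -> 'cV[K]_n ; _ : L2fun_val \in L2fun_pred }.

HB.instance Definition _ := [isSub for L2fun_val].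
HB.instance Definition _ := [Choice of L2fun by <:].
HB.instance Definition _ := [SubChoice_isSubLmodule of L2fun by <:].

Definition L2null : {pred L2fun} :=
  fun f => `[< L2fun_val f = cst 0 %[ae mu in I] >].

Fact L2null_zmod_closed : zmod_closed L2null.
Proof.
have FF := ae_filter_ringOfSetsType mu.
split; first by apply/asboolP; apply: filterE => x _.
move=> f g /asboolP f0 /asboolP g0; apply/asboolP.
apply: (filterS2 FF _ f0 g0) => x fx gx Ix.
by rewrite /= [LHS](_ : _ = L2fun_val f x - L2fun_val g x)// fx// gx// subr0.
Qed.

HB.instance Definition _ := GRing.isZmodClosed.Build L2fun L2null L2null_zmod_closed.

Definition L2 : Type := Quotient.quot L2null.

HB.instance Definition _ := GRing.Zmodule.on L2.

Definition L2class (f : L2fun) : L2 := (\pi_(Quotient.quot L2null) f)%qT.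

Definition L2repr (x : L2) : L2fun := repr (x : Quotient.quot L2null).

Definition L2scale (c : K) (x : L2) : L2 := L2class (c *: L2repr x).

Fact L2reprK x : L2class (L2repr x) = x. Proof. exact: reprK. Qed.

Fact L2classD f g : L2class (f + g) = L2class f + L2class g.
Proof. exact: (Quotient.pi_add L2null f g). Qed.

Fact L2classP f g : reflect (L2class f = L2class g) (f - g \in L2null).
Proof. by rewrite Quotient.idealrBE; exact: eqP. Qed.

Fact L2classZ c f : L2class (c *: f) = L2scale c (L2class f).
Proof.
apply/L2classP; rewrite -scalerBr.
have /L2classP : L2class f = L2class (L2repr (L2class f)) by rewrite L2reprK.
move=> /asboolP f0; apply/asboolP.
apply: (filterS (F := almost_everywhere mu) _ f0) => x fx Ix.
by rewrite /= [LHS](_ : _ = c *: L2fun_val (f - L2repr (L2class f)) x)// fx// scaler0.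
Qed.

Fact L2scaleA c d x : L2scale c (L2scale d x) = L2scale (c * d) x.
Proof. by rewrite -[x]L2reprK -!L2classZ scalerA. Qed.

Fact L2scale1 x : L2scale 1 x = x.
Proof. by rewrite -[x]L2reprK -!L2classZ scale1r. Qed.

Fact L2scaleDr : right_distributive L2scale +%R.
Proof.
move=> c x y; rewrite -[x]L2reprK -[y]L2reprK.
by rewrite -L2classD -!L2classZ -L2classD scalerDr.
Qed.

Fact L2scaleDl x : {morph L2scale^~ x : c d / c + d}.
Proof. by move=> c d; rewrite -[x]L2reprK -!L2classZ -L2classD scalerDl. Qed.

HB.instance Definition _ :=
  GRing.Zmodule_isLmodule.Build K L2 L2scaleA L2scale1 L2scaleDr L2scaleDl.

(* The value does not depend on the representatives. *)
Definition energy_ip (Hm : R -> 'M[K]_n) (x y : L2) : K :=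
  ofR k 2^-1 * intK mu I
    (fun z => ((map_mx conjK (L2repr y z))^T *m Hm z *m L2repr x z) 0 0).

Definition energy_space (Hm : R -> 'M[K]_n) : ipSpace R k :=
  IpSpace (energy_ip Hm).

Record energy_density (m0 M0 : R) (Hm : R -> 'M[K]_n) : Prop := {
  energy_density_measurable : forall i j,
    measurable_fun I (fun z => reK (Hm z i j)) /\
    measurable_fun I (fun z => imK (Hm z i j)) ;
  energy_density_bounded : exists C : R, forall i j, {ae mu, forall z, I z ->
    reK (Hm z i j) ^+ 2 + imK (Hm z i j) ^+ 2 <= C} ;
  energy_density_selfadjoint :
    {ae mu, forall z, I z -> (map_mx conjK (Hm z))^T = Hm z} ;
  energy_density_m0 : 0 < m0 ;
  energy_density_M0 : 0 < M0 ;
  energy_density_coercive : {ae mu, forall z, I z -> forall v : 'cV[K]_n,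
    m0 * sqnrm (v : euclid R k n) <=
      reK (((map_mx conjK v)^T *m Hm z *m v) 0 0) <=
    M0 * sqnrm (v : euclid R k n)} }.

End SquareIntegrable.

Section Operators.
Variables (R : realType) (k : RorC).
Local Notation K := (scal R k).
Implicit Types V W X : ipSpace R k.

(* An unbounded linear operator; the values off the domain are meaningless. *)
Record unbounded_op V W := UnboundedOp {
  op_dom : set V ;
  op_fun :> V -> W ;
  op_dom0 : op_dom 0 ;
  op_domP : forall (c : K) x y, op_dom x -> op_dom y -> op_dom (c *: x + y) ;
  op_linear : forall (c : K) x y, op_dom x -> op_dom y ->
    op_fun (c *: x + y) = c *: op_fun x + op_fun y }.

Record C0_semigroup X (S : R -> X -> X) : Prop := {
  C0_bounded : forall t, 0 <= t -> bounded_linear (S t) ;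
  C0_zero : forall x, S 0 x = x ;
  C0_add : forall s t x, 0 <= s -> 0 <= t -> S (s + t) x = S s (S t x) ;
  C0_continuous : forall x, (fun h => nrm (S h x - x)) @ 0^'+ --> (0 : R) }.

Definition generates X (D : set X) (A : X -> X) (S : R -> X -> X) : Prop :=
  C0_semigroup S /\
  forall x y, (D x /\ A x = y) <->
    (fun h => nrm (ofR k h^-1 *: (S h x - x) - y)) @ 0^'+ --> (0 : R).

(* z is in the domain of the adjoint of A, which maps it to v. *)
Definition adjoint_graph X (D : set X) (A : X -> X) (z v : X) : Prop :=
  forall x, D x -> ip (A x) z = ip x v.

Definition kernel_dom X V (cA : unbounded_op X X) (cB : unbounded_op X V) : set X :=
  [set x | op_dom cA x /\ cB x = 0].

(* Tr[f Q f^*], the squared norm of f in L_2^0. *)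
Definition L20_sqnrm V W (Q : V -> V) (f : V -> W) : \bar R :=
  trace (fun x => f (Q (adjoint f x))).

End Operators.

Section BochnerIntegral.
Variables (R : realType) (k : RorC) (V : ipSpace R k).
Local Notation mu := (@lebesgue_measure R).

Record simple_map := SimpleMap {
  sm_size : nat ;
  sm_set : 'I_sm_size -> set R ;
  sm_val : 'I_sm_size -> V ;
  sm_measurable : forall i, measurable (sm_set i) }.

Definition sm_fun (s : simple_map) (x : R) : V :=
  \sum_(i < sm_size s) ofR k (\1_(sm_set i) x) *: sm_val i.

Definition sm_integral (D : set R) (s : simple_map) : V :=
  \sum_(i < sm_size s) ofR k (fine (mu (D `&` sm_set i))) *: sm_val i.

(* For D of finite measure; the first condition is strong measurability. *)
Definition bochner_integral (D : set R) (f : R -> V) (v : V) : Prop :=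
  exists s : nat -> simple_map,
  [/\ {ae mu, forall x, D x -> (fun j => nrm (sm_fun (s j) x - f x)) @ \oo --> (0 : R)},
      (fun j => \int[mu]_(x in D) (nrm (sm_fun (s j) x - f x))%:E)%E @ \oo --> 0%E &
      (fun j => nrm (sm_integral D (s j) - v)) @ \oo --> (0 : R)].

Definition bochner_integrable (D : set R) (f : R -> V) : Prop :=
  exists v, bochner_integral D f v.

End BochnerIntegral.

Section Stochastic.
Variables (R : realType) (k : RorC).
Variables (d : measure_display) (Omega : measurableType d) (P : probability Omega R).
Local Notation K := (scal R k).
Local Notation mu := (@lebesgue_measure R).
Implicit Types V W X Z : ipSpace R k.

Record usual_filtration (F : R -> set_system Omega) : Prop := {
  filtration_sigma : forall t, 0 <= t -> sigma_algebra setT (F t) ;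
  filtration_sub : forall t, 0 <= t -> F t `<=` measurable ;
  filtration_mono : forall s t, 0 <= s -> s <= t -> F s `<=` F t ;
  filtration_right : forall t E, 0 <= t -> (forall s, t < s -> F s E) -> F t E ;
  filtration_complete : measure_is_complete P ;
  filtration_null : P.-negligible `<=` F 0 }.

Definition random_element V (G : set_system Omega) (xi : Omega -> V) : Prop :=
  forall U, borel U -> G (xi @^-1` U).

Definition adapted V (F : R -> set_system Omega) (J : set R) (X : R -> Omega -> V) : Prop :=
  forall t, J t -> random_element (F t) (X t).

(* Required of every process below whose paths are integrated: uniqueness up to
   modification is meaningless for processes that are not jointly measurable. *)
Definition measurable_process V (T : R) (X : R -> Omega -> V) : Prop :=
  forall U : set V, borel U ->
    measurable [set p : R * Omega | `[0, T]%classic p.1 /\ U (X p.1 p.2)].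

(* normal_prob is meaningful for a nonzero standard deviation only. *)
Definition real_gaussian (f : Omega -> R) (m s : R) : Prop :=
  measurable_fun setT f /\
  if s == 0 then {ae P, forall omega, f omega = m}
  else forall A, measurable A -> P (f @^-1` A) = normal_prob m s A.

(* Every real-linear bounded functional has the form reK <., z>. *)
Definition gaussian V (xi : Omega -> V) : Prop :=
  random_element measurable xi /\
  forall z : V, exists m s, real_gaussian (fun omega => reK (ip (xi omega) z)) m s.

(* xi is distributed as N(0, S), where the covariance operator is
   S z = E[<z, xi> xi]. *)
Definition centered_gaussian V (S : V -> V) (xi : Omega -> V) : Prop :=
  [/\ random_element measurable xi,
      forall z : V, exists s, real_gaussian (fun omega => reK (ip (xi omega) z)) 0 s &
      forall z1 z2 : V,
        intK P setT (fun omega => ip (xi omega) z1 * conjK (ip (xi omega) z2)) =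
        ip (S z2) z1].

Record covariance_operator Z (Q : Z -> Z) : Prop := {
  cov_bounded : bounded_linear Q ;
  cov_symmetric : forall x y, ip (Q x) y = ip x (Q y) ;
  cov_ge0 : forall x, 0 <= reK (ip (Q x) x) ;
  cov_trace : (trace Q < +oo)%E }.

Record wiener_process Z (F : R -> set_system Omega) (Q : Z -> Z)
    (w : R -> Omega -> Z) : Prop := {
  wiener0 : {ae P, forall omega, w 0 omega = 0} ;
  wiener_continuous : {ae P, forall omega, forall t, 0 <= t ->
    (fun s => nrm (w s omega - w t omega)) @ within `[0, +oo[ (nbhs t) --> (0 : R)} ;
  wiener_adapted : adapted F `[0, +oo[ w ;
  wiener_independent : forall s t E U, 0 <= s -> s <= t -> F s E -> borel U ->
    let G := (fun omega => w t omega - w s omega) @^-1` U in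
    P (E `&` G) = (P E * P G)%E ;
  wiener_gaussian : forall s t, 0 <= s -> s <= t ->
    centered_gaussian (fun z => ofR k (t - s) *: Q z)
      (fun omega => w t omega - w s omega) }.

Definition process_sigma Z (w : R -> Omega -> Z) : set_system Omega :=
  <<s [set E | exists t U, [/\ 0 <= t, borel U & E = w t @^-1` U]] >>.

Definition independent_of_process X Z (xi : Omega -> X) (w : R -> Omega -> Z) : Prop :=
  forall U E, borel U -> process_sigma w E ->
    P (xi @^-1` U `&` E) = (P (xi @^-1` U) * P E)%E.

(* Step functions on [0, t] with values in L(Z, X), as finite sums of
   op_i 1_{]lo_i, hi_i]}. *)
Record step_map Z X (t : R) := StepMap {
  st_size : nat ;
  st_lo : 'I_st_size -> R ;
  st_hi : 'I_st_size -> R ;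
  st_op : 'I_st_size -> Z -> X ;
  st_bounds : forall i, [/\ 0 <= st_lo i, st_lo i <= st_hi i & st_hi i <= t] ;
  st_bounded : forall i, bounded_linear (st_op i) }.

Definition st_fun Z X t (f : step_map Z X t) (s : R) : Z -> X :=
  fun z => \sum_(i < st_size f) ofR k (\1_(`]st_lo i, st_hi i]%classic) s) *: st_op i z.

Definition st_integral Z X t (w : R -> Omega -> Z) (f : step_map Z X t) : Omega -> X :=
  fun omega => \sum_(i < st_size f) st_op i (w (st_hi i) omega - w (st_lo i) omega).

(* I is the stochastic integral of the deterministic integrand Phi over [0, t]
   with respect to the Q-Wiener process w. *)
Definition stochastic_integral Z X (Q : Z -> Z) (w : R -> Omega -> Z) (t : R)
    (Phi : R -> Z -> X) (I : Omega -> X) : Prop :=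
  random_element measurable I /\
  exists f : nat -> step_map Z X t,
    (fun j => \int[mu]_(s in `[0%R, t])
       L20_sqnrm Q (fun z => st_fun (f j) s z - Phi s z)%R)%E @ \oo --> 0%E /\
    (fun j => 'E_P[fun omega => sqnrm (st_integral w (f j) omega - I omega)])%E
       @ \oo --> 0%E.

(* C^2_F([0, T]; V), for a process u together with its time derivative u'. *)
Record C2_process V (F : R -> set_system Omega) (T : R) (u u' : R -> Omega -> V) : Prop := {
  C2_adapted : adapted F `[0, T] u ;
  C2_derivative : {ae P, forall omega, forall t, 0 <= t <= T ->
    (fun h => nrm (ofR k h^-1 *: (u (t + h) omega - u t omega) - u' t omega))
      @ within [set h | 0 <= t + h <= T] 0^' --> (0 : R)} ;
  C2_moment : forall t, 0 <= t <= T ->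
    ('E_P[fun omega => sqnrm (u t omega)] < +oo)%E ;
  C2_moment_derivative : forall t, 0 <= t <= T ->
    ('E_P[fun omega => sqnrm (u' t omega)] < +oo)%E ;
  C2_continuous :
    {within `[0, T], continuous (fun t => fine 'E_P[fun omega => sqnrm (u t omega)]%E)} ;
  C2_continuous_derivative :
    {within `[0, T], continuous (fun t => fine 'E_P[fun omega => sqnrm (u' t omega)]%E)} }.

(* The conditions defining a BCO stochastic system, with A the restriction of
   cA to D(A) = kernel_dom cA cB, S the semigroup generated by A and B the
   operator lifting boundary values. *)
Record BCO_system X Z (m p : nat) (F : R -> set_system Omega)
    (cA : unbounded_op X X) (cB : unbounded_op X (euclid R k m))
    (cC : unbounded_op X (euclid R k p)) (S : R -> X -> X)
    (B : euclid R k m -> X) (Q : Z -> Z) (w : R -> Omega -> Z) (H : Z -> X) : Prop := {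
  BCO_dom : op_dom cA `<=` op_dom cB ;
  BCO_generates : generates (kernel_dom cA cB) cA S ;
  BCO_lift_bounded : bounded_linear B ;
  BCO_lift_dom : forall u, op_dom cA (B u) ;
  BCO_lift : forall u, cB (B u) = u ;
  BCO_lift_op : bounded_linear (fun u => cA (B u)) ;
  BCO_output_dom : kernel_dom cA cB `<=` op_dom cC ;
  BCO_output : exists M : R, forall x, kernel_dom cA cB x ->
    nrm (cC x) <= M * (nrm x + nrm (cA x)) ;
  BCO_hilbert : hilbert Z ;
  BCO_separable : separable Z ;
  BCO_covariance : covariance_operator Q ;
  BCO_wiener : wiener_process F Q w ;
  BCO_noise : bounded_linear H ;
  BCO_noise_trace : (L20_sqnrm Q H < +oo)%E }.

(* Solutions on [0, T] of dX = (A X + f) dt + H dw, X(0) = X0, for A with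
   domain D, generating the semigroup S. *)

Definition weak_solution X Z (T : R) (D : set X) (A : X -> X) (H : Z -> X)
    (w : R -> Omega -> Z) (f : R -> Omega -> X) (X0 : Omega -> X)
    (Y : R -> Omega -> X) : Prop :=
  [/\ measurable_process T Y,
      {ae P, forall omega, bochner_integrable `[0, T] (Y ^~ omega)} &
      forall z v, adjoint_graph D A z v -> forall t, 0 <= t <= T ->
        {ae P, forall omega,
          ip (Y t omega) z = ip (X0 omega) z +
            intK mu `[0, t] (fun s => ip (Y s omega) v + ip (f s omega) z) +
            ip (H (w t omega)) z}].

Definition mild_formula X Z (T : R) (S : R -> X -> X) (H : Z -> X) (Q : Z -> Z)
    (w : R -> Omega -> Z) (f : R -> Omega -> X) (X0 : Omega -> X)
    (Y : R -> Omega -> X) : Prop :=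
  forall t, 0 <= t <= T -> exists I : Omega -> X,
    stochastic_integral Q w t (fun s z => S (t - s) (H z)) I /\
    {ae P, forall omega, exists2 v,
      bochner_integral `[0, t] (fun s => S (t - s) (f s omega)) v &
      Y t omega = S t (X0 omega) + v + I omega}.

Definition mild_solution X Z (F : R -> set_system Omega) (T : R) (S : R -> X -> X)
    (H : Z -> X) (Q : Z -> Z) (w : R -> Omega -> Z) (f : R -> Omega -> X)
    (X0 : Omega -> X) (Y : R -> Omega -> X) : Prop :=
  [/\ measurable_process T Y /\ adapted F `[0, T] Y,
      forall t, 0 <= t <= T -> ('E_P[fun omega => sqnrm (Y t omega)] < +oo)%E,
      forall t, 0 <= t <= T ->
        (fun s => 'E_P[fun omega => sqnrm (Y s omega - Y t omega)])%E
          @ within `[0, T] (nbhs t) --> 0%E,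
      {ae P, forall omega, (\int[mu]_(s in `[0%R, T]) (sqnrm (Y s omega))%:E < +oo)%E} &
      mild_formula T S H Q w f X0 Y].

End Stochastic.

(* Main.v *)
(* With [rip] the real part of the inner product, every scalar identity becomes
   a pair of real ones.

   The stochastic convolution is the mean-square limit of the Riemann sums of
   [S (t - s) (H dw s)], controlled by the isometry
   [E |sum_i op_i (w hi_i - w lo_i)|^2 = int_0^t Tr (Phi_s Q Phi_s^* ) ds], which
   follows from the independence of the increments and from
   [Tr (G Q G^* ) = E |G (w 1 - w 0)|^2].  For [z] in the domain of [A^*],
   [rip (S t x) z - rip x z = int_0^t rip (S s x) (A^* z) ds]; applied to each cell
   of the Riemann sums it gives the weak identity of the stochastic convolution,
   and by Fubini that of the deterministic one.

   The difference [D] of two weak solutions satisfies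
   [rip (D t) z = int_0^t rip (D s) (A^* z) ds] almost surely.  For the test vector
   [zeta_h = int_0^h S_r^* z dr], for which [A^* zeta_h = S_h^* z - z], and with
   [e t = int_0^t D], this reads
   [int_0^h rip (S_r (D t)) z dr = rip (S_h (e t) - e t) z].  For [h = tau - t] and
   after integration over [t] in [0, tau] both sides contain the integral of
   [rip (S_r (D t)) z] over the same triangle, so that
   [int_0^tau rip (e t) z dt = 0] for every [tau]; hence [e = 0], and the displayed
   equation gives [D = 0].

   A process satisfying the mild formula agrees with this solution because
   stochastic integrals are determined almost surely, and each of the two notions
   of solution is stable under passage to a jointly measurable version. *)
Require Import Defs.
From HB Require Import structures.
From mathcomp Require Import all_boot all_order all_algebra.
From mathcomp Require Import all_classical all_reals all_analysis measurable_realfun.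
From mathcomp Require Import complex ring lra.

Set Implicit Arguments.
Unset Strict Implicit.
Unset Printing Implicit Defensive.

Import Order.TTheory GRing.Theory Num.Theory.
Import numFieldNormedType.Exports.

Local Open Scope classical_set_scope.
Local Open Scope ring_scope.

(** * Real and complex Hilbert spaces *)

(** The derivative [u'] is tied to [u] only off a null set, and no joint measurability is given for
    it, so neither the convolution with the forcing nor its adaptedness can be read off directly:
    both are proved for a version of the forcing that agrees with it on (0, T] off one null set, and
    integrals over time do not see the point 0. At each time the convolution is a pointwise limit of
    adapted Riemann sums whose meshes shrink fast enough for almost sure convergence, set to 0 on
    the measurable set where fast convergence fails; joint measurability and adaptedness survive
    this limit. All identities therefore hold almost surely for each fixed time, and Tonelli's
    theorem turns them into identities at almost every time along almost every path, which is what
    the triangle argument consumes. Test vectors averaged over an interval of length h lie in the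
    domain of the adjoint by construction, so that time-dependent test functions do not occur. The
    initial value is Gaussian only through its real projections; its second moment comes from a
    lower bound on the probability that their squares are large. *)

Section Scalars.
Variables (R : realType) (k : RorC).
Local Notation K := (scal R k).

(** Over the reals it is 0: imaginary parts are then 0 as well, and the identities that recover them
    from [rip] hold for both fields with one proof. *)
Definition iK : K :=
  match k return scal R k with RealField => 0 | ComplexField => Complex 0 1 end.

Lemma ofRD (a b : R) : ofR k (a + b) = ofR k a + ofR k b :> K.
Proof. by case: k => //=; apply/eqP; rewrite eq_complex/= !addr0 !eqxx. Qed.

Lemma ofRM (a b : R) : ofR k (a * b) = ofR k a * ofR k b :> K.
Proof.
case: k => //=; apply/eqP; rewrite eq_complex/=.
by rewrite !(mulr0, mul0r, subr0, addr0) !eqxx.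
Qed.

Lemma ofR0 : ofR k 0 = 0 :> K. Proof. by case: k. Qed.

Lemma ofR1 : ofR k 1 = 1 :> K. Proof. by case: k. Qed.

Lemma ofRN (a : R) : ofR k (- a) = - ofR k a :> K.
Proof. by apply: (@addrI _ (ofR k a)); rewrite -ofRD !subrr ofR0. Qed.

Lemma reK_ofR (a : R) : reK (ofR k a : K) = a. Proof. by case: k. Qed.

Lemma imK_ofR (a : R) : imK (ofR k a : K) = 0. Proof. by case: k. Qed.

Lemma reKN (x : K) : reK (- x) = - reK x.
Proof. by apply: (@addrI _ (reK x)); rewrite -reKD !subrr reK0. Qed.

Lemma imKN (x : K) : imK (- x) = - imK x.
Proof. by apply: (@addrI _ (imK x)); rewrite -imKD !subrr imK0. Qed.

Lemma scal_eq (x y : K) : reK x = reK y -> imK x = imK y -> x = y.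
Proof. by case: k x y => //= -[a b] [c d] /= -> ->. Qed.

Lemma conjKK (x : K) : conjK (conjK x) = x.
Proof. by apply: scal_eq; rewrite ?reK_conj// !imK_conj opprK. Qed.

Lemma conjKM (x y : K) : conjK (x * y) = conjK x * conjK y.
Proof.
by apply: scal_eq; rewrite !(reK_conj, imK_conj, reKM, imKM); ring.
Qed.

Lemma conjKD (x y : K) : conjK (x + y) = conjK x + conjK y.
Proof.
by apply: scal_eq; rewrite !(reK_conj, imK_conj, reKD, imKD)//; ring.
Qed.

Lemma conjKofR (a : R) : conjK (ofR k a) = ofR k a :> K.
Proof. by apply: scal_eq; rewrite ?reK_conj// imK_conj imK_ofR oppr0. Qed.

Lemma conjK0 : conjK 0 = 0 :> K.
Proof. by rewrite -ofR0 conjKofR. Qed.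

Lemma conjKiK : conjK iK = - iK :> K.
Proof.
apply: scal_eq; rewrite ?reK_conj ?imK_conj ?reKN ?imKN// /iK; case: k => //=;
by rewrite oppr0.
Qed.

Lemma reK_iKM (x : K) : reK (iK * x) = - imK x.
Proof. by rewrite reKM /iK; case: k x => //= [x|[a b]/=]; ring. Qed.

Lemma scalE (x : K) : x = ofR k (reK x) + ofR k (imK x) * iK.
Proof.
apply: scal_eq; rewrite ?(reKD, imKD, reKM, imKM, reK_ofR, imK_ofR) /iK;
by case: k x => //= [x|[a b]]/=; ring.
Qed.

Lemma reK_iKM' (x : K) : imK x = reK (- iK * x).
Proof. by rewrite mulNr reKN reK_iKM opprK. Qed.

Lemma mulK_conj (x : K) : x * conjK x = ofR k (reK x ^+ 2 + imK x ^+ 2).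
Proof.
apply: scal_eq; rewrite ?(reKM, imKM, reK_conj, imK_conj, reK_ofR, imK_ofR); ring.
Qed.

Lemma nat_ofR (b : bool) : (b%:R : K) = ofR k (b%:R).
Proof. by case: b; rewrite ?ofR0 ?ofR1. Qed.

Lemma reK_sum (I : Type) (r : seq I) (P : pred I) (F : I -> K) :
  reK (\sum_(i <- r | P i) F i) = \sum_(i <- r | P i) reK (F i).
Proof. exact: (big_morph (@reK R k) (@reKD R k) (@reK0 R k)). Qed.

Lemma imK_sum (I : Type) (r : seq I) (P : pred I) (F : I -> K) :
  imK (\sum_(i <- r | P i) F i) = \sum_(i <- r | P i) imK (F i).
Proof. exact: (big_morph (@imK R k) (@imKD R k) (@imK0 R k)). Qed.

End Scalars.
Arguments iK {R k}.

(* The real inner product underlying the K-valued one; the imaginary part of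
   [ip x y] is recovered as [rip x (iK *: y)]. *)
Definition rip (R : realType) (k : RorC) (V : ipSpace R k) (x y : V) : R :=
  reK (ip x y).

Section Geometry.
Variables (R : realType) (k : RorC) (V : ipSpace R k).
Hypothesis hV : hilbert V.
Local Notation K := (scal R k).
Implicit Types (x y z : V) (r s : R).

Lemma ipDl x y z : ip (x + y) z = ip x z + ip y z.
Proof. by have := hilbert_linear hV 1 x y z; rewrite scale1r mul1r. Qed.

Lemma ip0l z : ip 0 z = 0.
Proof. by apply: (@addrI _ (ip 0 z)); rewrite -ipDl !addr0. Qed.

Lemma ipZl (c : K) x z : ip (c *: x) z = c * ip x z.
Proof. by have := hilbert_linear hV c x 0 z; rewrite !addr0 ip0l addr0. Qed.

Lemma ipC x y : ip y x = conjK (ip x y). Proof. exact: hilbert_conj. Qed.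

Lemma ipZr (c : K) x z : ip x (c *: z) = conjK c * ip x z.
Proof. by rewrite ipC ipZl conjKM -ipC. Qed.

Lemma ipDr x y z : ip z (x + y) = ip z x + ip z y.
Proof. by rewrite ipC ipDl conjKD -!ipC. Qed.

Lemma ripC x y : rip x y = rip y x.
Proof. by rewrite /rip ipC reK_conj. Qed.

Lemma ripDl x y z : rip (x + y) z = rip x z + rip y z.
Proof. by rewrite /rip ipDl reKD. Qed.

Lemma ripDr x y z : rip z (x + y) = rip z x + rip z y.
Proof. by rewrite ![rip z _]ripC ripDl. Qed.

Lemma ripZl r x z : rip (ofR k r *: x) z = r * rip x z.
Proof. by rewrite /rip ipZl reKM reK_ofR imK_ofR mul0r subr0. Qed.

Lemma ripZr r x z : rip z (ofR k r *: x) = r * rip z x.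
Proof. by rewrite ![rip z _]ripC ripZl. Qed.

Lemma rip0l z : rip 0 z = 0. Proof. by rewrite /rip ip0l reK0. Qed.

Lemma rip0r z : rip z 0 = 0. Proof. by rewrite ripC rip0l. Qed.

Lemma ripNl x z : rip (- x) z = - rip x z.
Proof. by apply: (@addrI _ (rip x z)); rewrite -ripDl !subrr rip0l. Qed.

Lemma ripNr x z : rip z (- x) = - rip z x.
Proof. by rewrite ![rip z _]ripC ripNl. Qed.

Lemma ripBl x y z : rip (x - y) z = rip x z - rip y z.
Proof. by rewrite ripDl ripNl. Qed.

Lemma ripBr x y z : rip z (x - y) = rip z x - rip z y.
Proof. by rewrite ripDr ripNr. Qed.

Lemma rip_suml (I : Type) (s : seq I) (P : pred I) (F : I -> V) z :
  rip (\sum_(i <- s | P i) F i) z = \sum_(i <- s | P i) rip (F i) z.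
Proof. by rewrite (big_morph (fun x => rip x z) (fun x y => ripDl x y z) (rip0l z)). Qed.

Lemma rip_sumr (I : Type) (s : seq I) (P : pred I) (F : I -> V) z :
  rip z (\sum_(i <- s | P i) F i) = \sum_(i <- s | P i) rip z (F i).
Proof. by rewrite (big_morph (fun x => rip z x) (fun x y => ripDr x y z) (rip0r z)). Qed.

Lemma imK_ip x y : imK (ip x y) = rip x (iK *: y).
Proof. by rewrite /rip ipZr conjKiK mulNr reKN reK_iKM opprK. Qed.

Lemma rip_iK x y : rip (iK *: x) y = - rip x (iK *: y).
Proof. by rewrite -imK_ip /rip ipZl reK_iKM. Qed.

Lemma ip_eq x y z t : rip x y = rip z t -> rip x (iK *: y) = rip z (iK *: t) ->
  ip x y = ip z t.
Proof. by move=> h1 h2; apply: scal_eq; rewrite ?imK_ip. Qed.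

Lemma sqnrm_rip x : sqnrm x = rip x x. Proof. by []. Qed.

Lemma sqnrm_ge0 x : 0 <= sqnrm x. Proof. exact: hilbert_ge0. Qed.

Lemma imK_ipxx x : imK (ip x x) = 0.
Proof.
have := congr1 (@imK R k) (ipC x x); rewrite imK_conj; lra.
Qed.

Lemma sqnrm_eq0 x : sqnrm x = 0 -> x = 0.
Proof.
move=> h; apply: (hilbert_eq0 hV); apply: scal_eq; first by rewrite reK0.
by rewrite imK_ipxx imK0.
Qed.

Lemma sqnrm0 : sqnrm (0 : V) = 0. Proof. by rewrite sqnrm_rip rip0l. Qed.

Lemma rip_inj x y : (forall z, rip x z = rip y z) -> x = y.
Proof.
move=> h; apply/eqP; rewrite -subr_eq0; apply/eqP/sqnrm_eq0.
by rewrite sqnrm_rip ripBl h subrr.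
Qed.

Lemma sqnrmD x y : sqnrm (x + y) = sqnrm x + 2 * rip x y + sqnrm y.
Proof. rewrite !sqnrm_rip ripDl !ripDr (ripC y x); ring. Qed.

Lemma sqnrmN x : sqnrm (- x) = sqnrm x.
Proof. by rewrite !sqnrm_rip ripNl ripNr opprK. Qed.

Lemma sqnrmB x y : sqnrm (x - y) = sqnrm x - 2 * rip x y + sqnrm y.
Proof. by rewrite sqnrmD sqnrmN ripNr mulrN. Qed.

Lemma sqnrmBC x y : sqnrm (x - y) = sqnrm (y - x).
Proof. by rewrite -sqnrmN opprB. Qed.

Lemma sqnrmZ r x : sqnrm (ofR k r *: x) = r ^+ 2 * sqnrm x.
Proof. rewrite !sqnrm_rip ripZl ripZr; ring. Qed.

Lemma sqnrmD_le x y : sqnrm (x + y) <= 2 * sqnrm x + 2 * sqnrm y.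
Proof. have := sqnrm_ge0 (x - y); rewrite (sqnrmD x y) sqnrmB; lra. Qed.

Lemma sqnrmB_le x y : sqnrm (x - y) <= 2 * sqnrm x + 2 * sqnrm y.
Proof. by rewrite -(sqnrmN y) sqnrmD_le. Qed.

Lemma nrm_ge0 x : 0 <= nrm x. Proof. exact: sqrtr_ge0. Qed.

Lemma nrm_sqr x : nrm x ^+ 2 = sqnrm x.
Proof. by rewrite sqr_sqrtr// sqnrm_ge0. Qed.

Lemma nrm0 : nrm (0 : V) = 0. Proof. by rewrite /nrm sqnrm0 sqrtr0. Qed.

Lemma nrm_eq0 x : nrm x = 0 -> x = 0.
Proof. by move=> h; apply: sqnrm_eq0; rewrite -nrm_sqr h expr0n. Qed.

Lemma nrmN x : nrm (- x) = nrm x. Proof. by rewrite /nrm sqnrmN. Qed.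

Lemma nrmBC x y : nrm (x - y) = nrm (y - x).
Proof. by rewrite -nrmN opprB. Qed.

Lemma nrmZ r x : nrm (ofR k r *: x) = `|r| * nrm x.
Proof. by rewrite /nrm sqnrmZ sqrtrM ?sqr_ge0// sqrtr_sqr. Qed.

(** Only an inequality, because over the reals the left-hand side is 0. *)
Lemma sqnrm_iK x : sqnrm (iK *: x) <= sqnrm x.
Proof.
have := sqnrm_ge0 x; rewrite !sqnrm_rip rip_iK /rip !ipZr mulrA conjKiK mulrNN.
move: (ip x x) => c; rewrite reKM /iK.
by case: k c => /= [c|[u v]/=]; rewrite ?mulr0; lra.
Qed.

Lemma cauchy_schwarz_sq x y : rip x y ^+ 2 <= sqnrm x * sqnrm y.
Proof.
have [y0|y0] := eqVneq (sqnrm y) 0.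
  by rewrite (sqnrm_eq0 y0) rip0r expr0n/= sqnrm0 mulr0.
have yp : 0 < sqnrm y by rewrite lt_neqAle eq_sym y0 sqnrm_ge0.
(* The residual of [x] after projection on [y], multiplied by [sqnrm y] so that no division
   occurs. *)
have := sqnrm_ge0 (ofR k (sqnrm y) *: x - ofR k (rip x y) *: y).
rewrite sqnrmB !sqnrmZ ripZl ripZr.
have -> : sqnrm y ^+ 2 * sqnrm x - 2 * (sqnrm y * (rip x y * rip x y)) +
  rip x y ^+ 2 * sqnrm y = sqnrm y * (sqnrm x * sqnrm y - rip x y ^+ 2) by ring.
by rewrite pmulr_rge0// subr_ge0.
Qed.

Lemma cauchy_schwarz x y : `|rip x y| <= nrm x * nrm y.
Proof.
rewrite -(@ler_pXn2r _ 2)// ?nnegrE ?mulr_ge0 ?nrm_ge0//.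
by rewrite real_normK ?num_real// exprMn !nrm_sqr cauchy_schwarz_sq.
Qed.

Lemma nrmD x y : nrm (x + y) <= nrm x + nrm y.
Proof.
rewrite -(@ler_pXn2r _ 2)// ?nnegrE ?addr_ge0 ?nrm_ge0//.
have := le_trans (ler_norm _) (cauchy_schwarz x y).
rewrite sqrrD !nrm_sqr sqnrmD; lra.
Qed.

Lemma nrm_dist x y z : nrm (x - z) <= nrm (x - y) + nrm (y - z).
Proof. by rewrite (le_trans _ (nrmD _ _))// addrA subrK. Qed.

Lemma nrm_sub_ge x y : nrm x - nrm y <= nrm (x - y).
Proof. by rewrite lerBlDr -{1}(subrK y x) nrmD. Qed.

Lemma nrm_abs_dist x y : `|nrm x - nrm y| <= nrm (x - y).
Proof.
by rewrite ler_norml nrm_sub_ge andbT lerNl opprB nrmBC nrm_sub_ge.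
Qed.

Lemma nrm_le_rip x (c : R) : 0 <= c -> (forall z, rip x z <= c * nrm z) -> nrm x <= c.
Proof.
move=> c0 /(_ x); rewrite -sqnrm_rip -nrm_sqr expr2.
have [->|x0] := eqVneq (nrm x) 0; first by [].
by rewrite ler_pM2r// lt_neqAle eq_sym x0 nrm_ge0.
Qed.

Lemma nrm_sum (I : Type) (s : seq I) (P : pred I) (F : I -> V) :
  nrm (\sum_(i <- s | P i) F i) <= \sum_(i <- s | P i) nrm (F i).
Proof.
elim/big_rec2 : _ => [|i a x _ h]; first by rewrite nrm0.
by rewrite (le_trans (nrmD _ _))// lerD2l.
Qed.

Lemma nrm_le_sqnrm x y : sqnrm x <= sqnrm y -> nrm x <= nrm y.
Proof. exact: ler_wsqrtr. Qed.

Lemma nrm_le x c : 0 <= c -> sqnrm x <= c ^+ 2 -> nrm x <= c.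
Proof. by move=> c0 h; rewrite /nrm -(ger0_norm c0) -sqrtr_sqr ler_wsqrtr. Qed.

Lemma sqnrm_le x c : nrm x <= c -> sqnrm x <= c ^+ 2.
Proof.
move=> h; rewrite -nrm_sqr ler_pXn2r// nnegrE ?nrm_ge0//.
exact: le_trans (nrm_ge0 _) h.
Qed.

Lemma parallelogram x y :
  sqnrm (x + y) + sqnrm (x - y) = 2 * sqnrm x + 2 * sqnrm y.
Proof. rewrite (sqnrmD x y) sqnrmB; ring. Qed.

Definition vcvg (v : nat -> V) (l : V) := (fun i => nrm (v i - l)) @ \oo --> (0 : R).

Lemma vcvgP v l : vcvg v l <->
  forall e, 0 < e -> exists N, forall i, (N <= i)%N -> nrm (v i - l) < e.
Proof.
split.
  move=> /cvgrPdist_lt h e e0; have [N _ hN] := h e e0.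
  exists N => i /hN /=; rewrite sub0r normrN ger0_norm ?nrm_ge0//.
move=> h; apply/cvgrPdist_lt => e e0; have [N hN] := h e e0.
by exists N => // i /hN /=; rewrite sub0r normrN ger0_norm ?nrm_ge0.
Qed.

Lemma vcvg_rip v l z : vcvg v l -> (fun i => rip (v i) z) @ \oo --> rip l z.
Proof.
move=> h; apply/cvgrPdist_le => e e0.
have [N hN] := (vcvgP v l).1 h (e / (nrm z + 1)) (divr_gt0 e0 (ltr_pwDr ltr01 (nrm_ge0 z))).
exists N => // i /hN /= {}hN.
rewrite -ripBl (le_trans (cauchy_schwarz _ _))// nrmBC.
have z1 : 0 < nrm z + 1 by rewrite ltr_pwDr ?nrm_ge0.
move: hN; rewrite ltr_pdivlMr// => /ltW; apply: le_trans.
by rewrite ler_wpM2l ?nrm_ge0// lerDl.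
Qed.

Lemma vcvg_nrm v l : vcvg v l -> (fun i => nrm (v i)) @ \oo --> nrm l.
Proof.
move=> /vcvgP h; apply/cvgrPdist_le => e e0; have [N hN] := h e e0.
exists N => // i /hN /ltW /=; apply: le_trans.
by rewrite distrC nrm_abs_dist.
Qed.

Lemma vcvg_unique v l l' : vcvg v l -> vcvg v l' -> l = l'.
Proof.
move=> h h'; apply: rip_inj => z.
exact: (cvg_unique (@Rhausdorff R) (vcvg_rip h) (vcvg_rip h')).
Qed.

Definition vcauchy (v : nat -> V) := forall e : R, 0 < e -> exists N, forall i j,
  (N <= i)%N -> (N <= j)%N -> nrm (v i - v j) < e.

Lemma vcauchy_cvg v : vcauchy v -> exists l, vcvg v l.
Proof. exact: hilbert_complete. Qed.

End Geometry.

Arguments vcvg {R k V}.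
Arguments vcauchy {R k V}.

(** * Riesz representation and adjoints *)

Section Riesz.
Variables (R : realType) (k : RorC) (V : ipSpace R k).
Hypothesis hV : hilbert V.

(* The representing vector minimises [sqnrm x - 2 * phi x]. *)
Lemma riesz (phi : V -> R) (M : R) :
  (forall x y, phi (x + y) = phi x + phi y) ->
  (forall r x, phi (ofR k r *: x) = r * phi x) ->
  (forall x, `|phi x| <= M * nrm x) ->
  exists y, forall x, phi x = rip x y.
Proof.
move=> phiD phiZ phiM.
have phiN x : phi (- x) = - phi x.
  have := phiZ 0 0; rewrite mul0r ofR0 scale0r => p0.
  by apply: (@addrI _ (phi x)); rewrite -phiD !subrr p0.
pose J x := sqnrm x - 2 * phi x.
have Jlb x : - M ^+ 2 <= J x.
  have := le_trans (ler_norm _) (phiM x); rewrite /J -(nrm_sqr hV) => h.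
  have := sqr_ge0 (nrm x - M); nra.
have hinf : has_inf (range J).
  split; first by exists (J 0), 0.
  by exists (- M ^+ 2) => _ [x _ <-].
pose m := inf (range J).
have mJ x : m <= J x by apply: ge_inf; [case: hinf|exists x].
have [v hv] : {v : nat -> V & forall n, J (v n) < m + n.+1%:R^-1}.
  apply: (@choice _ _ (fun n x => J x < m + n.+1%:R^-1)) => n.
  have i0 : 0 < n.+1%:R^-1 :> R by rewrite invr_gt0.
  have [_ [x _ <-] hx] := inf_adherent i0 hinf.
  by exists x.
(* The midpoint of [x] and [y] has value at least [m]; by the parallelogram law near-minimisers are
   close to each other. *)
have key x y : sqnrm (x - y) <= 2 * (J x - m) + 2 * (J y - m).
  have := mJ (ofR k (2^-1) *: (x + y)).
  have := parallelogram hV x y.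
  rewrite /J (sqnrmZ hV) phiZ phiD; nra.
have cv : vcauchy v.
  move=> e e0.
  have [N hN] : exists N : nat, N.+1%:R^-1 < e ^+ 2 / 4.
    have p : 0 < e ^+ 2 / 4 by rewrite divr_gt0// exprn_gt0.
    have [N hN] := ltr_add_invr p.
    by exists N; rewrite add0r in hN.
  have small i : (N <= i)%N -> i.+1%:R^-1 <= N.+1%:R^-1 :> R.
    by move=> Ni; rewrite lef_pV2 ?posrE// ler_nat ltnS.
  exists N => i j /small Ni /small Nj.
  rewrite -(@ltr_pXn2r _ 2)// ?nnegrE ?nrm_ge0// ?(ltW e0)// (nrm_sqr hV).
  apply: (le_lt_trans (key _ _)); move: hN Ni Nj (hv i) (hv j).
  move: (i.+1%:R^-1) (j.+1%:R^-1) (N.+1%:R^-1) => a b c; lra.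
have [y yl] := vcauchy_cvg hV cv.
have Jy : J y <= m.
  apply/ler_addgt0Pr => e e0.
  have J1 : (fun n => J (v n)) @ \oo --> J y.
    apply: cvgB.
      rewrite (_ : (fun n => sqnrm (v n)) = (fun n => nrm (v n) * nrm (v n))); last first.
        by apply/funext => n; rewrite -expr2 nrm_sqr.
      by rewrite -(nrm_sqr hV) expr2; apply: cvgM; exact: vcvg_nrm.
    apply: cvgMr; apply/cvgrPdist_le => d d0.
    have [M0 Mp] : exists M', 0 < M' /\ forall x, `|phi x| <= M' * nrm x.
      exists (`|M| + 1); rewrite ltr_wpDl//; split=> // x.
      rewrite (le_trans (phiM x))// ler_wpM2r ?nrm_ge0//.
      by rewrite (le_trans (ler_norm _))// lerDl.
    have [N hN] := (vcvgP v y).1 yl (d / M0) (divr_gt0 d0 Mp.1).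
    exists N => // n /hN /=; rewrite ltr_pdivlMr ?Mp.1// => /ltW hn.
    rewrite -phiN -phiD (le_trans (Mp.2 _))// mulrC.
    by rewrite (nrmBC hV) .
  have : \forall n \near \oo, J (v n) <= m + e.
    have [N hN] := ltr_add_invr e0.
    exists N => // n /= Nn; apply: ltW; apply: (lt_trans (hv n)); rewrite ltrD2l.
    apply: le_lt_trans hN; rewrite add0r lef_pV2 ?posrE// ler_nat ltnS//.
  move=> h; rewrite -(cvg_lim (@Rhausdorff R) J1).
  by apply: limr_le => //; apply/cvg_ex; exists (J y).
exists y => z; apply/eqP; rewrite -subr_eq0; apply/eqP.
(* First-order condition along [z] at the minimiser [y]. *)
have q t : 0 <= t ^+ 2 * sqnrm z + 2 * t * (rip z y - phi z).
  have := le_trans Jy (mJ (y + ofR k t *: z)).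
  rewrite /J (sqnrmD hV) (sqnrmZ hV) phiD phiZ (ripZr hV) (ripC hV y z); lra.
(* This [t] is close to the minimiser of the quadratic. The 1 in the denominator covers [z = 0], and
   the resulting factor (a + 2) / (a + 1)^2 is still positive, which forces b = 0. *)
have := q ((phi z - rip z y) / (sqnrm z + 1)).
set b := phi z - rip z y; set a := sqnrm z.
have a0 : 0 <= a by exact: sqnrm_ge0.
have -> : rip z y - phi z = - b by rewrite opprB.
have a1 : 0 < a + 1 by lra.
have -> : (b / (a + 1)) ^+ 2 * a + 2 * (b / (a + 1)) * - b =
  - (b ^+ 2 * ((a + 2) / (a + 1) ^+ 2)) by field; rewrite gt_eqF.
rewrite oppr_ge0 => h; apply/eqP; rewrite -sqrf_eq0; apply/eqP/le_anti.
rewrite sqr_ge0 andbT; rewrite pmulr_lle0// in h.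
by rewrite divr_gt0// ?exprn_gt0//; lra.
Qed.

End Riesz.

Section Adjoint.
Variables (R : realType) (k : RorC) (V W : ipSpace R k).
Hypotheses (hV : hilbert V) (hW : hilbert W).
Implicit Types f : V -> W.

Lemma bounded_linear_D f x y : bounded_linear f -> f (x + y) = f x + f y.
Proof. by move=> [fl _]; have := fl 1 x y; rewrite !scale1r. Qed.

Lemma bounded_linear0 f : bounded_linear f -> f 0 = 0.
Proof.
by move=> h; apply: (@addrI _ (f 0)); rewrite -bounded_linear_D// !addr0.
Qed.

Lemma bounded_linear_Z f (c : scal R k) x : bounded_linear f -> f (c *: x) = c *: f x.
Proof.
by move=> h; have := h.1 c x 0; rewrite !addr0 bounded_linear0// addr0.
Qed.

Lemma bounded_linear_N f x : bounded_linear f -> f (- x) = - f x.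
Proof. by move=> h; rewrite -scaleN1r bounded_linear_Z// scaleN1r. Qed.

Lemma bounded_linear_B f x y : bounded_linear f -> f (x - y) = f x - f y.
Proof. by move=> h; rewrite bounded_linear_D// bounded_linear_N. Qed.

Lemma bounded_linear_sum f (I : Type) (s : seq I) (P : pred I) (F : I -> V) :
  bounded_linear f ->
  f (\sum_(i <- s | P i) F i) = \sum_(i <- s | P i) f (F i).
Proof.
move=> h; apply: (big_morph f _ (bounded_linear0 h)) => x y.
exact: bounded_linear_D.
Qed.

Lemma bounded_linear_bound f : bounded_linear f ->
  exists2 M, 0 < M & forall x, nrm (f x) <= M * nrm x.
Proof.
move=> [_ [M hM]]; exists (`|M| + 1); first by rewrite ltr_wpDl.
move=> x; rewrite (le_trans (hM x))// ler_wpM2r ?nrm_ge0//.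
by rewrite (le_trans (ler_norm _))// lerDl.
Qed.

(** [riesz], applied to [x => rip (f x) y] for each [y], gives the real part of the identity;
    testing with [- iK *: x] recovers the imaginary part. *)
Lemma adjointP f : bounded_linear f -> forall x y, ip (f x) y = ip x (adjoint f y).
Proof.
move=> fb; rewrite /adjoint; case: xgetP => [g _ //|h]; exfalso.
have [M M0 hM] := bounded_linear_bound fb.
have : {g : W -> V & forall y x, rip (f x) y = rip x (g y)}.
  apply: (@choice _ _ (fun y z => forall x, rip (f x) y = rip x z)) => y.
  apply: (@riesz _ _ _ hV _ (M * nrm y)).
  - by move=> x1 x2; rewrite bounded_linear_D// (ripDl hW).
  - by move=> r x; rewrite bounded_linear_Z// (ripZl hW).
  - move=> x; rewrite (le_trans (cauchy_schwarz hW _ _))//.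
    by rewrite mulrAC ler_wpM2r ?nrm_ge0.
move=> [g hg]; apply: (h g) => x y; apply: scal_eq; first exact: hg.
rewrite !reK_iKM' -!(ipZl hW, ipZl hV) -bounded_linear_Z//; exact: hg.
Qed.

Lemma rip_adjoint f x y : bounded_linear f -> rip (f x) y = rip x (adjoint f y).
Proof. by move=> h; rewrite /rip adjointP. Qed.

Lemma bounded_linear_sqnrm f : bounded_linear f ->
  exists2 M, 0 < M & forall x, sqnrm (f x) <= M * sqnrm x.
Proof.
move=> /bounded_linear_bound[M M0 h]; exists (M ^+ 2); first exact: exprn_gt0.
by move=> x; rewrite (le_trans (sqnrm_le hW (h x)))// exprMn (nrm_sqr hV).
Qed.

End Adjoint.

Section AdjointDouble.
Variables (R : realType) (k : RorC).
Implicit Types V W U : ipSpace R k.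

Lemma bounded_linear_comp V W U (f : V -> W) (g : W -> U) :
  hilbert U ->
  bounded_linear f -> bounded_linear g -> bounded_linear (g \o f).
Proof.
move=> hU fb gb; split; first by move=> c x y /=; rewrite fb.1 gb.1.
have [M M0 hM] := bounded_linear_bound fb.
have [N N0 hN] := bounded_linear_bound gb.
exists (N * M) => x /=; rewrite (le_trans (hN _))// -mulrA.
by rewrite ler_pM2l.
Qed.

Lemma bounded_linear_add V W (f g : V -> W) :
  hilbert W ->
  bounded_linear f -> bounded_linear g -> bounded_linear (fun x => f x + g x).
Proof.
move=> hW fb gb; split.
  by move=> c x y; rewrite fb.1 gb.1 scalerDr addrACA.
have [M M0 hM] := bounded_linear_bound fb.
have [N N0 hN] := bounded_linear_bound gb.
by exists (M + N) => x; rewrite (le_trans (nrmD hW _ _))// mulrDl lerD.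
Qed.

Lemma bounded_linear_scale V W (r : R) (f : V -> W) :
  hilbert W ->
  bounded_linear f -> bounded_linear (fun x => ofR k r *: f x).
Proof.
move=> hW fb; split.
  by move=> c x y; rewrite fb.1 scalerDr !scalerA (mulrC c).
have [M M0 hM] := bounded_linear_bound fb.
by exists (`|r| * M) => x; rewrite (nrmZ hW) -mulrA ler_wpM2l.
Qed.

Lemma bounded_linear_opp V W (f : V -> W) :
  hilbert W ->
  bounded_linear f -> bounded_linear (fun x => - f x).
Proof.
move=> hW fb; have := bounded_linear_scale (-1) hW fb.
by congr bounded_linear; apply/funext => x; rewrite ofRN ofR1 scaleN1r.
Qed.

Lemma bounded_linear_zero V W : hilbert W -> bounded_linear (fun _ : V => 0 : W).
Proof.
move=> hW; split; first by move=> c x y; rewrite scaler0 addr0.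
by exists 0 => x; rewrite (nrm0 hW) mul0r.
Qed.

Lemma bounded_linear_id V : bounded_linear (fun x : V => x).
Proof. by split=> //; exists 1 => x; rewrite mul1r. Qed.

Lemma bounded_linear_big V W (hW : hilbert W) (I : Type) (s : seq I) (P : pred I)
    (F : I -> V -> W) :
  (forall i, bounded_linear (F i)) ->
  bounded_linear (fun x => \sum_(i <- s | P i) F i x).
Proof.
move=> h; elim: s => [|i s ih].
  have := bounded_linear_zero V hW; congr bounded_linear.
  by apply/funext => x; rewrite big_nil.
case Pi : (P i).
  have := bounded_linear_add hW (h i) ih; congr bounded_linear.
  by apply/funext => x; rewrite big_cons Pi.
by move: ih; congr bounded_linear; apply/funext => x; rewrite big_cons Pi.
Qed.

End AdjointDouble.

(** * The uniform boundedness principle *)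

Section UniformBoundedness.
Variables (R : realType) (k : RorC) (V W : ipSpace R k) (I : Type).
Variable T : I -> V -> W.
Hypotheses (hV : hilbert V) (hW : hilbert W).
Hypothesis Tb : forall i, bounded_linear (T i).

(* Sokal's argument: one of [x + h] and [x - h] has an image at least as large
   as that of [h], so an unbounded family admits nested balls on which its
   members are ever larger. *)
Lemma uniform_boundedness :
  (forall x, exists c, forall i, nrm (T i x) <= c) ->
  exists2 M, 0 < M & forall i x, nrm (T i x) <= M * nrm x.
Proof.
move=> pb; apply: contrapT => nub.
have ub M : 0 < M -> exists i h, nrm h = 1 /\ M < nrm (T i h).
  move=> M0; apply: contrapT => no; apply: nub; exists M => // i x.
  have [->|x0] := eqVneq x 0.
    by rewrite (bounded_linear0 (Tb i)) !nrm0// mulr0.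
  have nx : 0 < nrm x.
    by rewrite lt_neqAle nrm_ge0 andbT eq_sym; apply: contra_neq x0; exact: nrm_eq0.
  rewrite leNgt; apply/negP => hx; apply: no; exists i, (ofR k (nrm x)^-1 *: x).
  rewrite (bounded_linear_Z _ _ (Tb i)) !nrmZ// ger0_norm ?invr_ge0 ?nrm_ge0//.
  split; first by rewrite mulVf ?gt_eqF.
  by rewrite mulrC ltr_pdivlMr.
(* A pair is a ball, given by centre and radius. The new ball lies inside the old one, has at most
   half its radius, and some member of the family is at least [n] on all of it. *)
have step (n : nat) (p : V * R) : exists q : V * R, 0 < p.2 ->
    [/\ 0 < q.2, q.2 <= p.2 / 2, nrm (q.1 - p.1) + q.2 <= p.2 &
    exists i, forall z, nrm (z - q.1) <= q.2 -> n%:R <= nrm (T i z)].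
  case: p => x r /=; have [r0|r0] := ltP 0 r; last by exists (x, r).
  have r20 : 0 < (n%:R + 1) / (r / 2) by rewrite divr_gt0// ?divr_gt0// ltr_wpDl.
  have [i [h [h1 hM]]] := ub _ r20.
  move: hM; rewrite ltr_pdivrMr ?divr_gt0// => hM.
  (* The images of [x + g] and [x - g] differ by that of [g + g], whose norm exceeds 2 (n + 1);
     hence one of them is longer than n + 1. *)
  have [y yx hy] : exists2 y, nrm (y - x) = r / 2 & n%:R + 1 < nrm (T i y).
    have r2 : 0 <= r / 2 by rewrite divr_ge0// ltW.
    pose g := ofR k (r / 2) *: h.
    have ng : nrm g = r / 2 by rewrite nrmZ// h1 mulr1 ger0_norm.
    have [h1'|h1'] := ltP (n%:R + 1) (nrm (T i (x + g))).
      by exists (x + g) => //; rewrite addrAC subrr add0r.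
    exists (x - g); first by rewrite addrAC subrr add0r nrmN.
    have : nrm (T i (g + g)) <= nrm (T i (x + g)) + nrm (T i (x - g)).
      have -> : g + g = (x + g) - (x - g) by rewrite opprB [x + g]addrC -addrA [x + _]addrC subrK.
      by rewrite (bounded_linear_B _ _ (Tb i)) (le_trans (nrmD hW _ _))// (nrmN hW).
    have -> : g + g = ofR k 2 *: g.
      by rewrite -{1 2}[g]scale1r -(ofR1 R k) -scalerDl -ofRD.
    rewrite 2!(bounded_linear_Z _ _ (Tb i)) !nrmZ// !ger0_norm//.
    move: hM h1'; nra.
  have [C C0 hC] := bounded_linear_bound (Tb i).
  (* A radius of at most [C^-1] moves the image by at most 1, the margin left in n + 1. *)
  exists (y, Num.min (r / 2) C^-1) => _ /=; split.
  - by rewrite lt_min divr_gt0//= invr_gt0.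
  - by rewrite ge_min lexx.
  - by rewrite yx [leRHS](splitr r) lerD2l ge_min lexx.
  - exists i => z; rewrite le_min => /andP[_].
    move=> hz.
    have : nrm (T i (z - y)) <= 1.
      by rewrite (le_trans (hC _))// -(@mulfV _ C) ?gt_eqF// ler_pM2l.
    rewrite (bounded_linear_B _ _ (Tb i)) => h2.
    have := nrm_sub_ge hW (T i y) (T i z); rewrite (nrmBC hW); lra.
have [F hF] := choice (fun np => step np.1 np.2).
pose s := fix s n := if n is m.+1 then F (m.+1, s m) else (0, 1) : V * R.
have s0 n : 0 < (s n).2.
  by elim: n => [/=|n ih]; [exact: ltr01|have [] := hF (n.+1, s n) ih].
have sh n := hF (n.+1, s n) (s0 n).
have nest n j : nrm ((s (j + n)%N).1 - (s n).1) + (s (j + n)%N).2 <= (s n).2.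
  elim: j => [|j ih]; first by rewrite add0n subrr nrm0// add0r.
  have [_ _ h _] := sh (j + n)%N; rewrite addSn /=.
  have := nrm_dist hV (F ((j + n).+1, s (j + n)%N)).1 (s (j + n)%N).1 (s n).1.
  move: h ih => /=; lra.
have sr n : (s n).2 <= 2^-1 ^+ n.
  elim: n => [|n ih]; first by rewrite expr0.
  have [_ h _ _] := sh n; rewrite (le_trans h)//= exprS mulrC ler_pM2l//.
have cs : vcauchy (fun n => (s n).1).
  move=> e e0.
  have [N hN] : exists N, 2^-1 ^+ N < e / 2.
    have : (fun n => 2^-1 ^+ n : R) @ \oo --> 0.
      by apply: cvg_expr; rewrite ger0_norm ?invr_ge0// invf_lt1// ltr1n.
    have e2 : 0 < e / 2 by rewrite divr_gt0.
    move=> /cvgrPdist_lt /(_ _ e2) [N _ /(_ N (leqnn _)) /=]; rewrite sub0r normrN ger0_norm ?exprn_ge0// => h.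
    by exists N.
  exists N => i j Ni Nj; have := nest N (i - N)%N; have := nest N (j - N)%N.
  rewrite !subnK// => h1 h2; have := nrm_dist hV (s i).1 (s N).1 (s j).1.
  rewrite (nrmBC hV (s N).1); have := s0 i; have := s0 j; have := sr N; move: hN.
  move: h1 h2; move: (2^-1 ^+ N) (s N) (s i) (s j) => c [a1 a2] [b1 b2] [c1 c2] /=.
  move: (nrm (a1 - c1)) (nrm (b1 - a1)) (nrm (b1 - c1)) => x y z; lra.
have [x xl] := vcauchy_cvg hV cs.
have xs n : nrm (x - (s n).1) <= (s n).2.
  apply/ler_addgt0Pr => e e0; have [N hN] := (vcvgP _ _).1 xl e e0.
  have := hN (N + n)%N (leq_addr _ _); have := nest n N; have := s0 (N + n)%N.
  by have := nrm_dist hV x (s (N + n)%N).1 (s n).1; rewrite (nrmBC hV x (s (N + n)%N).1); lra.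
have [c hc] := pb x.
have [n hn] : exists n : nat, c < n%:R.
  by exists (Num.truncn `|c|).+1; rewrite (le_lt_trans (ler_norm c))// truncnS_gt.
have [_ _ _ [i hi]] := sh n.
have := hi x (xs n.+1); have := hc i; move: hn.
by rewrite /= -natr1; lra.
Qed.

End UniformBoundedness.

(** * Gram-Schmidt, Fourier expansions and separability *)

Section Basis.
Variables (R : realType) (k : RorC) (V : ipSpace R k).
Hypothesis hV : hilbert V.
Local Notation K := (scal R k).

Definition total (v : nat -> V) := forall x, (forall n, ip x (v n) = 0) -> x = 0.

(** The table of the first [n] vectors; it makes the course-of-values recursion structural. *)
Fixpoint gs_upto (v : nat -> V) (n : nat) : nat -> V :=
  if n is m.+1 then fun i => if i == m
    then let r := v m - \sum_(j < m) ip (v m) (gs_upto v m j) *: gs_upto v m j in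
         ofR k (nrm r)^-1 *: r
    else gs_upto v m i
  else fun=> 0.

(* The residuals that vanish are kept, as the zero vector. *)
Definition gram_schmidt v n : V := gs_upto v n.+1 n.

Definition gs_residual v n : V :=
  v n - \sum_(j < n) ip (v n) (gram_schmidt v j) *: gram_schmidt v j.

Lemma gs_uptoE v n i : (i < n)%N -> gs_upto v n i = gram_schmidt v i.
Proof.
elim: n => // n ih; rewrite ltnS leq_eqVlt => /predU1P[->//|ilt].
by rewrite /= (ltn_eqF ilt) ih.
Qed.

Lemma gram_schmidtE v n :
  gram_schmidt v n = ofR k (nrm (gs_residual v n))^-1 *: gs_residual v n.
Proof.
rewrite /gram_schmidt /= eqxx /gs_residual.
by rewrite (eq_bigr (fun j : 'I_n => ip (v n) (gram_schmidt v j) *: gram_schmidt v j))//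
  => j _; rewrite gs_uptoE.
Qed.

Lemma ipxx (x : V) : ip x x = ofR k (sqnrm x) :> K.
Proof. by apply: scal_eq; rewrite ?reK_ofR// imK_ipxx// imK_ofR. Qed.

Lemma gram_schmidt_norm v n : ip (gram_schmidt v n) (gram_schmidt v n) =
  (gram_schmidt v n != 0)%:R.
Proof.
rewrite ipxx nat_ofR gram_schmidtE; congr ofR.
set r := gs_residual v n.
have [r0|r0] := eqVneq (nrm r) 0.
  by rewrite r0 invr0 ofR0 scale0r eqxx sqnrm0.
have h : sqnrm (ofR k (nrm r)^-1 *: r) = 1.
  by rewrite sqnrmZ// -(nrm_sqr hV) -exprMn mulVf// expr1n.
by rewrite h; case: eqP => // h0; move: h; rewrite h0 sqnrm0.
Qed.

Lemma ip_suml (I : Type) (s : seq I) (P : pred I) (F : I -> V) z :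
  ip (\sum_(i <- s | P i) F i) z = \sum_(i <- s | P i) ip (F i) z.
Proof. exact: (big_morph (fun x => ip x z) (fun x y => ipDl hV x y z) (ip0l hV z)). Qed.

Lemma gram_schmidt_orth v n i : (i < n)%N -> ip (gram_schmidt v n) (gram_schmidt v i) = 0.
Proof.
elim/ltn_ind: n i => n ih i ilt.
have orth j : (j < n)%N -> j != i -> ip (gram_schmidt v j) (gram_schmidt v i) = 0.
  move=> jn; rewrite neq_ltn => /orP[ji|ij]; last exact: ih.
  by rewrite ipC// (ih i ilt j ji) conjK0.
rewrite gram_schmidtE ipZl// [X in _ * X](_ : _ = 0) ?mulr0//.
rewrite /gs_residual ipDl// -scaleN1r ipZl// mulN1r ip_suml.
rewrite (bigD1 (Ordinal ilt))//= big1 => [|j ji]; last first.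
  by rewrite ipZl// orth ?mulr0//.
rewrite addr0 ipZl// gram_schmidt_norm.
case: eqP => [->|_]; last by rewrite mulr1 subrr.
by rewrite mulr0 subr0 ipC// ip0l// conjK0.
Qed.

Lemma gram_schmidt_onb v : total v ->
  orthonormal_basis [set n | gram_schmidt v n != 0] (gram_schmidt v).
Proof.
move=> tv; split.
  move=> i j /= i0 j0; have [->|] := eqVneq i j; first by rewrite gram_schmidt_norm j0.
  rewrite neq_ltn => /orP[ij|ji]; last exact: gram_schmidt_orth.
  by rewrite ipC// gram_schmidt_orth// conjK0.
move=> x hx; apply: tv => n.
have h0 i : ip x (gram_schmidt v i) = 0.
  have [->|i0] := eqVneq (gram_schmidt v i) 0; last exact: hx.
  by rewrite ipC// ip0l// conjK0.
have -> : v n = ofR k (nrm (gs_residual v n)) *: gram_schmidt v n +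
  \sum_(j < n) ip (v n) (gram_schmidt v j) *: gram_schmidt v j.
  rewrite gram_schmidtE scalerA -ofRM.
  have [r0|r0] := eqVneq (nrm (gs_residual v n)) 0.
    rewrite r0 mul0r ofR0 scale0r add0r; apply/eqP; rewrite -subr_eq0; apply/eqP.
    exact: nrm_eq0.
  by rewrite mulfV// ofR1 scale1r subrK.
rewrite ipDr// ipZr// h0 mulr0 add0r ipC// ip_suml big1 ?conjK0// => j _.
by rewrite ipZl// [ip (gram_schmidt v j) x]ipC// h0 conjK0 mulr0.
Qed.

Variables (D : set nat) (e : nat -> V).
Hypothesis onb : orthonormal_basis D e.

Definition fourier_sum (x : V) (N : nat) : V :=
  \sum_(i < N | `[< D i >]) ip x (e i) *: e i.

Definition abs2 (c : K) : R := reK c ^+ 2 + imK c ^+ 2.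

Lemma abs2_ge0 c : 0 <= abs2 c. Proof. by rewrite addr_ge0// sqr_ge0. Qed.

Lemma ip_fourier (x : V) N j : D j -> ip (fourier_sum x N) (e j) =
  if (j < N)%N then ip x (e j) else 0.
Proof.
move=> Dj; rewrite ip_suml; case: ltnP => jN.
  rewrite (bigD1 (Ordinal jN))/=; last exact/asboolP.
  rewrite big1 => [|i /andP[/asboolP Di ij]].
    by rewrite addr0 ipZl// onb.1// eqxx mulr1.
  rewrite ipZl// onb.1// (_ : (i == j :> nat) = false) ?mulr0//.
  by apply/negbTE; apply: contra_neq ij => ij; exact/val_inj.
rewrite big1// => i /asboolP Di; rewrite ipZl// onb.1//.
by rewrite ltn_eqF ?mulr0// (leq_trans (ltn_ord i)).
Qed.

Lemma rip_fourier x N (y : V) : rip y (fourier_sum x N) =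
  \sum_(i < N | `[< D i >]) reK (conjK (ip x (e i)) * ip y (e i)).
Proof.
rewrite rip_sumr//; apply: eq_bigr => i _; by rewrite /rip ipZr.
Qed.

Lemma reK_conjM (c : K) : reK (conjK c * c) = abs2 c.
Proof. by rewrite mulrC mulK_conj reK_ofR. Qed.

Lemma sqnrm_fourier x N : sqnrm (fourier_sum x N) =
  \sum_(i < N | `[< D i >]) abs2 (ip x (e i)).
Proof.
rewrite sqnrm_rip rip_fourier; apply: eq_bigr => i /asboolP Di.
by rewrite ip_fourier// ltn_ord reK_conjM.
Qed.

Lemma sqnrm_sub_fourier x N : sqnrm (x - fourier_sum x N) =
  sqnrm x - \sum_(i < N | `[< D i >]) abs2 (ip x (e i)).
Proof.
rewrite sqnrmB// sqnrm_fourier rip_fourier (eq_bigr (fun i : 'I_N => abs2 (ip x (e i)))).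
  by ring.
by move=> i _; rewrite reK_conjM.
Qed.

Lemma fourier_nd x : {homo (fun N => \sum_(i < N | `[< D i >]) abs2 (ip x (e i))) :
  n m / (n <= m)%N >-> n <= m}.
Proof.
apply/nondecreasing_seqP => n; rewrite big_mkcond [leRHS]big_mkcond/=.
by rewrite big_ord_recr/= lerDl; case: ifP => // _; exact: abs2_ge0.
Qed.

(** By Bessel's inequality the partial sums are Cauchy; the difference between [x] and their limit
    is orthogonal to the whole basis, hence 0. *)
Lemma fourier_cvg x : vcvg (fourier_sum x) x.
Proof.
have bessel N : \sum_(i < N | `[< D i >]) abs2 (ip x (e i)) <= sqnrm x.
  by have := sqnrm_ge0 hV (x - fourier_sum x N); rewrite sqnrm_sub_fourier subr_ge0.
set s := fun N => \sum_(i < N | `[< D i >]) abs2 (ip x (e i)).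
have diff i j : (j <= i)%N -> sqnrm (fourier_sum x i - fourier_sum x j) = s i - s j.
  move=> ji; rewrite sqnrmB// !sqnrm_fourier -/(s i) -/(s j).
  rewrite rip_fourier (eq_bigr (fun l : 'I_j => abs2 (ip x (e l)))) -/(s j); first by ring.
  by move=> l /asboolP Dl; rewrite ip_fourier// (leq_trans (ltn_ord l) ji) reK_conjM.
have [l sl] : exists l : R, s @ \oo --> l.
  exists (limn s); apply: nondecreasing_is_cvgn; first exact: fourier_nd.
  by exists (sqnrm x) => _ [N _ <-]; exact: bessel.
have cs : vcauchy (fourier_sum x).
  move=> eps e0; have e2 : 0 < eps ^+ 2 / 2 by rewrite divr_gt0// exprn_gt0.
  have /cvgrPdist_lt /(_ _ e2) [N _ hN] := sl.
  exists N.
  have main i j : (j <= i)%N -> (N <= i)%N -> (N <= j)%N ->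
      nrm (fourier_sum x i - fourier_sum x j) < eps.
    move=> ji /hN /= hi /hN /= hj; rewrite -(@ltr_pXn2r _ 2)// ?nnegrE ?nrm_ge0// ?(ltW e0)//.
    rewrite nrm_sqr// diff//; move: hi hj; rewrite !ltr_norml; lra.
  move=> i j Ni Nj; have [ji|/ltnW ij] := leqP j i; first exact: main.
  by rewrite nrmBC//; exact: main.
have [y yl] := vcauchy_cvg hV cs.
suff xy : x = y by move: yl; rewrite -xy.
apply/eqP; rewrite -subr_eq0; apply/eqP/onb.2 => i Di.
have lim (z : V) (N0 : nat) : (forall N, (N0 <= N)%N -> rip (fourier_sum x N) z = rip x z) ->
    rip (x - y) z = 0.
  move=> hz; rewrite ripBl//; apply/eqP; rewrite subr_eq0; apply/eqP.
  have h1 := vcvg_rip hV (z := z) yl.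
  have h2 : (fun N => rip (fourier_sum x N) z) @ \oo --> rip x z.
    apply: cvg_near_cst; exists N0 => // N /= /hz; exact.
  exact: (cvg_unique (@Rhausdorff R) h2 h1).
apply: scal_eq; rewrite ?reK0 ?imK0.
  apply: (lim _ i.+1) => N iN; by rewrite /rip ip_fourier// iN.
rewrite imK_ip//; apply: (lim _ i.+1) => N iN.
by rewrite -!imK_ip// ip_fourier// iN.
Qed.

Lemma parseval x :
  (fun N => \sum_(i < N | `[< D i >]) abs2 (ip x (e i))) @ \oo --> sqnrm x.
Proof.
under eq_fun do rewrite -sqnrm_fourier -nrm_sqr// expr2.
rewrite -nrm_sqr// expr2.
by apply: cvgM; apply: vcvg_nrm => //; exact: fourier_cvg.
Qed.

Lemma parseval_series x :
  (\sum_(i <oo | `[< D i >]) (abs2 (ip x (e i)))%:E = (sqnrm x)%:E)%E.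
Proof.
apply/cvg_lim => //.
rewrite (_ : (fun _ => _) = EFin \o
  (fun N => \sum_(i < N | `[< D i >]) abs2 (ip x (e i)))).
  by apply: cvg_EFin; [exact: nearW|exact: parseval].
by apply/funext => N /=; rewrite sumEFin big_mkord.
Qed.

Lemma basis_nrm i : D i -> nrm (e i) = 1.
Proof. by move=> Di; rewrite /nrm /sqnrm onb.1// eqxx nat_ofR reK_ofR sqrtr1. Qed.

(** Finite combinations with coefficients of rational real and imaginary parts are dense, and
    [pickle] enumerates them. The Euclidean and the energy space are shown to be separable in this
    way, from a countable total family. *)
Lemma onb_separable : separable V.
Proof.
pose c (q : rat * rat) : K := ofR k (ratr q.1) + ofR k (ratr q.2) * iK.
pose u (i : nat) : V := if `[< D i >] then e i else 0.
have u1 i : nrm (u i) <= 1.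
  by rewrite /u; case: asboolP => [/basis_nrm ->//|_]; rewrite nrm0.
pose v (s : seq (rat * rat)) : V := \sum_(i < size s) c (nth (0, 0) s i) *: u i.
exists (fun j => if unpickle j is Some s then v s else 0) => x eps e0.
suff [s hs] : exists s, nrm (x - v s) < eps by exists (pickle s); rewrite pickleK.
have qc (z : K) (d : R) : 0 < d -> exists q, forall i, nrm ((z - c q) *: u i) < d.
  move=> d0; have d2 : 0 < d / 2 by rewrite divr_gt0.
  have app (a : R) : exists q : rat, `|a - ratr q| < d / 2.
    have [q] := @rat_in_itvoo _ (a - d / 2) (a + d / 2) (ltac:(lra)).
    rewrite in_itv/= => /andP[h1 h2]; exists q; rewrite ltr_norml; lra.
  have [q1 h1] := app (reK z); have [q2 h2] := app (imK z).
  exists (q1, q2) => i.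
  have -> : z - c (q1, q2) = ofR k (reK z - ratr q1) + ofR k (imK z - ratr q2) * iK.
    by rewrite {1}(scalE z) /c /= !ofRD !ofRN; ring.
  rewrite scalerDl (le_lt_trans (nrmD hV _ _))// -scalerA !nrmZ//.
  have : nrm (iK *: u i) <= 1 by rewrite (le_trans (nrm_le_sqnrm (sqnrm_iK hV _))).
  have := u1 i; have := nrm_ge0 (u i); have := nrm_ge0 (iK *: u i).
  move: h1 h2 (normr_ge0 (reK z - ratr q1)) (normr_ge0 (imK z - ratr q2)).
  move: `|_| `|_| (nrm _) (nrm _) => A B C E; nra.
have fin N (d : R) : 0 < d ->
    exists s, nrm (fourier_sum x N - v s) < d /\ size s = N.
  elim: N d => [|N ih] d d0.
    by exists [::]; rewrite /v /fourier_sum/= !big_ord0 subrr nrm0.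
  have d2 : 0 < d / 2 by rewrite divr_gt0.
  have [s [hs sN]] := ih _ d2; have [q hq] := qc (ip x (e N)) _ d2.
  exists (rcons s q); rewrite size_rcons sN; split=> //.
  have -> : v (rcons s q) = v s + c q *: u N.
    rewrite /v size_rcons sN big_ord_recr/= nth_rcons sN ltnn eqxx; congr (_ + _).
    by apply: eq_bigr => i _; rewrite nth_rcons sN ltn_ord.
  have -> : fourier_sum x N.+1 = fourier_sum x N + ip x (e N) *: u N.
    rewrite /fourier_sum big_mkcond big_ord_recr/= -big_mkcond/=; congr (_ + _).
    by rewrite /u; case: asboolP => // _; rewrite scaler0.
  rewrite opprD addrACA -scalerBl (le_lt_trans (nrmD hV _ _))//.
  by have := hq N; lra.
have e2 : 0 < eps / 2 by rewrite divr_gt0.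
have [N hN] := (vcvgP _ _).1 (fourier_cvg x) _ e2.
have [s [hs _]] := fin N _ e2; exists s.
have := nrm_dist hV x (fourier_sum x N) (v s).
by have := hN N (leqnn _); rewrite nrmBC//; lra.
Qed.

End Basis.

(** A vector orthogonal to a dense sequence has norm at most its distance to any member of the
    sequence. *)
Lemma separable_total (R : realType) (k : RorC) (V : ipSpace R k) :
  hilbert V -> separable V -> exists v : nat -> V, total v.
Proof.
move=> hV [v hv]; exists v => x hx; apply: (nrm_eq0 hV).
apply/eqP; rewrite eq_le nrm_ge0 andbT; apply/ler_addgt0Pr => eps e0; rewrite add0r.
have [i hi] := hv x eps e0.
rewrite -(@ler_pXn2r _ 2)// ?nnegrE ?nrm_ge0// ?(ltW e0)// nrm_sqr//.
have : sqnrm (x - v i) <= eps ^+ 2 by apply: sqnrm_le => //; exact: ltW.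
rewrite sqnrmB// /rip hx reK0 mulr0 subr0; by apply: le_trans; rewrite lerDl sqnrm_ge0.
Qed.

(** * Weak measurability, Pettis and Bochner integrals *)

Section WeakMeasurability.
Variables (R : realType) (k : RorC).

(** Measurability of the real projections. On a separable space it is equivalent to Borel
    measurability ([wmeas_borel]), and it passes to sums, pointwise limits and images under bounded
    operators by real arguments. *)
Definition wmeas (V : ipSpace R k) d (T : measurableType d) (xi : T -> V) :=
  forall z, measurable_fun setT (fun t => rip (xi t) z).

Section Algebra.
Variables (V : ipSpace R k) (hV : hilbert V) (d : measure_display) (T : measurableType d).
Implicit Types xi eta : T -> V.

Lemma wmeas_cst (v : V) : wmeas (fun _ : T => v).
Proof. by move=> z; exact: measurable_cst. Qed.

Lemma wmeasD xi eta : wmeas xi -> wmeas eta -> wmeas (fun t => xi t + eta t).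
Proof.
move=> h1 h2 z; under eq_fun do rewrite ripDl//.
exact: measurable_funD (h1 z) (h2 z).
Qed.

Lemma wmeasN xi : wmeas xi -> wmeas (fun t => - xi t).
Proof.
move=> h z; under eq_fun do rewrite ripNl//.
exact: measurableT_comp (h z).
Qed.

Lemma wmeasB xi eta : wmeas xi -> wmeas eta -> wmeas (fun t => xi t - eta t).
Proof. by move=> h1 h2; apply: wmeasD => //; exact: wmeasN. Qed.

Lemma wmeasZ (r : T -> R) xi : measurable_fun setT r -> wmeas xi ->
  wmeas (fun t => ofR k (r t) *: xi t).
Proof.
move=> h1 h2 z; under eq_fun do rewrite ripZl//.
exact: measurable_funM (h1) (h2 z).
Qed.

Lemma wmeas_sum (I : Type) (s : seq I) (F : I -> T -> V) :
  (forall i, wmeas (F i)) -> wmeas (fun t => \sum_(i <- s) F i t).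
Proof.
move=> h z; under eq_fun do rewrite rip_suml//.
by apply: measurable_sum => i; exact: h.
Qed.

Lemma wmeas_cvg (F : nat -> T -> V) xi : (forall n, wmeas (F n)) ->
  (forall t, vcvg (fun n => F n t) (xi t)) -> wmeas xi.
Proof.
move=> h1 h2 z; apply: (@measurable_fun_cvg _ _ _ _ (fun n t => rip (F n t) z)).
  by move=> n; exact: h1.
by move=> t _; exact: vcvg_rip.
Qed.

Lemma wmeas_if (A : set T) xi eta : measurable A -> wmeas xi -> wmeas eta ->
  wmeas (fun t => if `[< A t >] then xi t else eta t).
Proof.
move=> mA h1 h2 z.
rewrite (_ : (fun t => _) = (fun t => if `[< A t >] then rip (xi t) z else rip (eta t) z)).
  apply: measurable_fun_ifT => //.
  apply: (measurable_fun_bool true); rewrite setTI.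
  by rewrite (_ : _ @^-1` _ = A)//; apply/seteqP; split=> t /= /asboolP.
by apply/funext => t; case: ifP.
Qed.

Lemma wmeas_comp d' (T' : measurableType d') (phi : T' -> T) xi :
  measurable_fun setT phi -> wmeas xi -> wmeas (xi \o phi).
Proof. by move=> h1 h2 z; exact: measurableT_comp (h2 z) h1. Qed.

End Algebra.

Lemma wmeas_bounded_linear (V W : ipSpace R k) (f : V -> W) (d : measure_display)
  (T : measurableType d) (xi : T -> V) : hilbert V -> hilbert W ->
  bounded_linear f -> wmeas xi -> wmeas (fun t => f (xi t)).
Proof.
move=> hV hW fb h z; under eq_fun do rewrite rip_adjoint//.
exact: h.
Qed.

Section Separable.
Variables (V : ipSpace R k) (hV : hilbert V) (sV : separable V).
Variables (d : measure_display) (T : measurableType d).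
Implicit Types xi eta : T -> V.

(** Parseval's identity along a countable orthonormal basis writes the squared norm as a limit of
    sums of measurable functions. *)
Lemma measurable_sqnrm xi : wmeas xi -> measurable_fun setT (fun t => sqnrm (xi t)).
Proof.
move=> h; have [v tv] := separable_total hV sV.
have onb := gram_schmidt_onb hV tv; set e := gram_schmidt v in onb.
apply: (@measurable_fun_cvg _ _ _ _ (fun N t => \sum_(i < N |
    `[< [set n | e n != 0] i >]) abs2 (ip (xi t) (e i)))).
  move=> N; have -> : (fun t => \sum_(i < N | `[< [set n | e n != 0] i >])
      abs2 (ip (xi t) (e i))) = (fun t => \sum_(i < N)
      (if `[< [set n | e n != 0] i >] then abs2 (ip (xi t) (e i)) else 0)).
    by apply/funext => t; rewrite big_mkcond.
  apply: measurable_sum => i; case: `[< [set n | e n != 0] i >]; last exact: measurable_cst.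
  rewrite /abs2; apply: measurable_funD; apply: measurable_funX.
    exact: h.
  by under eq_fun do rewrite imK_ip//; exact: h.
by move=> t _; exact: parseval.
Qed.

Lemma measurable_nrm xi : wmeas xi -> measurable_fun setT (fun t => nrm (xi t)).
Proof.
move=> /measurable_sqnrm; rewrite /nrm.
exact: measurableT_comp (continuous_measurable_fun (@sqrt_continuous R)).
Qed.

Lemma measurable_rip xi eta : wmeas xi -> wmeas eta ->
  measurable_fun setT (fun t => rip (xi t) (eta t)).
Proof.
move=> h1 h2; have -> : (fun t => rip (xi t) (eta t)) =
    (fun t => 2^-1 * (sqnrm (xi t + eta t) - sqnrm (xi t) - sqnrm (eta t))).
  by apply/funext => t; rewrite sqnrmD//; field.
apply: measurable_funM => //; apply: measurable_funB; last exact: measurable_sqnrm.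
by apply: measurable_funB; apply: measurable_sqnrm => //; exact: wmeasD.
Qed.

(** An open set is a countable union of balls centred at a dense sequence, and the norm is
    measurable; conversely the half-spaces where [rip x z] exceeds a constant are open. *)
Lemma wmeas_borel xi : wmeas xi <-> forall U, borel U -> measurable (xi @^-1` U).
Proof.
split=> [h|h z].
  suff : @borel R k V `<=` [set U | measurable (xi @^-1` U)] by [].
  apply: smallest_sub.
    split => /=.
    - by rewrite preimage_set0; exact: measurable0.
    - by move=> A mA; rewrite setTD preimage_setC; exact: measurableC.
    - by move=> A mA; rewrite preimage_bigcup; exact: bigcup_measurable.
  move=> U /= oU; have [v dv] := sV.
  rewrite (_ : xi @^-1` U = \bigcup_i \bigcup_(n in [set n |
      [set y | nrm (y - v i) < n.+1%:R^-1] `<=` U])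
      [set t | nrm (xi t - v i) < n.+1%:R^-1]).
    apply: bigcup_measurable => i _; apply: bigcup_measurable => n _.
    have mn := measurable_nrm (wmeasB hV h (wmeas_cst (T:=T) (v i))).
    have := mn measurableT `]-oo, n.+1%:R^-1[%classic (measurable_itv _).
    by rewrite setTI; congr measurable; apply/seteqP; split=> t /=; rewrite in_itv.
  apply/seteqP; split=> t /=; last by case=> i _ [n nU]; exact: nU.
  move=> Ut; have [eps e0 he] := oU _ Ut.
  have e2 : 0 < eps / 2 by rewrite divr_gt0.
  have [n hn] := ltr_add_invr e2; rewrite add0r in hn.
  have n0 : 0 < n.+1%:R^-1 :> R by rewrite invr_gt0.
  have [i hi] := dv (xi t) _ n0.
  exists i => //; exists n => //= y hy; apply: he.
  rewrite (le_lt_trans (nrm_dist hV _ (v i) _))// (nrmBC hV (v i)).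
  by rewrite (lt_le_trans (ltrD hy hi))// [leRHS](splitr eps) lerD// ltW.
apply: (measurability _ (RGenOInfty.measurableE R)).
move=> _ [_ [a ->] <-]; rewrite setTI.
rewrite (_ : _ @^-1` _ = xi @^-1` [set x | a < rip x z]); last first.
  by apply/seteqP; split=> t /=; rewrite in_itv/= andbT.
apply: h; apply: sub_sigma_algebra => x /= ax.
have z1 : 0 < nrm z + 1 by rewrite ltr_pwDr ?nrm_ge0.
exists ((rip x z - a) / (nrm z + 1)); first by rewrite divr_gt0// subr_gt0.
move=> y; rewrite ltr_pdivlMr// => hy.
have := cauchy_schwarz hV (y - x) z; rewrite ripBl// ler_norml => /andP[+ _].
have := nrm_ge0 (y - x); have := nrm_ge0 z; move: hy; nra.
Qed.

Lemma random_elementP xi : random_element measurable xi <-> wmeas xi.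
Proof. exact: iff_sym (wmeas_borel xi). Qed.

End Separable.
End WeakMeasurability.

(** * Weak integrals *)

Section Pettis.
Variables (R : realType) (k : RorC) (V : ipSpace R k).
Hypotheses (hV : hilbert V) (sV : separable V).
Variables (d : measure_display) (T : measurableType d) (mu : {measure set T -> \bar R}).
Implicit Types g h : T -> V.

Definition vintegrable g := wmeas g /\ (\int[mu]_x (nrm (g x))%:E < +oo)%E.

(** The integral is defined by its inner products, so that linearity, measurability in a parameter
    and Fubini reduce to real integrals; [bochner_pettis] and [pettis_bochner] identify it with the
    Bochner integral. *)
Definition pettis g : V :=
  xget 0 [set v | forall z, rip v z = Rintegral mu setT (fun x => rip (g x) z)].

Lemma vintegrable_nrm g : vintegrable g -> mu.-integrable setT (EFin \o (fun x => nrm (g x))).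
Proof.
move=> [mg ig]; apply/integrableP; split.
  by apply/measurable_EFinP; exact: measurable_nrm.
by under eq_integral do rewrite /= ger0_norm ?nrm_ge0//.
Qed.

Lemma vintegrable_rip g z : vintegrable g -> mu.-integrable setT (EFin \o (fun x => rip (g x) z)).
Proof.
move=> ig; have := integrableZl measurableT (nrm z) (vintegrable_nrm ig).
apply: le_integrable => //.
  by apply/measurable_EFinP; exact: ig.1.
move=> x _ /=; rewrite lee_fin normrM !(ger0_norm (nrm_ge0 _)) mulrC.
exact: cauchy_schwarz.
Qed.

Lemma EFin_Rintegral_le (f : T -> R) g (c : R) : vintegrable g -> 0 <= c ->
  mu.-integrable setT (EFin \o f) -> (forall x, `|f x| <= nrm (g x) * c) ->
  `|Rintegral mu setT f| <= fine (\int[mu]_x (nrm (g x))%:E)%E * c.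
Proof.
move=> ig c0 If h; rewrite (le_trans (le_normr_Rintegral measurableT If))//.
have Ig := vintegrable_nrm ig.
rewrite -/(Rintegral mu setT (fun x => nrm (g x))) -RintegralZr//.
apply: le_Rintegral => //.
- by apply: integrable_norm If.
- exact: (integrableZr measurableT c Ig).
Qed.

(** The functional sending [z] to the integral of [rip (g x) z] is bounded by the integral of the
    norm, so that [riesz] represents it. *)
Lemma pettisE g z : vintegrable g ->
  rip (pettis g) z = Rintegral mu setT (fun x => rip (g x) z).
Proof.
move=> ig; rewrite /pettis; case: xgetP => [v _ //|no]; exfalso.
have [|||v hv] := @riesz _ _ _ hV (fun z => Rintegral mu setT (fun x => rip (g x) z))
  (fine (\int[mu]_x (nrm (g x))%:E)%E).
- move=> x y; rewrite -RintegralD//; try exact: vintegrable_rip.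
  by apply: eq_Rintegral => t _; rewrite ripDr.
- move=> r x; rewrite -RintegralZl//; last exact: vintegrable_rip.
  by apply: eq_Rintegral => t _; rewrite ripZr.
- move=> x; apply: EFin_Rintegral_le => //; first exact: nrm_ge0.
    exact: vintegrable_rip.
  by move=> t; exact: cauchy_schwarz.
by apply: (no v) => y; rewrite hv ripC.
Qed.

Lemma pettis_unique g v : vintegrable g ->
  (forall z, rip v z = Rintegral mu setT (fun x => rip (g x) z)) -> v = pettis g.
Proof. by move=> ig h; apply: (rip_inj hV) => z; rewrite h pettisE. Qed.

Lemma nrm_pettis g : vintegrable g ->
  nrm (pettis g) <= fine (\int[mu]_x (nrm (g x))%:E)%E.
Proof.
move=> ig; apply: (nrm_le_rip hV).
  by apply: fine_ge0; apply: integral_ge0 => x _; rewrite lee_fin nrm_ge0.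
move=> z; rewrite pettisE//; apply: le_trans (ler_norm _) _.
apply: EFin_Rintegral_le => //; first exact: nrm_ge0.
  exact: vintegrable_rip.
by move=> t; exact: cauchy_schwarz.
Qed.

Lemma EFin_nrm_pettis g : vintegrable g ->
  ((nrm (pettis g))%:E <= \int[mu]_x (nrm (g x))%:E)%E.
Proof.
move=> ig; rewrite -[leRHS]fineK ?lee_fin ?nrm_pettis//.
rewrite ge0_fin_numE ?ig.2//.
by apply: integral_ge0 => x _; rewrite lee_fin nrm_ge0.
Qed.

Lemma vintegrable_le g (f : T -> R) : wmeas g -> measurable_fun setT f ->
  (\int[mu]_x (f x)%:E < +oo)%E -> (forall x, nrm (g x) <= f x) -> vintegrable g.
Proof.
move=> mg mf If h; split=> //; apply: le_lt_trans If.
apply: ge0_le_integral => //.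
- by move=> x _; rewrite lee_fin nrm_ge0.
- by apply/measurable_EFinP; exact: measurable_nrm.
- by apply/measurable_EFinP.
- by move=> x _; rewrite lee_fin h.
Qed.

Lemma vintegrableD g h : vintegrable g -> vintegrable h ->
  vintegrable (fun x => g x + h x).
Proof.
move=> ig ih.
apply: (@vintegrable_le _ (fun x => nrm (g x) + nrm (h x))).
- exact: wmeasD ig.1 ih.1.
- by apply: measurable_funD; apply: measurable_nrm => //; [exact: ig.1|exact: ih.1].
- under eq_integral do rewrite EFinD.
  rewrite ge0_integralD//; first by rewrite lte_add_pinfty ?ig.2 ?ih.2.
  + by move=> x _; rewrite lee_fin nrm_ge0.
  + by apply/measurable_EFinP/measurable_nrm => //; exact: ig.1.
  + by move=> x _; rewrite lee_fin nrm_ge0.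
  + by apply/measurable_EFinP/measurable_nrm => //; exact: ih.1.
- by move=> x; exact: nrmD.
Qed.

Lemma vintegrableN g : vintegrable g -> vintegrable (fun x => - g x).
Proof.
move=> [mg ig]; split; first exact: wmeasN.
by under eq_integral do rewrite nrmN//.
Qed.

Lemma vintegrableB g h : vintegrable g -> vintegrable h ->
  vintegrable (fun x => g x - h x).
Proof. by move=> ig /vintegrableN ih; exact: vintegrableD. Qed.

Lemma pettisB g h : vintegrable g -> vintegrable h ->
  pettis (fun x => g x - h x) = pettis g - pettis h.
Proof.
move=> ig ih; apply/esym/pettis_unique; first exact: vintegrableB.
move=> z; rewrite ripBl// !pettisE// -RintegralB//; try exact: vintegrable_rip.
by apply: eq_Rintegral => t _; rewrite ripBl.
Qed.

End Pettis.

Section PettisParameter.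
Variables (R : realType) (d1 d2 : measure_display).
Variables (T1 : measurableType d1) (T2 : measurableType d2).
Variable mu : {sigma_finite_measure set T1 -> \bar R}.

Lemma measurable_Rintegral_param (f : T1 * T2 -> R) : measurable_fun setT f ->
  measurable_fun setT (fun y => Rintegral mu setT (fun x => f (x, y))).
Proof.
move=> mf; rewrite /Rintegral; apply: measurableT_comp; first exact: fine_measurable.
under eq_fun do rewrite integralE.
have mE : measurable_fun setT (EFin \o f) by exact/measurable_EFinP.
apply: emeasurable_funB.
  rewrite [X in measurable_fun _ X](_ : _ = fubini_G mu (EFin \o f)^\+%E);
    last by apply/funext => y; apply: eq_integral => x _; rewrite !funeposE.
  exact: (measurable_fun_fubini_tonelli_G (m1 := mu) _ (measurable_funepos mE) (funepos_ge0 _)).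
rewrite [X in measurable_fun _ X](_ : _ = fubini_G mu (EFin \o f)^\-%E);
    last by apply/funext => y; apply: eq_integral => x _; rewrite !funenegE.
exact: (measurable_fun_fubini_tonelli_G (m1 := mu) _ (measurable_funeneg mE) (funeneg_ge0 _)).
Qed.

Lemma measurable_integral_param (f : T1 * T2 -> \bar R) : measurable_fun setT f ->
  (forall z, 0 <= f z)%E ->
  measurable_fun setT (fun y => \int[mu]_x f (x, y))%E.
Proof. by move=> mf f0; exact: measurable_fun_fubini_tonelli_G. Qed.

Variables (k : RorC) (V : ipSpace R k).
Hypotheses (hV : hilbert V) (sV : separable V).

Lemma wmeas_pettis (g : T1 * T2 -> V) : wmeas g ->
  (forall y, vintegrable mu (fun x => g (x, y))) ->
  wmeas (fun y => pettis mu (fun x => g (x, y))).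
Proof.
move=> mg ig z; under eq_fun do rewrite (pettisE hV sV _ (ig _)).
exact: (measurable_Rintegral_param (mg z)).
Qed.

End PettisParameter.

(** * Pointwise limits of fast mean-square Cauchy sequences *)

Section RieszFischer.
Variables (R : realType) (k : RorC) (V : ipSpace R k).
Hypotheses (hV : hilbert V) (sV : separable V).

Definition vlim (f : nat -> V) : V := xget 0 [set l | vcvg f l].

Lemma vlimP f : vcauchy f -> vcvg f (vlim f).
Proof.
move=> /(vcauchy_cvg hV)[l fl]; rewrite /vlim; case: xgetP => [l' _ //|no].
by case: (no l).
Qed.

(** A measurable criterion for convergence: if the sum is finite, the increments are of order 2^-n.
    The weight 4^n leaves room for increments whose second moments are of order 8^-n. *)
Definition fast (f : nat -> V) : \bar R :=
  (\sum_(n <oo) (4 ^+ n * sqnrm (f n.+1 - f n))%:E)%E.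

Lemma fast_ge0 f : (0 <= fast f)%E.
Proof.
by apply: nneseries_ge0 => n _ _; rewrite lee_fin mulr_ge0 ?exprn_ge0 ?sqnrm_ge0.
Qed.

Lemma fast_cauchy f : (fast f < +oo)%E -> vcauchy f.
Proof.
move=> ff.
have t0 n : (0 <= (4 ^+ n * sqnrm (f n.+1 - f n))%:E)%E.
  by rewrite lee_fin mulr_ge0 ?exprn_ge0 ?sqnrm_ge0.
have ffin : fast f \is a fin_num.
  by rewrite ge0_fin_numE//; apply: nneseries_ge0 => n _ _; exact: t0.
pose C := Num.sqrt (fine (fast f)).
have C0 : 0 <= C by exact: sqrtr_ge0.
have f0 : 0 <= fine (fast f).
  by apply: fine_ge0; apply: nneseries_ge0 => n _ _; exact: t0.
have step n : nrm (f n.+1 - f n) <= C * 2^-1 ^+ n.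
  apply: nrm_le; first by rewrite mulr_ge0// exprn_ge0.
  rewrite exprMn sqr_sqrtr// -exprM mulnC exprM.
  have : ((4 ^+ n * sqnrm (f n.+1 - f n))%:E <= fast f)%E.
    rewrite /fast (nneseriesD1 (n := n) (fun i _ => t0 i))//.
    by rewrite leeDl//; apply: nneseries_ge0 => i _ _; exact: t0.
  rewrite -{1}(fineK ffin) lee_fin.
  have -> : (2^-1 : R) ^+ 2 = 4^-1 by field.
  rewrite -ler_pdivlMl ?exprn_gt0// mulrC exprVn; exact.
have tail n m : nrm (f (m + n)%N - f n) <= 2 * C * 2^-1 ^+ n.
  suff : nrm (f (m + n)%N - f n) <= 2 * C * 2^-1 ^+ n - 2 * C * 2^-1 ^+ (m + n).
    move/le_trans; apply; rewrite lerBlDr lerDl mulr_ge0 ?mulr_ge0 ?exprn_ge0//.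
  elim: m => [|m ih]; first by rewrite add0n !subrr nrm0.
  rewrite addSn; apply: le_trans (nrm_dist hV _ (f (m + n)%N) _) _.
  have := step (m + n)%N; rewrite exprS.
  move: ih; move: (nrm _) (nrm _) (2^-1 ^+ n) (2^-1 ^+ (m + n)) => a b c e; nra.
move=> e e0.
have [N hN] : exists N, 2 * C * 2^-1 ^+ N < e / 2.
  have : geometric (2 * C) (2^-1 : R) @ \oo --> 0.
    by apply: cvg_geometric; rewrite ger0_norm ?invr_ge0// invf_lt1// ltr1n.
  have e2 : 0 < e / 2 by rewrite divr_gt0.
  move=> /cvgrPdist_lt /(_ _ e2) [N _ /(_ N (leqnn _)) /=].
  rewrite sub0r normrN ger0_norm ?mulr_ge0 ?exprn_ge0// => h.
  by exists N.
exists N => i j Ni Nj; apply: le_lt_trans (nrm_dist hV _ (f N) _) _.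
have := tail N (i - N)%N; have := tail N (j - N)%N; rewrite !subnK// (nrmBC hV (f N)).
move=> h1 h2; rewrite [ltRHS](splitr e); apply: ltrD; exact: le_lt_trans hN.
Qed.

Variables (d : measure_display) (T : measurableType d).

(** The limit where [fast] is finite and 0 elsewhere. It is total, and measurable for every
    sigma-algebra for which all [f n] are; one definition thus serves for joint measurability and
    for adaptedness. *)
Definition flim (f : nat -> T -> V) (x : T) : V :=
  vlim (fun n => if `[< (fast (f ^~ x) < +oo)%E >] then f n x else 0).

Lemma flimP f x : (fast (f ^~ x) < +oo)%E -> vcvg (f ^~ x) (flim f x).
Proof.
move=> h; have -> : flim f x = vlim (f ^~ x); last exact: vlimP (fast_cauchy h).
by rewrite /flim; congr vlim; apply/funext => n; rewrite asboolT.
Qed.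

Lemma flim_bad f x : ~ (fast (f ^~ x) < +oo)%E -> flim f x = 0.
Proof.
move=> h; rewrite /flim; under eq_fun do rewrite asboolF//.
apply: (@vcvg_unique _ _ _ hV (fun=> 0)).
  by apply: vlimP => e e0; exists 0%N => i j _ _; rewrite subrr nrm0.
by apply/vcvgP => e e0; exists 0%N => i _; rewrite subrr nrm0.
Qed.

Lemma measurable_fast (f : nat -> T -> V) : (forall n, wmeas (f n)) ->
  measurable_fun setT (fun x => fast (f ^~ x)).
Proof.
move=> mf; apply: ge0_emeasurable_sum => [n x _ _|n _].
  by rewrite lee_fin mulr_ge0 ?exprn_ge0 ?sqnrm_ge0.
apply/measurable_EFinP; apply: measurable_funM => //.
apply: (@measurable_sqnrm _ _ _ hV sV _ _ (fun x => f n.+1 x - f n x)).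
by apply: wmeasB => //; exact: mf.
Qed.

Lemma measurable_fast_fin (f : nat -> T -> V) : (forall n, wmeas (f n)) ->
  measurable [set x | (fast (f ^~ x) < +oo)%E].
Proof.
move=> mf; have := emeasurable_fun_infty_o measurableT (measurable_fast mf) +oo%E.
by rewrite setTI.
Qed.

Lemma wmeas_flim f : (forall n, wmeas (f n)) -> wmeas (flim f).
Proof.
move=> mf; apply: (wmeas_cvg hV
  (F := fun n x => if `[< (fast (f ^~ x) < +oo)%E >] then f n x else 0)).
  move=> n; apply: (wmeas_if (measurable_fast_fin mf)); first exact: mf.
  exact: wmeas_cst.
move=> x; have [h|h] := pselect (fast (f ^~ x) < +oo)%E.
  have := flimP h; congr vcvg; apply/funext => n; by rewrite asboolT.
rewrite flim_bad//; apply/vcvgP => e e0; exists 0%N => i _.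
by rewrite asboolF// subrr nrm0.
Qed.

Variable mu : {measure set T -> \bar R}.

Definition L2sq (g : T -> V) : \bar R := (\int[mu]_x (sqnrm (g x))%:E)%E.

Lemma L2sq_ge0 g : (0 <= L2sq g)%E.
Proof. by apply: integral_ge0 => x _; rewrite lee_fin sqnrm_ge0. Qed.

Lemma emeasurable_sqnrm (g : T -> V) : wmeas g ->
  measurable_fun setT (fun x => (sqnrm (g x))%:E).
Proof. by move=> mg; apply/measurable_EFinP; exact: measurable_sqnrm. Qed.

Lemma L2sqD_le (g h : T -> V) : wmeas g -> wmeas h ->
  (L2sq (fun x => g x + h x)%R <= 2%:E * L2sq g + 2%:E * L2sq h)%E.
Proof.
move=> mg mh; rewrite /L2sq -!ge0_integralZl//; try exact: emeasurable_sqnrm;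
  try by move=> x _; rewrite lee_fin sqnrm_ge0.
rewrite -ge0_integralD//; last 4 first.
- by move=> x _; rewrite mule_ge0// lee_fin sqnrm_ge0.
- by apply: measurable_funeM; exact: emeasurable_sqnrm.
- by move=> x _; rewrite mule_ge0// lee_fin sqnrm_ge0.
- by apply: measurable_funeM; exact: emeasurable_sqnrm.
apply: ge0_le_integral => //.
- by move=> x _; rewrite lee_fin sqnrm_ge0.
- by apply: emeasurable_sqnrm; exact: wmeasD.
- by apply: emeasurable_funD; apply: measurable_funeM; exact: emeasurable_sqnrm.
- by move=> x _; rewrite -!EFinM -EFinD lee_fin sqnrmD_le.
Qed.

Lemma L2sqN g : L2sq (fun x => - g x)%R = L2sq g.
Proof. by apply: eq_integral => x _; rewrite sqnrmN. Qed.

Lemma L2sqBC g h : L2sq (fun x => g x - h x)%R = L2sq (fun x => h x - g x)%R.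
Proof. by apply: eq_integral => x _; rewrite sqnrmBC. Qed.

Lemma L2sq_dist (g h l : T -> V) : wmeas g -> wmeas h -> wmeas l ->
  (L2sq (fun x => g x - l x)%R <=
   2%:E * L2sq (fun x => g x - h x)%R + 2%:E * L2sq (fun x => h x - l x)%R)%E.
Proof.
move=> mg mh ml; have := L2sqD_le (wmeasB hV mg mh) (wmeasB hV mh ml).
rewrite (_ : (fun x => g x - h x + (h x - l x)) = (fun x => g x - l x))//.
by apply/funext => x; rewrite addrA subrK.
Qed.

Lemma nneseries_le_half (u : nat -> \bar R) (C : R) :
  (forall n, 0 <= u n)%E -> (forall n, u n <= (C * 2^-1 ^+ n)%:E)%E ->
  (\sum_(n <oo) u n <= (2 * C)%:E)%E.
Proof.
move=> u0 uC; have C0 : 0 <= C by have := le_trans (u0 0%N) (uC 0%N); rewrite expr0 mulr1.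
apply: lime_le; first exact: is_cvg_nneseries.
apply: nearW => n; apply: (@le_trans _ _ (2 * C - 2 * C * 2^-1 ^+ n)%:E).
  elim: n => [|n ih]; first by rewrite big_geq// expr0 mulr1 subrr.
  rewrite big_nat_recr//=; apply: le_trans (leeD ih (uC n)) _.
  by rewrite -EFinD lee_fin exprS; move: (2^-1 ^+ n) => c; lra.
by rewrite lee_fin lerBlDr lerDl mulr_ge0 ?mulr_ge0 ?exprn_ge0.
Qed.

Section Convergence.
Variables (f : nat -> T -> V) (C : R).
Hypothesis mf : forall n, wmeas (f n).
Hypothesis fC : forall n, (L2sq (fun x => f n.+1 x - f n x)%R <= (C * 8^-1 ^+ n)%:E)%E.

(** The integral of [fast] is a series with terms at most 4^n C 8^-n = C 2^-n. *)
Lemma fast_ae : {ae mu, forall x, (fast (f ^~ x) < +oo)%E}.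
Proof.
have m n : measurable_fun setT (fun x => (4 ^+ n * sqnrm (f n.+1 x - f n x))%:E).
  apply/measurable_EFinP; apply: measurable_funM => //.
  apply: (@measurable_sqnrm _ _ _ hV sV _ _ (fun x => f n.+1 x - f n x)).
  by apply: wmeasB => //; exact: mf.
have p n x : (0 <= (4 ^+ n * sqnrm (f n.+1 x - f n x))%:E)%E.
  by rewrite lee_fin mulr_ge0 ?exprn_ge0 ?sqnrm_ge0.
have : (\int[mu]_x fast (f ^~ x) < +oo)%E.
  rewrite /fast integral_nneseries//.
  apply: (@le_lt_trans _ _ (2 * C)%:E); last by rewrite ltry.
  apply: nneseries_le_half => n; first by apply: integral_ge0 => x _; exact: p.
  under eq_integral do rewrite EFinM.
  rewrite ge0_integralZl//; last 2 first.
    by apply: emeasurable_sqnrm; apply: wmeasB => //; exact: mf.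
    by move=> x _; rewrite lee_fin sqnrm_ge0.
  apply: (@le_trans _ _ ((4 ^+ n)%:E * (C * 8^-1 ^+ n)%:E)%E).
    by apply: lee_pmul; [rewrite lee_fin exprn_ge0|exact: L2sq_ge0|exact: lexx|exact: fC].
  rewrite -EFinM lee_fin mulrCA -exprMn.
  by have -> : 4 * 8^-1 = 2^-1 :> R by field.
move=> Ifin; have : mu.-integrable setT (fun x => fast (f ^~ x)).
  apply/integrableP; split; first exact: measurable_fast.
  rewrite (eq_integral (fun x => fast (f ^~ x)))// => x _.
  by rewrite gee0_abs// fast_ge0.
move=> /(integrable_ae measurableT); apply: filterS => x /(_ I).
by rewrite fin_numElt => /andP[].
Qed.

(** Fatou's lemma: the distance from [f n] to the limit is at most the lower limit of the distances
    from [f n] to [f (m + n)]. *)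
Lemma L2sq_flim n : (L2sq (fun x => f n x - flim f x)%R <= (4 * C * 8^-1 ^+ n)%:E)%E.
Proof.
have C0 : 0 <= C.
  by have := le_trans (L2sq_ge0 _) (fC 0%N); rewrite expr0 mulr1 lee_fin.
(* The constant 4 survives the induction on [m]: the inequality with factors 2 gives 2 C + 2 (4 C /
   8) = 3 C. *)
have bd m : forall n, (L2sq (fun x => f n x - f (m + n)%N x)%R <= (4 * C * 8^-1 ^+ n)%:E)%E.
  elim: m => [|m ih] {}n.
    rewrite /L2sq; under eq_integral do rewrite add0n subrr sqnrm0//.
    by rewrite integral0 lee_fin !mulr_ge0// exprn_ge0.
  apply: le_trans (L2sq_dist (mf n) (mf n.+1) (mf _)) _.
  rewrite L2sqBC addSnnS.
  apply: le_trans (leeD (lee_pmul _ _ (lexx _) (fC n)) (lee_pmul _ _ (lexx _) (ih n.+1))) _;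
    rewrite ?lee_fin//; try exact: L2sq_ge0.
  have e0 : 0 <= 8^-1 ^+ n :> R by rewrite exprn_ge0.
  by rewrite exprS; move: C0 e0; move: (8^-1 ^+ n) => c; nra.
have mB m : wmeas (fun x => f n x - f (m + n)%N x) by apply: wmeasB => //; exact: mf.
have := @fatou _ _ _ mu setT measurableT (fun m x => (sqnrm (f n x - f (m + n)%N x))%:E)
  (fun m => emeasurable_sqnrm (mB m)) (fun m x _ => sqnrm_ge0 hV _).
move=> fat.
have lim x : (fast (f ^~ x) < +oo)%E ->
    limn_einf (fun m => (sqnrm (f n x - f (m + n)%N x))%:E) =
    (sqnrm (f n x - flim f x))%:E.
  move=> /flimP /= hx.
  suff h : (fun m => (sqnrm (f n x - f (m + n)%N x))%:E) @ \oo --> (sqnrm (f n x - flim f x))%:E.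
    by rewrite (cvg_limn_einf_sup h).1.
  apply: cvg_EFin; first exact: nearW.
  have : vcvg (fun m => f n x - f (m + n)%N x) (f n x - flim f x).
    apply/vcvgP => e e0; have [N hN] := (vcvgP _ _).1 hx _ e0.
    exists N => i Ni; rewrite opprB addrC subrKA (nrmBC hV).
    by apply: hN; rewrite (leq_trans Ni)// leq_addr.
  move=> /(vcvg_nrm hV) h.
  rewrite (_ : fine \o _ = (fun m => nrm (f n x - f (m + n)%N x) * nrm (f n x - f (m + n)%N x))).
    by rewrite -(nrm_sqr hV) expr2; exact: cvgM.
  by apply/funext => m /=; rewrite -(nrm_sqr hV) expr2.
apply: (@le_trans _ _ (\int[mu]_x limn_einf (fun m => (sqnrm (f n x - f (m + n)%N x))%:E))%E).
  apply: ae_ge0_le_integral => //.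
  - by move=> x _; rewrite lee_fin sqnrm_ge0.
  - by apply: emeasurable_sqnrm; apply: (wmeasB hV (mf n)); exact: wmeas_flim.
  - move=> x _; rewrite limn_einf_lim; apply: lime_ge; first exact: is_cvg_einfs.
    by apply: nearW => m; apply: le_ereal_inf_tmp => _ [i /= _ <-]; rewrite lee_fin sqnrm_ge0.
  - apply: (@emeasurable_fun_cvg _ _ _ _
      (fun m x => einfs (fun i => (sqnrm (f n x - f (i + n)%N x))%:E) m)).
      by move=> m; apply: measurable_fun_einfs => i; exact: emeasurable_sqnrm.
    by move=> x _; rewrite limn_einf_lim; exact: is_cvg_einfs.
  - by apply: filterS fast_ae => x hx _; rewrite lim.
apply: le_trans fat _; rewrite limn_einf_lim.
apply: lime_le; first exact: is_cvg_einfs.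
apply: nearW => m; apply: le_trans (bd m n).
by apply: ereal_inf_lbound; exists m => //=.
Qed.

End Convergence.
End RieszFischer.

(** * Reflections, translations and exchange of null sets *)

Section LebesgueInvariance.
Variable R : realType.
Local Notation mu := (@lebesgue_measure R).

(** The image of Lebesgue measure under the reflection gives every half-open interval its length,
    hence is Lebesgue measure. Translations are composed of two reflections. *)
Lemma ge0_integral_reflect (c : R) (f : R -> \bar R) : measurable_fun setT f ->
  (forall x, 0 <= f x)%E -> (\int[mu]_x f (c - x)%R = \int[mu]_x f x)%E.
Proof.
move=> mf f0.
have mc : measurable_fun setT (fun x : R => c - x) by exact: measurable_funB.
have := @ge0_integral_pushforward _ _ (measurableTypeR R) (measurableTypeR R) R
  _ mc mu setT f measurableT mf (fun y _ => f0 y).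
rewrite preimage_setT => <-.
apply: eq_measure_integral => A mA _; apply/esym.
apply: lebesgue_measure_unique => //.
move=> _ [[a b] /= _ <-].
rewrite /pushforward (_ : _ @^-1` _ = `[c - b, c - a[%classic); last first.
  by apply/seteqP; split=> x /=; rewrite !in_itv/= => /andP[h1 h2]; apply/andP; split; lra.
rewrite !lebesgue_measure_itv/= !lte_fin ltrD2l ltrN2 -!EFinD.
by case: ifP => // _; congr (_%:E); ring.
Qed.

Lemma Rintegral_reflect (c : R) (f : R -> R) : measurable_fun setT f ->
  \int[mu]_x f (c - x) = \int[mu]_x f x.
Proof.
move=> mf; rewrite /Rintegral; congr fine.
have mE : measurable_fun setT (EFin \o f) by exact/measurable_EFinP.
rewrite integralE [RHS]integralE; congr (_ - _)%E.
  rewrite -[RHS](ge0_integral_reflect c (measurable_funepos mE) (funepos_ge0 _)).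
  by apply: eq_integral => x _; rewrite !funeposE.
rewrite -[RHS](ge0_integral_reflect c (measurable_funeneg mE) (funeneg_ge0 _)).
by apply: eq_integral => x _; rewrite !funenegE.
Qed.

Lemma Rintegral_translate (c : R) (f : R -> R) : measurable_fun setT f ->
  \int[mu]_x f (x - c) = \int[mu]_x f x.
Proof.
move=> mf.
have mf' : measurable_fun setT (fun x : R => f (- x)).
  by apply: measurableT_comp => //; exact: oppr_measurable.
rewrite -[RHS](Rintegral_reflect 0) // -[in RHS](Rintegral_reflect c); last first.
  by under eq_fun do rewrite sub0r.
by apply: eq_Rintegral => x _; rewrite sub0r opprB.
Qed.

End LebesgueInvariance.

Section SwapAlmostEverywhere.
Variables (R : realType) (d1 d2 : measure_display).
Variables (T1 : measurableType d1) (T2 : measurableType d2).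
Variable mu1 : {sigma_finite_measure set T1 -> \bar R}.
Variable mu2 : {sigma_finite_measure set T2 -> \bar R}.

(** By Tonelli the double integral of |h| vanishes in one order, hence in the other. With time as
    first factor this turns an equality that holds almost surely at each time into one that holds,
    for almost every outcome, at almost every time. *)
Lemma ae_swap (h : T1 * T2 -> R) : measurable_fun setT h ->
  (forall x, {ae mu2, forall y, h (x, y) = 0}) ->
  {ae mu2, forall y, {ae mu1, forall x, h (x, y) = 0}}.
Proof.
move=> mh h0.
have mE : measurable_fun setT (fun z => `|(h z)%:E|%E).
  by apply: measurableT_comp => //; exact/measurable_EFinP.
have := fubini_tonelli (m1 := mu1) (m2 := mu2) _ mE (fun z => abse_ge0 _).
have x0 x : (\int[mu2]_y `|(h (x, y))%:E| = 0)%E.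
  have my : measurable_fun setT (fun y => (h (x, y))%:E).
    by apply/measurable_EFinP; exact: (measurable_fun_pair2 x mh).
  apply: (ae_eq_integral_abs mu2 measurableT my).2.
  by apply: filterS (h0 x) => y /= -> _.
under eq_integral do rewrite x0.
rewrite integral0 => /esym I0.
have mG : measurable_fun setT (fun y => \int[mu1]_x `|(h (x, y))%:E|)%E.
  exact: (measurable_integral_param mu1 mE (fun z => abse_ge0 _)).
have I0' : (\int[mu2]_y `| \int[mu1]_x `|(h (x, y))%:E| | = 0)%E.
  rewrite -[RHS]I0; apply: eq_integral => y _; rewrite gee0_abs//.
  exact: integral_ge0.
have := (ae_eq_integral_abs _ measurableT mG).1 I0'.
apply: filterS => y /(_ I) /= hy.
have my : measurable_fun setT (fun x => (h (x, y))%:E).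
  by apply/measurable_EFinP; exact: (measurable_fun_pair1 y mh).
have := (ae_eq_integral_abs _ measurableT my).1 hy.
by apply: filterS => x /(_ I) /= [].
Qed.

End SwapAlmostEverywhere.

Lemma cvg_ereal_lt (R : realType) (u : nat -> \bar R) (l a : \bar R) :
  u @ \oo --> l -> (l < a)%E -> \forall n \near \oo, (u n < a)%E.
Proof.
move=> ul la; apply: (ul [set x | (x < a)%E]); apply: open_nbhs_nbhs.
by split=> //; exact: open_ereal_lt_ereal.
Qed.

Lemma finite_integrable_indic (R : realType) d (T : measurableType d)
    (mu : {measure set T -> \bar R}) (A : set T) :
  measurable A -> (mu A < +oo)%E -> mu.-integrable setT (EFin \o \1_A).
Proof.
move=> mA fA; apply/integrableP; split.
  by apply/measurable_EFinP; exact: measurable_indic.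
under eq_integral do rewrite /= ger0_norm//.
by rewrite integral_indic// setIT.
Qed.

Lemma finite_integrable_indicZ (R : realType) d (T : measurableType d)
    (mu : {measure set T -> \bar R}) (A : set T) (r : R) :
  measurable A -> (mu A < +oo)%E ->
  mu.-integrable setT (EFin \o (fun x => \1_A x * r)).
Proof.
move=> mA fA; have := integrableZr measurableT r (finite_integrable_indic mA fA).
by apply: eq_integrable => // x _; rewrite /= EFinM.
Qed.

Lemma Rintegral_bigsum (R : realType) d (T : measurableType d)
    (mu : {measure set T -> \bar R}) (I : Type) (s : seq I) (F : I -> T -> R) :
  (forall i, mu.-integrable setT (EFin \o F i)) ->
  Rintegral mu setT (fun x => \sum_(i <- s) F i x) =
  \sum_(i <- s) Rintegral mu setT (F i).
Proof.
move=> iF.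
have iS r : mu.-integrable setT (EFin \o (fun x => \sum_(i <- r) F i x)).
  have := integrable_sum measurableT r (P := xpredT) (fun i _ => iF i); apply: eq_integrable => // x _.
  by rewrite /= sumEFin.
elim: s => [|i s ih].
  rewrite big_nil; transitivity (Rintegral mu setT (cst 0)).
    by apply: eq_Rintegral => x _; rewrite big_nil.
  by rewrite /Rintegral integral0.
rewrite big_cons -ih -RintegralD//.
by apply: eq_Rintegral => x _; rewrite big_cons.
Qed.

Lemma Rintegral_indic (R : realType) d (T : measurableType d)
    (mu : {measure set T -> \bar R}) (A : set T) :
  measurable A -> Rintegral mu setT \1_A = fine (mu A).
Proof. by move=> mA; rewrite /Rintegral integral_indic// setIT. Qed.

(** * The Bochner integral as a weak integral *)

Section Bochner.
Variables (R : realType) (k : RorC) (V : ipSpace R k).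
Hypotheses (hV : hilbert V) (sV : separable V).
Local Notation mu := (@lebesgue_measure R).
Variables (D : set R).
Hypotheses (mD : measurable D) (fD : (mu D < +oo)%E).

Definition vrestr (g : R -> V) (x : R) : V := if `[< D x >] then g x else 0.

Lemma integral_vrestr (phi : V -> R) (g : R -> V) : phi 0 = 0 ->
  (\int[mu]_(x in D) (phi (g x))%:E = \int[mu]_x (phi (vrestr g x))%:E)%E.
Proof.
move=> p0; rewrite integral_mkcond; apply: eq_integral => x _.
rewrite /patch /vrestr; case: ifPn => [|/negP].
  by rewrite inE => Dx; rewrite asboolT.
by rewrite inE => Dx; rewrite asboolF// p0.
Qed.

Lemma vrestrB g h x : vrestr (fun x => g x - h x) x = vrestr g x - vrestr h x.
Proof. by rewrite /vrestr; case: ifP => // _; rewrite subr0. Qed.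

Lemma wmeas_sm_fun (s : simple_map V) : wmeas (sm_fun s).
Proof.
apply: (wmeas_sum hV (index_enum _) (F := fun i x => ofR k (\1_(sm_set i) x) *: sm_val i)) => i.
apply: (wmeasZ hV); last exact: wmeas_cst.
by apply: measurable_indic; exact: sm_measurable.
Qed.

Lemma nrm_sm_fun (s : simple_map V) x :
  nrm (sm_fun s x) <= \sum_(i < sm_size s) nrm (sm_val i).
Proof.
apply: le_trans (nrm_sum hV _ _ _) _; apply: ler_sum => i _.
rewrite nrmZ// ler_piMl ?nrm_ge0// ger0_norm; last by rewrite indicE ler0n.
by rewrite indicE; case: (_ \in _).
Qed.

Lemma vintegrable_sm_fun (s : simple_map V) : vintegrable mu (vrestr (sm_fun s)).
Proof.
pose M := \sum_(i < sm_size s) nrm (sm_val i).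
have M0 : 0 <= M by apply: sumr_ge0 => i _; exact: nrm_ge0.
have := @vintegrable_le _ _ _ hV sV _ (measurableTypeR R) mu (vrestr (sm_fun s)) (fun x => M * \1_D x). apply.
- by apply: wmeas_if; [exact: mD|exact: wmeas_sm_fun|exact: wmeas_cst].
- by apply: measurable_funM => //; exact: measurable_indic.
- under eq_integral do rewrite EFinM.
  rewrite ge0_integralZl//; last first.
    by apply/measurable_EFinP; exact: measurable_indic.
  by rewrite integral_indic// setIT lte_mul_pinfty.
- move=> x; rewrite /vrestr indicE; case: asboolP => Dx.
    by rewrite mem_set// mulr1 nrm_sm_fun.
  by rewrite nrm0// mulr_ge0.
Qed.

Lemma pettis_sm_fun (s : simple_map V) :
  pettis mu (vrestr (sm_fun s)) = sm_integral D s.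
Proof.
apply/esym/pettis_unique => //; first exact: vintegrable_sm_fun.
move=> z; rewrite /sm_integral rip_suml//.
have fi (i : 'I_(sm_size s)) : (mu (D `&` sm_set i) < +oo)%E.
  apply: le_lt_trans fD; apply: le_measure; rewrite ?inE//.
  by apply: measurableI => //; exact: sm_measurable.
have mi (i : 'I_(sm_size s)) : measurable (D `&` sm_set i).
  by apply: measurableI => //; exact: sm_measurable.
transitivity (\sum_(i < sm_size s)
    \int[mu]_x (\1_(D `&` sm_set i) x * rip (sm_val i) z)).
  apply: eq_bigr => i _; rewrite ripZl// RintegralZr//; last first.
    exact: (@finite_integrable_indic R _ (measurableTypeR R) mu _ (mi i) (fi i)).
  by rewrite (Rintegral_indic (T := measurableTypeR R) mu (mi i)).
have Ii (i : 'I_(sm_size s)) : mu.-integrable setT (EFin \o (fun x => \1_(D `&` sm_set i) x * rip (sm_val i) z)).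
  exact: (@finite_integrable_indicZ R _ (measurableTypeR R) mu _ _ (mi i) (fi i)).
rewrite -(@Rintegral_bigsum R _ (measurableTypeR R) mu)//.
apply: eq_Rintegral => x _; rewrite /vrestr; case: asboolP => Dx.
  rewrite /sm_fun rip_suml//; apply: eq_bigr => i _; rewrite ripZl// indicI/=.
  by rewrite [\1_D x]indicE mem_set// mul1r.
rewrite rip0l// big1// => i _; rewrite indicI/= [\1_D x]indicE memNset//.
by rewrite !mul0r.
Qed.

Lemma nrm_sm_integral_sub (s : simple_map V) g : vintegrable mu (vrestr g) ->
  ((nrm (sm_integral D s - pettis mu (vrestr g)))%:E <=
   \int[mu]_(x in D) (nrm (sm_fun s x - g x))%:E)%E.
Proof.
move=> ig; rewrite -pettis_sm_fun -pettisB//; last exact: vintegrable_sm_fun.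
rewrite (@integral_vrestr (@nrm R k V) (fun x => sm_fun s x - g x)) ?nrm0//.
under eq_integral do rewrite vrestrB.
by apply: EFin_nrm_pettis => //; apply: vintegrableB => //; exact: vintegrable_sm_fun.
Qed.

(** Some simple map is at distance less than 1 from [g] in the mean, and simple maps are integrable
    on a set of finite measure. *)
Lemma bochner_vintegrable g v : wmeas (vrestr g) -> bochner_integral D g v ->
  vintegrable mu (vrestr g).
Proof.
move=> mg [s [_ si _]].
have [j hj] : exists j, (\int[mu]_(x in D) (nrm (sm_fun (s j) x - g x))%:E < 1)%E.
  have : \forall j \near \oo,
      (\int[mu]_(x in D) (nrm (sm_fun (s j) x - g x))%:E < 1)%E.
    by apply: cvg_ereal_lt si _; rewrite lte_fin.
  by case=> N _ /(_ N (leqnn _)) h; exists N.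
have -> : vrestr g = (fun x => vrestr (sm_fun (s j)) x - vrestr (fun x => sm_fun (s j) x - g x) x).
  by apply/funext => x; rewrite vrestrB subKr.
apply: vintegrableB => //; first exact: vintegrable_sm_fun.
split.
  have -> : vrestr (fun x => sm_fun (s j) x - g x) = (fun x => vrestr (sm_fun (s j)) x - vrestr g x).
    by apply/funext => x; rewrite vrestrB.
  by apply: wmeasB => //; exact: (vintegrable_sm_fun _).1.
rewrite (integral_vrestr _ (nrm0 hV)) in hj.
by apply: lt_trans hj _; rewrite ltry.
Qed.

Lemma bochner_pettis g v : wmeas (vrestr g) -> bochner_integral D g v ->
  v = pettis mu (vrestr g).
Proof.
move=> mg bi; have ig := bochner_vintegrable mg bi.
have [s [_ si sv]] := bi.
apply: (vcvg_unique hV sv); apply/vcvgP => e e0.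
have : \forall j \near \oo,
    (\int[mu]_(x in D) (nrm (sm_fun (s j) x - g x))%:E < e%:E)%E.
  by apply: cvg_ereal_lt si _; rewrite lte_fin.
case=> N _ hN; exists N => i Ni; rewrite -lte_fin.
exact: le_lt_trans (nrm_sm_integral_sub _ ig) (hN i Ni).
Qed.


Lemma nrm_vrestr_sub g (s : simple_map V) :
  (\int[mu]_(x in D) (nrm (sm_fun s x - g x))%:E =
   \int[mu]_x (nrm (vrestr (sm_fun s) x - vrestr g x))%:E)%E.
Proof.
rewrite (@integral_vrestr (@nrm R k V) (fun x => sm_fun s x - g x)) ?nrm0//.
by apply: eq_integral => x _; rewrite vrestrB.
Qed.

Section Approximation.
Variable (g : R -> V).
Hypothesis ig : vintegrable mu (vrestr g).
Variable v : nat -> V.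
Hypothesis dv : forall (x : V) (e : R), 0 < e -> exists i, nrm (x - v i) < e.

Let c (i : nat) : V := if i is j.+1 then v j else 0.

(* [near_index j x] is the index of the element closest to [g x] among the
   first [j] elements of the dense sequence, starting from [0]. *)
Fixpoint near_index (j : nat) (x : R) : nat :=
  if j is i.+1 then
    if nrm (vrestr g x - v i) < nrm (vrestr g x - c (near_index i x)) then i.+1
    else near_index i x
  else 0%N.

Let near_set j (i : nat) : set R := [set x | near_index j x = i].

Lemma near_index_lt j x : (near_index j x < j.+1)%N.
Proof.
elim: j => //= j ih; case: ifP => // _; exact: leq_trans ih _.
Qed.

Lemma wmeas_near j : wmeas (fun x => c (near_index j x)) /\
  forall i, measurable (near_set j i).
Proof.
elim: j => [|j [ih1 ih2]].
  split; first exact: wmeas_cst.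
  move=> [|i]; rewrite /near_set /=; last first.
    by rewrite (_ : [set x | _] = set0)//; apply/seteqP; split.
  by rewrite (_ : [set x | _] = setT)//; apply/seteqP; split.
have mA : measurable [set x | nrm (vrestr g x - v j) < nrm (vrestr g x - c (near_index j x))].
  have m1 : measurable_fun setT (fun x => nrm (vrestr g x - v j)).
    by apply: (measurable_nrm hV sV); apply: (wmeasB hV ig.1); exact: wmeas_cst.
  have m2 : measurable_fun setT (fun x => nrm (vrestr g x - c (near_index j x))).
    by apply: (measurable_nrm hV sV); exact: (wmeasB hV ig.1).
  have := measurable_fun_ltr m1 m2 measurableT (Y := [set true]) I.
  by rewrite setTI; congr measurable; apply/seteqP; split.
have eqn : (fun x => c (near_index j.+1 x)) = (fun x =>
    if `[< [set x | nrm (vrestr g x - v j) < nrm (vrestr g x - c (near_index j x))] x >]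
    then v j else c (near_index j x)).
  by apply/funext => x /=; rewrite asboolb; case: ifP.
split; first by rewrite eqn; apply: wmeas_if => //; exact: wmeas_cst.
set A := [set x | _ < _] in mA.
move=> i; have [->|ij] := eqVneq i j.+1.
  rewrite (_ : near_set _ _ = A)//; apply/seteqP; split=> x; rewrite /near_set /A /=.
    by case: ifP => // _ h; have := near_index_lt j x; rewrite h ltnn.
  by move=> ->.
rewrite (_ : near_set _ _ = near_set j i `\` A); first exact: measurableD.
apply/seteqP; split=> x; rewrite /near_set /A /=.
  by case: ifP => [_ h|/negbT/negP h1 h2]; [rewrite h eqxx in ij|].
by case=> h /negP/negbTE ->.
Qed.

Definition near_simple (j : nat) : simple_map V :=
  @SimpleMap R k V j.+1 (fun i : 'I_j.+1 => near_set j i) (fun i : 'I_j.+1 => c i)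
    (fun i : 'I_j.+1 => (wmeas_near j).2 i).

Lemma near_simpleE j x : sm_fun (near_simple j) x = c (near_index j x).
Proof.
rewrite /sm_fun /= (bigD1 (Ordinal (near_index_lt j x)))//= big1 => [|i ij].
  by rewrite addr0 indicE mem_set//= ofR1 scale1r.
rewrite indicE memNset ?ofR0 ?scale0r// => h; move: ij => /eqP; apply.
by apply/val_inj; rewrite /= h.
Qed.

Lemma near_index_le j x i : (i <= j)%N ->
  nrm (vrestr g x - c (near_index j x)) <= nrm (vrestr g x - c i).
Proof.
elim: j i => [|j ih] i; first by rewrite leqn0 => /eqP ->.
rewrite leq_eqVlt => /predU1P[->|ilt] /=; case: ifPn.
- by [].
- by rewrite -leNgt.
- by move=> /ltW /le_trans; apply; exact: ih.
- by move=> _; exact: ih.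
Qed.

(** Because [c 0 = 0] is among the candidates; this is the majorant for dominated convergence. *)
Lemma near_bound j x : nrm (vrestr g x - c (near_index j x)) <= nrm (vrestr g x).
Proof. by have := near_index_le x (leq0n j); rewrite /c subr0. Qed.

Lemma near_cvg x : (fun j => nrm (vrestr g x - c (near_index j x))) @ \oo --> (0 : R).
Proof.
apply/cvgrPdist_lt => e e0; have [i hi] := dv (vrestr g x) e0.
exists i.+1 => // j /= ij; rewrite sub0r normrN ger0_norm ?nrm_ge0//.
by apply: le_lt_trans (near_index_le x ij) _.
Qed.

Lemma near_simple_cvg x : D x ->
  (fun j => nrm (sm_fun (near_simple j) x - g x)) @ \oo --> (0 : R).
Proof.
move=> Dx; have -> : (fun j => nrm (sm_fun (near_simple j) x - g x)) =
    (fun j => nrm (vrestr g x - c (near_index j x))); last exact: near_cvg.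
by apply/funext => j; rewrite near_simpleE (nrmBC hV) /vrestr asboolT.
Qed.

Lemma near_integral_cvg :
  (\int[mu]_(x in D) (nrm (sm_fun (near_simple j) x - g x))%:E @[j --> \oo] --> 0)%E.
Proof.
under eq_fun do rewrite nrm_vrestr_sub.
have key j x : nrm (vrestr (sm_fun (near_simple j)) x - vrestr g x) <=
               nrm (vrestr g x - c (near_index j x)).
  rewrite {1}/vrestr; case: asboolP => Dx; first by rewrite near_simpleE (nrmBC hV).
  by rewrite {1}/vrestr asboolF// subrr nrm0// nrm_ge0.
have m j : measurable_fun setT (fun x =>
    (nrm (vrestr (sm_fun (near_simple j)) x - vrestr g x))%:E).
  apply/measurable_EFinP; apply: (measurable_nrm hV sV).
  by apply: (wmeasB hV) ig.1; exact: (vintegrable_sm_fun _).1.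
have := @dominated_convergence _ _ _ mu setT measurableT
  (fun j x => (nrm (vrestr (sm_fun (near_simple j)) x - vrestr g x))%:E) (cst 0%E)
  (fun x => (nrm (vrestr g x))%:E) m (measurable_cst _) _ (vintegrable_nrm hV sV ig) _.
case.
- apply: filterE => x _; apply: cvg_EFin; first exact: nearW.
  apply: (@squeeze_cvgr _ _ _ _ (fun=> 0) (fun j => nrm (vrestr g x - c (near_index j x)))).
  + by apply: nearW => j; rewrite nrm_ge0 key.
  + exact: cvg_cst.
  + exact: near_cvg.
- apply: filterE => x j _; rewrite /= lee_fin ger0_norm ?nrm_ge0//.
  exact: le_trans (key _ _) (near_bound _ _).
by move=> _ _; rewrite integral0.
Qed.

End Approximation.

Lemma pettis_bochner g : vintegrable mu (vrestr g) ->
  bochner_integral D g (pettis mu (vrestr g)).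
Proof.
move=> ig; have [v dv] := sV; have FF := ae_filter_ringOfSetsType mu.
exists (near_simple ig v); split.
- by apply: filterE => x Dx; exact: near_simple_cvg.
- exact: near_integral_cvg.
- apply/vcvgP => e e0; have e1 : (0 < e%:E :> \bar R)%E by rewrite lte_fin.
  case: (cvg_ereal_lt (near_integral_cvg ig dv) e1) => N _ hN.
  exists N => i Ni; rewrite -lte_fin.
  exact: le_lt_trans (nrm_sm_integral_sub _ ig) (hN i Ni).
Qed.

End Bochner.

(** * Semigroups *)

Section IntervalIntegrals.
Variable R : realType.
Local Notation mu := (@lebesgue_measure R).
Implicit Types (phi psi : R -> R) (a b c : R).

Definition itg phi a b : R := Rintegral mu `[a, b]%classic phi.

Definition itgable phi a b := mu.-integrable `[a, b]%classic (EFin \o phi).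

Lemma continuous_itgable phi a b : continuous phi -> itgable phi a b.
Proof.
move=> cf; apply: continuous_compact_integrable; first exact: segment_compact.
exact: continuous_subspaceT.
Qed.

Lemma itgableW phi a b a' b' : a <= a' -> b' <= b -> itgable phi a b -> itgable phi a' b'.
Proof.
move=> aa bb; apply: integrableS => //.
by apply: subset_itv; rewrite bnd_simp.
Qed.

Lemma itg_add phi a b c : a <= b -> b <= c -> itgable phi a c ->
  itg phi a c = itg phi a b + itg phi b c.
Proof.
move=> ab bc ic; apply/eqP; rewrite addrC -subr_eq; apply/eqP.
have := @Rintegral_itvB R phi (BLeft a) (BRight c) b ic; rewrite !bnd_simp => /(_ ab bc).
rewrite -/(itg phi a c) -/(itg phi a b) => ->.
rewrite Rintegral_itv_obnd_cbnd//.
apply: integrableS ic => //.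
by apply: subset_itv; rewrite bnd_simp.
Qed.

Lemma itg_cst a b c : a <= b -> itg (cst c) a b = (b - a) * c.
Proof.
move=> ab; rewrite /itg Rintegral_cst//.
rewrite mulrC; congr (_ * c).
have h : mu `[a, b]%classic = (b - a)%:E.
  rewrite lebesgue_measure_itv/= lte_fin; case: ltP => //= ba.
  have -> : b = a by apply/le_anti; rewrite ba ab.
  by rewrite subrr.
exact: (congr1 fine h).
Qed.

Lemma itgable_cst c a b : itgable (cst c) a b.
Proof. by apply: continuous_itgable => x; exact: cvg_cst. Qed.

Lemma itgB phi psi a b : itgable phi a b -> itgable psi a b ->
  itg (fun s => phi s - psi s) a b = itg phi a b - itg psi a b.
Proof. by move=> h1 h2; rewrite /itg RintegralB//; exact: measurable_itv. Qed.

Lemma itgD phi psi a b : itgable phi a b -> itgable psi a b ->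
  itg (fun s => phi s + psi s) a b = itg phi a b + itg psi a b.
Proof. by move=> h1 h2; rewrite /itg RintegralD//; exact: measurable_itv. Qed.

Lemma itg_bound phi a b (e : R) : a <= b -> itgable phi a b ->
  (forall s, a <= s <= b -> `|phi s| <= e) -> `|itg phi a b| <= e * (b - a).
Proof.
move=> ab ip h; rewrite /itg (le_trans (le_normr_Rintegral _ ip))//.
rewrite mulrC -(itg_cst e ab); apply: le_Rintegral => //.
- exact: integrable_norm ip.
- exact: itgable_cst.
Qed.

Lemma itg_near_cst phi a b c (e : R) : a <= b -> itgable phi a b ->
  (forall s, a <= s <= b -> `|phi s - c| <= e) ->
  `|itg phi a b - (b - a) * c| <= e * (b - a).
Proof.
move=> ab ip h; rewrite -itg_cst// -itgB//; last exact: itgable_cst.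
apply: itg_bound => //; have := itgable_cst c a b => ic.
by rewrite /itgable (_ : _ \o _ = (fun x => (EFin \o phi) x - (EFin \o cst c) x)%E)//;
  apply: integrableB => //; exact: measurable_itv.
Qed.

Lemma itgE phi a b : itg phi a b = \int[mu]_x (\1_`[a, b]%classic x * phi x).
Proof.
rewrite /itg Rintegral_mkcond; apply: eq_Rintegral => x _.
by rewrite /patch indicE; case: ifP => _; rewrite ?mul1r ?mul0r.
Qed.

Lemma itg_reflect phi a b c : measurable_fun setT phi ->
  itg (fun s => phi (c - s)) a b = itg phi (c - b) (c - a).
Proof.
move=> mp; rewrite !itgE -[RHS](Rintegral_reflect c)//; last first.
  by apply: measurable_funM => //; apply: measurable_indic; exact: measurable_itv.
apply: eq_Rintegral => x _; congr (_ * _); rewrite !indicE; congr (_%:R).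
congr nat_of_bool; rewrite -[LHS]asboolb -[RHS]asboolb; apply/asbool_equiv_eq.
by rewrite !inE/= !in_itv/=; split=> /andP[h1 h2]; apply/andP; split; lra.
Qed.

Lemma itg_translate phi a b c : measurable_fun setT phi ->
  itg (fun s => phi (s - c)) a b = itg phi (a - c) (b - c).
Proof.
move=> mp; rewrite !itgE -[RHS](Rintegral_translate c)//; last first.
  by apply: measurable_funM => //; apply: measurable_indic; exact: measurable_itv.
apply: eq_Rintegral => x _; congr (_ * _); rewrite !indicE; congr (_%:R).
congr nat_of_bool; rewrite -[LHS]asboolb -[RHS]asboolb; apply/asbool_equiv_eq.
by rewrite !inE/= !in_itv/=; split=> /andP[h1 h2]; apply/andP; split; lra.
Qed.

Lemma eq_itg phi psi a b : (forall s, a <= s <= b -> phi s = psi s) ->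
  itg phi a b = itg psi a b.
Proof.
by move=> h; apply: eq_Rintegral => x; rewrite inE/= in_itv/=; exact: h.
Qed.

(** Subdivide [[0, T]] into pieces shorter than d and telescope. This replaces the mean value
    theorem where only one-sided difference quotients are controlled, uniformly in the left
    endpoint. *)
Lemma local_estimate_zero (G : R -> R) (T : R) : 0 <= T ->
  (forall e, 0 < e -> exists2 d, 0 < d & forall a b, 0 <= a -> a <= b -> b <= T ->
     b - a < d -> `|G b - G a| <= e * (b - a)) ->
  G T = G 0.
Proof.
move=> T0 h; apply/eqP; rewrite -subr_eq0 -normr_le0; apply/ler_addgt0Pr => e e0.
rewrite add0r; have e1 : 0 < e / (T + 1) by rewrite divr_gt0//; lra.
have [d d0 hd] := h _ e1.
pose n := (Num.truncn (T / d)).+1; have n0 : 0 < n%:R :> R by rewrite ltr0n.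
have hn : T / n%:R < d.
  by rewrite ltr_pdivrMr// mulrC -ltr_pdivrMr// truncnS_gt.
pose t i := T * (i%:R / n%:R).
have tle i : (i <= n)%N -> t i <= T.
  by move=> ile; rewrite /t ler_piMr// ler_pdivrMr// mul1r ler_nat.
have ts i : t i.+1 - t i = T / n%:R.
  by rewrite /t -mulrBr -mulrBl -natrB// subSnn mul1r.
have key i : (i <= n)%N -> `|G (t i) - G 0| <= e / (T + 1) * t i.
  elim: i => [|i ih] ile; first by rewrite /t mul0r mulr0 subrr normr0 mulr0.
  rewrite (le_trans (ler_distD (G (t i)) _ _))//.
  have -> : t i.+1 = (t i.+1 - t i) + t i by rewrite subrK.
  rewrite mulrDr lerD//; last by apply: ih; exact: ltnW.
  rewrite subrK; apply: hd; rewrite ?tle//.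
  - by rewrite /t mulr_ge0// divr_ge0// ler0n.
  - by rewrite -subr_ge0 ts divr_ge0// ltW.
  - by rewrite ts.
have := key n (leqnn _); rewrite /t divff ?gt_eqF// mulr1 => /le_trans; apply.
by rewrite mulrAC ler_pdivrMr; [nra|lra].
Qed.

End IntervalIntegrals.

Lemma measurable_nat_index (R : realType) d (T : measurableType d)
    (g : nat -> T -> R) (m : T -> nat) :
  (forall i, measurable_fun setT (g i)) -> (forall i, measurable [set x | m x = i]) ->
  measurable_fun setT (fun x => g (m x) x).
Proof.
move=> mg mm _ Y mY; rewrite setTI.
rewrite (_ : _ @^-1` _ = \bigcup_i ([set x | m x = i] `&` g i @^-1` Y)).
  apply: bigcup_measurable => i _; apply: measurableI => //.
  by have := mg i measurableT Y mY; rewrite setTI.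
apply/seteqP; split=> x /=; first by move=> h; exists (m x).
by case=> i _ [<-].
Qed.

Lemma measurable_truncn (R : realType) d (T : measurableType d) (r : T -> R) (i : nat) :
  measurable_fun setT r -> (forall x, 0 <= r x) ->
  measurable [set x | Num.truncn (r x) = i].
Proof.
move=> mr r0.
have := mr measurableT `[i%:R, i.+1%:R[%classic (measurable_itv _); rewrite setTI.
congr measurable; apply/seteqP; split=> x /=; rewrite in_itv/=.
  by move=> /andP[h1 h2]; apply/eqP; rewrite truncn_eq// h1.
by move=> <-; exact: truncn_itv.
Qed.

(** * Boundedness, continuity and measurability of orbits *)

Section Semigroup.
Variables (R : realType) (k : RorC) (X : ipSpace R k).
Hypotheses (hX : hilbert X) (sX : separable X).
Variable S : R -> X -> X.
Hypothesis hS : C0_semigroup S.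
Local Notation mu := (@lebesgue_measure R).

Lemma C0_right (x : X) (e : R) : 0 < e ->
  exists2 d, 0 < d & forall h, 0 <= h -> h < d -> nrm (S h x - x) < e.
Proof.
move=> e0; have /cvgrPdist_lt /(_ _ e0) := C0_continuous hS x.
move=> [d /= d0 hd].
exists d => // h; rewrite le_eqVlt => /predU1P[<-|h0] hdlt.
  by rewrite (C0_zero hS) subrr nrm0.
have := hd h; rewrite /= sub0r normrN gtr0_norm// => /(_ hdlt h0).
by rewrite sub0r normrN ger0_norm ?nrm_ge0.
Qed.

(** Otherwise there are times tending to 0 at which the operators have norms tending to infinity,
    although each orbit stays bounded near 0; this contradicts uniform boundedness. *)
Lemma C0_local_bound : exists2 M, 1 <= M & exists2 d, 0 < d &
  forall h x, 0 <= h -> h < d -> nrm (S h x) <= M * nrm x.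
Proof.
apply: contrapT => no.
have [f hf] : {f : nat -> R & forall n,
    [/\ 0 <= f n, f n < n.+1%:R^-1 & exists x, n.+1%:R * nrm x < nrm (S (f n) x)]}.
  apply: (@choice _ _ (fun n t => [/\ 0 <= t, t < n.+1%:R^-1 &
    exists x, n.+1%:R * nrm x < nrm (S t x)])) => n.
  apply: contrapT => no1; apply: no; exists n.+1%:R; first by rewrite ler1n.
  exists n.+1%:R^-1; first by rewrite invr_gt0.
  move=> h x h0 hn; rewrite leNgt; apply/negP => hx; apply: no1.
  by exists h; split=> //; exists x.
have [||M M0 hM] := @uniform_boundedness R k X X nat (fun n => S (f n)) hX hX.
- by move=> n; apply: C0_bounded => //; case: (hf n).
- move=> x; have [d d0 hd] := C0_right x ltr01.
  have [N hN] := ltr_add_invr d0; rewrite add0r in hN.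
  exists (\sum_(i < N) nrm (S (f i) x) + (nrm x + 1)) => i.
  have s0 : 0 <= \sum_(i < N) nrm (S (f i) x) by apply: sumr_ge0 => j _; exact: nrm_ge0.
  have [iN|Ni] := ltnP i N.
    rewrite (bigD1 (Ordinal iN))//= -addrA lerDl addr_ge0//.
      by apply: sumr_ge0 => j _; exact: nrm_ge0.
    by rewrite addr_ge0// nrm_ge0.
  have [f0 fi _] := hf i.
  have : f i < d.
    apply: lt_le_trans fi _; apply: ltW; apply: le_lt_trans hN.
    by rewrite lef_pV2 ?posrE// ler_nat ltnS.
  move=> /(hd _ f0) h1; have := nrm_sub_ge hX (S (f i) x) x; lra.
- have [n hn] : exists n : nat, M < n%:R.
    by exists (Num.truncn M).+1; exact: truncnS_gt.
  have [_ _ [x hx]] := hf n.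
  have := hM n x; rewrite leNgt => /negP; apply; apply: le_lt_trans hx.
  by rewrite ler_wpM2r ?nrm_ge0// (le_trans (ltW hn))// ler_nat.
Qed.

Lemma C0_bound (T : R) : exists2 M, 1 <= M &
  forall t x, 0 <= t -> t <= T -> nrm (S t x) <= M * nrm x.
Proof.
have [M M1 [d d0 hd]] := C0_local_bound.
(* A time below n d / 2 is covered by n steps shorter than d, each of which costs a factor M. *)
have key n t x : 0 <= t -> t < n%:R * (d / 2) -> nrm (S t x) <= M ^+ n * nrm x.
  elim: n t x => [|n ih] t x t0; first by rewrite mul0r; lra.
  have [td|td] := ltP t d.
    move=> _; rewrite (le_trans (hd _ _ t0 td))// ler_wpM2r ?nrm_ge0//.
    by rewrite exprS ler_peMr ?exprn_ege1//; lra.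
  rewrite -natr1 => tn.
  have -> : t = d / 2 + (t - d / 2) by rewrite addrC subrK.
  rewrite (C0_add hS) ?divr_ge0 ?(ltW d0)//; last by lra.
  rewrite (le_trans (hd _ _ _ _))//; [lra|lra|].
  rewrite exprS -mulrA ler_pM2l; last by lra.
  by apply: ih; [lra|nra].
pose n := (Num.truncn (T / (d / 2))).+1.
exists (M ^+ n); first exact: exprn_ege1.
move=> t x t0 tT; apply: key => //; apply: le_lt_trans tT _.
by rewrite -ltr_pdivrMr ?divr_gt0// truncnS_gt.
Qed.

Lemma C0_B (t : R) (x y : X) : 0 <= t -> S t (x - y) = S t x - S t y.
Proof. by move=> t0; apply: bounded_linear_B; exact: C0_bounded. Qed.

Lemma C0_modulus (T : R) : exists2 M, 1 <= M & forall s t x, 0 <= s -> s <= t -> t <= T ->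
  nrm (S t x - S s x) <= M * nrm (S (t - s) x - x).
Proof.
have [M M1 hM] := C0_bound T; exists M => // s t x s0 st tT.
have -> : S t x = S s (S (t - s) x).
  by rewrite -(C0_add hS) ?subr_ge0// addrC subrK.
by rewrite -C0_B//; apply: hM => //; exact: le_trans st tT.
Qed.

Lemma C0_uniform (T : R) (x : X) (e : R) : 0 < e -> exists2 d, 0 < d &
  forall s t, 0 <= s -> s <= T -> 0 <= t -> t <= T -> `|t - s| < d -> nrm (S t x - S s x) < e.
Proof.
move=> e0; have [M M1 hM] := C0_modulus T.
have M0 : 0 < M by lra.
have [d d0 hd] := C0_right x (divr_gt0 e0 M0).
exists d => // s t s0 sT t0 tT.
wlog st : s t s0 sT t0 tT / s <= t.
  move=> W h; have [st|/ltW ts] := leP s t; first exact: W.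
  by rewrite (nrmBC hX); apply: W => //; rewrite distrC.
rewrite ger0_norm ?subr_ge0// => h.
rewrite (le_lt_trans (hM _ _ _ s0 st tT))// mulrC -ltr_pdivlMr//.
by apply: hd; rewrite ?subr_ge0.
Qed.

Definition pos (t : R) : R := Num.max t 0.

Lemma pos_ge0 t : 0 <= pos t. Proof. by rewrite /pos le_max lexx orbT. Qed.

Lemma pos_id t : 0 <= t -> pos t = t. Proof. by move=> t0; exact/max_idPl. Qed.

Lemma pos_lip s t : `|pos s - pos t| <= `|s - t|.
Proof.
rewrite /pos /Num.max; case: ltP => h1; case: ltP => h2;
  rewrite ?subrr ?normr0 ?normr_ge0// ?subr0 ?sub0r.
- by rewrite normrN ger0_norm// ler0_norm; lra.
- by rewrite ger0_norm// ger0_norm; lra.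
Qed.

(* The orbit, continued by the constant [x] to negative times. *)
Definition flow (t : R) (x : X) : X := S (pos t) x.

Lemma flowE t x : 0 <= t -> flow t x = S t x.
Proof. by move=> t0; rewrite /flow pos_id. Qed.

Lemma flow_pos t x : flow (pos t) x = flow t x.
Proof. by rewrite /flow (pos_id (pos_ge0 _)). Qed.

Lemma flow0 x : flow 0 x = x.
Proof. by rewrite flowE// (C0_zero hS). Qed.

Lemma flowD s t x : 0 <= s -> 0 <= t -> flow (s + t) x = flow s (flow t x).
Proof.
by move=> s0 t0; rewrite !flowE ?addr_ge0// (C0_add hS).
Qed.

Lemma flow_bounded t : bounded_linear (flow t).
Proof. exact: (C0_bounded hS (pos_ge0 t)). Qed.

Lemma flow_bound (T : R) : exists2 M, 1 <= M &
  forall t x, t <= T -> nrm (flow t x) <= M * nrm x.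
Proof.
have [M M1 hM] := C0_bound (pos T); exists M => // t x tT; apply: hM; first exact: pos_ge0.
by rewrite /pos ge_max le_max tT/= le_max lexx orbT.
Qed.

Lemma flow_vcvg (x : X) (t : R) (u : nat -> R) : u @ \oo --> t ->
  vcvg (fun n => flow (u n) x) (flow t x).
Proof.
move=> ut; apply/vcvgP => e e0.
have [d d0 hd] := C0_uniform (pos t + 1) x e0.
have d1 : 0 < Num.min d 1 by rewrite lt_min d0 ltr01.
have /cvgrPdist_lt /(_ _ d1) [N _ hN] := ut.
exists N => n /hN /= h; have := le_lt_trans (pos_lip t (u n)) h.
rewrite lt_min distrC => /andP[h1 h2]; apply: hd => //; try exact: pos_ge0.
- by rewrite lerDl.
- by move: h2; rewrite ltr_norml; lra.
Qed.

Lemma flow_continuous (x z : X) : continuous (fun t => rip (flow t x) z).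
Proof.
move=> t; apply/cvgrPdist_lt => e e0.
have z1 : 0 < nrm z + 1 by rewrite ltr_pwDr ?nrm_ge0.
have [d d0 hd] := C0_uniform (pos t + 1) x (divr_gt0 e0 z1).
have d1 : 0 < Num.min d 1 by rewrite lt_min d0 ltr01.
exists (Num.min d 1) => //= s hs; have := le_lt_trans (pos_lip t s) hs.
rewrite lt_min => /andP[h1 h2].
rewrite -ripBl// (le_lt_trans (cauchy_schwarz hX _ _))//.
have h3 : nrm (flow t x - flow s x) < e / (nrm z + 1).
  apply: hd => //; try exact: pos_ge0.
    by move: h2; rewrite ltr_norml; lra.
  by rewrite lerDl.
move: h3; rewrite ltr_pdivlMr//; apply: le_lt_trans.
by rewrite ler_wpM2l ?nrm_ge0// lerDl.
Qed.

End Semigroup.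

Section SemigroupMeasurability.
Variables (R : realType) (k : RorC) (X : ipSpace R k).
Hypotheses (hX : hilbert X) (sX : separable X).
Variable S : R -> X -> X.
Hypothesis hS : C0_semigroup S.
Local Notation mu := (@lebesgue_measure R).
Local Notation flow := (flow S).

(* The times are approximated from above by points of a lattice. *)
Lemma wmeas_flow d (T : measurableType d) (tau : T -> R) (xi : T -> X) :
  measurable_fun setT tau -> wmeas xi -> wmeas (fun y => flow (tau y) (xi y)).
Proof.
move=> mt mx.
have mpos : measurable_fun setT (fun y => pos (tau y)).
  by apply: measurable_maxr => //; exact: measurable_cst.
pose i n y := Num.truncn (pos (tau y) * n.+1%:R).
pose t n j : R := j.+1%:R / n.+1%:R.
have n1 n : 0 < n.+1%:R :> R by rewrite ltr0n.
apply: (wmeas_cvg hX (F := fun n y => flow (t n (i n y)) (xi y))).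
  move=> n z; apply: (@measurable_nat_index _ _ _ (fun j y => rip (flow (t n j) (xi y)) z)).
    move=> j; have := wmeas_bounded_linear hX hX (flow_bounded hS (t n j)) mx.
    exact.
  move=> j; apply: measurable_truncn; last by move=> y; rewrite mulr_ge0// pos_ge0.
  by apply: measurable_funM => //; exact: measurable_cst.
move=> y; have -> : flow (tau y) (xi y) = flow (pos (tau y)) (xi y).
  by rewrite flow_pos.
apply: (flow_vcvg hX hS); apply/cvgrPdist_le => e e0.
have [N hN] := ltr_add_invr e0; rewrite add0r in hN.
exists N => // n /= Nn; rewrite distrC.
have p0 : 0 <= pos (tau y) * n.+1%:R by rewrite mulr_ge0// pos_ge0.
have /andP[h1 h2] := truncn_itv p0; rewrite -/(i n y) in h1 h2.
have hn : n.+1%:R^-1 <= e.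
  by apply: ltW; apply: le_lt_trans hN; rewrite lef_pV2 ?posrE// ler_nat ltnS.
have l1 : pos (tau y) <= t n (i n y) by rewrite /t ler_pdivlMr// ltW.
have l2 : t n (i n y) <= pos (tau y) + n.+1%:R^-1.
  by rewrite /t -[_.+1%:R]natr1 mulrDl mul1r lerD2r ler_pdivrMr.
by rewrite ger0_norm ?subr_ge0// lerBlDl (le_trans l2)// lerD2l.
Qed.

End SemigroupMeasurability.

(** * The generator and its adjoint *)

Section Generator.
Variables (R : realType) (k : RorC) (X : ipSpace R k).
Hypotheses (hX : hilbert X) (sX : separable X).
Variable S : R -> X -> X.
Variables (D : set X) (A : X -> X).
Hypothesis gS : generates D A S.
Local Notation mu := (@lebesgue_measure R).
Local Notation flow := (flow S).
Let hS : C0_semigroup S := gS.1.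

Lemma flow_itgable (x z : X) a b : itgable (fun s => rip (flow s x) z) a b.
Proof. by apply: continuous_itgable; exact: flow_continuous. Qed.

Lemma flow_integral_exists (x : X) (t : R) : 0 <= t ->
  exists y, forall z, rip y z = itg (fun s => rip (flow s x) z) 0 t.
Proof.
move=> t0; have [M M1 hM] := flow_bound hX hS t.
have [|||y hy] := @riesz _ _ _ hX (fun z => itg (fun s => rip (flow s x) z) 0 t)
  (M * nrm x * (t - 0)).
- move=> z1 z2; rewrite -itgD; try exact: flow_itgable.
  by apply: eq_itg => s _; rewrite ripDr.
- move=> r z; rewrite /itg -RintegralZl//; last exact: flow_itgable.
  by apply: eq_Rintegral => s _; rewrite ripZr.
- move=> z; rewrite mulrAC; apply: itg_bound => //; first exact: flow_itgable.
  move=> s /andP[_ st]; rewrite (le_trans (cauchy_schwarz hX _ _))//.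
  by rewrite ler_wpM2r ?nrm_ge0// hM.
by exists y => z; rewrite hy ripC.
Qed.

Lemma flow_integral_adjoint (z : X) (t : R) : 0 <= t ->
  exists zeta, forall x, rip x zeta = itg (fun s => rip (flow s x) z) 0 t.
Proof.
move=> t0; have [M M1 hM] := flow_bound hX hS t.
have [|||y hy] := @riesz _ _ _ hX (fun x => itg (fun s => rip (flow s x) z) 0 t)
  (M * nrm z * (t - 0)).
- move=> x1 x2; rewrite -itgD; try exact: flow_itgable.
  by apply: eq_itg => s _; rewrite (bounded_linear_D _ _ (flow_bounded hS s)) ripDl.
- move=> r x; rewrite /itg -RintegralZl//; last exact: flow_itgable.
  apply: eq_Rintegral => s _.
  by rewrite (bounded_linear_Z _ _ (flow_bounded hS s)) ripZl.
- move=> x; rewrite mulrAC; apply: itg_bound => //; first exact: flow_itgable.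
  move=> s /andP[_ st]; rewrite (le_trans (cauchy_schwarz hX _ _))//.
  by rewrite mulrAC ler_wpM2r ?nrm_ge0// hM.
by exists y => x; rewrite -hy.
Qed.

(** Applying the operator at time [h] shifts the interval of integration to [h, t + h]; the overlap
    with [0, t] cancels. *)
Lemma flow_integral_shift (x y : X) (t h : R) : 0 <= t -> 0 <= h ->
  (forall z, rip y z = itg (fun s => rip (flow s x) z) 0 t) ->
  forall z, rip (flow h y - y) z = itg (fun s => rip (flow s x) z) t (t + h) -
                                  itg (fun s => rip (flow s x) z) 0 h.
Proof.
move=> t0 h0 hy z; rewrite ripBl// rip_adjoint//; last exact: flow_bounded.
rewrite !hy.
have -> : itg (fun s => rip (flow s x) (adjoint (flow h) z)) 0 t =
          itg (fun s => rip (flow s x) z) h (t + h).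
  have mo : measurable_fun setT (fun s => rip (flow s x) z).
    by apply: continuous_measurable_fun; exact: flow_continuous.
  have := @itg_translate R (fun s => rip (flow s x) z) 0 t (- h) mo.
  rewrite sub0r !opprK => <-; apply: eq_itg => s /andP[s0 st].
  rewrite -rip_adjoint//; last exact: flow_bounded.
  by rewrite -flowD// addrC.
have i1 := flow_itgable x z 0 (t + h).
have th : t <= t + h by rewrite lerDl.
have hth : h <= t + h by rewrite lerDr.
have := itg_add h0 hth i1; rewrite (itg_add t0 th i1) => e.
by rewrite -(addrK (itg (fun s => rip (flow s x) z) 0 h) (itg _ h (t + h))) [_ + itg _ 0 h]addrC -e; ring.
Qed.

Lemma flow_near (x : X) (t e : R) : 0 <= t -> 0 < e -> exists2 d, 0 < d &
  forall s, t <= s -> s < t + d -> nrm (flow s x - flow t x) < e.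
Proof.
move=> t0 e0; have [d d0 hd] := C0_uniform hX hS (t + 1) x e0.
have d1 : 0 < Num.min d 1 by rewrite lt_min d0 ltr01.
exists (Num.min d 1) => // s ts sd.
have h1 : s - t < Num.min d 1 by lra.
move: h1; rewrite lt_min => /andP[h1 h2].
rewrite !flowE//; last exact: le_trans ts.
apply: hd => //; [lra|lra|lra|].
by rewrite ger0_norm ?subr_ge0.
Qed.

Lemma itg_flow_near (x z : X) (t h e : R) : 0 <= t -> 0 <= h ->
  (forall s, t <= s -> s <= t + h -> nrm (flow s x - flow t x) <= e) ->
  `|itg (fun s => rip (flow s x) z) t (t + h) - h * rip (flow t x) z| <= e * nrm z * h.
Proof.
move=> t0 h0 he; have th : t <= t + h by rewrite lerDl.
have := @itg_near_cst R (fun s => rip (flow s x) z) t (t + h) (rip (flow t x) z) (e * nrm z) th.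
rewrite [t + h - t]addrAC subrr add0r; apply; first exact: flow_itgable.
move=> s /andP[ts sth]; rewrite -ripBl// (le_trans (cauchy_schwarz hX _ _))//.
by rewrite ler_wpM2r ?nrm_ge0// he.
Qed.

(** By [flow_integral_shift] the difference quotient of [y] is the mean of the orbit over [t, t + h]
    minus its mean over [0, h], and both means converge by continuity of the orbit. *)
Lemma generates_integral (x y : X) (t : R) : 0 <= t ->
  (forall z, rip y z = itg (fun s => rip (flow s x) z) 0 t) ->
  D y /\ A y = flow t x - x.
Proof.
move=> t0 hy; apply/(gS.2 _ _).2/cvgrPdist_lt => e e0.
have e3 : 0 < e / 3 by rewrite divr_gt0.
have [d1 d10 hd1] := flow_near x t0 e3.
have [d2 d20 hd2] := flow_near x (lexx 0) e3.
have d0 : 0 < Num.min d1 d2 by rewrite lt_min d10 d20.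
exists (Num.min d1 d2) => //= h; rewrite /= sub0r normrN => + h0.
rewrite gtr0_norm// lt_min => /andP[hh1 hh2].
rewrite sub0r normrN ger0_norm ?nrm_ge0//.
apply: (@le_lt_trans _ _ (e / 3 + e / 3)); last by lra.
apply: (nrm_le_rip hX); first by lra.
move=> z; rewrite ripBl// ripZl//.
have -> : S h y = flow h y by rewrite flowE// ltW.
rewrite (flow_integral_shift t0 (ltW h0) hy z).
have k1 := @itg_flow_near x z t h (e / 3) t0 (ltW h0).
have k2 := @itg_flow_near x z 0 h (e / 3) (lexx 0) (ltW h0).
have {}k1 : `|itg (fun s => rip (flow s x) z) t (t + h) - h * rip (flow t x) z| <=
    e / 3 * nrm z * h.
  by apply: k1 => s ts sh; apply/ltW/hd1 => //; apply: le_lt_trans sh _; rewrite ltrD2l.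
have {}k2 : `|itg (fun s => rip (flow s x) z) 0 (0 + h) - h * rip (flow 0 x) z| <=
    e / 3 * nrm z * h.
  by apply: k2 => s ts sh; apply/ltW/hd2 => //; apply: le_lt_trans sh _; rewrite ltrD2l.
rewrite add0r flow0// in k2; rewrite ripBl//.
set a := itg _ t _ in k1 *; set b := itg _ 0 _ in k2 *.
have -> : h^-1 * (a - b) - (rip (flow t x) z - rip x z) =
  h^-1 * (a - h * rip (flow t x) z) - h^-1 * (b - h * rip x z).
  by field; rewrite gt_eqF.
have q (c : R) : `|c| <= e / 3 * nrm z * h -> `|h^-1 * c| <= e / 3 * nrm z.
  move=> hc; rewrite normrM gtr0_norm ?invr_gt0// mulrC ler_pdivrMr//.
move: (q _ k1) (q _ k2); rewrite !ler_norml => /andP[_ A1] /andP[A2 _].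
lra.
Qed.

Lemma adjoint_graph_rip z v : adjoint_graph D A z v -> forall x, D x ->
  rip (A x) z = rip x v.
Proof. by move=> h x Dx; rewrite /rip h. Qed.

(** The integral of the orbit lies in the domain for every [x], so that [A] can be moved onto [z]
    even if the orbit itself stays outside the domain. *)
Lemma flow_weak z v : adjoint_graph D A z v -> forall (x : X) (t : R), 0 <= t ->
  rip (flow t x) z - rip x z = itg (fun s => rip (flow s x) v) 0 t.
Proof.
move=> h x t t0; have [y hy] := flow_integral_exists x t0.
have [Dy Ay] := generates_integral t0 hy.
by rewrite -hy -(adjoint_graph_rip h Dy) Ay ripBl.
Qed.

Lemma flow_weak_shift z v : adjoint_graph D A z v -> forall (x : X) (s t : R), s <= t ->
  rip (flow (t - s) x) z - rip x z = itg (fun r => rip (flow (r - s) x) v) s t.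
Proof.
move=> h x s t st; rewrite (flow_weak h)//; last by rewrite subr_ge0.
have mo : measurable_fun setT (fun s => rip (flow s x) v).
  by apply: continuous_measurable_fun; exact: flow_continuous.
by rewrite (itg_translate s t s mo) subrr.
Qed.

Lemma adjoint_graph_iK z v : adjoint_graph D A z v ->
  adjoint_graph D A (iK *: z) (iK *: v).
Proof. by move=> h x Dx; rewrite !ipZr// h. Qed.

(** The generator only provides the right derivative at time 0. The semigroup carries it to every
    left endpoint with a uniform bound, and [local_estimate_zero] then makes the difference of the
    two sides constant. *)
Lemma flow_generator (x : X) : D x -> forall (t : R) z, 0 <= t ->
  rip (flow t x) z - rip x z = itg (fun s => rip (flow s (A x)) z) 0 t.
Proof.
move=> Dx t z t0.
pose G r := rip (flow r x) z - rip x z - itg (fun s => rip (flow s (A x)) z) 0 r.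
suff : G t = G 0.
  have g0 : itg (fun s => rip (flow s (A x)) z) 0 0 = 0.
    have := itg_add (lexx 0) (lexx 0) (flow_itgable (A x) z 0 0); lra.
  rewrite /G g0 flow0// subrr subr0 => /eqP.
  by rewrite subr_eq0 => /eqP.
apply: local_estimate_zero => // e e0.
have [M M1 hM] := flow_bound hX hS t.
have z1 : 0 < M * (nrm z + 1) by rewrite mulr_gt0 ?ltr_pwDr ?nrm_ge0//; lra.
(* Two errors are to be at most e / 2 each: that of the difference quotient and the oscillation of
   the orbit of [A x]. Both are amplified by the bound M of the operator at time [a] and by the norm
   of [z]. *)
have e2 : 0 < e / 2 / (M * (nrm z + 1)) by rewrite !divr_gt0.
have /cvgrPdist_lt /(_ _ e2) [d1 /= d10 hd1] := (gS.2 x (A x)).1 (conj Dx erefl).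
have [d2 d20 hd2] := C0_right hX hS (A x) e2.
exists (Num.min d1 d2); first by rewrite lt_min d10 d20.
move=> a b a0; rewrite le_eqVlt => /predU1P[<-|ab] bt.
  by rewrite !subrr normr0 mulr0.
rewrite lt_min => /andP[hh1 hh2].
set h := b - a in hh1 hh2 *; have h0 : 0 < h by rewrite subr_gt0.
have bE : b = a + h by rewrite /h addrC subrK.
have ah : a <= a + h by rewrite lerDl ltW.
have -> : G b - G a = rip (flow a (flow h x - x)) z - itg (fun s => rip (flow s (A x)) z) a (a + h).
  rewrite /G bE (itg_add a0 ah (flow_itgable _ _ _ _)).
  rewrite flowD ?(ltW h0)// (bounded_linear_B _ _ (flow_bounded hS a)) ripBl//; ring.
have -> : rip (flow a (flow h x - x)) z - itg (fun s => rip (flow s (A x)) z) a (a + h) =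
  h * rip (flow a (ofR k h^-1 *: (flow h x - x) - A x)) z -
  (itg (fun s => rip (flow s (A x)) z) a (a + h) - h * rip (flow a (A x)) z).
  rewrite (bounded_linear_B _ (A x) (flow_bounded hS a)) (bounded_linear_Z _ _ (flow_bounded hS a)).
  by rewrite ripBl// ripZl//; field; rewrite gt_eqF.
have u1 : nrm (ofR k h^-1 *: (flow h x - x) - A x) <= e / 2 / (M * (nrm z + 1)).
  have := hd1 h; rewrite /= sub0r normrN gtr0_norm// => /(_ hh1 h0).
  by rewrite sub0r normrN ger0_norm ?nrm_ge0// flowE ?(ltW h0)// => /ltW.
have u2 s : a <= s -> s <= a + h -> nrm (flow s (A x) - flow a (A x)) <= e / 2 / (nrm z + 1).
  move=> as_ sh; have sa : 0 <= s - a by rewrite subr_ge0.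
  have -> : s = a + (s - a) by rewrite addrC subrK.
  rewrite flowD// -(bounded_linear_B _ _ (flow_bounded hS a)).
  rewrite (le_trans (hM _ _ _))//; first by lra.
  have := hd2 _ sa (ltac:(lra)); rewrite flowE// => /ltW hq.
  rewrite (le_trans (ler_wpM2l _ hq))//; first by lra.
  rewrite le_eqVlt; apply/orP; left; apply/eqP; field.
  by apply/andP; split; [have := nrm_ge0 z; lra|lra].
have k2 := itg_flow_near z a0 (ltW h0) u2.
have k1 : `|h * rip (flow a (ofR k h^-1 *: (flow h x - x) - A x)) z| <= e / 2 * h.
  rewrite normrM gtr0_norm// mulrC ler_pM2r//.
  rewrite (le_trans (cauchy_schwarz hX _ _))//.
  apply: (@le_trans _ _ (M * (e / 2 / (M * (nrm z + 1))) * nrm z)).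
    rewrite ler_wpM2r ?nrm_ge0//.
    by rewrite (le_trans (hM _ _ _))//; [lra|rewrite ler_wpM2l//; lra].
  have -> : M * (e / 2 / (M * (nrm z + 1))) * nrm z = e / 2 * (nrm z / (nrm z + 1)).
    by field; apply/andP; split; [have := nrm_ge0 z; lra|lra].
  by rewrite ler_piMr ?divr_ge0 ?(ltW e0)// ler_pdivrMr ?mul1r ?lerDl// ltr_pwDr ?nrm_ge0.
have k2' : e / 2 / (nrm z + 1) * nrm z * h <= e / 2 * h.
  rewrite ler_pM2r// mulrAC ler_pdivrMr ?ltr_pwDr ?nrm_ge0//.
  by rewrite ler_wpM2l ?divr_ge0 ?(ltW e0)// lerDl.
have := ler_normB (h * rip (flow a (ofR k h^-1 *: (flow h x - x) - A x)) z)
  (itg (fun s => rip (flow s (A x)) z) a (a + h) - h * rip (flow a (A x)) z).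
move/le_trans; apply; lra.
Qed.

(* The elements [int_0^h S_r^* z dr] are the test functions of the uniqueness
   proof. *)
Lemma adjoint_graph_integral (z zeta : X) (h : R) : 0 <= h ->
  (forall x, rip x zeta = itg (fun s => rip (flow s x) z) 0 h) ->
  adjoint_graph D A zeta (adjoint (flow h) z - z).
Proof.
move=> h0 hz x Dx.
(* The real part of the claim; the imaginary part is the same statement for [iK *: z] and
   [iK *: zeta]. *)
have real z' zeta' : (forall x, rip x zeta' = itg (fun s => rip (flow s x) z') 0 h) ->
    rip (A x) zeta' = rip x (adjoint (flow h) z' - z').
  move=> hz'; rewrite hz' -(flow_generator Dx)// ripBr// -rip_adjoint//.
  exact: flow_bounded.
apply: ip_eq => //; first exact: real.
rewrite scalerBr.
have -> : iK *: adjoint (flow h) z = adjoint (flow h) (iK *: z).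
  apply: (rip_inj hX) => y; rewrite !(ripC hX _ y) -rip_adjoint//; last exact: flow_bounded.
  have := adjointP hX hX (flow_bounded hS h) y z.
  by move=> e; rewrite -!imK_ip// e.
apply: real => y.
have -> : rip y (iK *: zeta) = rip (- iK *: y) zeta.
  by rewrite scaleNr ripNl// rip_iK// opprK.
rewrite hz; apply: eq_itg => s _.
rewrite (bounded_linear_Z _ _ (flow_bounded hS s)) scaleNr ripNl// rip_iK//.
by rewrite opprK.
Qed.

End Generator.

(** * Gaussian random elements and the isometry *)

Import HBNNSimple.

Section Density.
Variables (R : realType) (d : measure_display) (T : measurableType d).
Variables (mu nu : {measure set T -> \bar R}) (g : T -> R).
Hypotheses (mg : measurable_fun setT g) (g0 : forall x, 0 <= g x).
Hypothesis nuE : forall A, measurable A -> (nu A = \int[mu]_(x in A) (g x)%:E)%E.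

(** True for simple functions by [nuE], then by monotone convergence. *)
Lemma ge0_integral_density (f : T -> \bar R) : measurable_fun setT f ->
  (forall x, 0 <= f x)%E ->
  (\int[nu]_x f x = \int[mu]_x (f x * (g x)%:E))%E.
Proof.
move=> mf f0.
have mE : measurable_fun setT (EFin \o g) by exact/measurable_EFinP.
have h0 (h : {nnsfun T >-> R}) r x : 0 <= r * \1_(h @^-1` [set r]) x.
  rewrite indicE; case: (boolP (_ \in _)) => [|_]; last by rewrite mulr0.
  by rewrite inE/= mulr1 => <-.
have sf (h : {nnsfun T >-> R}) :
    (\int[nu]_x (h x)%:E = \int[mu]_x ((h x)%:E * (g x)%:E))%E.
  rewrite integralT_nnsfun sintegralE.
  under [RHS]eq_integral => x _.
    rewrite (fimfunE h) -fsumEFin// ge0_mule_fsuml; last first.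
      by move=> r; rewrite EFinM; exact: nnfun_muleindic_ge0.
    over.
  rewrite /= ge0_integral_fsum//; last 2 first.
  - move=> r; apply: emeasurable_funM => //; apply/measurable_EFinP.
    by apply: measurable_funM => //; exact: measurable_indic.
  - by move=> r x _; rewrite mule_ge0// ?lee_fin// h0.
  apply: eq_fsbigr => r _; rewrite nuE//.
  have [r0|r0] := ltP r 0.
    rewrite preimage_nnfun0// integral_set0 mule0.
    rewrite (eq_integral (cst 0%E)) ?integral0// => x _.
    by rewrite indic0 mulr0 mul0e.
  rewrite -ge0_integralZl//=; last 2 first.
  - exact: measurable_funTS.
  - by move=> x _; rewrite lee_fin.
  rewrite integral_mkcond; apply: eq_integral => x _.
  rewrite /patch indicE; case: ifP => _; first by rewrite mulr1.
  by rewrite mulr0 mul0e.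
pose h := nnsfun_approx measurableT mf.
have hf x : (fun n => (h n x)%:E) @ \oo --> f x.
  exact: (cvg_nnsfun_approx measurableT mf (fun x _ => f0 x) I).
have hn x : {homo (fun n => (h n x)%:E) : n m / (n <= m)%N >-> (n <= m)%E}.
  by move=> n m nm; rewrite lee_fin; exact/lefP/nd_nnsfun_approx.
have l1 : (fun n => \int[nu]_x (h n x)%:E)%E @ \oo --> (\int[nu]_x f x)%E.
  rewrite (_ : f = fun x => limn (fun n => (h n x)%:E)); last first.
    by apply/funext => x; apply/esym/cvg_lim => //; exact: hf.
  apply: cvg_monotone_convergence => //.
    by move=> n; apply/measurable_EFinP.
  by move=> n x _; rewrite lee_fin.
have l2 : (fun n => \int[mu]_x ((h n x)%:E * (g x)%:E))%E @ \oo -->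
    (\int[mu]_x (f x * (g x)%:E))%E.
  rewrite (_ : (fun x => f x * (g x)%:E)%E =
      fun x => limn (fun n => (h n x)%:E * (g x)%:E)%E); last first.
    apply/funext => x; apply/esym/cvg_lim => //.
    by apply: cvgeZr => //; exact: hf.
  apply: cvg_monotone_convergence => //.
  - by move=> n; apply: emeasurable_funM => //; exact/measurable_EFinP.
  - by move=> n x _; rewrite mule_ge0// lee_fin.
  - by move=> x _ n m nm; apply: lee_wpmul2r; [rewrite lee_fin|exact: hn].
have {}l2 : (fun n => \int[nu]_x (h n x)%:E)%E @ \oo --> (\int[mu]_x (f x * (g x)%:E))%E.
  by under eq_fun do rewrite sf.
exact: (cvg_unique _ l1 l2).
Qed.

End Density.

Lemma integral_probability_cst (R : realType) d (T : measurableType d)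
    (P : probability T R) (c : R) : (\int[P]_w c%:E = c%:E)%E.
Proof.
transitivity (c%:E * P setT)%E; first exact: integral_cst.
by rewrite probability_setT mule1.
Qed.

(** * Moments and anticoncentration of real Gaussian variables *)

Section RealGaussian.
Variables (R : realType) (d : measure_display) (Omega : measurableType d).
Variable P : probability Omega R.
Local Notation mu := (@lebesgue_measure R).
Variables (f : Omega -> R) (m s : R).
Hypothesis gf : real_gaussian P f m s.

Let mf : measurable_fun setT f := gf.1.

Lemma gaussian_integral (phi : R -> \bar R) : s != 0 -> measurable_fun setT phi ->
  (forall x, 0 <= phi x)%E ->
  (\int[P]_w phi (f w) = \int[mu]_x (phi x * (normal_pdf m s x)%:E))%E.
Proof.
move=> s0 mphi phi0.
have := @ge0_integral_pushforward _ _ Omega (measurableTypeR R) R f mf P setT phi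
  measurableT mphi (fun x _ => phi0 x).
rewrite preimage_setT => <-.
apply: ge0_integral_density => //.
- exact: measurable_normal_pdf.
- by move=> x; exact: normal_pdf_ge0.
- move=> A mA; have := gf.2; rewrite (negbTE s0) => /(_ A mA).
  by rewrite /pushforward /normal_prob.
Qed.

Lemma gaussian_degenerate : s = 0 -> {ae P, forall w, f w = m}.
Proof. by move=> s0; have := gf.2; rewrite s0 eqxx. Qed.

(* [y <= exp y] at [y = (x - m)^2 / (4 s^2)] bounds [(x - m)^2] times the
   density by a multiple of the density with twice the variance. *)
Lemma sqr_normal_pdf_le x : s != 0 ->
  (x - m) ^+ 2 * normal_pdf m s x <= 8 * s ^+ 2 * normal_pdf m (Num.sqrt 2 * s) x.
Proof.
move=> s0; have s2 : 0 < s ^+ 2 by rewrite lt_neqAle eq_sym sqrf_eq0 s0 sqr_ge0.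
have t0 : Num.sqrt 2 * s != 0 by rewrite mulf_neq0// gt_eqF// sqrtr_gt0.
rewrite !normal_pdfE//.
have tE : (Num.sqrt 2 * s) ^+ 2 = 2 * s ^+ 2 by rewrite exprMn sqr_sqrtr.
(* The peaks differ by a factor sqrt 2, rounded up to 2; together with the 4 in the definition of
   [y] it gives the constant 8. *)
have pk : normal_peak s <= 2 * normal_peak (Num.sqrt 2 * s).
  have q0 : 0 < s ^+ 2 * pi *+ 2 by rewrite pmulrn_lgt0// mulr_gt0// pi_gt0.
  have -> : normal_peak (Num.sqrt 2 * s) = (Num.sqrt 2 * Num.sqrt (s ^+ 2 * pi *+ 2))^-1.
    rewrite /normal_peak tE -sqrtrM//; congr (Num.sqrt _)^-1; ring.
  rewrite /normal_peak; set r := Num.sqrt (s ^+ 2 * pi *+ 2).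
  have r0 : 0 < r by rewrite sqrtr_gt0.
  have q2 : 0 < Num.sqrt 2 :> R by rewrite sqrtr_gt0.
  have : Num.sqrt 2 <= Num.sqrt (2 ^+ 2) :> R by rewrite ler_wsqrtr//; lra.
  rewrite sqrtr_sqr ger0_norm// => h.
  by rewrite invfM mulrA ler_pMl ?invr_gt0// ler_pdivlMr// mul1r.
set y := (x - m) ^+ 2 / (4 * s ^+ 2).
have e1 : normal_fun m s x = expR (- y) * expR (- y).
  rewrite /normal_fun -expRD; congr expR; rewrite /y; field.
  by rewrite -sqrf_eq0 gt_eqF.
have e2 : normal_fun m (Num.sqrt 2 * s) x = expR (- y).
  rewrite /normal_fun tE; congr expR; rewrite /y; field.
  by rewrite -sqrf_eq0 gt_eqF.
have ye : y * expR (- y) <= 1.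
  rewrite -(expRxMexpNx_1 y) ler_wpM2r ?expR_ge0//.
  have := expR_ge1Dx y; lra.
have xy : (x - m) ^+ 2 = 4 * s ^+ 2 * y by rewrite /y; field; rewrite -sqrf_eq0 gt_eqF.
have p0 := normal_peak_ge0 (Num.sqrt 2 * s); have p1 := normal_peak_ge0 s.
rewrite e1 e2 xy; move: pk ye (expR_gt0 (- y)) s2 p0 p1.
move: (normal_peak (Num.sqrt 2 * s)) (normal_peak s) (expR (- y)) (s ^+ 2).
move=> b a E q h1 h2 h3 h4 h5 h6.
have -> : 4 * q * y * (a * (E * E)) = 4 * q * a * E * (y * E) by ring.
apply: (@le_trans _ _ (4 * q * a * E * 1)).
  by rewrite ler_wpM2l// !mulr_ge0// ltW.
have -> : 8 * q * (b * E) = 4 * q * (2 * b) * E by ring.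
by rewrite mulr1 ler_wpM2r ?(ltW h3)// ler_wpM2l// mulr_ge0// ltW.
Qed.

(** [sqr_normal_pdf_le] integrated against a density of total mass 1. The constant is crude: what
    matters later is a bound by a fixed multiple of [s ^+ 2]. *)
Lemma gaussian_variance_le : (\int[P]_w ((f w - m) ^+ 2)%:E <= (8 * s ^+ 2)%:E)%E.
Proof.
have m2 (T : measurableType d) (h : Omega -> R) : measurable_fun setT h ->
    measurable_fun setT (fun w => ((h w - m) ^+ 2)%:E).
  move=> mh; apply/measurable_EFinP; apply: measurable_funX.
  by apply: measurable_funB => //; exact: measurable_cst.
have [s0|s0] := eqVneq s 0.
  rewrite (@ge0_ae_eq_integral _ _ _ P setT _ (cst 0%E))//.
  - by rewrite integral0 lee_fin mulr_ge0// sqr_ge0.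
  - exact: (m2 Omega).
  - by move=> w _; rewrite lee_fin sqr_ge0.
  - apply: filterS (gaussian_degenerate s0) => w /= -> _.
    by rewrite subrr expr0n.
have mphi : measurable_fun setT (fun x : R => ((x - m) ^+ 2)%:E).
  apply/measurable_EFinP; apply: measurable_funX.
  by apply: measurable_funB => //; exact: measurable_cst.
rewrite (gaussian_integral s0 mphi); last by move=> x; rewrite lee_fin sqr_ge0.
apply: (@le_trans _ _ (\int[mu]_x ((8 * s ^+ 2)%:E *
    (normal_pdf m (Num.sqrt 2 * s) x)%:E))%E).
  apply: ge0_le_integral => //.
  - by move=> x _; rewrite -EFinM lee_fin mulr_ge0 ?sqr_ge0 ?normal_pdf_ge0.
  - apply: emeasurable_funM => //; apply/measurable_EFinP; exact: measurable_normal_pdf.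
  - by apply: measurable_funeM; apply/measurable_EFinP; exact: measurable_normal_pdf.
  - by move=> x _; rewrite -!EFinM lee_fin sqr_normal_pdf_le.
rewrite ge0_integralZl//; last 3 first.
- by apply/measurable_EFinP; exact: measurable_normal_pdf.
- by move=> x _; rewrite lee_fin normal_pdf_ge0.
- by rewrite lee_fin mulr_ge0// sqr_ge0.
by rewrite integral_normal_pdf mule1.
Qed.

Lemma gaussian_moment_le : (\int[P]_w ((f w) ^+ 2)%:E <= (16 * (m ^+ 2 + s ^+ 2))%:E)%E.
Proof.
have mB : measurable_fun setT (fun w => ((f w - m) ^+ 2)%:E).
  apply/measurable_EFinP; apply: measurable_funX.
  by apply: measurable_funB => //; exact: measurable_cst.
apply: (@le_trans _ _ (\int[P]_w (2%:E * ((f w - m) ^+ 2)%:E + (2 * m ^+ 2)%:E))%E).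
  apply: ge0_le_integral => //.
  - by move=> x _; rewrite lee_fin sqr_ge0.
  - by apply/measurable_EFinP; exact: measurable_funX.
  - by apply: emeasurable_funD => //; exact: measurable_funeM.
  - move=> x _; rewrite -EFinM -EFinD lee_fin; have := sqr_ge0 (f x - m - m); nra.
rewrite ge0_integralD//; last 3 first.
- by move=> x _; rewrite mule_ge0// lee_fin sqr_ge0.
- exact: measurable_funeM.
- by move=> x _; rewrite lee_fin mulr_ge0// sqr_ge0.
rewrite ge0_integralZl//; last by move=> x _; rewrite lee_fin sqr_ge0.
rewrite integral_probability_cst; apply: le_trans (leeD (lee_pmul _ _ (lexx _) gaussian_variance_le) (lexx _)) _.
- by rewrite lee_fin.
- by apply: integral_ge0 => x _; rewrite lee_fin sqr_ge0.
by rewrite -EFinM -EFinD lee_fin; have := sqr_ge0 s; have := sqr_ge0 m; lra.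
Qed.

Lemma normal_pdf_reflect x : s != 0 -> normal_pdf m s (m + m - x) = normal_pdf m s x.
Proof.
move=> s0; rewrite !normal_pdfE// /normal_fun.
by rewrite (_ : m + m - x - m = - (x - m)) ?sqrrN//; ring.
Qed.

Lemma gaussian_mean : m = 0 -> Rintegral P setT f = 0.
Proof.
move=> m0; have [s0|s0] := eqVneq s 0.
  have -> : Rintegral P setT f = Rintegral P setT (cst 0).
    rewrite /Rintegral; congr fine; apply: ae_eq_integral => //.
    - exact/measurable_EFinP.
    - by apply/measurable_EFinP; exact: measurable_cst.
    - by apply: filterS (gaussian_degenerate s0) => w /= -> _; rewrite m0.
  by rewrite /Rintegral integral0.
rewrite /Rintegral integralE.
have mp : measurable_fun setT (fun x : R => (Num.max x 0)%:E).
  by apply/measurable_EFinP; apply: measurable_maxr => //; exact: measurable_cst.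
have mn : measurable_fun setT (fun x : R => (Num.max (- x) 0)%:E).
  apply/measurable_EFinP; apply: measurable_maxr; last exact: measurable_cst.
  exact: oppr_measurable.
have e : (\int[P]_w (fun x => (f x)%:E)^\+ w = \int[P]_w (fun x => (f x)%:E)^\- w)%E.
  rewrite (eq_integral (fun w => (Num.max (f w) 0)%:E)); last first.
    by move=> w _; rewrite funeposE -EFin_max.
  rewrite [RHS](eq_integral (fun w => (Num.max (- f w) 0)%:E)); last first.
    by move=> w _; rewrite funenegE -EFinN -EFin_max.
  rewrite (gaussian_integral s0 mp); last by move=> x; rewrite lee_fin le_max lexx orbT.
  rewrite (gaussian_integral s0 mn); last by move=> x; rewrite lee_fin le_max lexx orbT.
  rewrite -[RHS](ge0_integral_reflect 0).
  - apply: eq_integral => x _; rewrite sub0r opprK.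
    by have := normal_pdf_reflect x s0; rewrite m0 addr0 sub0r => ->.
  - by apply: emeasurable_funM => //; apply/measurable_EFinP; exact: measurable_normal_pdf.
  - by move=> x; rewrite mule_ge0// lee_fin ?normal_pdf_ge0// le_max lexx orbT.
(* Both parts have the integral [I]; if [I] is infinite, the real integral is 0 by convention. *)
rewrite e; set I := (\int[P]_w _)%E.
by have := fin_num_abs I; case: I => //= r _; rewrite subrr.
Qed.

Lemma gaussian_preimage (B : set R) : s != 0 -> measurable B ->
  (P (f @^-1` B) = \int[mu]_(x in B) (normal_pdf m s x)%:E)%E.
Proof. by move=> s0 mB; have := gf.2; rewrite (negbTE s0) => /(_ B mB). Qed.

(** Reflection at [m] exchanges the two half-lines, whose probabilities add up to at least 1. *)
Lemma gaussian_half : s != 0 ->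
  (2^-1%:E <= P (f @^-1` [set x | (m <= x)%R]))%E /\
  (2^-1%:E <= P (f @^-1` [set x | (x <= m)%R]))%E.
Proof.
move=> s0.
have m1 : measurable [set x : R | (m <= x)%R].
  rewrite (_ : [set x | _] = `[m, +oo[%classic); first exact: measurable_itv.
  by apply/seteqP; split=> x; rewrite /= in_itv/= andbT.
have m2 : measurable [set x : R | (x <= m)%R].
  rewrite (_ : [set x | _] = `]-oo, m]%classic); first exact: measurable_itv.
  by apply/seteqP; split=> x; rewrite /= in_itv/=.
have e : P (f @^-1` [set x | (m <= x)%R]) = P (f @^-1` [set x | (x <= m)%R]).
  rewrite (gaussian_preimage s0 m1) (gaussian_preimage s0 m2).
  rewrite [LHS]integral_mkcond [RHS]integral_mkcond.
  rewrite -(@ge0_integral_reflect R (m + m)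
    ((fun x => (normal_pdf m s x)%:E) \_ [set x | (x <= m)%R])).
  - apply: eq_integral => x _; rewrite /patch.
    have -> : (x \in [set x | m <= x]) = (m + m - x \in [set x | x <= m]).
      by apply/idP/idP; rewrite !inE/=; lra.
    by case: ifP => // _; rewrite normal_pdf_reflect.
  - apply/(measurable_restrictT _ m2); apply/measurable_funTS/measurable_EFinP.
    exact: measurable_normal_pdf.
  - by move=> x; rewrite erestrict_ge0// => y _; rewrite lee_fin normal_pdf_ge0.
have t1 : (1 <= P (f @^-1` [set x | (m <= x)%R]) + P (f @^-1` [set x | (x <= m)%R]))%E.
  rewrite -(probability_setT P).
  have -> : [set: Omega] = f @^-1` [set x | (m <= x)%R] `|` f @^-1` [set x | (x <= m)%R].
    by apply/seteqP; split=> // w _ /=; have [h|/ltW h] := leP m (f w); [left|right].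
  apply: measureU2; [have := mf measurableT m1|have := mf measurableT m2];
    by rewrite setTI.
have h (p : \bar R) : (1 <= p + p)%E -> (2^-1%:E <= p)%E.
  by case: p => [r| |]//; rewrite ?leey// -EFinD !lee_fin; lra.
by split; apply: h; [rewrite {2}e|rewrite -{1}e].
Qed.

(* Half of the mass lies beyond the mean if [s ^+ 2 <= m ^+ 2], and outside the
   ball of radius [|s| / 2] otherwise. *)
Lemma gaussian_anticoncentration :
  (2^-1%:E <= P [set w | ((m ^+ 2 + s ^+ 2) / 8 <= f w ^+ 2)%R])%E.
Proof.
set A := [set w | _].
have mA : measurable A.
  have := measurable_fun_ler (@measurable_cst _ _ Omega _ setT ((m ^+ 2 + s ^+ 2) / 8))
    (measurable_funX 2 mf) measurableT (Y := [set true]) I.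
  by rewrite setTI; congr measurable; apply/seteqP; split.
have sub (B : set R) : measurable B -> f @^-1` B `<=` A -> (P (f @^-1` B) <= P A)%E.
  move=> mB BA; apply: le_measure => //; rewrite inE//.
  by have := mf measurableT mB; rewrite setTI.
have [s0|s0] := eqVneq s 0.
  have -> : P A = 1%E.
    apply/eqP; rewrite eq_le probability_le1//= -(probability_setT P).
    have -> : [set: Omega] = A `|` ~` A by rewrite setUv.
    apply: le_trans (measureU2 _ mA (measurableC mA)) _.
    rewrite [X in (_ + X)%E](_ : _ = 0%E) ?adde0//.
    apply/eqP; rewrite -measure_le0; apply/eqP.
    have [N [mN N0 sN]] := gaussian_degenerate s0.
    apply/eqP; rewrite -N0; apply: le_measure; rewrite ?inE//; first exact: measurableC.
    move=> w /= Aw; apply: sN => /= fw; apply: Aw; rewrite /A/= fw s0.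
    have := sqr_ge0 m; lra.
  by rewrite lee_fin; lra.
have [sm|ms] := leP (s ^+ 2) (m ^+ 2).
  have [h1 h2] := gaussian_half s0.
  have [m0|m0] := leP 0 m.
    apply: le_trans h1 _; apply: sub.
      rewrite (_ : [set x | _] = `[m, +oo[%classic); first exact: measurable_itv.
      by apply/seteqP; split=> x; rewrite /= in_itv/= andbT.
    by move=> w /= h; rewrite /A/=; nra.
  apply: le_trans h2 _; apply: sub.
    rewrite (_ : [set x | _] = `]-oo, m]%classic); first exact: measurable_itv.
    by apply/seteqP; split=> x; rewrite /= in_itv/=.
  by move=> w /= h; rewrite /A/=; nra.
(* The interval of length |s| carries at most |s| times the peak of the density, which is 1 / sqrt
   (2 pi) and hence at most 1 / 2. *)
pose r := `|s| / 2; have r0 : 0 < r by rewrite divr_gt0// normr_gt0.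
pose B : set R := `](- r), r[%classic.
have mB : measurable B by exact: measurable_itv.
have mfB : measurable (f @^-1` B) by have := mf measurableT mB; rewrite setTI.
have PB : (P (f @^-1` B) <= 2^-1%:E)%E.
  rewrite gaussian_preimage//.
  apply: (@le_trans _ _ (\int[mu]_(x in B) (normal_peak s)%:E)%E).
    apply: ge0_le_integral => //.
    - by move=> x _; rewrite lee_fin normal_pdf_ge0.
    - by apply/measurable_funTS/measurable_EFinP; exact: measurable_normal_pdf.
    - by move=> x _; rewrite lee_fin normal_pdf_ub.
  have hB : mu B = `|s|%:E.
    rewrite lebesgue_measure_itv/= lte_fin ifT; last by lra.
    by rewrite -EFinD opprK; congr (_%:E); rewrite /r; lra.
  have -> : (\int[mu]_(x in B) (normal_peak s)%:E = (normal_peak s)%:E * `|s|%:E)%E.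
    by rewrite -hB; exact: integral_cst.
  rewrite -EFinM lee_fin.
  have s2 : 0 < s ^+ 2 by rewrite lt_neqAle eq_sym sqrf_eq0 s0 sqr_ge0.
  rewrite /normal_peak -mulrnAr sqrtrM ?sqr_ge0// sqrtr_sqr invfM mulrAC mulVf ?normr_eq0// mul1r.
  have pi2 : 0 < pi *+ 2 :> R by rewrite pmulrn_lgt0// pi_gt0.
  rewrite lef_pV2; [|by rewrite posrE sqrtr_gt0|by rewrite posrE].
  have : Num.sqrt (2 ^+ 2) <= Num.sqrt (pi *+ 2) :> R.
    by rewrite ler_wsqrtr//; have := pi_ge2 R; lra.
  by rewrite sqrtr_sqr ger0_norm.
have : (1 <= P A + P (f @^-1` B))%E.
  rewrite -(probability_setT P); apply: le_trans (measureU2 _ mA mfB).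
  apply: le_measure; rewrite ?inE//; first exact: measurableU.
  move=> w _; rewrite /A /B /=; have [h|h] := leP ((m ^+ 2 + s ^+ 2) / 8) (f w ^+ 2); first by left.
  right; rewrite in_itv/= -ltr_norml -(@ltr_pXn2r _ 2)// ?nnegrE ?(ltW r0)//.
  rewrite real_normK ?num_real// /r exprMn real_normK ?num_real//.
  have -> : (2^-1 : R) ^+ 2 = 4^-1 by field.
  by lra.
move: PB; case: (P A) => [p| |]//; case: (P (f @^-1` B)) => [q| |]//; rewrite ?leey//.
by rewrite -EFinD !lee_fin; lra.
Qed.

End RealGaussian.

(** * Independence and sums of Gaussian squares *)

Section Independence.
Variables (R : realType) (d : measure_display) (Omega : measurableType d).
Variable P : probability Omega R.
Variables f g : Omega -> R.
Hypotheses (mf : measurable_fun setT f) (mg : measurable_fun setT g).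
Hypothesis indep : forall A B, measurable A -> measurable B ->
  (P (f @^-1` A `&` g @^-1` B) = P (f @^-1` A) * P (g @^-1` B))%E.
Hypothesis ig : P.-integrable setT (EFin \o g).
Hypothesis ifg : P.-integrable setT (EFin \o (fun w => f w * g w)).

(** The joint law is the product of the two laws; in Fubini's formula the inner integral is [x]
    times the mean of [g]. *)
Lemma independent_integral0 : Rintegral P setT g = 0 ->
  Rintegral P setT (fun w => f w * g w) = 0.
Proof.
move=> g0.
pose F : {RV P >-> R} := mfun_Sub (mem_set mf).
pose G : {RV P >-> R} := mfun_Sub (mem_set mg).
have mfg : measurable_fun setT (fun w => (f w, g w)) by exact: measurable_fun_pair.
pose h (z : R * R) := (z.1 * z.2)%:E.
have mh : measurable_fun setT h.
  apply/measurable_EFinP; apply: measurable_funM;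
  [exact: measurable_fst|exact: measurable_snd].
have e1 : (\int[P]_w (f w * g w)%:E = \int[pushforward P (fun w => (f w, g w))]_z h z)%E.
  by rewrite (integral_pushforward mfg mh)// preimage_setT.
have e2 : (\int[pushforward P (fun w => (f w, g w))]_z h z =
    \int[distribution P F \x distribution P G]_z h z)%E.
  apply: eq_measure_integral => A mA _; apply/esym; apply: product_measure_unique => //.
have ih : (distribution P F \x distribution P G)%E.-integrable setT h.
  apply/integrableP; split => //.
  have <- : (\int[pushforward P (fun w => (f w, g w))]_z `|h z| =
      \int[distribution P F \x distribution P G]_z `|h z|)%E.
    apply: eq_measure_integral => A mA _; apply/esym; apply: product_measure_unique => //.
  rewrite ge0_integral_pushforward//; last exact: measurableT_comp.
  by rewrite preimage_setT; have /integrableP[] := ifg.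
rewrite /Rintegral e1 e2 -(integral12_prod_meas1 ih).
rewrite (eq_integral (cst 0%E)) ?integral0// => x _.
rewrite /fubini_F /h /=.
have ig' : (distribution P G).-integrable setT (EFin \o id).
  apply/integrableP; split; first exact/measurable_EFinP.
  rewrite ge0_integral_pushforward//; last first.
    by apply: measurableT_comp => //; exact/measurable_EFinP.
  by rewrite preimage_setT; have /integrableP[] := ig.
under eq_integral do rewrite EFinM.
rewrite integralZl//.
have -> : (\int[distribution P G]_y y%:E = \int[P]_w (g w)%:E)%E.
  have mE : measurable_fun setT (EFin : R -> \bar R) by exact/measurable_EFinP.
  have := @integral_pushforward _ _ Omega R R g mg P setT EFin mE.
  by rewrite preimage_setT => /(_ ig measurableT).
have := integrable_fin_num measurableT ig; rewrite -/(Rintegral P setT g) => fg.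
by rewrite -(fineK fg) [fine _]g0 mule0.
Qed.

End Independence.

Section GaussianSquares.
Variables (R : realType) (d : measure_display) (Omega : measurableType d).
Variable P : probability Omega R.

(* Each square exceeds an eighth of its size with probability one half, hence
   so does a fixed proportion of any sum of squares; a random variable bounding
   such sums then bounds the sum of the sizes. *)
Lemma gaussian_squares_bounded (Y : Omega -> R) : measurable_fun setT Y ->
  exists C : R, forall (N : nat) (g : 'I_N -> Omega -> R) (m s : 'I_N -> R),
    (forall i, real_gaussian P (g i) (m i) (s i)) ->
    (forall w, \sum_(i < N) g i w ^+ 2 <= Y w) ->
    \sum_(i < N) (m i ^+ 2 + s i ^+ 2) <= C.
Proof.
move=> mY.
have mB c : measurable [set w | Y w <= c].
  have := mY measurableT `]-oo, c]%classic (measurable_itv _); rewrite setTI.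
  by congr measurable; apply/seteqP; split=> w; rewrite /= in_itv.
(* On an event of probability at least 3/4 the variable [Y] is at most [c]; any event of probability
   1/2 meets it with probability at least 1/4. *)
have [c c0 hc] : exists2 c : R, 0 <= c & ((3 / 4)%:E <= P [set w | (Y w <= c)%R])%E.
  have : (fun n : nat => P [set w | (Y w <= n%:R)%R]) @ \oo --> P (\bigcup_n [set w | (Y w <= n%:R)%R]).
    apply: nondecreasing_cvg_mu => //; first exact: bigcup_measurable.
    move=> n p np; apply/subsetPset => w /= h; apply: le_trans h _; by rewrite ler_nat.
  have -> : \bigcup_n [set w | Y w <= n%:R] = [set: Omega].
    apply/seteqP; split=> // w _; exists (Num.truncn `|Y w|).+1 => //=.
    by rewrite (le_trans (ler_norm _))// ltW// truncnS_gt.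
  rewrite probability_setT => hl.
  have : \forall n \near \oo, ((3 / 4)%:E < P [set w | (Y w <= n%:R)%R])%E.
    apply: (hl [set x | ((3 / 4)%:E < x)%E]); apply: open_nbhs_nbhs; split.
      exact: open_ereal_gt_ereal.
    by rewrite /= lte_fin; lra.
  case=> n _ /(_ n (leqnn _)) /= h; exists n%:R => //; exact: ltW.
(* A factor 8 from the size of the squares on [A i], a factor 4 from the probability that [A i] and
   [B] occur together. *)
exists (32 * c) => N g m s gg gY.
set w := fun i => m i ^+ 2 + s i ^+ 2.
have w0 i : 0 <= w i by rewrite addr_ge0// sqr_ge0.
pose B := [set t | Y t <= c].
pose A i := [set t | w i / 8 <= g i t ^+ 2].
have mA i : measurable (A i).
  have := measurable_fun_ler (@measurable_cst _ _ Omega _ setT (w i / 8))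
    (measurable_funX 2 (gg i).1) measurableT (Y := [set true]) I.
  by rewrite setTI; congr measurable; apply/seteqP; split.
have mAB i : measurable (A i `&` B) by apply: measurableI; [exact: mA|exact: mB].
have PAB i : (4^-1%:E <= P (A i `&` B))%E.
  have := gaussian_anticoncentration (gg i); rewrite -/(w i) -/(A i) => h1.
  have : (P (A i) <= P (A i `&` B) + (1 - P B))%E.
    rewrite -(probability_setC P (mB c)).
    apply: le_trans (measureU2 _ (measurableI _ _ (mA i) (mB c)) (measurableC (mB c))).
    apply: le_measure; rewrite ?inE//.
      by apply: measurableU; [exact: mAB|exact: measurableC].
    by move=> t At; have [Bt|Bt] := pselect (B t); [left|right].
  move: h1 hc; rewrite -/B; case: (P (A i)) => [x| |]//; case: (P B) => [y| |]//;
    case: (P (A i `&` B)) => [z| |]//; rewrite ?leey//.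
  by rewrite -EFinB -!EFinD !lee_fin; lra.
have ub : (\int[P]_t (\sum_(i < N) (w i * \1_(A i `&` B) t))%:E <= (8 * c)%:E)%E.
  apply: (@le_trans _ _ (\int[P]_t (8 * c)%:E)%E).
    apply: ge0_le_integral => //.
    - by move=> t _; rewrite lee_fin sumr_ge0// => i _; rewrite mulr_ge0// indicE.
    - apply/measurable_EFinP; apply: measurable_sum => i.
      by apply: measurable_funM => //; apply: measurable_indic; exact: mAB.
    - move=> t _; rewrite lee_fin; have [Bt|Bt] := pselect (B t); last first.
        rewrite big1 ?mulr_ge0// => i _; rewrite indicE memNset ?mulr0//.
        by move=> [].
      apply: le_trans (_ : 8 * \sum_(i < N) g i t ^+ 2 <= _); last first.
        by rewrite ler_pM2l// (le_trans (gY t)).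
      rewrite mulr_sumr; apply: ler_sum => i _.
      have [At|At] := pselect (A i t).
        rewrite indicE mem_set//= mulr1; have : w i / 8 <= g i t ^+ 2 by []; lra.
      rewrite indicE memNset; last by case.
  by rewrite mulr0 mulr_ge0// sqr_ge0.
  by rewrite integral_probability_cst.
have lb : ((\sum_(i < N) w i / 4)%:E <= \int[P]_t (\sum_(i < N) (w i * \1_(A i `&` B) t))%:E)%E.
  under eq_integral do rewrite -sumEFin.
  rewrite ge0_integral_sum//; last 2 first.
  - by move=> i; apply/measurable_EFinP; exact: measurable_funM.
  - by move=> i t _; rewrite lee_fin mulr_ge0// indicE.
  rewrite -sumEFin; apply: lee_sum => i _.
  under eq_integral do rewrite EFinM.
  rewrite ge0_integralZl//; last 2 first.
  - by apply/measurable_EFinP.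
  - by rewrite lee_fin.
  rewrite integral_indic ?setIT//.
  by rewrite EFinM; apply: lee_wpmul2l; [rewrite lee_fin; exact: w0|exact: PAB].
have := le_trans lb ub; rewrite lee_fin -mulr_suml; lra.
Qed.

End GaussianSquares.

(** * Square integrable random elements *)

Section SquareIntegrable.
Variables (R : realType) (k : RorC) (V : ipSpace R k).
Hypotheses (hV : hilbert V) (sV : separable V).
Variables (d : measure_display) (Omega : measurableType d) (P : {measure set Omega -> \bar R}).
Implicit Types xi eta : Omega -> V.

Definition sqint xi := wmeas xi /\ (L2sq P xi < +oo)%E.

Definition cov xi eta : R := Rintegral P setT (fun w => rip (xi w) (eta w)).

Lemma sqint_sqnrm xi : sqint xi -> P.-integrable setT (EFin \o (fun w => sqnrm (xi w))).
Proof.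
move=> [mx fx]; apply/integrableP; split; first exact: emeasurable_sqnrm.
by under eq_integral do rewrite /= ger0_norm ?sqnrm_ge0//.
Qed.

Lemma rip_le_sqnrm (x y : V) : `|rip x y| <= sqnrm x + sqnrm y.
Proof.
have := sqnrm_ge0 hV (x + y); have := sqnrm_ge0 hV (x - y).
have := sqnrm_ge0 hV x; have := sqnrm_ge0 hV y.
rewrite sqnrmB// (sqnrmD hV x y) ler_norml; lra.
Qed.

Lemma sqint_rip xi eta : sqint xi -> sqint eta ->
  P.-integrable setT (EFin \o (fun w => rip (xi w) (eta w))).
Proof.
move=> hx he; have := integrableD measurableT (sqint_sqnrm hx) (sqint_sqnrm he).
apply: le_integrable => //.
  by apply/measurable_EFinP; apply: measurable_rip => //; [exact: hx.1|exact: he.1].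
move=> w _ /=; rewrite lee_fin [leRHS]ger0_norm ?addr_ge0 ?sqnrm_ge0//.
exact: rip_le_sqnrm.
Qed.

Lemma sqintD xi eta : sqint xi -> sqint eta -> sqint (fun w => xi w + eta w).
Proof.
move=> [mx fx] [me fe]; split; first exact: wmeasD.
apply: le_lt_trans (L2sqD_le hV sV _ mx me) _.
by rewrite lte_add_pinfty// lte_mul_pinfty.
Qed.

Lemma sqintN xi : sqint xi -> sqint (fun w => - xi w).
Proof. by move=> [mx fx]; split; [exact: wmeasN|rewrite L2sqN]. Qed.

Lemma sqintB xi eta : sqint xi -> sqint eta -> sqint (fun w => xi w - eta w).
Proof. by move=> hx /sqintN; exact: sqintD. Qed.

Lemma sqint0 : sqint (fun=> 0).
Proof.
split; first exact: wmeas_cst.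
by rewrite /L2sq; under eq_integral do rewrite sqnrm0//; rewrite integral0.
Qed.

Lemma sqint_sum (I : Type) (s : seq I) (F : I -> Omega -> V) :
  (forall i, sqint (F i)) -> sqint (fun w => \sum_(i <- s) F i w).
Proof.
move=> h; elim: s => [|i s ih].
  rewrite (_ : (fun w => _) = fun=> 0); first exact: sqint0.
  by apply/funext => w; rewrite big_nil.
rewrite (_ : (fun w => _) = fun w => F i w + \sum_(j <- s) F j w).
  exact: sqintD.
by apply/funext => w; rewrite big_cons.
Qed.

Lemma L2sq_cov xi : sqint xi -> L2sq P xi = (cov xi xi)%:E.
Proof.
move=> hx; rewrite /cov /Rintegral fineK//.
exact: integrable_fin_num (sqint_sqnrm hx).
Qed.

Lemma cov_self_ge0 xi : 0 <= cov xi xi.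
Proof. by apply: Rintegral_ge0 => w _; exact: sqnrm_ge0. Qed.

Lemma covC xi eta : cov xi eta = cov eta xi.
Proof. by apply: eq_Rintegral => w _; rewrite ripC. Qed.

Lemma covDl xi eta chi : sqint xi -> sqint eta -> sqint chi ->
  cov (fun w => xi w + eta w) chi = cov xi chi + cov eta chi.
Proof.
move=> hx he hc; rewrite /cov -RintegralD//; try exact: sqint_rip.
by apply: eq_Rintegral => w _; rewrite ripDl.
Qed.

Lemma covDr xi eta chi : sqint xi -> sqint eta -> sqint chi ->
  cov chi (fun w => xi w + eta w) = cov chi xi + cov chi eta.
Proof. by move=> hx he hc; rewrite covC covDl// !(covC chi). Qed.

Lemma covBl xi eta chi : sqint xi -> sqint eta -> sqint chi ->
  cov (fun w => xi w - eta w) chi = cov xi chi - cov eta chi.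
Proof.
move=> hx he hc; rewrite /cov -RintegralB//; try exact: sqint_rip.
by apply: eq_Rintegral => w _; rewrite ripBl.
Qed.

Lemma covBr xi eta chi : sqint xi -> sqint eta -> sqint chi ->
  cov chi (fun w => xi w - eta w) = cov chi xi - cov chi eta.
Proof. by move=> hx he hc; rewrite covC covBl// !(covC chi). Qed.

Lemma cov_suml (I : Type) (s : seq I) (F : I -> Omega -> V) chi :
  (forall i, sqint (F i)) -> sqint chi ->
  cov (fun w => \sum_(i <- s) F i w) chi = \sum_(i <- s) cov (F i) chi.
Proof.
move=> h hc; rewrite /cov -Rintegral_bigsum; last by move=> i; exact: sqint_rip.
by apply: eq_Rintegral => w _; rewrite rip_suml.
Qed.

Lemma cov_sumr (I : Type) (s : seq I) (F : I -> Omega -> V) chi :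
  (forall i, sqint (F i)) -> sqint chi ->
  cov chi (fun w => \sum_(i <- s) F i w) = \sum_(i <- s) cov chi (F i).
Proof.
by move=> h hc; rewrite covC cov_suml//; apply: eq_bigr => i _; rewrite covC.
Qed.

Lemma cov_sqD xi eta : sqint xi -> sqint eta ->
  cov (fun w => xi w + eta w) (fun w => xi w + eta w) =
  cov xi xi + 2 * cov xi eta + cov eta eta.
Proof.
move=> hx he; rewrite covDl//; last exact: sqintD.
by rewrite !covDr// (covC eta xi); ring.
Qed.

Lemma measurable_abs2 xi e : wmeas xi -> measurable_fun setT (fun w => abs2 (ip (xi w) e)).
Proof.
move=> mx; rewrite (_ : (fun w => _) =
    fun w => rip (xi w) e ^+ 2 + rip (xi w) (iK *: e) ^+ 2).
  by apply: measurable_funD; apply: measurable_funX; exact: mx.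
by apply/funext => w; rewrite /abs2 imK_ip.
Qed.

Lemma L2sq_parseval (D : set nat) (e : nat -> V) xi : orthonormal_basis D e -> wmeas xi ->
  L2sq P xi = (\sum_(i <oo | `[< D i >]) \int[P]_w (abs2 (ip (xi w) (e i)))%:E)%E.
Proof.
move=> onb mx; rewrite /L2sq.
under eq_integral do rewrite -(parseval_series hV onb) eseries_mkcond.
rewrite integral_nneseries//; last 2 first.
- move=> i; case: `[< D i >]; last exact: measurable_cst.
  by apply/measurable_EFinP; exact: measurable_abs2.
- by move=> i w _; case: ifP => // _; rewrite lee_fin abs2_ge0.
rewrite [RHS]eseries_mkcond; apply: eq_eseriesr => i _.
by case: ifP => // _; rewrite integral0.
Qed.

End SquareIntegrable.

Lemma sqint_bounded_linear (R : realType) (k : RorC) (V W : ipSpace R k) (f : V -> W)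
    d (Omega : measurableType d) (P : {measure set Omega -> \bar R}) (xi : Omega -> V) :
  hilbert V -> separable V -> hilbert W -> separable W -> bounded_linear f ->
  sqint P xi -> sqint P (fun w => f (xi w)).
Proof.
move=> hV sV hW sW fb [mx fx]; split; first exact: wmeas_bounded_linear.
have [M M0 hM] := bounded_linear_sqnrm hV hW fb.
apply: (@le_lt_trans _ _ (M%:E * L2sq P xi)%E).
  rewrite /L2sq -ge0_integralZl//.
  - apply: ge0_le_integral => //.
    + by move=> w _; rewrite lee_fin sqnrm_ge0.
    + by apply: emeasurable_sqnrm => //; exact: wmeas_bounded_linear.
    + by apply: measurable_funeM; exact: emeasurable_sqnrm.
    + by move=> w _; rewrite -EFinM lee_fin.
  - exact: emeasurable_sqnrm.
  - by move=> w _; rewrite lee_fin sqnrm_ge0.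
  - by rewrite lee_fin ltW.
by rewrite lte_mul_pinfty// ?lee_fin ?ltW.
Qed.

(** Independence of increments is stated for Borel sets of the Hilbert space; this brings it to the
    real projections. *)
Lemma borel_rip_preimage (R : realType) (k : RorC) (V : ipSpace R k) (z : V) (B : set R) :
  hilbert V -> measurable B -> borel ((fun x : V => rip x z) @^-1` B).
Proof.
move=> hV mB.
suff : <<s @RGenOInfty.G R >> `<=` [set B : set R | borel ((fun x : V => rip x z) @^-1` B)].
  apply; change (measurable (B : set (g_sigma_algebraType (@RGenOInfty.G R)))).
  by rewrite -RGenOInfty.measurableE.
apply: smallest_sub => [|_ [a ->]/=].
  split => /=.
  - by rewrite preimage_set0; exact: sigma_algebra0.
  - by move=> A mA; rewrite setTD preimage_setC -setTD; exact: sigma_algebraCD.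
  - by move=> A mA; rewrite preimage_bigcup; exact: sigma_algebra_bigcup.
apply: sub_sigma_algebra => x /=; rewrite in_itv/= andbT => ax.
have z1 : 0 < nrm z + 1 by rewrite ltr_pwDr ?nrm_ge0.
exists ((rip x z - a) / (nrm z + 1)); first by rewrite divr_gt0// subr_gt0.
move=> y; rewrite in_itv/= andbT ltr_pdivlMr// => hy.
have := cauchy_schwarz hV (y - x) z; rewrite ripBl// ler_norml => /andP[+ _].
have := nrm_ge0 (y - x); have := nrm_ge0 z; move: hy; nra.
Qed.

(** * Centered Gaussian random elements and their covariance *)

Section CenteredGaussian.
Variables (R : realType) (k : RorC) (Z : ipSpace R k).
Hypotheses (hZ : hilbert Z) (sZ : separable Z).
Variables (d : measure_display) (Omega : measurableType d) (P : probability Omega R).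

Lemma reK_intK (T : measurableType d) (mu : {measure set T -> \bar R}) (D : set T)
  (f : T -> scal R k) : reK (intK mu D f) = Rintegral mu D (fun x => reK (f x)).
Proof. by move: f; rewrite /intK /reK; case: k. Qed.

Lemma imK_intK (T : measurableType d) (mu : {measure set T -> \bar R}) (D : set T)
  (f : T -> scal R k) : imK (intK mu D f) = Rintegral mu D (fun x => imK (f x)).
Proof.
by move: f; rewrite /intK /imK; case: k => //= f; rewrite /Rintegral integral0.
Qed.

Variables (S : Z -> Z) (xi : Omega -> Z).
Hypothesis gx : centered_gaussian P S xi.

Lemma centered_gaussian_wmeas : wmeas xi.
Proof. by apply/(wmeas_borel hZ sZ); case: gx. Qed.

Lemma centered_gaussian_rip z :
  [/\ measurable_fun setT (fun w => rip (xi w) z),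
      (\int[P]_w (rip (xi w) z ^+ 2)%:E < +oo)%E &
      Rintegral P setT (fun w => rip (xi w) z) = 0].
Proof.
have [_ /(_ z) [s gs] _] := gx; split.
- exact: gs.1.
- by apply: le_lt_trans (gaussian_moment_le gs) _; rewrite ltry.
- exact: (gaussian_mean gs).
Qed.

(** The covariance identity is about real integrals, where an infinite value would read as 0;
    finiteness of the second moments makes it an identity of extended reals. *)
Lemma centered_gaussian_abs2 z :
  (\int[P]_w (abs2 (ip (xi w) z))%:E = (reK (ip (S z) z))%:E)%E.
Proof.
have [_ _ /(_ z z)] := gx => /(congr1 (@reK R k)); rewrite reK_intK => <-.
have -> : (fun w => reK (ip (xi w) z * conjK (ip (xi w) z))) = fun w => abs2 (ip (xi w) z).
  by apply/funext => w; rewrite mulK_conj reK_ofR.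
rewrite /Rintegral fineK// ge0_fin_numE; last first.
  by apply: integral_ge0 => w _; rewrite lee_fin abs2_ge0.
have [m1 f1 _] := centered_gaussian_rip z.
have [m2 f2 _] := centered_gaussian_rip (iK *: z).
have -> : (\int[P]_w (abs2 (ip (xi w) z))%:E = \int[P]_w (rip (xi w) z ^+ 2)%:E +
    \int[P]_w (rip (xi w) (iK *: z) ^+ 2)%:E)%E.
  rewrite -ge0_integralD//.
  - by apply: eq_integral => w _; rewrite /abs2 imK_ip// EFinD.
  - by move=> w _; rewrite lee_fin sqr_ge0.
  - by apply/measurable_EFinP; exact: measurable_funX.
  - by move=> w _; rewrite lee_fin sqr_ge0.
  - by apply/measurable_EFinP; exact: measurable_funX.
by rewrite lte_add_pinfty.
Qed.

(** Parseval's identity for [G (xi w)]: its coefficient along [e i] is that of [xi w] along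
    [adjoint G (e i)]. *)
Lemma centered_gaussian_trace (V : ipSpace R k) (G : Z -> V) (D : set nat) (e : nat -> V) :
  hilbert V -> separable V -> bounded_linear G -> orthonormal_basis D e ->
  L2sq P (fun w => G (xi w)) =
  (\sum_(i <oo | `[< D i >]) (reK (ip (G (S (adjoint G (e i)))) (e i)))%:E)%E.
Proof.
move=> hV sV Gb onb.
rewrite (L2sq_parseval hV P onb); last first.
  exact: wmeas_bounded_linear centered_gaussian_wmeas.
apply: eq_eseriesr => i _.
under eq_integral do rewrite (adjointP hZ hV Gb).
by rewrite centered_gaussian_abs2 (adjointP hZ hV Gb).
Qed.

End CenteredGaussian.

(** * Wiener increments and the isometry for step functions *)

Section WienerIsometry.
Variables (R : realType) (k : RorC) (Z : ipSpace R k).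
Hypotheses (hZ : hilbert Z) (sZ : separable Z).
Variables (d : measure_display) (Omega : measurableType d) (P : probability Omega R).
Variables (F : R -> set_system Omega) (Q : Z -> Z) (w : R -> Omega -> Z).
Hypotheses (uF : usual_filtration P F) (cQ : covariance_operator Q).
Hypothesis wW : wiener_process P F Q w.
Local Notation mu := (@lebesgue_measure R).

Definition incr (s t : R) : Omega -> Z := fun o => w t o - w s o.

Definition unit_incr : Omega -> Z := incr 0 1.

Lemma unit_incr_gaussian : centered_gaussian P Q unit_incr.
Proof.
have := wiener_gaussian wW (lexx 0) ler01; congr (centered_gaussian P _ _).
by apply/funext => z; rewrite subr0 ofR1 scale1r.
Qed.

Lemma separable_onb (V : ipSpace R k) : hilbert V -> separable V ->
  exists De : set nat * (nat -> V), orthonormal_basis De.1 De.2.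
Proof.
move=> hV sV; have [v tv] := separable_total hV sV.
by exists ([set n | gram_schmidt v n != 0], gram_schmidt v); exact: gram_schmidt_onb.
Qed.

Section Target.
Variables (V : ipSpace R k).
Hypotheses (hV : hilbert V) (sV : separable V).
Implicit Types G : Z -> V.

Lemma cov_op_ge0 G (e : V) : bounded_linear G ->
  0 <= reK (ip (G (Q (adjoint G e))) e).
Proof. by move=> Gb; rewrite (adjointP hZ hV Gb); exact: (Defs.cov_ge0 cQ). Qed.

(* The trace does not depend on the basis because it is a second moment. *)
Lemma L20_sqnrmE G : bounded_linear G ->
  L20_sqnrm Q G = L2sq P (fun o => G (unit_incr o)).
Proof.
move=> Gb; rewrite /L20_sqnrm /trace.
have [De0 onb0] := separable_onb hV sV.
have e De : orthonormal_basis De.1 De.2 ->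
    (\esum_(i in De.1) (reK (ip (G (Q (adjoint G (De.2 i)))) (De.2 i)))%:E)%E =
    L2sq P (fun o => G (unit_incr o)).
  move=> onb; rewrite (centered_gaussian_trace hZ sZ unit_incr_gaussian hV sV Gb onb).
  rewrite nneseries_esum; last by move=> i _; rewrite lee_fin cov_op_ge0.
  by congr esum; apply/seteqP; split=> i /= /asboolP.
rewrite (_ : [set _ | De in _] = [set L2sq P (fun o => G (unit_incr o))]).
  by rewrite ereal_sup1.
apply/seteqP; split=> x /=.
  by move=> [De onb <-]; rewrite e.
by move=> ->; exists De0 => //; rewrite e.
Qed.

Lemma incr_scaling G (s t : R) : 0 <= s -> s <= t -> bounded_linear G ->
  L2sq P (fun o => G (incr s t o)) = ((t - s)%:E * L2sq P (fun o => G (unit_incr o)))%E.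
Proof.
move=> s0 st Gb; have [De onb] := separable_onb hV sV.
rewrite (centered_gaussian_trace hZ sZ unit_incr_gaussian hV sV Gb onb).
rewrite (centered_gaussian_trace hZ sZ (wiener_gaussian wW s0 st) hV sV Gb onb).
rewrite -nneseriesZl//; last by move=> i _; rewrite lee_fin cov_op_ge0.
apply: eq_eseriesr => i _; rewrite (bounded_linear_Z _ _ Gb) ipZl// reKM reK_ofR imK_ofR.
by rewrite mul0r subr0 EFinM.
Qed.

End Target.

(** [L20_sqnrmE] for the identity operator equates the second moment with the trace of [Q]. *)
Lemma unit_incr_sqint : sqint P unit_incr.
Proof.
split; first exact: centered_gaussian_wmeas unit_incr_gaussian.
have := L20_sqnrmE hZ sZ (bounded_linear_id Z); rewrite /= => <-.
apply: le_lt_trans (cov_trace cQ); rewrite /L20_sqnrm.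
rewrite (_ : (fun x => Q _) = Q)//; apply/funext => x; congr Q.
apply: (rip_inj hZ) => z; rewrite ripC// -(rip_adjoint hZ hZ)//; last exact: bounded_linear_id.
by rewrite ripC.
Qed.

Lemma incr_sqint s t : 0 <= s -> s <= t -> sqint P (incr s t).
Proof.
move=> s0 st; split; first exact: centered_gaussian_wmeas (wiener_gaussian wW s0 st).
rewrite (incr_scaling hZ sZ s0 st (bounded_linear_id Z)).
by rewrite lte_mul_pinfty ?lee_fin ?subr_ge0// unit_incr_sqint.2.
Qed.

Section Isometry.
Variables (V : ipSpace R k).
Hypotheses (hV : hilbert V) (sV : separable V).
Implicit Types G : Z -> V.

Lemma incr_op_sqint G s t : bounded_linear G -> 0 <= s -> s <= t ->
  sqint P (fun o => G (incr s t o)).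
Proof. by move=> Gb s0 st; apply: sqint_bounded_linear => //; exact: incr_sqint. Qed.

Lemma wiener_rip_F s z A : 0 <= s -> measurable A ->
  F s ((fun o => rip (incr 0 s o) z) @^-1` A).
Proof.
move=> s0 mA.
have sF := filtration_sigma uF s0.
pose T := g_sigma_algebraType (F s).
have mW r : 0 <= r -> r <= s -> @wmeas R k Z _ T (w r).
  move=> r0 rs; apply/(wmeas_borel hZ sZ) => U bU.
  apply: sub_sigma_algebra; apply: (filtration_mono uF r0 rs).
  by apply: (wiener_adapted wW) => //=; rewrite in_itv/= r0.
have := wmeasB hZ (mW s s0 (lexx s)) (mW 0 (lexx 0) s0) z.
move=> /(_ measurableT A mA); rewrite setTI.
have := sigma_algebra_id sF => e; rewrite /measurable/= e.
exact.
Qed.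

(** The first factor is measurable for [F s], the second is independent of [F s] and has mean 0. *)
Lemma incr_uncorrelated s t (z z' : Z) : 0 <= s -> s <= t ->
  Rintegral P setT (fun o => rip (incr 0 s o) z * rip (incr s t o) z') = 0.
Proof.
move=> s0 st.
have [m1 f1 _] := centered_gaussian_rip (wiener_gaussian wW (lexx 0) s0) z.
have [m2 f2 i2] := centered_gaussian_rip (wiener_gaussian wW s0 st) z'.
have sq (f : Omega -> R) : measurable_fun setT f -> (\int[P]_o (f o ^+ 2)%:E < +oo)%E ->
    P.-integrable setT (EFin \o (fun o => f o ^+ 2)).
  move=> mf ff; apply/integrableP; split.
    by apply/measurable_EFinP; exact: measurable_funX.
  by under eq_integral do rewrite /= ger0_norm ?sqr_ge0//.
have i1 := sq _ m1 f1; have i3 := sq _ m2 f2.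
apply: independent_integral0 => //.
- move=> A B mA mB.
  have FA := wiener_rip_F z s0 mA.
  pose U : set Z := (fun x => rip x z') @^-1` B.
  have bU : borel U.
    exact: borel_rip_preimage.
  exact: (wiener_independent wW s0 st FA bU).
- have h1 : P.-integrable setT (cst (1%:E : \bar R)).
    exact: finite_measure_integrable_cst.
  have := integrableD measurableT i3 h1; apply: le_integrable => //.
    exact/measurable_EFinP.
  move=> o _ /=; rewrite lee_fin [leRHS]ger0_norm ?addr_ge0 ?sqr_ge0//.
  move: (rip _ _) => x; rewrite ler_norml; apply/andP; split; nra.
- have := integrableD measurableT i1 i3; apply: le_integrable => //.
    by apply/measurable_EFinP; exact: measurable_funM.
  move=> o _ /=; rewrite lee_fin [leRHS]ger0_norm ?addr_ge0 ?sqr_ge0//.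
  move: (rip _ _) (rip _ _) => x y; rewrite ler_norml; apply/andP; split.
    by have := sqr_ge0 (x + y); nra.
  by have := sqr_ge0 (x - y); nra.
Qed.


Lemma integral_sqrD (f g : Omega -> R) :
  measurable_fun setT f -> measurable_fun setT g ->
  (\int[P]_o (f o ^+ 2)%:E < +oo)%E -> (\int[P]_o (g o ^+ 2)%:E < +oo)%E ->
  Rintegral P setT (fun o => f o * g o) = 0 ->
  (\int[P]_o ((f o + g o) ^+ 2)%:E = \int[P]_o (f o ^+ 2)%:E + \int[P]_o (g o ^+ 2)%:E)%E.
Proof.
move=> mf mg ff fg fg0.
have sq (h : Omega -> R) : measurable_fun setT h -> (\int[P]_o (h o ^+ 2)%:E < +oo)%E ->
    P.-integrable setT (EFin \o (fun o => h o ^+ 2)).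
  move=> mh fh; apply/integrableP; split.
    by apply/measurable_EFinP; exact: measurable_funX.
  by under eq_integral do rewrite /= ger0_norm ?sqr_ge0//.
have i1 := sq _ mf ff; have i2 := sq _ mg fg.
have i3 : P.-integrable setT (EFin \o (fun o => f o * g o)).
  have := integrableD measurableT i1 i2; apply: le_integrable => //.
    by apply/measurable_EFinP; exact: measurable_funM.
  move=> o _ /=; rewrite lee_fin [leRHS]ger0_norm ?addr_ge0 ?sqr_ge0//.
  move: (f o) (g o) => x y; rewrite ler_norml; apply/andP; split.
    by have := sqr_ge0 (x + y); nra.
  by have := sqr_ge0 (x - y); nra.
have e3 : (\int[P]_o (f o * g o)%:E = 0)%E.
  by rewrite -[LHS]fineK ?(integrable_fin_num _ i3)//; congr EFin.
rewrite (_ : (\int[P]_o ((f o + g o) ^+ 2)%:E =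
    \int[P]_o (((f o ^+ 2)%:E + (g o ^+ 2)%:E) + 2%:E * (f o * g o)%:E))%E); last first.
  by apply: eq_integral => o _; rewrite -EFinM -!EFinD; congr EFin; ring.
rewrite integralD//; last 2 first.
- exact: integrableD.
- exact: integrableZl.
by rewrite integralZl// e3 mule0 adde0 integralD.
Qed.

(** Orthogonality is read off Pythagoras' identity. Along a basis this is an equality of series of
    nonnegative terms, so that no signed series is exchanged with an integral, and on each
    coordinate it is [incr_uncorrelated] for adjoint vectors. *)
Lemma incr_orthogonal G G' s t : bounded_linear G -> bounded_linear G' -> 0 <= s -> s <= t ->
  cov P (fun o => G (incr 0 s o)) (fun o => G' (incr s t o)) = 0.
Proof.
move=> Gb Gb' s0 st.
have hx := incr_op_sqint Gb (lexx 0) s0; have he := incr_op_sqint Gb' s0 st.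
have [De onb] := separable_onb hV sV.
suff : L2sq P (fun o => G (incr 0 s o) + G' (incr s t o)) =
    (L2sq P (fun o => G (incr 0 s o)) + L2sq P (fun o => G' (incr s t o)))%E.
  rewrite !L2sq_cov//; last exact: sqintD.
  by rewrite cov_sqD// => -[]; lra.
rewrite (L2sq_parseval hV P onb hx.1) (L2sq_parseval hV P onb he.1).
rewrite (L2sq_parseval hV P onb); last exact: wmeasD hx.1 he.1.
rewrite -nneseriesD; last 2 first.
- by move=> i _ _; apply: integral_ge0 => o _; rewrite lee_fin abs2_ge0.
- by move=> i _ _; apply: integral_ge0 => o _; rewrite lee_fin abs2_ge0.
apply: eq_eseriesr => i _; set e := De.2 i.
have abs2E (xi : Omega -> V) : wmeas xi -> (\int[P]_o (abs2 (ip (xi o) e))%:E =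
    \int[P]_o (rip (xi o) e ^+ 2)%:E + \int[P]_o (rip (xi o) (iK *: e) ^+ 2)%:E)%E.
  move=> mx; rewrite -ge0_integralD//.
  - by apply: eq_integral => o _; rewrite /abs2 imK_ip// EFinD.
  - by move=> o _; rewrite lee_fin sqr_ge0.
  - by apply/measurable_EFinP; apply: measurable_funX; exact: mx.
  - by move=> o _; rewrite lee_fin sqr_ge0.
  - by apply/measurable_EFinP; apply: measurable_funX; exact: mx.
have key z : (\int[P]_o (rip (G (incr 0 s o) + G' (incr s t o)) z ^+ 2)%:E =
    \int[P]_o (rip (G (incr 0 s o)) z ^+ 2)%:E +
    \int[P]_o (rip (G' (incr s t o)) z ^+ 2)%:E)%E.
  under eq_integral do rewrite ripDl//.
  have gs := centered_gaussian_rip (wiener_gaussian wW (lexx 0) s0) (adjoint G z).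
  have gt := centered_gaussian_rip (wiener_gaussian wW s0 st) (adjoint G' z).
  apply: integral_sqrD.
  - exact: hx.1.
  - exact: he.1.
  - by case: gs => _ + _; under eq_integral do rewrite -(rip_adjoint hZ hV)//.
  - by case: gt => _ + _; under eq_integral do rewrite -(rip_adjoint hZ hV)//.
  apply: etrans (incr_uncorrelated (adjoint G z) (adjoint G' z) s0 st).
  by apply: eq_Rintegral => o _; rewrite -!(rip_adjoint hZ hV).
rewrite !abs2E//; [|exact: he.1|exact: hx.1|exact: wmeasD hx.1 he.1].
by rewrite !key addeACA.
Qed.

(** The longer increment is cut at [s] and its second piece is orthogonal to the first factor. The
    remaining covariance follows by polarisation from the scaling of second moments, applied to [G],
    [G'] and their sum. *)
Lemma incr0_cov G G' s t : bounded_linear G -> bounded_linear G' -> 0 <= s -> 0 <= t ->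
  cov P (fun o => G (incr 0 s o)) (fun o => G' (incr 0 t o)) =
  Num.min s t * cov P (fun o => G (unit_incr o)) (fun o => G' (unit_incr o)).
Proof.
wlog st : s t G G' / s <= t => [hw|] Gb Gb' s0 t0.
  have [st|/ltW ts] := leP s t; first by rewrite hw// min_l.
  by rewrite covC// hw// min_l// (covC hV).
rewrite min_l//.
have uS G0 : bounded_linear G0 -> sqint P (fun o => G0 (unit_incr o)).
  by move=> b; exact: incr_op_sqint.
have bS G0 : bounded_linear G0 -> sqint P (fun o => G0 (incr 0 s o)).
  by move=> b; exact: incr_op_sqint.
have iS := incr_op_sqint Gb' s0 st.
have -> : (fun o => G' (incr 0 t o)) = fun o => G' (incr 0 s o) + G' (incr s t o).
  by apply/funext => o; rewrite -bounded_linear_D//; congr G'; rewrite /incr [RHS]addrC addrA subrK.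
rewrite covDr//; [|exact: bS|exact: bS].
rewrite incr_orthogonal// addr0.
have sc G0 : bounded_linear G0 -> cov P (fun o => G0 (incr 0 s o)) (fun o => G0 (incr 0 s o)) =
    s * cov P (fun o => G0 (unit_incr o)) (fun o => G0 (unit_incr o)).
  move=> b0; have := incr_scaling hV sV (lexx 0) s0 b0.
  by rewrite subr0 (L2sq_cov hV sV (bS _ b0)) (L2sq_cov hV sV (uS _ b0)) -EFinM => -[].
have := sc _ (bounded_linear_add hV Gb Gb'); rewrite /= cov_sqD//; [|exact: bS|exact: bS].
rewrite cov_sqD//; [|exact: uS|exact: uS].
rewrite !sc//; set A := cov P _ _; set B := cov P _ _; set C := cov P _ _; set D := cov P _ _; nra.
Qed.

(** The combination of minima is the length of the overlap of the two intervals, as [overlap_indic]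
    shows. *)
Lemma incr_cov G G' a b c e : bounded_linear G -> bounded_linear G' ->
  0 <= a -> a <= b -> 0 <= c -> c <= e ->
  cov P (fun o => G (incr a b o)) (fun o => G' (incr c e o)) =
  (Num.min b e - Num.min b c - Num.min a e + Num.min a c) *
    cov P (fun o => G (unit_incr o)) (fun o => G' (unit_incr o)).
Proof.
move=> Gb Gb' a0 ab c0 ce; have b0 := le_trans a0 ab; have e0 := le_trans c0 ce.
have iE (G0 : Z -> V) x y : bounded_linear G0 -> (fun o => G0 (incr x y o)) =
    (fun o => G0 (incr 0 y o) - G0 (incr 0 x o)).
  move=> b1; apply/funext => o; rewrite -bounded_linear_B//; congr G0.
  by rewrite /incr opprB addrA subrK.
have bS G0 r : bounded_linear G0 -> 0 <= r -> sqint P (fun o => G0 (incr 0 r o)).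
  by move=> b1 r0; exact: incr_op_sqint.
rewrite (iE _ a b)// (iE _ c e)//.
rewrite covBl//; [|exact: bS|exact: bS|by apply: sqintB => //; exact: bS].
do 2 (rewrite covBr//; [|exact: bS|exact: bS|exact: bS]).
rewrite (incr0_cov Gb Gb' b0 e0) (incr0_cov Gb Gb' b0 c0).
rewrite (incr0_cov Gb Gb' a0 e0) (incr0_cov Gb Gb' a0 c0).
move: (cov P _ _) (Num.min b e) (Num.min b c) (Num.min a e) (Num.min a c) => x1 x2 x3 x4 x5.
ring.
Qed.

Lemma overlap_indic (t a b c e : R) : 0 <= a -> a <= b -> b <= t -> 0 <= c -> c <= e -> e <= t ->
  Rintegral mu setT (fun s => \1_(`[0, t]) s * (\1_(`]a, b]) s * \1_(`]c, e]) s)) =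
  Num.min b e - Num.min b c - Num.min a e + Num.min a c.
Proof.
move=> a0 ab bt c0 ce et.
rewrite (_ : (fun s => _) = \1_(`]Num.max a c, Num.min b e]) :> (R -> R)); last first.
  apply/funext => s; rewrite !indicE -!natrM !mulnb; congr ((nat_of_bool _)%:R).
  apply/idP/idP => [/and3P[]|]; rewrite !inE/= !in_itv/= gt_max le_min.
    by move=> _ /andP[-> ->] /andP[-> ->].
  move=> /andP[/andP[h1 h2] /andP[h3 h4]].
  apply/and3P; split; rewrite inE/= in_itv/= ?h1 ?h2//.
  by rewrite (le_trans a0 (ltW h1)) (le_trans h3 bt).
rewrite Rintegral_indic//.
have := @lebesgue_measure_itv R `]Num.max a c, Num.min b e]; rewrite /= lte_fin => ->.
case: ifPn => /=; rewrite ?lt_max ?gt_min /Num.min /Num.max/=; repeat case: ifPn; lra.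
Qed.

(** Both sides expand into the same double sum of overlap lengths times covariances of unit
    increments. The intervals may overlap and the index set is any finite type, so that differences
    of step functions need no common refinement. *)
Lemma finite_isometry (I : finType) (lo hi : I -> R) (op : I -> Z -> V) (t : R) :
  (forall i, [/\ 0 <= lo i, lo i <= hi i & hi i <= t]) ->
  (forall i, bounded_linear (op i)) ->
  L2sq P (fun o => \sum_i op i (w (hi i) o - w (lo i) o)) =
  (\int[mu]_(s in `[0%R, t]) L2sq P (fun o =>
     \sum_i ofR k (\1_(`]lo i, hi i]) s) *: op i (unit_incr o))%R)%E.
Proof.
move=> hb hop.
have uS i : sqint P (fun o => op i (unit_incr o)) by apply: incr_op_sqint.
have iS i : sqint P (fun o => op i (incr (lo i) (hi i) o)).
  by have [? ? _] := hb i; exact: incr_op_sqint.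
have zS (r : I -> R) i : sqint P (fun o => ofR k (r i) *: op i (unit_incr o)).
  have := incr_op_sqint (bounded_linear_scale (r i) hV (hop i)) (lexx 0) ler01.
  exact.
rewrite [LHS](L2sq_cov hV sV (sqint_sum hV sV (index_enum I) iS)).
rewrite (cov_suml hV sV (index_enum I) iS (sqint_sum hV sV (index_enum I) iS)).
pose q i j := cov P (fun o => op i (unit_incr o)) (fun o => op j (unit_incr o)).
have covZ (r : I -> R) i j : cov P (fun o => ofR k (r i) *: op i (unit_incr o))
    (fun o => ofR k (r j) *: op j (unit_incr o)) = (r i * r j) * q i j.
  rewrite /q /cov -RintegralZl//; last exact: sqint_rip.
  by apply: eq_Rintegral => o _; rewrite ripZl// ripZr// mulrA.
pose g s := \sum_i \sum_j
  (\1_(`[0, t]) s * (\1_(`]lo i, hi i]) s * \1_(`]lo j, hi j]) s)) * q i j : R.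
have -> : (\int[mu]_(s in `[0%R, t]) L2sq P (fun o =>
     \sum_i ofR k (\1_(`]lo i, hi i]) s) *: op i (unit_incr o))%R)%E =
    (\int[mu]_s (g s)%:E)%E.
  rewrite integral_mkcond; apply: eq_integral => s _; rewrite patchE.
  case: ifPn => hs; last first.
    rewrite /g big1// => i _; rewrite big1// => j _.
    by rewrite [X in X * _ * _]indicE (negbTE hs) !mul0r.
  have sS := sqint_sum hV sV (index_enum I) (zS (fun i => \1_(`]lo i, hi i]) s)).
  rewrite (L2sq_cov hV sV sS) (cov_suml hV sV (index_enum I) (zS _) sS).
  congr EFin; apply: eq_bigr => i _.
  have := cov_sumr hV sV (index_enum I) (zS (fun i => \1_(`]lo i, hi i]) s))
    (zS (fun i => \1_(`]lo i, hi i]) s) i).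
  rewrite /= => ->.
  apply: eq_bigr => j _; rewrite (covZ (fun i => \1_(`]lo i, hi i]) s)).
  by rewrite [X in _ = X * _ * _]indicE hs mul1r.
have iE i j : (fun s => \1_(`[0, t]) s * (\1_(`]lo i, hi i]) s * \1_(`]lo j, hi j]) s)) =
    \1_(`[0, t] `&` (`]lo i, hi i] `&` `]lo j, hi j])) :> (R -> R).
  by rewrite !indicI.
have mI i j : measurable (`[0, t] `&` (`]lo i, hi i] `&` `]lo j, hi j]) : set R).
  by do !apply: measurableI.
have fI i j : (mu (`[0%R, t] `&` (`]lo i, hi i] `&` `]lo j, hi j])) < +oo)%E.
  apply: (@le_lt_trans _ _ (mu `[0%R, t])).
    by apply: le_measure; [rewrite inE; exact: mI|rewrite inE|exact: subIsetl].
  by rewrite lebesgue_measure_itv/=; case: ifP => // _; rewrite -EFinB ltry.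
have ig0 i j : mu.-integrable setT (EFin \o (fun s =>
    \1_(`[0, t]) s * (\1_(`]lo i, hi i]) s * \1_(`]lo j, hi j]) s) : R)).
  rewrite iE; apply: finite_integrable_indic; [exact: mI|exact: fI].
have ig i j : mu.-integrable setT (EFin \o (fun s =>
    (\1_(`[0, t]) s * (\1_(`]lo i, hi i]) s * \1_(`]lo j, hi j]) s)) * q i j : R)).
  rewrite (_ : (fun s => _) = (fun s =>
      \1_(`[0, t] `&` (`]lo i, hi i] `&` `]lo j, hi j])) s * q i j : R)); last first.
    by apply/funext => s; rewrite -iE.
  by apply: finite_integrable_indicZ; [exact: mI|exact: fI].
have igs i : mu.-integrable setT (EFin \o (fun s => \sum_j
    (\1_(`[0, t]) s * (\1_(`]lo i, hi i]) s * \1_(`]lo j, hi j]) s)) * q i j : R)).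
  rewrite (_ : EFin \o _ = fun s => (\sum_j
    ((\1_(`[0, t]) s * (\1_(`]lo i, hi i]) s * \1_(`]lo j, hi j]) s)) * q i j)%:E)%E).
    by apply: (integrable_sum (measurableT : measurable (setT : set (measurableTypeR R)))) => j _; exact: ig.
  by apply/funext => s /=; rewrite sumEFin.
have ig' : mu.-integrable setT (EFin \o g).
  rewrite (_ : EFin \o _ = fun s => (\sum_i (\sum_j
    ((\1_(`[0, t]) s * (\1_(`]lo i, hi i]) s * \1_(`]lo j, hi j]) s)) * q i j))%:E)%E).
    by apply: (integrable_sum (measurableT : measurable (setT : set (measurableTypeR R)))) => j _; exact: igs.
  by apply/funext => s /=; rewrite sumEFin.
rewrite -[RHS]fineK; last exact: integrable_fin_num ig'.
congr EFin; rewrite -[RHS]/(Rintegral mu setT g) Rintegral_bigsum//.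
apply: eq_bigr => i _; rewrite Rintegral_bigsum//.
rewrite (cov_sumr hV sV (index_enum I) iS (iS i)); apply: eq_bigr => j _.
have [a0 ab bt] := hb i; have [c0 ce et] := hb j.
rewrite incr_cov// -(overlap_indic a0 ab bt c0 ce et).
by rewrite -RintegralZr//; exact: ig0.
Qed.

End Isometry.

End WienerIsometry.

(** * The stochastic convolution *)

Lemma L2sq_le_scale (R : realType) (k : RorC) (V W : ipSpace R k) d (T : measurableType d)
    (mu : {measure set T -> \bar R}) (c : R) (xi : T -> V) (eta : T -> W) :
  hilbert V -> separable V -> hilbert W -> separable W ->
  wmeas xi -> wmeas eta -> 0 <= c -> (forall o, nrm (xi o) <= c * nrm (eta o)) ->
  (L2sq mu xi <= (c ^+ 2)%:E * L2sq mu eta)%E.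
Proof.
move=> hV sV hW sW mx me c0 h; rewrite /L2sq -ge0_integralZl//; last 3 first.
- exact: emeasurable_sqnrm.
- by move=> o _; rewrite lee_fin sqnrm_ge0.
- by rewrite lee_fin sqr_ge0.
apply: ge0_le_integral => //.
- by move=> o _; rewrite lee_fin sqnrm_ge0.
- exact: emeasurable_sqnrm.
- by apply: measurable_funeM; exact: emeasurable_sqnrm.
- move=> o _; rewrite -EFinM lee_fin -(nrm_sqr hW) -exprMn -(nrm_sqr hV).
  by rewrite lerXn2r// nnegrE ?mulr_ge0 ?nrm_ge0.
Qed.

Lemma L2sq_zero (R : realType) (k : RorC) (V : ipSpace R k) d (T : measurableType d)
    (mu : {measure set T -> \bar R}) (xi : T -> V) : hilbert V ->
  (forall o, xi o = 0) -> L2sq mu xi = 0%E.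
Proof.
move=> hV h; rewrite /L2sq; under eq_integral do rewrite h sqnrm0//.
by rewrite integral0.
Qed.

(** Integrates the error bounds below: a small constant, plus a crude bound on a few short
    intervals. *)
Lemma integral_cst_indic (R : realType) (t c C : R) (l : seq (R * R)) :
  0 <= t -> 0 <= c -> 0 <= C -> (forall p, p \in l -> p.1 <= p.2) ->
  (\int[@lebesgue_measure R]_(s in `[0%R, t])
     (c + C * \sum_(p <- l) \1_(`[p.1, p.2]%classic) s)%:E <=
   (c * t + C * \sum_(p <- l) (p.2 - p.1))%:E)%E.
Proof.
move=> t0 c0 C0 hl.
have mS (l' : seq (R * R)) : measurable_fun (setT : set (measurableTypeR R))
    (fun s => \sum_(p <- l') \1_(`[p.1, p.2]%classic) s : R).
  by apply: measurable_sum => p; exact: measurable_indic.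
have S0 (l' : seq (R * R)) s : 0 <= \sum_(p <- l') \1_(`[p.1, p.2]%classic) s :> R.
  by apply: sumr_ge0 => p _; rewrite indicE.
under eq_integral do rewrite EFinD EFinM.
rewrite ge0_integralD//=; last 2 first.
- by move=> s _; rewrite -EFinM lee_fin mulr_ge0.
- apply: measurable_funTS; apply: measurable_funeM; apply/measurable_EFinP; exact: mS.
rewrite integral_cst//= lebesgue_measure_itv/= EFinD; apply: leeD.
  case: ifP => _; last by rewrite mule0 lee_fin mulr_ge0.
  by rewrite -EFinB subr0 EFinM.
rewrite ge0_integralZl//; last 2 first.
- apply: measurable_funTS; apply/measurable_EFinP; exact: mS.
- by move=> s _; rewrite lee_fin.
rewrite EFinM; apply: lee_wpmul2l; first by rewrite lee_fin.
apply: (@le_trans _ _ (\int[@lebesgue_measure R]_s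
     (\sum_(p <- l) \1_(`[p.1, p.2]%classic) s)%:E)%E).
  apply: ge0_subset_integral => //.
  - by apply/measurable_EFinP; exact: mS.
  - by move=> s _; rewrite lee_fin.
elim: l hl => [|p l ih] hl.
  by rewrite big_nil; under eq_integral do rewrite big_nil; rewrite integral0.
rewrite big_cons EFinD; under eq_integral do rewrite big_cons EFinD.
rewrite ge0_integralD//; last 3 first.
- by apply/measurable_EFinP; exact: measurable_indic.
- by move=> s _; rewrite lee_fin.
- by apply/measurable_EFinP; exact: mS.
apply: leeD; last by apply: ih => q ql; apply: hl; rewrite inE ql orbT.
have hp : p.1 <= p.2 by apply: hl; rewrite mem_head.
rewrite integral_indic//= setIT lebesgue_measure_itv/=; case: ifP => _ //.
by rewrite lee_fin subr_ge0.
Qed.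

(** * Riemann sums of the stochastic convolution *)

Section StochasticConvolution.
Variables (R : realType) (k : RorC) (Z X : ipSpace R k).
Hypotheses (hZ : hilbert Z) (sZ : separable Z) (hX : hilbert X) (sX : separable X).
Variables (d : measure_display) (Omega : measurableType d) (P : probability Omega R).
Variables (F : R -> set_system Omega) (Q : Z -> Z) (w : R -> Omega -> Z).
Hypotheses (uF : usual_filtration P F) (cQ : covariance_operator Q).
Hypothesis wW : wiener_process P F Q w.
Local Notation mu := (@lebesgue_measure R).
Local Notation U := (unit_incr w).

(** The difference of the two sums is again a sum of operators applied to increments, indexed by the
    disjoint union, so that the isometry applies to it directly. *)
Lemma family_dist (I J : finType) (lo hi : I -> R) (op : I -> Z -> X)
    (lo' hi' : J -> R) (op' : J -> Z -> X) (t : R) (G : R -> \bar R) :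
  (forall i, [/\ 0 <= lo i, lo i <= hi i & hi i <= t]) -> (forall i, bounded_linear (op i)) ->
  (forall j, [/\ 0 <= lo' j, lo' j <= hi' j & hi' j <= t]) ->
  (forall j, bounded_linear (op' j)) ->
  measurable_fun (setT : set (measurableTypeR R)) G ->
  (forall s, 0 <= s -> s <= t -> (L2sq P (fun o =>
     \sum_i ofR k (\1_(`]lo i, hi i]) s) *: op i (U o) -
     \sum_j ofR k (\1_(`]lo' j, hi' j]) s) *: op' j (U o))%R <= G s)%E) ->
  (L2sq P (fun o => \sum_i op i (w (hi i) o - w (lo i) o) -
                    \sum_j op' j (w (hi' j) o - w (lo' j) o))%R <=
   \int[mu]_(s in `[0%R, t]) G s)%E.
Proof.
move=> hb hop hb' hop' mG hG.
pose LO (x : I + J) := match x with inl i => lo i | inr j => lo' j end.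
pose HI (x : I + J) := match x with inl i => hi i | inr j => hi' j end.
pose OP (x : I + J) := match x with inl i => op i | inr j => fun z => - op' j z end.
have hB x : [/\ 0 <= LO x, LO x <= HI x & HI x <= t] by case: x.
have hO x : bounded_linear (OP x) by case: x => //= j; exact: bounded_linear_opp.
have uS x : wmeas (fun o => OP x (U o)).
  by have [] := incr_op_sqint hZ sZ cQ wW hX sX (hO x) (lexx 0) ler01.
have E1 : (fun o => \sum_i op i (w (hi i) o - w (lo i) o) -
                    \sum_j op' j (w (hi' j) o - w (lo' j) o)) =
          (fun o => \sum_x OP x (w (HI x) o - w (LO x) o)).
  by apply/funext => o; rewrite big_sumType/= sumrN.
have E2 s : (fun o =>
     \sum_i ofR k (\1_(`]lo i, hi i]) s) *: op i (U o) -
     \sum_j ofR k (\1_(`]lo' j, hi' j]) s) *: op' j (U o)) =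
    (fun o => \sum_x ofR k (\1_(`]LO x, HI x]) s) *: OP x (U o)).
  apply/funext => o; rewrite big_sumType/= -sumrN; congr (_ + _).
  by apply: eq_bigr => j _; rewrite scalerN.
rewrite E1 (finite_isometry hZ sZ uF cQ wW hX sX hB hO).
apply: ge0_le_integral => //.
- by move=> s _; exact: L2sq_ge0.
- apply: measurable_funTS.
  pose f (p : Omega * measurableTypeR R) : \bar R :=
    (sqnrm (\sum_x ofR k (\1_(`]LO x, HI x]%classic) p.2) *: OP x (U p.1)))%:E.
  apply: (@measurable_integral_param R _ _ Omega (measurableTypeR R) P f).
    apply: emeasurable_sqnrm => //.
    apply: (wmeas_sum hX (index_enum (I + J)%type)
      (F := fun x (p : Omega * measurableTypeR R) =>
        ofR k (\1_(`]LO x, HI x]%classic) p.2) *: OP x (U p.1))) => x.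
    apply: (wmeasZ hX (r := fun p : Omega * measurableTypeR R =>
       \1_(`]LO x, HI x]%classic) p.2)).
      by apply: measurableT_comp => //; exact: measurable_indic.
    exact: (wmeas_comp (phi := fst) measurable_fst (uS x)).
  by move=> z; rewrite lee_fin sqnrm_ge0.
- exact: measurable_funTS.
- by move=> s /=; rewrite in_itv/= => /andP[s0 st]; rewrite -E2; exact: hG.
Qed.

Variables (S : R -> X -> X) (H : Z -> X).
Hypotheses (hS : C0_semigroup S) (Hb : bounded_linear H).
Local Notation flow := (flow S).
Local Notation HU := (fun o => H (U o)).

Lemma HU_sqint : sqint P HU.
Proof. exact: (incr_op_sqint hZ sZ cQ wW hX sX Hb (lexx 0) ler01). Qed.

Definition noise_size : R := cov P HU HU.

Lemma noise_sizeE : L2sq P HU = noise_size%:E.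
Proof. exact: L2sq_cov HU_sqint. Qed.

Lemma flow_incr_wmeas t : wmeas (fun o => flow t (HU o)).
Proof. exact: (wmeas_bounded_linear hX hX (flow_bounded hS t) HU_sqint.1). Qed.

(** With [b] true a cell counts once it has ended by time [r], with [b] false once it has begun. A
    cell that does not count is collapsed to the point 0 and contributes nothing. *)
Definition conv_on (h : R) (b : bool) (r : R) (i : nat) : bool := (i + b)%:R * h <= r.
Definition conv_lo h b r (i : nat) : R := if conv_on h b r i then i%:R * h else 0.
Definition conv_hi h b r (i : nat) : R := if conv_on h b r i then i.+1%:R * h else 0.
Definition conv_op h r (i : nat) : Z -> X := fun z => flow (r - i%:R * h) (H z).

(* The Riemann sum of the stochastic convolution at time [r] on the grid
   [i * h]; [b] tells whether the cell containing [r] is dropped, as it must be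
   for the sum to be adapted. *)
Definition conv_sum (h : R) (N : nat) (b : bool) (r : R) : Omega -> X := fun o =>
  \sum_(i < N) conv_op h r i (w (conv_hi h b r i) o - w (conv_lo h b r i) o).

Definition conv_step h (N : nat) b r s : Omega -> X := fun o =>
  \sum_(i < N) ofR k (\1_(`]conv_lo h b r i, conv_hi h b r i]) s) *: conv_op h r i (U o).

(** The integrand of the convolution applied to a unit increment. By [L20_sqnrmE] its second moment
    is the squared norm in L_2^0 of the integrand, so that estimates on operators become estimates
    on one random element. *)
Definition conv_kernel r s : Omega -> X := fun o =>
  if s <= r then flow (r - s) (HU o) else 0.

Lemma conv_op_bounded h r i : bounded_linear (conv_op h r i).
Proof. exact: (bounded_linear_comp hX Hb (flow_bounded hS _)). Qed.

Lemma conv_bounds h N b r t (i : 'I_N) : 0 < h -> N%:R * h <= t ->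
  [/\ 0 <= conv_lo h b r i, conv_lo h b r i <= conv_hi h b r i & conv_hi h b r i <= t].
Proof.
move=> h0 hN; have N0 : 0 <= N%:R * h by rewrite mulr_ge0// ltW.
rewrite /conv_lo /conv_hi; case: ifP => _; last by split=> //; exact: le_trans hN.
split; first by rewrite mulr_ge0// ltW.
  by rewrite ler_pM2r// ler_nat.
by apply: le_trans hN; rewrite ler_pM2r// ler_nat.
Qed.

Lemma conv_step_wmeas h N b r s : wmeas (conv_step h N b r s).
Proof.
apply: (wmeas_sum hX (index_enum 'I_N) (F := fun (i : 'I_N) o =>
  ofR k (\1_(`]conv_lo h b r i, conv_hi h b r i]) s) *: conv_op h r i (U o))) => i.
apply: (wmeasZ hX (r := fun=> \1_(`]conv_lo h b r i, conv_hi h b r i]) s)) => //.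
exact: flow_incr_wmeas.
Qed.

Lemma conv_kernel_wmeas r s : wmeas (conv_kernel r s).
Proof.
rewrite /conv_kernel; case: (s <= r); first exact: flow_incr_wmeas.
exact: wmeas_cst.
Qed.

Lemma grid_index (h : R) N (s : R) : 0 < h -> 0 < s -> s <= N%:R * h ->
  exists i : 'I_N, i%:R * h < s /\ s <= i.+1%:R * h.
Proof.
move=> h0 s0; elim: N => [|N ih] sN.
  by move: s0; rewrite ltNge (le_trans sN)// mul0r.
have [/ih [i [i1 i2]]|hs] := leP s (N%:R * h).
  by exists (widen_ord (leqnSn N) i).
by exists ord_max.
Qed.

Lemma conv_step_in h N b r s (i : 'I_N) o : 0 < h -> i%:R * h < s -> s <= i.+1%:R * h ->
  conv_step h N b r s o = if conv_on h b r i then flow (r - i%:R * h) (HU o) else 0.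
Proof.
move=> h0 i1 i2; rewrite /conv_step (bigD1 i)//= big1 ?addr0.
  rewrite /conv_lo /conv_hi /conv_op; case: ifP => _.
    by rewrite indicE mem_set ?ofR1 ?scale1r//= in_itv/= i1 i2.
  rewrite indicE memNset ?ofR0 ?scale0r//= in_itv/=.
  by case/andP => s1 s2; move: (lt_le_trans s1 s2); rewrite ltxx.
move=> j ji; rewrite indicE memNset ?ofR0 ?scale0r//= in_itv/= /conv_lo /conv_hi.
case: ifP => _ /andP[s1 s2]; last by move: (lt_le_trans s1 s2); rewrite ltxx.
have : (j%:R * h < i.+1%:R * h) by exact: lt_le_trans i2.
have : (i%:R * h < j.+1%:R * h) by exact: lt_le_trans s2.
rewrite !ltr_pM2r// !ltr_nat !ltnS => h1 h2.
by move/eqP: ji; apply; apply/val_inj/eqP; rewrite eqn_leq h1 h2.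
Qed.

Lemma conv_step_out h N b r s o : 0 < h -> N%:R * h < s -> conv_step h N b r s o = 0.
Proof.
move=> h0 sN; rewrite /conv_step big1// => i _.
rewrite indicE memNset ?ofR0 ?scale0r//= in_itv/= => /andP[_ s2].
have [_ _ h3] := @conv_bounds h N b r (N%:R * h) i h0 (lexx _).
by move: (lt_le_trans sN (le_trans s2 h3)); rewrite ltxx.
Qed.

Lemma conv_step_0 h N b r o : 0 < h -> conv_step h N b r 0 o = 0.
Proof.
move=> h0; rewrite /conv_step big1// => i _.
rewrite indicE memNset ?ofR0 ?scale0r//= in_itv/= => /andP[s1 _].
have [h3 _ _] := @conv_bounds h N b r (N%:R * h) i h0 (lexx _).
by move: (lt_le_trans s1 h3); rewrite ltxx.
Qed.

Section Closeness.
Variables (Tm M : R).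
Hypotheses (M1 : 1 <= M) (fM : forall t x, t <= Tm -> nrm (flow t x) <= M * nrm x).

Let M0 : 0 <= M. Proof. exact: le_trans M1. Qed.

Lemma conv_step_bound h N b r s o : 0 < h -> 0 <= s -> r <= Tm ->
  nrm (conv_step h N b r s o) <= M * nrm (HU o).
Proof.
move=> h0 s0 rT; have B0 : 0 <= M * nrm (HU o) by rewrite mulr_ge0// nrm_ge0.
have [sN|sN] := ltP (N%:R * h) s; first by rewrite conv_step_out// nrm0.
move: s0; rewrite le_eqVlt => /orP[/eqP <-|s0]; first by rewrite conv_step_0// nrm0.
have [i [i1 i2]] := grid_index h0 s0 sN.
rewrite (conv_step_in b r o h0 i1 i2); case: ifP => _; last by rewrite nrm0.
by apply: fM; rewrite (le_trans _ rT)// gerBl mulr_ge0// ltW.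
Qed.

Lemma conv_kernel_bound r s o : 0 <= s -> r <= Tm ->
  nrm (conv_kernel r s o) <= M * nrm (HU o).
Proof.
move=> s0 rT; rewrite /conv_kernel; case: ifP => _; last first.
  by rewrite nrm0// mulr_ge0// nrm_ge0.
by apply: fM; rewrite (le_trans _ rT)// gerBl.
Qed.

(** Away from 0 and from [r] the step and the kernel differ by the operator at time [r - s] applied
    to [flow q (HU o) - HU o], where [q], the distance to the left end of the cell, is at most [h].
    Within [h] of 0 or [r] the crude bound 2 M on the difference is used, and beyond [r + h] both
    vanish. *)
Lemma conv_step_close h N b r s E : 0 < h -> 0 <= r -> r <= N%:R * h -> r <= Tm ->
  0 <= s -> 0 <= E ->
  (forall q, 0 <= q -> q <= h -> (L2sq P (fun o => flow q (HU o) - HU o)%R <= E%:E)%E) ->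
  (L2sq P (fun o => conv_step h N b r s o - conv_kernel r s o)%R <=
   (M ^+ 2 * E + 4 * M ^+ 2 * noise_size *
     (\1_(`[(r - h), (r + h)]%classic) s + \1_(`[(- h), h]%classic) s))%:E)%E.
Proof.
move=> h0 r0 rN rT s0 E0 hE.
have n0 : 0 <= noise_size by exact: cov_self_ge0.
have M2 : 0 <= M ^+ 2 by rewrite sqr_ge0.
have ms := wmeasB hX (conv_step_wmeas h N b r s) (conv_kernel_wmeas r s).
have crude : (L2sq P (fun o => conv_step h N b r s o - conv_kernel r s o)%R <=
    (4 * M ^+ 2 * noise_size)%:E)%E.
  apply: (le_trans (L2sq_le_scale P (c := 2 * M) hX sX hX sX ms HU_sqint.1 _ _)).
  - by rewrite mulr_ge0.
  - move=> o; rewrite (le_trans (nrmD hX _ _))// nrmN//.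
    have := conv_step_bound N b o h0 s0 rT; have := conv_kernel_bound o s0 rT.
    set a := nrm (conv_kernel _ _ _); set c := nrm (conv_step _ _ _ _ _ _).
    set e := nrm _; lra.
  - by rewrite noise_sizeE -EFinM lee_fin exprMn -natrX.
have [sr|sr] := boolP ((r - h <= s) && (s <= r + h)).
  apply: (le_trans crude); rewrite lee_fin.
  rewrite [X in _ * (X + _)]indicE mem_set/= ?in_itv//=.
  rewrite mulrDr mulr1 addrCA lerDl addr_ge0// mulr_ge0//.
  by rewrite !mulr_ge0.
have [sh|sh] := leP s h.
  apply: (le_trans crude); rewrite lee_fin.
  rewrite [X in _ * (_ + X)]indicE mem_set/= ?in_itv//=; last first.
    by rewrite sh andbT (le_trans _ s0)// oppr_le0 ltW.
  rewrite mulrDr mulr1 addrA lerDr addr_ge0// mulr_ge0//.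
  by rewrite !mulr_ge0.
have tail x : 0 <= x -> (x <= M ^+ 2 * E + 4 * M ^+ 2 * noise_size *
     (\1_(`[(r - h), (r + h)]%classic) s + \1_(`[(- h), h]%classic) s) + x).
  by move=> x0; rewrite lerDr addr_ge0// mulr_ge0// ?mulr_ge0// addr_ge0.
have rest0 : 0 <= 4 * M ^+ 2 * noise_size *
     (\1_(`[(r - h), (r + h)]%classic) s + \1_(`[(- h), h]%classic) s).
  by rewrite mulr_ge0// ?mulr_ge0// addr_ge0.
have [rs|rs] := ltP (r + h) s.
  rewrite L2sq_zero//; first by rewrite lee_fin addr_ge0// mulr_ge0.
  move=> o; rewrite /conv_kernel leNgt (lt_trans _ rs) ?ltrDl//= subr0.
  have [sN|sN] := ltP (N%:R * h) s; first exact: conv_step_out.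
  have [i [i1 i2]] := grid_index h0 (lt_trans h0 sh) sN.
  rewrite (conv_step_in b r o h0 i1 i2) /conv_on ifF//; apply/negbTE.
  rewrite -ltNge; apply: lt_le_trans (_ : i%:R * h <= _).
    by move: i2; rewrite -addn1 natrD mulrDl mul1r; lra.
  by rewrite ler_pM2r// ler_nat leq_addr.
have sr' : s < r - h by move: sr; rewrite rs andbT -ltNge.
have sler : s <= r by lra.
have [i [i1 i2]] := grid_index h0 (lt_trans h0 sh) (le_trans sler rN).
have on : conv_on h b r i.
  apply: (@le_trans _ _ (i.+1%:R * h)).
    by rewrite ler_pM2r// ler_nat -addn1 leq_add2l leq_b1.
  by rewrite -addn1 natrD mulrDl mul1r; lra.
apply: (@le_trans _ _ ((M ^+ 2)%:E * L2sq P (fun o => flow (s - i%:R * h) (HU o) - HU o)%R)%E).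
  apply: (L2sq_le_scale _ hX sX hX sX ms) => //.
    by apply: wmeasB => //; [exact: flow_incr_wmeas|exact: HU_sqint.1].
  move=> o; rewrite (conv_step_in b r o h0 i1 i2) on /conv_kernel sler.
  have -> : r - i%:R * h = (r - s) + (s - i%:R * h) by ring.
  have f1 : 0 <= r - s by rewrite subr_ge0.
  have f2 : 0 <= s - i%:R * h by rewrite subr_ge0 ltW.
  rewrite (flowD hS (HU o) f1 f2).
  rewrite -(bounded_linear_B _ _ (flow_bounded hS _)).
  by apply: fM; rewrite (le_trans _ rT)// gerBl.
apply: (@le_trans _ _ ((M ^+ 2)%:E * E%:E)%E).
  apply: lee_wpmul2l; first by rewrite lee_fin.
  apply: hE; first by rewrite subr_ge0 ltW.
  by move: i2; rewrite -addn1 natrD mulrDl mul1r; lra.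
by rewrite -EFinM lee_fin lerDl.
Qed.

Lemma conv_kernel_close r r' s E : r' <= r -> r <= Tm -> 0 <= s -> 0 <= E ->
  (L2sq P (fun o => flow (r - r') (HU o) - HU o)%R <= E%:E)%E ->
  (L2sq P (fun o => conv_kernel r s o - conv_kernel r' s o)%R <=
   (M ^+ 2 * E + M ^+ 2 * noise_size * \1_(`[r', r]%classic) s)%:E)%E.
Proof.
move=> rr rT s0 E0 hE.
have n0 : 0 <= noise_size by exact: cov_self_ge0.
have M2 : 0 <= M ^+ 2 by rewrite sqr_ge0.
have ms := wmeasB hX (conv_kernel_wmeas r s) (conv_kernel_wmeas r' s).
have [sr'|sr'] := leP s r'.
  have sr := le_trans sr' rr.
  apply: (@le_trans _ _ ((M ^+ 2)%:E * L2sq P (fun o => flow (r - r') (HU o) - HU o)%R)%E).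
    apply: (L2sq_le_scale _ hX sX hX sX ms) => //.
      by apply: wmeasB => //; [exact: flow_incr_wmeas|exact: HU_sqint.1].
    move=> o; rewrite /conv_kernel sr sr'.
    have -> : r - s = (r' - s) + (r - r') by ring.
    rewrite (flowD hS) ?subr_ge0//.
    rewrite -(bounded_linear_B _ _ (flow_bounded hS _)).
    by apply: fM; rewrite (le_trans _ (le_trans rr rT))// gerBl.
  apply: (@le_trans _ _ ((M ^+ 2)%:E * E%:E)%E).
    by apply: lee_wpmul2l; first by rewrite lee_fin.
  by rewrite -EFinM lee_fin lerDl !mulr_ge0.
have [sr|sr] := leP s r; last first.
  rewrite L2sq_zero//; first by rewrite lee_fin addr_ge0// !mulr_ge0.
  by move=> o; rewrite /conv_kernel !leNgt sr (le_lt_trans rr sr)/= subr0.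
apply: (@le_trans _ _ ((M ^+ 2)%:E * L2sq P HU)%E).
  apply: (L2sq_le_scale _ hX sX hX sX ms) => //; first exact: HU_sqint.1.
  move=> o; have -> : conv_kernel r' s o = 0 by rewrite /conv_kernel leNgt sr'.
  rewrite subr0.
  exact: conv_kernel_bound.
rewrite noise_sizeE -EFinM lee_fin indicE mem_set/= ?in_itv/= ?sr ?(ltW sr')//.
by rewrite mulr1 lerDr mulr_ge0.
Qed.

(** Two times, two grids and both rules for the last cell are compared at once: the one estimate
    yields convergence, independence of the grid and mean-square continuity. The chain is step,
    kernel at [r], kernel at [r'], step. *)
Lemma conv_dist (t0 : R) : 0 <= t0 -> exists2 C, 0 <= C & forall E h N b h' N' b' r r',
  0 < h -> 0 < h' -> 0 <= r' -> r' <= r -> r <= N%:R * h -> N%:R * h <= t0 ->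
  r' <= N'%:R * h' -> N'%:R * h' <= t0 -> r <= Tm -> 0 <= E ->
  (forall q, 0 <= q -> [|| q <= h, q <= h' | q <= r - r'] ->
    (L2sq P (fun o => flow q (HU o) - HU o)%R <= E%:E)%E) ->
  (L2sq P (fun o => conv_sum h N b r o - conv_sum h' N' b' r' o)%R <=
   (C * (E + h + h' + (r - r')))%:E)%E.
Proof.
move=> t00; have n0 : 0 <= noise_size by exact: cov_self_ge0.
have M2 : 0 <= M ^+ 2 by rewrite sqr_ge0.
have c1 : 0 <= M ^+ 2 * t0 by rewrite mulr_ge0.
have c2 : 0 <= M ^+ 2 * noise_size by rewrite mulr_ge0.
(* Two uses of [L2sq_dist] give 2 + 2 (2 + 2) = 10 for the constant part and 2 * 2 * 4 = 16 on the
   exceptional intervals, whose total length is at most four times h + h' + (r - r'). *)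
exists (10 * (M ^+ 2 * t0) + 64 * (M ^+ 2 * noise_size)).
  by rewrite addr_ge0// mulr_ge0.
move=> E h N b h' N' b' r r' h0 h0' r0' rr rN Nt rN' Nt' rT E0 hE.
have r0 := le_trans r0' rr; have rT' := le_trans rr rT.
pose l := [:: (r - h, r + h); (- h, h); (r', r); (r' - h', r' + h'); (- h', h')].
pose G s := (10 * M ^+ 2 * E + 16 * M ^+ 2 * noise_size *
   \sum_(p <- l) \1_(`[p.1, p.2]%classic) s) : R.
apply: (@le_trans _ _ (\int[mu]_(s in `[0%R, t0]) (G s)%:E)%E).
  apply: (@family_dist 'I_N 'I_N' (fun i => conv_lo h b r i) (fun i => conv_hi h b r i)
    (fun i => conv_op h r i) (fun i => conv_lo h' b' r' i) (fun i => conv_hi h' b' r' i)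
    (fun i => conv_op h' r' i) t0 (EFin \o G)).
  - by move=> i; exact: conv_bounds.
  - by move=> i; exact: conv_op_bounded.
  - by move=> i; exact: conv_bounds.
  - by move=> i; exact: conv_op_bounded.
  - apply/measurable_EFinP; apply: measurable_funD => //; apply: measurable_funM => //.
    by apply: measurable_sum => p; exact: measurable_indic.
  - move=> s s0 _ /=; rewrite -/(conv_step h N b r s _).
    have m1 := conv_step_wmeas h N b r s; have m2 := conv_step_wmeas h' N' b' r' s.
    have k1 := conv_kernel_wmeas r s; have k2 := conv_kernel_wmeas r' s.
    have e1 := conv_step_close (N := N) b h0 r0 rN rT s0 E0
      (fun q q0 qh => hE q q0 (introT or3P (Or31 _ _ qh))).
    have e2 := conv_step_close (N := N') b' h0' r0' rN' rT' s0 E0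
      (fun q q0 qh => hE q q0 (introT or3P (Or32 _ _ qh))).
    have rr0 : 0 <= r - r' by rewrite subr_ge0.
    have e3 := conv_kernel_close rr rT s0 E0
      (hE _ rr0 (introT or3P (Or33 _ _ (lexx _)))).
    apply: (le_trans (L2sq_dist hX sX P m1 k1 m2)).
    have t2 := L2sq_dist hX sX P k1 k2 m2.
    rewrite [X in (_ <= 2%:E * _ + 2%:E * X)%E]L2sqBC// in t2.
    apply: (@le_trans _ _ (2%:E * (M ^+ 2 * E + 4 * M ^+ 2 * noise_size *
     (\1_(`[(r - h)%R, (r + h)%R]%classic) s + \1_(`[(- h)%R, h]%classic) s))%:E +
      2%:E * (2%:E * (M ^+ 2 * E + M ^+ 2 * noise_size * \1_(`[r', r]%classic) s)%:E +
       2%:E * (M ^+ 2 * E + 4 * M ^+ 2 * noise_size *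
     (\1_(`[(r' - h')%R, (r' + h')%R]%classic) s + \1_(`[(- h')%R, h']%classic) s))%:E))%E).
      apply: leeD; first by apply: lee_wpmul2l.
      apply: lee_wpmul2l => //; apply: (le_trans t2).
      by apply: leeD; apply: lee_wpmul2l.
    rewrite -!(EFinM, EFinD) lee_fin /G /l !big_cons big_nil /=.
    set x1 := \1_ _ s; set x2 := \1_ _ s; set x3 := \1_ _ s.
    set x4 := \1_ _ s; set x5 := \1_ _ s.
    have y1 : 0 <= x1 by []. have y2 : 0 <= x2 by [].
    have y3 : 0 <= x3 by []. 
    have z1 : 0 <= M ^+ 2 * noise_size * x1 by rewrite mulr_ge0.
    have z2 : 0 <= M ^+ 2 * noise_size * x2 by rewrite mulr_ge0.
    have z3 : 0 <= M ^+ 2 * noise_size * x3 by rewrite mulr_ge0.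
    rewrite -subr_ge0.
    set m2' := M ^+ 2; rewrite -/m2' in z1 z2 z3.
    have -> : 10 * m2' * E + 16 * m2' * noise_size * (x1 + (x2 + (x3 + (x4 + (x5 + 0))))) -
      (2 * (m2' * E + 4 * m2' * noise_size * (x1 + x2)) +
       2 * (2 * (m2' * E + m2' * noise_size * x3) +
            2 * (m2' * E + 4 * m2' * noise_size * (x4 + x5)))) =
      8 * (m2' * noise_size * x1) + 8 * (m2' * noise_size * x2) + 12 * (m2' * noise_size * x3).
      by ring.
    by rewrite !addr_ge0// mulr_ge0.
apply: (le_trans (integral_cst_indic t00 _ _ _)).
- by rewrite !mulr_ge0.
- by rewrite !mulr_ge0.
- move=> p; rewrite !inE => /orP[/eqP ->|/orP[/eqP ->|/orP[/eqP ->|/orP[/eqP ->|/eqP ->]]]] //=; lra.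
rewrite lee_fin /l !big_cons big_nil/=.
have rr0 : 0 <= r - r' by rewrite subr_ge0.
rewrite -subr_ge0.
set m2' := M ^+ 2.
have -> : (10 * (m2' * t0) + 64 * (m2' * noise_size)) * (E + h + h' + (r - r')) -
   (10 * m2' * E * t0 + 16 * m2' * noise_size *
   (r + h - (r - h) + (h - - h + (r - r' + (r' + h' - (r' - h') + (h' - - h' + 0)))))) =
   10 * (m2' * t0) * (h + h' + (r - r')) + m2' * noise_size * (64 * E + 48 * (r - r')) by ring.
have h1 := ltW h0; have h2 := ltW h0'.
have p1 : 0 <= h + h' + (r - r') by apply: addr_ge0 => //; exact: addr_ge0.
have p2 : 0 <= 64 * E + 48 * (r - r') by rewrite addr_ge0// mulr_ge0.
have p3 : 0 <= 10 * (m2' * t0) by rewrite mulr_ge0.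
apply: addr_ge0; exact: mulr_ge0.
Qed.

End Closeness.
End StochasticConvolution.

(** * The mean-square limit and its regularity *)

Section StochasticConvolutionLimit.
Variables (R : realType) (k : RorC) (Z X : ipSpace R k).
Hypotheses (hZ : hilbert Z) (sZ : separable Z) (hX : hilbert X) (sX : separable X).
Variables (d : measure_display) (Omega : measurableType d) (P : probability Omega R).
Variables (F : R -> set_system Omega) (Q : Z -> Z) (w : R -> Omega -> Z).
Hypotheses (uF : usual_filtration P F) (cQ : covariance_operator Q).
Hypothesis wW : wiener_process P F Q w.
Variables (S : R -> X -> X) (H : Z -> X).
Hypotheses (hS : C0_semigroup S) (Hb : bounded_linear H).
Local Notation mu := (@lebesgue_measure R).
Local Notation U := (unit_incr w).
Local Notation flow := (flow S).
Local Notation HU := (fun o => H (U o)).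
Local Notation conv_sum := (conv_sum w S H).

Let HUs : sqint P HU := HU_sqint hZ sZ hX sX cQ wW Hb.
Let fHU t : wmeas (fun o => flow t (HU o)) := flow_incr_wmeas hZ sZ hX sX cQ wW hS Hb t.

(** Dominated convergence: each orbit is continuous at 0, and the orbit differences are bounded by a
    multiple of the square integrable noise. The convergence theorem is sequential, hence the
    argument by contradiction. *)
Lemma noise_modulus (E : R) : 0 < E -> exists2 e, 0 < e & forall q, 0 <= q -> q <= e ->
  (L2sq P (fun o => flow q (HU o) - HU o)%R <= E%:E)%E.
Proof.
move=> E0; apply: contrapT => no.
have h n : exists q : R, [/\ 0 <= q, q <= n.+1%:R^-1 &
    ~ (L2sq P (fun o => flow q (HU o) - HU o)%R <= E%:E)%E].
  apply: contrapT => hn; apply: no; exists n.+1%:R^-1; first by rewrite invr_gt0.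
  by move=> q q0 qn; apply: contrapT => hE; apply: hn; exists q.
have [q hq] := choice h.
have [M M1 fM] := flow_bound hX hS 1.
have q0 : q @ \oo --> (0 : R).
  apply/cvgrPdist_lt => e e0.
  have [m hm] := ltr_add_invr e0; rewrite add0r in hm.
  exists m => //= n /= mn; have [a b _] := hq n.
  rewrite sub0r normrN ger0_norm// (le_lt_trans b)// (le_lt_trans _ hm)//.
  by rewrite lef_pV2 ?posrE// ler_nat ltnS.
have q1 n : q n <= 1.
  by have [_ b _] := hq n; rewrite (le_trans b)// invf_le1// ler1n.
pose C : R := 2 * M ^+ 2 + 2.
have cv : (fun n => L2sq P (fun o => flow (q n) (HU o) - HU o)%R) @ \oo --> (\int[P]_o 0)%E.
  apply: (@dominated_cvg _ _ _ P setT measurableT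
    (fun n o => (sqnrm (flow (q n) (HU o) - HU o))%:E) (cst 0%E)
    (fun o => (C * sqnrm (HU o))%:E)).
  - move=> n; apply: emeasurable_sqnrm => //.
    exact: (wmeasB hX (fHU (q n)) HUs.1).
  - move=> o _; apply/cvg_EFin; first by near=> n.
    have h2 : (fun n => nrm (flow (q n) (HU o) - HU o)) @ \oo --> (0 : R).
      by have := flow_vcvg hX hS (HU o) q0; rewrite (flow0 hS).
    suff : (fun n => sqnrm (flow (q n) (HU o) - HU o)) @ \oo --> (0 : R) by [].
    under eq_fun do rewrite -(nrm_sqr hX) expr2.
    by have h3 := cvgM h2 h2; rewrite mulr0 in h3; exact: h3.
  - by [].
  - under eq_fun do rewrite EFinM.
    exact: integrableZl (sqint_sqnrm hX sX HUs).
  - move=> n o _ /=; rewrite lee_fin ger0_norm ?sqnrm_ge0//.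
    have h1 : sqnrm (flow (q n) (HU o)) <= M ^+ 2 * sqnrm (HU o).
      rewrite -!(nrm_sqr hX) -exprMn lerXn2r ?nnegrE ?mulr_ge0 ?nrm_ge0//.
        exact: le_trans M1.
      exact: fM.
    have h2 := sqnrmB_le hX (flow (q n) (HU o)) (HU o).
    apply: (le_trans h2); rewrite /C.
    by move: h1; move: (sqnrm _) (sqnrm (H _)) (M ^+ 2) => x y z; lra.
rewrite integral0 in cv.
have E0' : (0 < E%:E :> \bar R)%E by rewrite lte_fin.
have [n _ hn] := cvg_ereal_lt cv E0'.
by have [_ _] := hq n; apply; apply/ltW/hn => /=.
Unshelve. all: by end_near. Qed.

Lemma conv_sumE h N b r o : conv_sum h N b r o =
  \sum_(i < N) flow (r - i%:R * h) (if `[< (i + b)%:R * h <= r >]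
    then H (w (i.+1%:R * h) o - w (i%:R * h) o) else 0).
Proof.
apply: eq_bigr => i _; rewrite /conv_op /conv_hi /conv_lo /conv_on asboolb.
by case: ifP => // _; rewrite subrr (bounded_linear0 Hb).
Qed.

Lemma wiener_incr_wmeas s t : 0 <= s -> s <= t -> wmeas (fun o => w t o - w s o).
Proof. by move=> s0 st; exact: centered_gaussian_wmeas (wiener_gaussian wW s0 st). Qed.

Lemma grid_incr_wmeas h (i : nat) : 0 < h ->
  wmeas (fun o => H (w (i.+1%:R * h) o - w (i%:R * h) o)).
Proof.
move=> h0; apply: wmeas_bounded_linear => //.
by apply: wiener_incr_wmeas; rewrite ?mulr_ge0 ?(ltW h0)// ler_pM2r// ler_nat.
Qed.

Lemma conv_sum_wmeas h N b : 0 < h ->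
  wmeas (fun p : measurableTypeR R * Omega => conv_sum h N b p.1 p.2).
Proof.
move=> h0; rewrite (_ : (fun p => _) = fun p : measurableTypeR R * Omega =>
  \sum_(i < N) flow (p.1 - i%:R * h) (if `[< (i + b)%:R * h <= p.1 >]
    then H (w (i.+1%:R * h) p.2 - w (i%:R * h) p.2) else 0)); last first.
  by apply/funext => p; exact: conv_sumE.
apply: (wmeas_sum hX (index_enum 'I_N) (F := fun (i : 'I_N) (p : measurableTypeR R * Omega) =>
  flow (p.1 - i%:R * h) (if `[< (i + b)%:R * h <= p.1 >]
    then H (w (i.+1%:R * h) p.2 - w (i%:R * h) p.2) else 0))) => i.
refine (wmeas_flow hX hS (tau := fun p : measurableTypeR R * Omega => p.1 - i%:R * h)
  (xi := fun p : measurableTypeR R * Omega => if `[< (i + b)%:R * h <= p.1 >]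
    then H (w (i.+1%:R * h) p.2 - w (i%:R * h) p.2) else 0) _ _).
  by apply: measurable_funB => //; exact: measurable_fst.
apply: (@wmeas_if _ _ _ _ _ [set p : measurableTypeR R * Omega | (i + b)%:R * h <= p.1]).
- rewrite (_ : [set _ | _] = fst @^-1` `[(i + b)%:R * h, +oo[%classic).
    by rewrite -[X in measurable X]setTI; apply: measurable_fst.
  by apply/seteqP; split=> p /=; rewrite in_itv/= andbT.
- exact: (wmeas_comp (phi := snd) measurable_snd (grid_incr_wmeas i h0)).
- exact: wmeas_cst.
Qed.

Lemma conv_sum_wmeas1 h N b r : 0 < h -> wmeas (conv_sum h N b r).
Proof.
move=> h0; apply: (wmeas_comp (phi := pair (r : measurableTypeR R)) _ (conv_sum_wmeas N b h0)).
exact: measurable_pair1.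
Qed.

Lemma wiener_wmeas_F r s : 0 <= r -> r <= s -> @wmeas R k Z _ (g_sigma_algebraType (F s)) (w r).
Proof.
move=> r0 rs; apply/(wmeas_borel hZ sZ) => V bV.
apply: sub_sigma_algebra; apply: (filtration_mono uF r0 rs).
by apply: (wiener_adapted wW) => //=; rewrite in_itv/= r0.
Qed.

Lemma conv_sum_adapted h N r : 0 < h -> 0 <= r ->
  @wmeas R k X _ (g_sigma_algebraType (F r)) (conv_sum h N true r).
Proof.
move=> h0 r0; pose Om := g_sigma_algebraType (F r).
rewrite (_ : conv_sum h N true r = fun o : Om =>
  \sum_(i < N) flow (r - i%:R * h) (if `[< (i + true)%:R * h <= r >]
    then H (w (i.+1%:R * h) o - w (i%:R * h) o) else 0)); last first.
  by apply/funext => o; exact: conv_sumE.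
apply: (wmeas_sum hX (index_enum 'I_N) (F := fun (i : 'I_N) (o : Om) =>
  flow (r - i%:R * h) (if `[< (i + true)%:R * h <= r >]
    then H (w (i.+1%:R * h) o - w (i%:R * h) o) else 0))) => i.
apply: (wmeas_bounded_linear hX hX (flow_bounded hS _)).
case: asboolP => [ir|_]; last exact: wmeas_cst.
apply: wmeas_bounded_linear => //; rewrite addn1 in ir.
have i0 : 0 <= i%:R * h by rewrite mulr_ge0// ltW.
have i1 : i%:R * h <= i.+1%:R * h by rewrite ler_pM2r// ler_nat.
apply: wmeasB => //.
  exact: wiener_wmeas_F (le_trans i0 i1) ir.
exact: wiener_wmeas_F i0 (le_trans i1 ir).
Qed.

Variable T : R.
Hypothesis T0 : 0 < T.

(** The step length and the noise modulus are both made at most 8^-n, so that by [conv_dist]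
    consecutive Riemann sums are at the distance that [L2sq_flim] asks for. *)
Lemma mesh_exists : exists N : nat -> nat, forall n : nat,
  T / (N n).+1%:R <= 8^-1 ^+ n /\
  forall q, 0 <= q -> q <= T / (N n).+1%:R ->
    (L2sq P (fun o => flow q (HU o) - HU o)%R <= (8^-1 ^+ n)%:E)%E.
Proof.
have h n : exists m : nat, T / m.+1%:R <= 8^-1 ^+ n /\
    forall q, 0 <= q -> q <= T / m.+1%:R ->
    (L2sq P (fun o => flow q (HU o) - HU o)%R <= (8^-1 ^+ n)%:E)%E.
  have p0 : 0 < 8^-1 ^+ n :> R by rewrite exprn_gt0.
  have [e e0 he] := noise_modulus p0.
  have m0 : 0 < Num.min e (8^-1 ^+ n) / T by rewrite divr_gt0// lt_min e0.
  have [m hm] := ltr_add_invr m0; rewrite add0r ltr_pdivlMr// mulrC lt_min in hm.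
  have [m1 m2] := andP hm.
  exists m; split; first exact: ltW.
  by move=> q q0 qm; apply: he => //; rewrite (le_trans qm)// ltW.
by have [N hN] := choice h; exists N.
Qed.

Definition mesh : nat -> nat := projT1 (cid mesh_exists).

Definition step n : R := T / (mesh n).+1%:R.

Lemma step_gt0 n : 0 < step n. Proof. by rewrite divr_gt0. Qed.

Lemma step_size n : (mesh n).+1%:R * step n = T.
Proof. by rewrite /step mulrC divfK. Qed.

Lemma step_le n : step n <= 8^-1 ^+ n.
Proof. exact: (projT2 (cid mesh_exists) n).1. Qed.

Lemma step_noise n q : 0 <= q -> q <= step n ->
  (L2sq P (fun o => flow q (HU o) - HU o)%R <= (8^-1 ^+ n)%:E)%E.
Proof. exact: (projT2 (cid mesh_exists) n).2. Qed.

Definition approx n : R -> Omega -> X := conv_sum (step n) (mesh n).+1 true.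

Lemma approx_wmeas n : wmeas (fun p : measurableTypeR R * Omega => approx n p.1 p.2).
Proof. exact: conv_sum_wmeas (step_gt0 n). Qed.

Lemma approx_wmeas1 n r : wmeas (approx n r).
Proof. exact: conv_sum_wmeas1 (step_gt0 n). Qed.

Definition stoch_conv (r : R) (o : Omega) : X := flim (fun n => approx n r) o.

Lemma stoch_conv_wmeas :
  wmeas (fun p : measurableTypeR R * Omega => stoch_conv p.1 p.2).
Proof.
exact: (wmeas_flim hX sX (f := fun n (p : measurableTypeR R * Omega) => approx n p.1 p.2)
  approx_wmeas).
Qed.

Lemma stoch_conv_wmeas1 r : wmeas (stoch_conv r).
Proof. exact: (wmeas_flim hX sX (fun n => approx_wmeas1 n r)). Qed.

Lemma stoch_conv_adapted r : 0 <= r ->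
  @wmeas R k X _ (g_sigma_algebraType (F r)) (stoch_conv r).
Proof.
move=> r0; apply: (@wmeas_flim _ _ _ hX sX _ (g_sigma_algebraType (F r))) => n.
exact: conv_sum_adapted (step_gt0 n) r0.
Qed.

Lemma exp8_le (m n : nat) : (m <= n)%N -> (8^-1 ^+ n <= 8^-1 ^+ m :> R).
Proof. by move=> mn; rewrite ler_wiXn2l// ?invr_ge0// invf_le1// ler1n. Qed.

Lemma exp8_small (c e : R) : 0 <= c -> 0 < e -> exists n, c * 8^-1 ^+ n < e.
Proof.
move=> c0 e0; have c1 : 0 < c + 1 by rewrite ltr_pwDr.
have e1 : 0 < e / (c + 1) by rewrite divr_gt0.
have : (fun n => 8^-1 ^+ n) @ \oo --> (0 : R).
  by apply: cvg_expr; rewrite ger0_norm ?invr_ge0// invf_lt1// ltr1n.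
move=> /cvgrPdist_lt /(_ _ e1) [n _ hn]; exists n.
have := hn n (leqnn n); rewrite sub0r normrN ger0_norm ?exprn_ge0 ?invr_ge0//.
rewrite ltr_pdivlMr// mulrC => h; apply: le_lt_trans h.
by rewrite ler_wpM2r ?exprn_ge0 ?invr_ge0// lerDl.
Qed.

Lemma approx_rate : exists2 C, 0 <= C & forall r n, 0 <= r -> r <= T ->
  (L2sq P (fun o => approx n r o - stoch_conv r o)%R <= (C * 8^-1 ^+ n)%:E)%E.
Proof.
have [M M1 fM] := flow_bound hX hS T.
have [C C0 hC] := conv_dist hZ sZ hX sX uF cQ wW hS Hb M1 fM (ltW T0).
(* A factor 4 from [L2sq_flim]; a factor 3 because the modulus and the two step lengths are each at
   most 8^-n. *)
exists (4 * (3 * C)); first by rewrite !mulr_ge0.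
move=> r n r0 rT; apply: (L2sq_flim hX sX (fun n => approx_wmeas1 n r)) => {}n.
apply: (le_trans (hC (8^-1 ^+ n) _ _ _ _ _ _ r r _ _ _ _ _ _ _ _ _ _ _)) => //.
- exact: step_gt0.
- exact: step_gt0.
- by rewrite step_size.
- by rewrite step_size.
- by rewrite step_size.
- by rewrite step_size.
- move=> q q0 /or3P[qs|qs|qs].
  + by apply: (le_trans (step_noise q0 qs)); rewrite lee_fin exp8_le.
  + exact: step_noise.
  + by apply: step_noise => //; rewrite (le_trans qs)// subrr ltW// step_gt0.
- rewrite lee_fin subrr addr0 [leRHS](_ : _ = C * (8^-1 ^+ n + 8^-1 ^+ n + 8^-1 ^+ n)).
    rewrite ler_wpM2l// !lerD ?step_le//.
    by rewrite (le_trans (step_le _))// exp8_le.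
  by ring.
Qed.

(** The weak identity at time [t] wants a grid that ends at [t] and cells that count from their
    beginning, so that each term is a whole orbit. These sums, though not adapted, have the same
    limit, uniformly in the time [r]. *)
Lemma stoch_conv_close t (e : R) : 0 < t -> t <= T -> 0 < e -> exists N, forall r,
  0 <= r -> r <= t ->
  (L2sq P (fun o => conv_sum (t / N.+1%:R) N.+1 false r o - stoch_conv r o)%R <= e%:E)%E.
Proof.
move=> t0 tT e0.
have [M M1 fM] := flow_bound hX hS T.
have [C C0 hC] := conv_dist hZ sZ hX sX uF cQ wW hS Hb M1 fM (ltW T0).
have [C' C0' hC'] := approx_rate.
have [n hn] : exists n, (6 * C + 2 * C') * 8^-1 ^+ n < e.
  by apply: exp8_small => //; rewrite addr_ge0// mulr_ge0.
have p0 : 0 < 8^-1 ^+ n :> R by rewrite exprn_gt0.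
have [eta eta0 heta] := noise_modulus p0.
have m0 : 0 < Num.min eta (8^-1 ^+ n) / t by rewrite divr_gt0// lt_min eta0.
have [m hm] := ltr_add_invr m0; rewrite add0r ltr_pdivlMr// mulrC lt_min in hm.
have [m1 m2] := andP hm.
have h0 : 0 < t / m.+1%:R by rewrite divr_gt0.
have ht : m.+1%:R * (t / m.+1%:R) = t by rewrite mulrC divfK.
exists m => r r0 rt; have rT := le_trans rt tT.
apply: (le_trans (L2sq_dist hX sX P (conv_sum_wmeas1 m.+1 false r h0)
  (approx_wmeas1 n r) (stoch_conv_wmeas1 r))).
have b1 : (L2sq P (fun o => conv_sum (t / m.+1%:R) m.+1 false r o - approx n r o)%R <=
    (C * (3 * 8^-1 ^+ n))%:E)%E.
  apply: (le_trans (hC (8^-1 ^+ n) _ _ _ _ _ _ r r _ _ _ _ _ _ _ _ _ _ _)) => //.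
  - exact: step_gt0.
  - by rewrite ht.
  - by rewrite ht.
  - by rewrite step_size.
  - by rewrite step_size.
  - move=> q q0 /or3P[qs|qs|qs].
    + by apply: heta => //; rewrite (le_trans qs)// ltW.
    + exact: step_noise.
    + by apply: step_noise => //; rewrite (le_trans qs)// subrr ltW// step_gt0.
  - rewrite lee_fin subrr addr0 ler_wpM2l//.
    rewrite [leRHS](_ : _ = 8^-1 ^+ n + 8^-1 ^+ n + 8^-1 ^+ n); last by ring.
    by rewrite !lerD ?step_le// ltW.
apply: (@le_trans _ _ (2%:E * (C * (3 * 8^-1 ^+ n))%:E + 2%:E * (C' * 8^-1 ^+ n)%:E)%E).
  by apply: leeD; apply: lee_wpmul2l => //; exact: hC'.
rewrite -!(EFinM, EFinD) lee_fin (le_trans _ (ltW hn))//.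
by rewrite le_eqVlt; apply/orP; left; apply/eqP; ring.
Qed.

Lemma stoch_conv_continuous (e : R) : 0 < e -> exists2 eta, 0 < eta & forall r r',
  0 <= r' -> r' <= r -> r <= T -> r - r' < eta ->
  (L2sq P (fun o => stoch_conv r o - stoch_conv r' o)%R <= e%:E)%E.
Proof.
move=> e0.
have [M M1 fM] := flow_bound hX hS T.
have [C C0 hC] := conv_dist hZ sZ hX sX uF cQ wW hS Hb M1 fM (ltW T0).
have [C' C0' hC'] := approx_rate.
(* Two uses of [L2sq_dist] give 2 * 2 * 4 = 16, the 4 being the number of terms of size 8^-n in
   [conv_dist], and 2 + 2 * 2 = 6 for the two distances to the limit. *)
have [n hn] : exists n, (16 * C + 6 * C') * 8^-1 ^+ n < e.
  by apply: exp8_small => //; rewrite addr_ge0// mulr_ge0.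
have p0 : 0 < 8^-1 ^+ n :> R by rewrite exprn_gt0.
have [eta eta0 heta] := noise_modulus p0.
exists (Num.min eta (8^-1 ^+ n)); first by rewrite lt_min eta0.
move=> r r' r0' rr rT; rewrite lt_min => /andP[d1 d2].
have r0 := le_trans r0' rr; have rT' := le_trans rr rT.
have b1 : (L2sq P (fun o => approx n r o - approx n r' o)%R <= (C * (4 * 8^-1 ^+ n))%:E)%E.
  apply: (le_trans (hC (8^-1 ^+ n) _ _ _ _ _ _ r r' _ _ _ _ _ _ _ _ _ _ _)) => //.
  - exact: step_gt0.
  - exact: step_gt0.
  - by rewrite step_size.
  - by rewrite step_size.
  - by rewrite step_size.
  - by rewrite step_size.
  - move=> q q0 /or3P[qs|qs|qs].
    + exact: step_noise.
    + exact: step_noise.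
    + by apply: heta => //; rewrite (le_trans qs)// ltW.
  - rewrite lee_fin ler_wpM2l//.
    rewrite [leRHS](_ : _ = 8^-1 ^+ n + 8^-1 ^+ n + 8^-1 ^+ n + 8^-1 ^+ n); last by ring.
    by rewrite !lerD ?step_le// ltW.
apply: (le_trans (L2sq_dist hX sX P (stoch_conv_wmeas1 r) (approx_wmeas1 n r)
  (stoch_conv_wmeas1 r'))).
apply: (@le_trans _ _ (2%:E * (C' * 8^-1 ^+ n)%:E + 2%:E * (2%:E * (C * (4 * 8^-1 ^+ n))%:E
   + 2%:E * (C' * 8^-1 ^+ n)%:E))%E).
  apply: leeD; apply: lee_wpmul2l => //; first by rewrite L2sqBC//; exact: hC'.
  apply: (le_trans (L2sq_dist hX sX P (approx_wmeas1 n r) (approx_wmeas1 n r')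
    (stoch_conv_wmeas1 r'))).
  by apply: leeD; apply: lee_wpmul2l => //; exact: hC'.
rewrite -!(EFinM, EFinD) lee_fin (le_trans _ (ltW hn))//.
by rewrite le_eqVlt; apply/orP; left; apply/eqP; ring.
Qed.

Lemma approx_sqint n r : 0 <= r -> r <= T -> sqint P (approx n r).
Proof.
move=> r0 rT; apply: (sqint_sum hX sX (index_enum 'I_(mesh n).+1) (F := fun i o =>
  conv_op S H (step n) r i (w (conv_hi (step n) true r i) o - w (conv_lo (step n) true r i) o))).
move=> i; have sT : (mesh n).+1%:R * step n <= T by rewrite step_size.
have [h1 h2 _] := conv_bounds true r i (step_gt0 n) sT.
exact: (incr_op_sqint hZ sZ cQ wW hX sX (conv_op_bounded hX hS Hb _ _ _) h1 h2).
Qed.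

Lemma stoch_conv_sqint r : 0 <= r -> r <= T -> sqint P (stoch_conv r).
Proof.
move=> r0 rT; have [C C0 hC] := approx_rate.
have s0 : sqint P (fun o => approx 0 r o - stoch_conv r o).
  split; first by apply: wmeasB => //; [exact: approx_wmeas1|exact: stoch_conv_wmeas1].
  by apply: le_lt_trans (hC _ _ r0 rT) _; rewrite ltry.
have := sqintB hX sX (approx_sqint 0 r0 rT) s0.
by congr (sqint P _); apply/funext => o; rewrite opprB addrCA subrr addr0.
Qed.

(** Uniform mean-square continuity propagates a bound from time 0 in finitely many steps of length
    [eta / 2]. *)
Lemma stoch_conv_bounded : exists C : R, forall r, 0 <= r -> r <= T ->
  (L2sq P (stoch_conv r) <= C%:E)%E.
Proof.
have [eta eta0 heta] := stoch_conv_continuous ltr01.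
suff h n : n%:R * (eta / 2) <= T + eta / 2 -> exists C : R, forall r, 0 <= r -> r <= T ->
    r <= n%:R * (eta / 2) -> (L2sq P (stoch_conv r) <= C%:E)%E.
  have e2 : 0 < eta / 2 by rewrite divr_gt0.
  have T1 : 0 <= T / (eta / 2) by rewrite divr_ge0 ?ltW.
  have /andP[n1 n2] := Num.Theory.truncn_itv T1.
  have [|C hC] := h (Num.truncn (T / (eta / 2))).+1.
    by rewrite -addn1 natrD mulrDl mul1r lerD2r -ler_pdivlMr.
  exists C => r r0 rT; apply: hC => //; apply: (le_trans rT).
  by rewrite -ler_pdivrMr// ltW.
have e2 : 0 < eta / 2 by rewrite divr_gt0.
elim: n => [|n ih] hn.
  exists (cov P (stoch_conv 0) (stoch_conv 0)) => r r0 rT; rewrite mul0r => r0'.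
  have -> : r = 0 by apply/eqP; rewrite eq_le r0 r0'.
  by rewrite (L2sq_cov hX sX (stoch_conv_sqint (lexx 0) (ltW T0))).
have [|C hC] := ih.
  by rewrite (le_trans _ hn)// ler_pM2r// ler_nat.
exists (2 * C + 2) => r r0 rT hr.
pose r' := Num.max 0 (r - eta / 2).
have r0' : 0 <= r' by rewrite le_max lexx.
have rr : r' <= r by rewrite ge_max r0 gerBl ltW.
have de : r - r' < eta.
  have : r - eta / 2 <= r' by rewrite le_max lexx orbT.
  by lra.
have rn : r' <= n%:R * (eta / 2).
  rewrite /r' ge_max; apply/andP; split; first by rewrite mulr_ge0// ltW.
  by rewrite lerBlDr; move: hr; rewrite -addn1 natrD mulrDl mul1r.
have := heta r r' r0' rr rT de => h1.
have h2 := hC r' r0' (le_trans rr rT) rn.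
have mD := wmeasB hX (stoch_conv_wmeas1 r) (stoch_conv_wmeas1 r').
have := L2sqD_le hX sX P (stoch_conv_wmeas1 r') mD.
rewrite (_ : (fun x => _) = stoch_conv r); last first.
  by apply/funext => o; rewrite addrC subrK.
move=> h3; apply: (le_trans h3).
apply: (@le_trans _ _ (2%:E * C%:E + 2%:E * 1%:E)%E).
  by apply: leeD; apply: lee_wpmul2l.
by rewrite -!(EFinM, EFinD) lee_fin mulr1.
Qed.

End StochasticConvolutionLimit.

Lemma ge0_cvge0 (R : realType) (I : Type) (F : set_system I) (FF : Filter F)
    (u : I -> \bar R) : (forall i, 0 <= u i)%E ->
  (forall e : R, 0 < e -> \forall i \near F, (u i <= e%:E)%E) -> u @ F --> 0%E.
Proof.
move=> u0 h; apply/fine_cvgP; split.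
  apply: filterS (h 1 ltr01) => i ui.
  by rewrite ge0_fin_numE// (le_lt_trans ui)// ltry.
apply/cvgrPdist_le => e e0; apply: filterS (h e e0) => i ui /=.
have fi : u i \is a fin_num by rewrite ge0_fin_numE// (le_lt_trans ui)// ltry.
rewrite sub0r normrN ger0_norm ?fine_ge0//.
by rewrite -lee_fin fineK.
Qed.

Section NullMoment.
Variables (R : realType) (k : RorC) (V : ipSpace R k).
Hypotheses (hV : hilbert V) (sV : separable V).
Variables (d : measure_display) (Omega : measurableType d) (P : {measure set Omega -> \bar R}).

Lemma small_ae0 (W : Omega -> R) : measurable_fun setT W ->
  (forall e : R, 0 < e -> (\int[P]_o `|W o|%:E <= e%:E)%E) -> {ae P, forall o, W o = 0}.
Proof.
move=> mW h; have mE : measurable_fun setT (EFin \o W) by exact/measurable_EFinP.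
have I0 : (\int[P]_o `|(EFin \o W) o| = 0)%E.
  apply/eqP; rewrite eq_le integral_ge0 ?andbT; last by move=> o _; exact: abse_ge0.
  by apply/lee_addgt0Pr => e e0; rewrite add0e; exact: h.
have /(ae_eq_integral_abs P measurableT mE) := I0.
by apply: filterS => o /(_ I) /= [].
Qed.

Lemma L2sq0_ae xi : wmeas xi -> L2sq P xi = 0%E -> {ae P, forall o, xi o = 0 :> V}.
Proof.
move=> mx I0.
have : {ae P, forall o, sqnrm (xi o) = 0}.
  apply: small_ae0; first exact: measurable_sqnrm.
  move=> e e0; under eq_integral do rewrite ger0_norm ?sqnrm_ge0//.
  by rewrite -[X in (X <= _)%E]/(L2sq P xi) I0 lee_fin ltW.
by apply: filterS => o; exact: (sqnrm_eq0 hV).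
Qed.

End NullMoment.

(** * Jointly measurable processes *)

Section Processes.
Variables (R : realType) (k : RorC) (V : ipSpace R k).
Hypotheses (hV : hilbert V) (sV : separable V).
Variables (d : measure_display) (Omega : measurableType d) (P : probability Omega R).
Local Notation mu := (@lebesgue_measure R).
Implicit Types Y L : R -> Omega -> V.

Definition jmeas Y := wmeas (fun p : measurableTypeR R * Omega => Y p.1 p.2).

Lemma jmeas_path Y o : jmeas Y -> wmeas (Y ^~ o : measurableTypeR R -> V).
Proof.
move=> jY; apply: (wmeas_comp (phi := fun s : measurableTypeR R => (s, o)) _ jY).
exact: measurable_pair2.
Qed.

Lemma jmeas_at Y t : jmeas Y -> wmeas (Y t).
Proof.
move=> jY; apply: (wmeas_comp (phi := pair (t : measurableTypeR R)) _ jY).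
exact: measurable_pair1.
Qed.

Lemma jmeasB Y L : jmeas Y -> jmeas L -> jmeas (fun s o => Y s o - L s o).
Proof. exact: wmeasB. Qed.

Lemma jmeasD Y L : jmeas Y -> jmeas L -> jmeas (fun s o => Y s o + L s o).
Proof. exact: wmeasD. Qed.

Lemma jmeas_sqnrm Y : jmeas Y ->
  measurable_fun setT (fun p : measurableTypeR R * Omega => (sqnrm (Y p.1 p.2))%:E).
Proof. by move=> jY; exact: emeasurable_sqnrm. Qed.

Lemma jmeas_restr Y a b : jmeas Y ->
  jmeas (fun s o => if `[< `[a, b]%classic s >] then Y s o else 0).
Proof.
move=> jY; apply: (@wmeas_if _ _ _ _ _ [set p : measurableTypeR R * Omega | `[a, b]%classic p.1]
  (fun p => Y p.1 p.2)).
- rewrite (_ : [set _ | _] = fst @^-1` `[a, b]%classic)//.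
  by rewrite -[X in measurable X]setTI; apply: measurable_fst.
- exact: jY.
- exact: wmeas_cst.
Qed.

Lemma tonelli_path Y a b : jmeas Y ->
  (\int[P]_o \int[mu]_(s in `[a, b]) (sqnrm (Y s o))%:E =
   \int[mu]_(s in `[a, b]) L2sq P (Y s))%E.
Proof.
move=> jY; pose YD s o := if `[< `[a, b]%classic s >] then Y s o else 0.
have jD : jmeas YD := jmeas_restr a b jY.
have := @fubini_tonelli _ _ _ _ R mu P
  (fun p : measurableTypeR R * Omega => (sqnrm (YD p.1 p.2))%:E) (jmeas_sqnrm jD)
  (fun p => sqnrm_ge0 hV _ : (0 <= (sqnrm (YD p.1 p.2))%:E)%E).
have eD s o : (if s \in `[a, b]%classic then (sqnrm (Y s o))%:E else 0%E) = (sqnrm (YD s o))%:E.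
  rewrite /YD; case: asboolP; first by move=> h; rewrite (mem_set h).
  by move=> h; rewrite (memNset h) sqnrm0.
move=> /= e; transitivity (\int[P]_o \int[mu]_s (sqnrm (YD s o))%:E)%E.
  apply: eq_integral => o _; rewrite integral_mkcond; apply: eq_integral => s _.
  by rewrite patchE eD.
rewrite -e [RHS]integral_mkcond; apply: eq_integral => s _.
under eq_integral do rewrite -eD; rewrite patchE.
by case: ifPn => // _; rewrite integral0.
Qed.

Lemma jmeas_L2sq Y : jmeas Y -> measurable_fun (setT : set (measurableTypeR R))
  (fun s => L2sq P (Y s)).
Proof.
move=> jY; apply: (@measurable_integral_param R _ _ Omega (measurableTypeR R) P
  (fun p : Omega * measurableTypeR R => (sqnrm (Y p.2 p.1))%:E)).
  apply: emeasurable_sqnrm => //.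
  apply: (wmeas_comp (phi := fun p : Omega * measurableTypeR R => (p.2, p.1)) _ jY).
  exact: measurable_swap.
by move=> z; rewrite lee_fin sqnrm_ge0.
Qed.

Lemma integral_L2sq_le Y (a b C : R) : a <= b -> jmeas Y -> 0 <= C ->
  (forall s, a <= s -> s <= b -> (L2sq P (Y s) <= C%:E)%E) ->
  (\int[mu]_(s in `[a, b]) L2sq P (Y s) <= (C * (b - a))%:E)%E.
Proof.
move=> ab jY C0 h; apply: (@le_trans _ _ (\int[mu]_(s in `[a, b]) C%:E)%E).
  apply: ge0_le_integral => //.
  - by move=> s _; exact: L2sq_ge0.
  - by apply: measurable_funTS; exact: jmeas_L2sq.
  - by move=> s /=; rewrite in_itv/= => /andP[]; exact: h.
rewrite integral_cst//= lebesgue_measure_itv/= lte_fin.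
case: ifPn => [_|]; first by rewrite -EFinB -EFinM.
rewrite -leNgt => ba; have -> : a = b by apply/eqP; rewrite eq_le ab ba.
by rewrite mule0 subrr mulr0.
Qed.

Lemma measurable_path_sqnrm Y a b : jmeas Y ->
  measurable_fun setT (fun o => \int[mu]_(s in `[a, b]) (sqnrm (Y s o))%:E)%E.
Proof.
move=> jY; pose YD s o := if `[< `[a, b]%classic s >] then Y s o else 0.
have jD : jmeas YD := jmeas_restr a b jY.
rewrite (_ : (fun o => _) = fun o => \int[mu]_s (sqnrm (YD s o))%:E)%E.
  apply: (@measurable_integral_param R _ _ (measurableTypeR R) Omega mu
    (fun p : measurableTypeR R * Omega => (sqnrm (YD p.1 p.2))%:E) (jmeas_sqnrm jD)).
  by move=> z; rewrite lee_fin sqnrm_ge0.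
apply/funext => o; rewrite integral_mkcond; apply: eq_integral => s _; rewrite patchE /YD.
case: asboolP; first by move=> h; rewrite (mem_set h).
by move=> h; rewrite (memNset h) sqnrm0.
Qed.

Lemma ae_path_sqint Y (t C : R) : 0 <= t -> jmeas Y ->
  (forall s, 0 <= s -> s <= t -> (L2sq P (Y s) <= C%:E)%E) ->
  {ae P, forall o, (\int[mu]_(s in `[0%R, t]) (sqnrm (Y s o))%:E < +oo)%E}.
Proof.
move=> t0 jY hC.
have C0 : 0 <= C.
  by rewrite -lee_fin; apply: le_trans (hC 0 (lexx _) t0); exact: L2sq_ge0.
have mI := measurable_path_sqnrm 0 t jY.
have I0 o : (0 <= \int[mu]_(s in `[0%R, t]) (sqnrm (Y s o))%:E)%E.
  by apply: integral_ge0 => s _; rewrite lee_fin sqnrm_ge0.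
have If : P.-integrable setT (fun o => \int[mu]_(s in `[0%R, t]) (sqnrm (Y s o))%:E)%E.
  apply/integrableP; split => //; under eq_integral do rewrite gee0_abs//.
  rewrite tonelli_path//; apply: le_lt_trans (integral_L2sq_le t0 jY C0 hC) _.
  by rewrite ltry.
apply: filterS (integrable_ae measurableT If) => o /(_ I) fo.
by rewrite -ge0_fin_numE.
Qed.

Lemma path_itgable (g : R -> V) v (a b t : R) : wmeas (g : measurableTypeR R -> V) ->
  (\int[mu]_(s in `[0%R, t]) (sqnrm (g s))%:E < +oo)%E -> 0 <= a -> b <= t ->
  itgable (fun s => rip (g s) v) a b.
Proof.
move=> mg fg a0 bt; apply: (itgableW a0 bt).
have fI : (mu `[0%R, t] < +oo)%E.
  by rewrite lebesgue_measure_itv/=; case: ifP => // _; rewrite -EFinB ltry.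
have i1 : mu.-integrable `[0, t] (EFin \o (fun s => sqnrm (g s))).
  apply/integrableP; split.
    by apply: measurable_funTS; exact: emeasurable_sqnrm.
  by under eq_integral do rewrite /= ger0_norm ?sqnrm_ge0//.
have i2 : itgable (cst (sqnrm v)) 0 t by exact: itgable_cst.
have mI : measurable (`[0, t]%classic : set (measurableTypeR R)) by exact: measurable_itv.
have := integrableD mI i1 i2; apply: le_integrable => //.
  by apply/measurable_EFinP; apply: measurable_funTS; exact: mg.
move=> s _ /=; rewrite lee_fin [leRHS]ger0_norm ?addr_ge0 ?sqnrm_ge0//.
exact: rip_le_sqnrm.
Qed.

Lemma rip_young (x y : V) (e : R) : 0 < e ->
  `|rip x y| <= e^-1 * sqnrm x + e * sqnrm y.
Proof.
move=> e0.
have h1 := rip_le_sqnrm hV (ofR k (Num.sqrt e)^-1 *: x) (ofR k (Num.sqrt e) *: y).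
move: h1; rewrite ripZl// ripZr// mulrA mulVf ?mul1r; last by rewrite sqrtr_eq0 -ltNge.
by rewrite !sqnrmZ// exprVn sqr_sqrtr// ltW.
Qed.

Lemma measurable_itg_param (f : measurableTypeR R * Omega -> R) a b : measurable_fun setT f ->
  measurable_fun setT (fun o => itg (fun s => f (s, o)) a b).
Proof.
move=> mf; under eq_fun do rewrite itgE.
apply: (@measurable_Rintegral_param R _ _ (measurableTypeR R) Omega mu
  (fun p : measurableTypeR R * Omega => \1_(`[a, b]%classic) p.1 * f p)).
apply: measurable_funM => //.
by apply: measurableT_comp => //; exact: measurable_indic.
Qed.

Lemma EFin_itg_le (phi psi : R -> R) (a b : R) : itgable phi a b ->
  (forall s, `|phi s| <= psi s) ->
  measurable_fun (setT : set (measurableTypeR R)) psi ->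
  (`|itg phi a b|%:E <= \int[mu]_(s in `[a, b]) (psi s)%:E)%E.
Proof.
move=> iphi h mpsi; have mphi := measurable_int _ iphi.
rewrite /itg /Rintegral -abse_EFin fineK ?(integrable_fin_num _ iphi)//.
apply: (le_trans (le_abse_integral mu _ mphi)) => //.
apply: ge0_le_integral => //.
- exact: measurableT_comp.
- by apply: measurable_funTS; exact/measurable_EFinP.
- by move=> s _ /=; rewrite lee_fin.
Qed.

(** The defect [W] of the identity for [Y] is that of the difference [L - Y], since [L] has none.
    Young's inequality with parameter [eta] bounds it by squared norms, and a distance [eta ^+ 2]
    makes its mean of order [eta]. *)
Lemma weak_identity_limit Y (c : Omega -> R) (z v : V) (t : R) : 0 <= t -> jmeas Y ->
  measurable_fun setT c ->
  {ae P, forall o, (\int[mu]_(s in `[0%R, t]) (sqnrm (Y s o))%:E < +oo)%E} ->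
  (forall e : R, 0 < e -> exists L, [/\ jmeas L,
     forall s, 0 <= s -> s <= t -> (L2sq P (fun o => L s o - Y s o)%R <= e%:E)%E &
     forall o, itgable (fun s => rip (L s o) v) 0 t /\
       rip (L t o) z - c o = itg (fun s => rip (L s o) v) 0 t]) ->
  {ae P, forall o, rip (Y t o) z = c o + itg (fun s => rip (Y s o) v) 0 t}.
Proof.
move=> t0 jY mc fY hL.
have mYv : measurable_fun setT (fun p : measurableTypeR R * Omega => rip (Y p.1 p.2) v) by exact: jY.
pose W o := c o - rip (Y t o) z + itg (fun s => rip (Y s o) v) 0 t.
have mW : measurable_fun setT W.
  apply: measurable_funD; last exact: (measurable_itg_param 0 t mYv).
  by apply: measurable_funB => //; exact: (jmeas_at t jY).
have sv := sqnrm_ge0 hV v; have sz := sqnrm_ge0 hV z.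
suff : {ae P, forall o, W o = 0}.
  by apply: filterS => o; rewrite /W => h; move: h; set a := rip _ _; lra.
apply: small_ae0 => // e e0.
(* Collects the constants so that the mean of the defect is at most [eta * A]. *)
pose A := 1 + t + sqnrm z + t * sqnrm v.
have A0 : 0 < A.
  have : 0 <= t * sqnrm v by rewrite mulr_ge0.
  by rewrite /A; lra.
pose eta := e / A; have eta0 : 0 < eta by rewrite divr_gt0.
have [|L [jL hLY hLw]] := hL (eta ^+ 2); first by rewrite exprn_gt0.
pose D s o := L s o - Y s o; have jD : jmeas D := jmeasB jL jY.
pose K := eta * (sqnrm z + t * sqnrm v).
have K0 : 0 <= K by rewrite mulr_ge0 ?(ltW eta0)// addr_ge0// mulr_ge0.
have ei0 : 0 <= eta^-1 by rewrite invr_ge0 ltW.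
have mDt : measurable_fun setT (fun o => (sqnrm (D t o))%:E).
  by apply: emeasurable_sqnrm => //; exact: jmeas_at.
have mDI : measurable_fun setT (fun o => \int[mu]_(s in `[0%R, t]) (sqnrm (D s o))%:E)%E.
  exact: measurable_path_sqnrm.
have DI0 o : (0 <= \int[mu]_(s in `[0%R, t]) (sqnrm (D s o))%:E)%E.
  by apply: integral_ge0 => s _; rewrite lee_fin sqnrm_ge0.
have bnd : {ae P, forall o, (`|W o|%:E <= eta^-1%:E * (sqnrm (D t o))%:E + (K%:E +
    eta^-1%:E * \int[mu]_(s in `[0%R, t]) (sqnrm (D s o))%:E))%E}.
  apply: filterS fY => o fo; have [iL eL] := hLw o.
  have iY : itgable (fun s => rip (Y s o) v) 0 t.
    by apply: (path_itgable v _ fo) => //; exact: jmeas_path.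
  have iD : itgable (fun s => rip (D s o) v) 0 t.
    have mI : measurable (`[0, t]%classic : set (measurableTypeR R)) by exact: measurable_itv.
    have := integrableB mI iL iY.
    by congr (integrable _ _ _); apply/funext => s /=; rewrite -EFinB /D ripBl.
  have -> : W o = rip (D t o) z - itg (fun s => rip (D s o) v) 0 t.
    have -> : itg (fun s => rip (D s o) v) 0 t =
        itg (fun s => rip (L s o) v) 0 t - itg (fun s => rip (Y s o) v) 0 t.
      by rewrite -itgB//; apply: eq_itg => s _; rewrite ripBl.
    by rewrite -eL /W ripBl//; ring.
  have mD : wmeas (D ^~ o : measurableTypeR R -> V) := jmeas_path o jD.
  have b1 := rip_young (D t o) z eta0.
  have := EFin_itg_le iD (fun s => rip_young (D s o) v eta0) _.
  have mp : measurable_fun (setT : set (measurableTypeR R))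
      (fun s => eta^-1 * sqnrm (D s o) + eta * sqnrm v).
    apply: measurable_funD => //; apply: measurable_funM => //.
    exact: (measurable_sqnrm hV sV mD).
  move=> /(_ mp); under eq_integral do rewrite EFinD EFinM.
  rewrite ge0_integralD//=; last 3 first.
  - by move=> s _; rewrite mule_ge0// ?lee_fin// sqnrm_ge0.
  - apply: measurable_funTS; apply: measurable_funeM.
    exact: emeasurable_sqnrm.
  - by move=> s _; rewrite lee_fin mulr_ge0// ltW.
  rewrite ge0_integralZl//; last 2 first.
  - by apply: measurable_funTS; exact: emeasurable_sqnrm.
  - by move=> s _; rewrite lee_fin sqnrm_ge0.
  rewrite integral_cst//= => b2.
  have b3 : (mu `[0%R, t] <= t%:E)%E.
    rewrite lebesgue_measure_itv/=; case: ifP => _; last by rewrite lee_fin.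
    by rewrite -EFinB subr0.
  apply: (@le_trans _ _ ((eta^-1 * sqnrm (D t o) + eta * sqnrm z)%:E +
     (eta^-1%:E * \int[mu]_(s in `[0%R, t]) (sqnrm (D s o))%:E + (eta * sqnrm v)%:E * t%:E))%E).
    apply: (@le_trans _ _ (`|rip (D t o) z|%:E + `|itg (fun s => rip (D s o) v) 0 t|%:E)%E).
      by rewrite -EFinD lee_fin ler_normB.
    apply: leeD; first by rewrite lee_fin.
    apply: (le_trans b2); apply: leeD => //; apply: lee_wpmul2l => //.
    by rewrite lee_fin mulr_ge0// ltW.
  rewrite EFinD -!addeA; apply: leeD => //.
  rewrite addeC -addeA addeC; apply: leeD => //.
  by rewrite -EFinM -EFinD lee_fin /K le_eqVlt; apply/orP; left; apply/eqP; ring.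
have h1 : (\int[P]_o `|W o|%:E <= \int[P]_o (eta^-1%:E * (sqnrm (D t o))%:E + (K%:E +
    eta^-1%:E * \int[mu]_(s in `[0%R, t]) (sqnrm (D s o))%:E)))%E.
  apply: ae_ge0_le_integral => //.
  - by apply/measurable_EFinP; exact: measurableT_comp.
  - move=> o _; rewrite !adde_ge0// ?mule_ge0// ?lee_fin// ?sqnrm_ge0//.
  - apply: emeasurable_funD; first exact: measurable_funeM.
    by apply: emeasurable_funD => //; exact: measurable_funeM.
  - by apply: filterS bnd => o + _.
apply: (le_trans h1).
rewrite ge0_integralD//; last 4 first.
- by move=> o _; rewrite mule_ge0// lee_fin// sqnrm_ge0.
- exact: measurable_funeM.
- by move=> o _; rewrite adde_ge0// mule_ge0.
- by apply: emeasurable_funD => //; exact: measurable_funeM.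
rewrite ge0_integralD//; last 2 first.
- by move=> o _; rewrite mule_ge0.
- exact: measurable_funeM.
rewrite integral_probability_cst !ge0_integralZl//; last first.
  by move=> o _; rewrite lee_fin sqnrm_ge0.
rewrite tonelli_path// -[X in (_ * X + _ <= _)%E]/(L2sq P (D t)).
apply: (@le_trans _ _ (eta^-1%:E * (eta ^+ 2)%:E + (K%:E + eta^-1%:E * (eta ^+ 2 * (t - 0))%:E))%E).
  apply: leeD; first by apply: lee_wpmul2l => //; exact: hLY.
  apply: leeD => //; apply: lee_wpmul2l => //.
  by apply: integral_L2sq_le => //; rewrite sqr_ge0.
rewrite -!EFinM -!EFinD lee_fin /K subr0.
have -> : eta^-1 * eta ^+ 2 + (eta * (sqnrm z + t * sqnrm v) + eta^-1 * (eta ^+ 2 * t)) = eta * A.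
  by rewrite /A; field; rewrite gt_eqF.
by rewrite /eta divfK// gt_eqF.
Qed.

End Processes.

(** * The weak identity and the stochastic integral of the noise *)

Section StochasticConvolutionProperties.
Variables (R : realType) (k : RorC) (Z X : ipSpace R k).
Hypotheses (hZ : hilbert Z) (sZ : separable Z) (hX : hilbert X) (sX : separable X).
Variables (d : measure_display) (Omega : measurableType d) (P : probability Omega R).
Variables (F : R -> set_system Omega) (Q : Z -> Z) (w : R -> Omega -> Z).
Hypotheses (uF : usual_filtration P F) (cQ : covariance_operator Q).
Hypothesis wW : wiener_process P F Q w.
Variables (S : R -> X -> X) (H : Z -> X).
Hypotheses (hS : C0_semigroup S) (Hb : bounded_linear H).
Local Notation mu := (@lebesgue_measure R).
Local Notation U := (unit_incr w).
Local Notation flow := (flow S).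
Local Notation HU := (fun o => H (U o)).
Local Notation conv_sum := (conv_sum w S H).

(** The term of cell [i] is an orbit started at time i h from the value [x i]; [flow_weak_shift] is
    its weak identity, and the starting values telescope to the whole increment. *)
Lemma conv_sum_weak (D : set X) (A : X -> X) (z v : X) (t : R) (N : nat) (o : Omega) :
  generates D A S -> adjoint_graph D A z v -> 0 < t ->
  itgable (fun r => rip (conv_sum (t / N.+1%:R) N.+1 false r o) v) 0 t /\
  rip (conv_sum (t / N.+1%:R) N.+1 false t o) z - rip (H (w t o - w 0 o)) z =
  itg (fun r => rip (conv_sum (t / N.+1%:R) N.+1 false r o) v) 0 t.
Proof.
move=> gS zv t0; set h := t / N.+1%:R.
have h0 : 0 < h by rewrite divr_gt0.
have ht : N.+1%:R * h = t by rewrite /h mulrC divfK.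
pose x (i : nat) : X := H (w (i.+1%:R * h) o - w (i%:R * h) o).
pose phi (i : nat) (r : R) := rip (flow (r - i%:R * h) (if `[< i%:R * h <= r >] then x i else 0)) v.
pose psi (i : nat) (r : R) := rip (flow (r - i%:R * h) (x i)) v.
have cE r : conv_sum h N.+1 false r o =
    \sum_(i < N.+1) flow (r - i%:R * h) (if `[< i%:R * h <= r >] then x i else 0).
  by rewrite (conv_sumE w S Hb); apply: eq_bigr => i _; rewrite addn0.
have ripE r : rip (conv_sum h N.+1 false r o) v = \sum_(i < N.+1) phi i r.
  by rewrite cE rip_suml.
have it (i : 'I_N.+1) : i%:R * h <= t.
  by rewrite -ht ler_pM2r// ler_nat ltnW.
have i0 (i : nat) : 0 <= i%:R * h by rewrite mulr_ge0// ltW.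
have psiI (i : 'I_N.+1) : itgable (psi i) (i%:R * h) t.
  apply: continuous_itgable => r.
  apply: (@continuous_comp _ _ _ (fun r => r - i%:R * h) (fun r => rip (flow r (x i)) v)).
    by apply: cvgB; [exact: cvg_id|exact: cvg_cst].
  exact: flow_continuous.
have patchE' (i : 'I_N.+1) : (EFin \o phi i) \_ `[0, t] = (EFin \o psi i) \_ `[i%:R * h, t].
  apply/funext => r; rewrite !patchE.
  case: ifPn; rewrite ?inE/= ?notin_setE/= in_itv/=.
    move=> /andP[r0 rt]; case: ifPn; rewrite ?inE/= ?notin_setE/= in_itv/=.
      by move=> /andP[ir _]; rewrite /phi asboolT.
    move=> /negP; rewrite rt andbT => ir.
    rewrite /phi asboolF; last exact/negP.
    by rewrite (bounded_linear0 (flow_bounded hS _)) rip0l.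
  move=> /negP h1; case: ifPn => //; rewrite inE/= in_itv/= => /andP[ir rt].
  by case: h1; rewrite rt andbT (le_trans (i0 i) ir).
have mI a b : measurable (`[a, b]%classic : set (measurableTypeR R)) by exact: measurable_itv.
have phiI (i : 'I_N.+1) : itgable (phi i) 0 t.
  apply/(integrable_mkcond _ (mI 0 t)); rewrite patchE'.
  exact: ((integrable_mkcond _ (mI (i%:R * h) t)).1 (psiI i)).
have phiE (i : 'I_N.+1) : itg (phi i) 0 t = itg (psi i) (i%:R * h) t.
  rewrite /itg /Rintegral integral_mkcond [in RHS]integral_mkcond.
  congr (fine _); apply: eq_integral => r _.
  exact: (congr1 (fun f => f r) (patchE' i)).
have sumI : itgable (fun r => rip (conv_sum h N.+1 false r o) v) 0 t.
  rewrite /itgable (_ : EFin \o _ = fun r => (\sum_(i < N.+1) (phi i r)%:E)%E).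
    by apply: (integrable_sum (mI 0 t)) => i _; exact: phiI.
  by apply/funext => r /=; rewrite ripE sumEFin.
split => //.
have -> : itg (fun r => rip (conv_sum h N.+1 false r o) v) 0 t = \sum_(i < N.+1) itg (phi i) 0 t.
  rewrite itgE; under [RHS]eq_bigr do rewrite itgE.
  rewrite -Rintegral_bigsum.
    by apply: eq_Rintegral => r _; rewrite ripE mulr_sumr.
  move=> i; have /(integrable_mkcond _ (mI 0 t)) := phiI i; congr (integrable _ _ _).
  apply/funext => r; rewrite patchE /= indicE; case: ifP => _; first by rewrite mul1r.
  by rewrite mul0r.
rewrite cE rip_suml//.
have -> : rip (H (w t o - w 0 o)) z = \sum_(i < N.+1) rip (x i) z.
  rewrite -rip_suml// /x -(bounded_linear_sum _ _ _ Hb); congr (rip (H _) z).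
  rewrite -(big_mkord xpredT (fun i => w (i.+1%:R * h) o - w (i%:R * h) o)).
  by rewrite (telescope_sumr (fun i : nat => w (i%:R * h) o))// mul0r ht.
rewrite -sumrB; apply: eq_bigr => i _; rewrite asboolT//.
by rewrite (flow_weak_shift hX gS zv (x i) (it i)) phiE.
Qed.

Variable T : R.
Hypothesis T0 : 0 < T.
Local Notation stoch_conv := (stoch_conv hZ sZ hX sX cQ wW hS Hb T0).
Local Notation approx := (approx hZ sZ hX sX cQ wW hS Hb T0).
Local Notation step := (step hZ sZ hX sX cQ wW hS Hb T0).
Local Notation mesh := (mesh hZ sZ hX sX cQ wW hS Hb T0).

Lemma stoch_conv_jmeas : jmeas stoch_conv.
Proof. exact: stoch_conv_wmeas. Qed.

Lemma stoch_conv_path : {ae P, forall o,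
  (\int[mu]_(s in `[0%R, T]) (sqnrm (stoch_conv s o))%:E < +oo)%E}.
Proof.
have [C hC] := stoch_conv_bounded hZ sZ hX sX uF cQ wW hS Hb T0.
exact: (ae_path_sqint hX sX (ltW T0) stoch_conv_jmeas hC).
Qed.

(** At time 0 no cell has ended, so that every approximation vanishes. *)
Lemma stoch_conv0 o : stoch_conv 0 o = 0.
Proof.
have h n : approx n 0 o = 0.
  rewrite /approx (conv_sumE w S Hb) big1// => i _; rewrite asboolF.
    by rewrite (bounded_linear0 (flow_bounded hS _)).
  apply/negP; rewrite -ltNge mulr_gt0//; last exact: step_gt0.
  by rewrite ltr0n addn1.
have f0 : (fast (fun n => approx n 0 o) < +oo)%E.
  rewrite /fast eseries0// => n _ _; by rewrite !h subrr sqnrm0// mulr0.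
have := flimP hX (f := fun n => approx n 0) f0.
rewrite /vcvg/= (_ : (fun i => nrm _) = fun=> nrm (- stoch_conv 0 o)); last first.
  by apply/funext => n; rewrite h sub0r.
move=> /(cvg_lim (@Rhausdorff R)); rewrite lim_cst//= nrmN//.
exact: nrm_eq0.
Qed.

Lemma stoch_conv_weak (D : set X) (A : X -> X) (z v : X) (t : R) :
  generates D A S -> adjoint_graph D A z v -> 0 <= t -> t <= T ->
  {ae P, forall o, rip (stoch_conv t o) z =
    rip (H (w t o)) z + itg (fun s => rip (stoch_conv s o) v) 0 t}.
Proof.
move=> gS zv; rewrite le_eqVlt => /orP[/eqP <- _|t0 tT].
  apply: filterS (wiener0 wW) => o w0.
  rewrite stoch_conv0 w0 (bounded_linear0 Hb) !rip0l// add0r /itg.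
  by rewrite set_itv1 Rintegral_set1.
have mc : measurable_fun setT (fun o => rip (H (w t o - w 0 o)) z).
  have := wmeas_bounded_linear hZ hX Hb (wiener_incr_wmeas hZ sZ wW (lexx 0) (ltW t0)).
  exact.
have fY : {ae P, forall o, (\int[mu]_(s in `[0%R, t]) (sqnrm (stoch_conv s o))%:E < +oo)%E}.
  apply: filterS stoch_conv_path => o; apply: le_lt_trans.
  apply: ge0_subset_integral => //.
  - apply: measurable_funTS; apply: emeasurable_sqnrm => //.
    exact: (jmeas_path o stoch_conv_jmeas).
  - by move=> s _; rewrite lee_fin sqnrm_ge0.
  - by apply: subset_itvl; rewrite bnd_simp.
have hh : {ae P, forall o, rip (stoch_conv t o) z =
    rip (H (w t o - w 0 o)) z + itg (fun s => rip (stoch_conv s o) v) 0 t}.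
  apply: (weak_identity_limit hX sX (ltW t0) stoch_conv_jmeas mc fY) => e e0.
  have [N hN] := stoch_conv_close hZ sZ hX sX uF cQ wW hS Hb T0 t0 tT e0.
  exists (conv_sum (t / N.+1%:R) N.+1 false); split => //.
  - by apply: (conv_sum_wmeas hZ sZ hX wW hS Hb); rewrite divr_gt0.
  - by move=> o; exact: conv_sum_weak gS zv t0.
have FF := ae_filter_ringOfSetsType P.
apply: (filterS2 _ _ (wiener0 wW) hh) => o w0.
by rewrite w0 subr0.
Qed.

Lemma conv_kernel_wmeas2 r :
  wmeas (fun p : Omega * measurableTypeR R => conv_kernel w S H r p.2 p.1).
Proof.
rewrite (_ : (fun p => _) = fun p : Omega * measurableTypeR R =>
    if `[< p.2 <= r >] then flow (r - p.2) (HU p.1) else 0); last first.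
  by apply/funext => p; rewrite asboolb.
apply: (@wmeas_if _ _ _ _ _ [set p : Omega * measurableTypeR R | p.2 <= r]).
- rewrite (_ : [set _ | _] = snd @^-1` `]-oo, r]%classic).
    by rewrite -[X in measurable X]setTI; apply: measurable_snd.
  by apply/seteqP; split=> p /=; rewrite in_itv.
- refine (wmeas_flow hX hS (tau := fun p : Omega * measurableTypeR R => r - p.2)
    (xi := fun p => HU p.1) _ _).
    by apply: measurable_funB => //; exact: measurable_snd.
  exact: (wmeas_comp (phi := fst) measurable_fst (HU_sqint hZ sZ hX sX cQ wW Hb).1).
- exact: wmeas_cst.
Qed.

Lemma measurable_L2sq_param (f : R -> Omega -> X) :
  wmeas (fun p : Omega * measurableTypeR R => f p.2 p.1) ->
  measurable_fun (setT : set (measurableTypeR R)) (fun s => L2sq P (f s)).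
Proof.
move=> mf; apply: (@measurable_integral_param R _ _ Omega (measurableTypeR R) P
  (fun p : Omega * measurableTypeR R => (sqnrm (f p.2 p.1))%:E)).
  exact: emeasurable_sqnrm.
by move=> z; rewrite lee_fin sqnrm_ge0.
Qed.

Lemma st_fun_bounded t (f : step_map Z X t) s : bounded_linear (st_fun f s).
Proof.
apply: (bounded_linear_big hX) => i; apply: bounded_linear_scale => //.
exact: st_bounded.
Qed.

Lemma kernel_op_bounded t s : s <= t -> bounded_linear (fun z => S (t - s) (H z)).
Proof.
by move=> st; apply: (bounded_linear_comp hX Hb (C0_bounded hS _)); rewrite subr_ge0.
Qed.

Lemma L20_kernel t (f : step_map Z X t) s : s <= t ->
  L20_sqnrm Q (fun z => st_fun f s z - S (t - s) (H z)) =
  L2sq P (fun o => st_fun f s (U o) - conv_kernel w S H t s o).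
Proof.
move=> st; rewrite (L20_sqnrmE hZ sZ cQ wW hX sX).
  rewrite /conv_kernel; congr (L2sq P _); apply/funext => o.
  by rewrite st flowE// subr_ge0.
apply: (bounded_linear_add hX (st_fun_bounded f s)).
exact: (bounded_linear_opp hX (kernel_op_bounded st)).
Qed.

Lemma st_fun_wmeas2 t (f : step_map Z X t) :
  wmeas (fun p : Omega * measurableTypeR R => st_fun f p.2 (U p.1)).
Proof.
apply: (wmeas_sum hX (index_enum 'I_(st_size f))
  (F := fun i (p : Omega * measurableTypeR R) =>
  ofR k (\1_(`]st_lo i, st_hi i]%classic) p.2) *: st_op i (U p.1))) => i.
apply: (wmeasZ hX (r := fun p : Omega * measurableTypeR R =>
   \1_(`]st_lo i, st_hi i]%classic) p.2)).
  by apply: measurableT_comp => //; exact: measurable_indic.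
exact: (wmeas_comp (phi := fst) (xi := fun o => st_op i (U o)) measurable_fst
  (incr_op_sqint hZ sZ cQ wW hX sX (st_bounded i) (lexx 0) ler01).1).
Qed.

Lemma st_integral_wmeas t (f : step_map Z X t) : wmeas (st_integral w f).
Proof.
apply: (wmeas_sum hX (index_enum 'I_(st_size f))
  (F := fun i o => st_op i (w (st_hi i) o - w (st_lo i) o))) => i.
apply: (wmeas_bounded_linear hZ hX (st_bounded i)).
by have [h1 h2 _] := st_bounds i; exact: (wiener_incr_wmeas hZ sZ wW).
Qed.

(** Two sequences of step maps approximating the same integrand approach each other, hence by
    [family_dist] so do their integrals in mean square. *)
Lemma stochastic_integral_unique t (I I' : Omega -> X) : 0 <= t ->
  stochastic_integral P Q w t (fun s z => S (t - s) (H z)) I ->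
  stochastic_integral P Q w t (fun s z => S (t - s) (H z)) I' ->
  {ae P, forall o, I o = I' o}.
Proof.
move=> t0 [mI [f [f1 f2]]] [mI' [g [g1 g2]]].
move/(random_elementP hX sX): mI => mI; move/(random_elementP hX sX): mI' => mI'.
have IE (h : step_map Z X t) : (\int[mu]_(s in `[0%R, t])
       L20_sqnrm Q (fun z => st_fun h s z - S (t - s) (H z))%R)%E =
    (\int[mu]_(s in `[0%R, t]) L2sq P (fun o => st_fun h s (U o) - conv_kernel w S H t s o)%R)%E.
  by apply: eq_integral => s; rewrite inE/= in_itv/= => /andP[_ st]; exact: L20_kernel.
rewrite (funext (fun j => IE (f j))) in f1; rewrite (funext (fun j => IE (g j))) in g1.
have mK (h : step_map Z X t) : wmeas (fun p : Omega * measurableTypeR R =>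
    st_fun h p.2 (U p.1) - conv_kernel w S H t p.2 p.1).
  by apply: wmeasB => //; [exact: st_fun_wmeas2|exact: conv_kernel_wmeas2].
suff : {ae P, forall o, I o - I' o = 0} by apply: filterS => o /eqP; rewrite subr_eq0 => /eqP.
apply: (L2sq0_ae hX sX); first exact: wmeasB.
apply/eqP; rewrite eq_le L2sq_ge0// andbT.
apply/lee_addgt0Pr => e e0; rewrite add0e.
(* The four errors enter the final bound with the factors 8, 8, 2 and 4, which add up to 22. *)
have e64 : 0 < e / 64 by rewrite divr_gt0.
have e64' : (0 < (e / 64)%:E :> \bar R)%E by rewrite lte_fin.
rewrite unlock in f2 g2.
have [n _ hn] := filterI (filterI (cvg_ereal_lt f1 e64') (cvg_ereal_lt g1 e64'))
  (filterI (cvg_ereal_lt f2 e64') (cvg_ereal_lt g2 e64')).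
have [[a1 a2] [a3 a4]] := hn n (leqnn n).
have mG (h : step_map Z X t) : measurable_fun (setT : set (measurableTypeR R))
    (fun s => L2sq P (fun o => st_fun h s (U o) - conv_kernel w S H t s o)%R).
  exact: (measurable_L2sq_param (f := fun s o =>
    st_fun h s (U o) - conv_kernel w S H t s o) (mK h)).
have a5 : (L2sq P (fun o => st_integral w (f n) o - st_integral w (g n) o)%R <= (e / 16)%:E)%E.
  pose G s := (2%:E * L2sq P (fun o => st_fun (f n) s (U o) - conv_kernel w S H t s o)%R +
    2%:E * L2sq P (fun o => st_fun (g n) s (U o) - conv_kernel w S H t s o)%R)%E.
  apply: (@le_trans _ _ (\int[mu]_(s in `[0%R, t]) G s)%E).
    apply: (family_dist hZ sZ hX sX uF cQ wW (I := 'I_(st_size (f n))) (J := 'I_(st_size (g n)))).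
    - exact: st_bounds.
    - exact: st_bounded.
    - exact: st_bounds.
    - exact: st_bounded.
    - by apply: emeasurable_funD; exact: measurable_funeM.
    - move=> s _ _.
      have m1 (h : step_map Z X t) : wmeas (fun o => st_fun h s (U o)).
        exact: (wmeas_comp (phi := fun o => (o, s)) (measurable_pair2 _) (st_fun_wmeas2 h)).
      have m2 := conv_kernel_wmeas hZ sZ hX sX cQ wW hS Hb t s.
      apply: (le_trans (L2sq_dist hX sX P (m1 (f n)) m2 (m1 (g n)))).
      by rewrite [X in (_ + _ * X <= _)%E]L2sqBC.
  rewrite ge0_integralD//; last 4 first.
  - by move=> s _; rewrite mule_ge0// L2sq_ge0.
  - by apply: measurable_funTS; exact: measurable_funeM.
  - by move=> s _; rewrite mule_ge0// L2sq_ge0.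
  - by apply: measurable_funTS; exact: measurable_funeM.
  rewrite !ge0_integralZl//; last 4 first.
  - exact: measurable_funTS.
  - by move=> s _; rewrite L2sq_ge0.
  - exact: measurable_funTS.
  - by move=> s _; rewrite L2sq_ge0.
  apply: (@le_trans _ _ (2%:E * (e / 64)%:E + 2%:E * (e / 64)%:E)%E).
    by apply: leeD; (apply: lee_wpmul2l; first by rewrite lee_fin); apply/ltW; [exact: a1|exact: a2].
  by rewrite -!EFinM -EFinD lee_fin; lra.
apply: (le_trans (L2sq_dist hX sX P mI (st_integral_wmeas (f n)) mI')).
apply: (@le_trans _ _ (2%:E * (e / 64)%:E +
    2%:E * (2%:E * (e / 16)%:E + 2%:E * (e / 64)%:E))%E).
  apply: leeD; apply: lee_wpmul2l => //; first by rewrite L2sqBC// ltW.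
  apply: (le_trans (L2sq_dist hX sX P (st_integral_wmeas (f n)) (st_integral_wmeas (g n)) mI')).
  by apply: leeD; apply: lee_wpmul2l => //; exact: ltW.
by rewrite -!(EFinM, EFinD) lee_fin; lra.
Qed.

(** The adapted Riemann sums at time [t] use only cells that end before [t]; they are integrals of
    step maps on [[0, t]], as the definition of the stochastic integral requires. *)
Lemma stoch_conv_integral t : 0 <= t -> t <= T ->
  stochastic_integral P Q w t (fun s z => S (t - s) (H z)) (stoch_conv t).
Proof.
move=> t0 tT; split; first by apply/(random_elementP hX sX); exact: stoch_conv_wmeas1.
have hb n (i : 'I_(mesh n).+1) : [/\ 0 <= conv_lo (step n) true t i,
    conv_lo (step n) true t i <= conv_hi (step n) true t i & conv_hi (step n) true t i <= t].
  have s0 : 0 < step n := step_gt0 _ _ _ _ _ _ _ _ _ n.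
  rewrite /conv_lo /conv_hi; case: ifP; last by [].
  rewrite /conv_on addn1 => it; split => //; first by rewrite mulr_ge0// ltW.
  by rewrite ler_pM2r// ler_nat.
have ob n (i : 'I_(mesh n).+1) : bounded_linear (conv_op S H (step n) t i).
  exact: conv_op_bounded.
pose f n : step_map Z X t := @StepMap R k Z X t (mesh n).+1
  (fun i => conv_lo (step n) true t i) (fun i => conv_hi (step n) true t i)
  (fun i => conv_op S H (step n) t i) (hb n) (ob n).
exists f; split; last first.
  have [C C0 hC] := approx_rate hZ sZ hX sX uF cQ wW hS Hb T0.
  rewrite unlock; apply: ge0_cvge0.
    by move=> n; exact: (L2sq_ge0 hX P).
  move=> e e0; have [N hN] := exp8_small C0 e0.
  exists N => // n /= Nn.
  apply: (le_trans (hC t n t0 tT)); rewrite lee_fin; apply: le_trans (ltW hN).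
  by rewrite ler_wpM2l// exp8_le.
have [M M1 fM] := flow_bound hX hS T.
have n0 : 0 <= noise_size P w H by exact: cov_self_ge0.
have M2 : 0 <= M ^+ 2 by rewrite sqr_ge0.
pose C : R := M ^+ 2 * t + 16 * (M ^+ 2 * noise_size P w H).
have C0 : 0 <= C by apply: addr_ge0; [exact: mulr_ge0|rewrite mulr_ge0// mulr_ge0].
apply: ge0_cvge0.
  move=> n; rewrite (_ : (\int[mu]_(s in _) _)%E = (\int[mu]_(s in `[0%R, t])
     L2sq P (fun o => st_fun (f n) s (U o) - conv_kernel w S H t s o)%R)%E).
    by apply: integral_ge0 => s _; exact: L2sq_ge0.
  by apply: eq_integral => s; rewrite inE/= in_itv/= => /andP[_ st]; exact: L20_kernel.
move=> e e0; have [N hN] := exp8_small C0 e0.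
exists N => // n /= Nn; have s0 : 0 < step n := step_gt0 _ _ _ _ _ _ _ _ _ n.
have p0 : 0 <= 8^-1 ^+ n :> R by rewrite exprn_ge0// invr_ge0.
apply: (@le_trans _ _ (\int[mu]_(s in `[0%R, t])
    (M ^+ 2 * 8^-1 ^+ n + 4 * M ^+ 2 * noise_size P w H *
     \sum_(p <- [:: ((t - step n), (t + step n)); (- step n, step n)])
       \1_(`[p.1, p.2]%classic) s)%:E)%E).
  rewrite (_ : (\int[mu]_(s in _) L20_sqnrm _ _)%E = (\int[mu]_(s in `[0%R, t])
     L2sq P (fun o => st_fun (f n) s (U o) - conv_kernel w S H t s o)%R)%E); last first.
    by apply: eq_integral => s; rewrite inE/= in_itv/= => /andP[_ st]; exact: L20_kernel.
  apply: ge0_le_integral => //.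
  - by move=> s _; exact: L2sq_ge0.
  - apply: measurable_funTS.
    apply: (measurable_L2sq_param (f := fun s o =>
      st_fun (f n) s (U o) - conv_kernel w S H t s o)).
    by apply: wmeasB => //; [exact: st_fun_wmeas2|exact: conv_kernel_wmeas2].
  - apply: measurable_funTS; apply/measurable_EFinP; apply: measurable_funD => //.
    by apply: measurable_funM => //; apply: measurable_sum => p; exact: measurable_indic.
  - move=> s /=; rewrite in_itv/= => /andP[s00 st].
    rewrite !big_cons big_nil addr0.
    apply: (conv_step_close hZ sZ hX sX cQ wW hS Hb M1 fM true s0 t0 _ tT s00 p0).
      by rewrite step_size.
    by move=> q q0 qs; exact: (step_noise q0 qs).
apply: (le_trans (integral_cst_indic t0 _ _ _)).
- by rewrite mulr_ge0.
- by rewrite -mulrA mulr_ge0//; exact: mulr_ge0.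
- by move=> p; rewrite !inE => /orP[/eqP ->|/eqP ->] /=; lra.
rewrite lee_fin !big_cons big_nil /=; apply: le_trans (ltW hN).
apply: (@le_trans _ _ (C * 8^-1 ^+ n)); last by rewrite ler_wpM2l// exp8_le.
have hs := step_le hZ sZ hX sX cQ wW hS Hb T0 n.
have h1 : (M ^+ 2 * noise_size P w H) * step n <= (M ^+ 2 * noise_size P w H) * 8^-1 ^+ n.
  by rewrite ler_wpM2l//; exact: mulr_ge0.
rewrite /C; move: h1; clear.
move: (8^-1 ^+ n) (step n) (noise_size _ _ _) (M ^+ 2) => p q r m; lra.
Qed.

End StochasticConvolutionProperties.

(** * The deterministic convolution *)

Section Triangle.
Variable R : realType.
Local Notation mu := (@lebesgue_measure R).
Local Notation RR := (measurableTypeR R * measurableTypeR R)%type.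

(** The bound on [k] is asked on the triangle only, so the kernel is cut off outside it before
    Fubini's theorem is applied on the plane; as a product of indicators the cut-off is visibly
    measurable. *)
Lemma itg_triangle (k : RR -> R) (b : R -> R) (tau : R) : measurable_fun setT k ->
  measurable_fun (setT : set (measurableTypeR R)) b -> (\int[mu]_s (b s)%:E < +oo)%E ->
  (forall s, 0 <= b s) -> 0 <= tau ->
  (forall s r, 0 <= s -> s <= r -> r <= tau -> `|k (s, r)| <= b s) ->
  [/\ itg (fun s => itg (fun r => k (s, r)) s tau) 0 tau =
      itg (fun r => itg (fun s => k (s, r)) 0 r) 0 tau,
      itgable (fun s => itg (fun r => k (s, r)) s tau) 0 tau &
      itgable (fun r => itg (fun s => k (s, r)) 0 r) 0 tau].
Proof.
move=> mk mb fb b0 tau0 kb.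
pose K (p : RR) : R := \1_(`[0, +oo[%classic) p.1 * \1_(`[0, +oo[%classic) (p.2 - p.1) *
  \1_(`]-oo, tau]%classic) p.2 * k p.
have mK : measurable_fun setT K.
  apply: measurable_funM => //; apply: measurable_funM.
    apply: measurable_funM.
      by apply: measurableT_comp; [exact: measurable_indic|exact: measurable_fst].
    apply: measurableT_comp; first exact: measurable_indic.
    by apply: measurable_funB; [exact: measurable_snd|exact: measurable_fst].
  by apply: measurableT_comp; [exact: measurable_indic|exact: measurable_snd].
have Kin s r : 0 <= s -> s <= r -> r <= tau -> K (s, r) = k (s, r).
  move=> s0 sr rt; rewrite /K /= !indicE !mem_set ?mul1r//= in_itv/= ?andbT//.
  by rewrite subr_ge0.
have Kout s r : ~ [/\ 0 <= s, s <= r & r <= tau] -> K (s, r) = 0.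
  move=> h; rewrite /K /= !indicE -!natrM !mulnb.
  rewrite (_ : (_ \in _) && _ && _ = false) ?mul0r//; apply/negP.
  move=> /andP[/andP[]]; rewrite !inE/= !in_itv/= !andbT subr_ge0 => *.
  exact: h.
have Kb s r : `|K (s, r)| <= \1_(`[0, tau]%classic) r * b s.
  have [[s0 sr rt]|h] := pselect [/\ 0 <= s, s <= r & r <= tau].
    rewrite Kin// indicE mem_set ?mul1r; first exact: kb.
    by rewrite /= in_itv/= rt (le_trans s0).
  by rewrite Kout// normr0 mulr_ge0.
have mK1 s : measurable_fun setT (fun r : measurableTypeR R => K (s, r)).
  by apply: measurableT_comp => //; exact: measurable_pair1.
have mK2 r : measurable_fun setT (fun s : measurableTypeR R => K (s, r)).
  by apply: measurableT_comp => //; exact: measurable_pair2.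
have I1 : (\int[mu]_r (\1_(`[0%R, tau]%classic) r)%:E <= tau%:E)%E.
  rewrite integral_indic//= setIT lebesgue_measure_itv/=; case: ifP => _.
    by rewrite -EFinB subr0.
  by rewrite lee_fin.
have m1 : measurable_fun setT (EFin \o (\1_(`[0, tau]%classic) : measurableTypeR R -> R)).
  by apply/measurable_EFinP; exact: measurable_indic.
have mbE : measurable_fun setT (EFin \o (b : measurableTypeR R -> R)) by exact/measurable_EFinP.
have kb1 s : (\int[mu]_r `|(K (s, r))%:E| <= (b s)%:E * tau%:E)%E.
  apply: le_trans (_ : \int[mu]_r ((b s)%:E * (\1_(`[0%R, tau]%classic) r)%:E) <= _)%E.
    apply: ge0_le_integral => //.
    - by apply: measurableT_comp => //; exact/measurable_EFinP.
    - exact: measurable_funeM.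
    - by move=> r _; rewrite -EFinM lee_fin mulrC.
  rewrite ge0_integralZl//; last by rewrite lee_fin.
  by apply: lee_wpmul2l => //; rewrite lee_fin.
have iK1 s : mu.-integrable setT (fun r => (K (s, r))%:E).
  apply/integrableP; split; first exact/measurable_EFinP.
  by apply: (le_lt_trans (kb1 s)); rewrite -EFinM ltry.
have iK2 r : mu.-integrable setT (fun s => (K (s, r))%:E).
  apply/integrableP; split; first exact/measurable_EFinP.
  apply: le_lt_trans fb; apply: ge0_le_integral => //.
  - by apply: measurableT_comp => //; exact/measurable_EFinP.
  - move=> s _; rewrite lee_fin (le_trans (Kb s r))// -[leRHS]mul1r ler_wpM2r//.
have mKE : measurable_fun setT (EFin \o K) by exact/measurable_EFinP.
have fK : (\int[mu]_s \int[mu]_r `|(EFin \o K) (s, r)| < +oo)%E.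
  apply: (@le_lt_trans _ _ (\int[mu]_s ((b s)%:E * tau%:E))%E); last first.
    rewrite ge0_integralZr//; last by move=> s _; rewrite lee_fin.
    by rewrite muleC lte_mul_pinfty// lee_fin.
  apply: ge0_le_integral => //.
  - by move=> s _; apply: integral_ge0 => r _; exact: abse_ge0.
  - apply: (@measurable_fun_fubini_tonelli_F _ _ _ _ R mu (abse \o (EFin \o K))).
      exact: measurableT_comp.
    by move=> z; exact: abse_ge0.
  - by under eq_fun do rewrite muleC; exact: measurable_funeM.
  - by move=> s _; exact: kb1.
have iK := (@integrable12ltyP _ _ (measurableTypeR R) (measurableTypeR R) R mu mu
  (EFin \o K) mKE).2 fK.
pose FF s := Rintegral mu setT (fun r => K (s, r)).
pose GG r := Rintegral mu setT (fun s => K (s, r)).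
have FFE s : ((FF s)%:E = \int[mu]_r (K (s, r))%:E)%E.
  by rewrite /FF /Rintegral fineK//; exact: integrable_fin_num (iK1 s).
have GGE r : ((GG r)%:E = \int[mu]_s (K (s, r))%:E)%E.
  by rewrite /GG /Rintegral fineK//; exact: integrable_fin_num (iK2 r).
have FFitg s : FF s = \1_(`[0, tau]%classic) s * itg (fun r => k (s, r)) s tau.
  rewrite indicE; case: (boolP (_ \in _)); rewrite ?inE ?notin_setE /= in_itv/=.
    move=> /andP[s0 st]; rewrite mul1r itgE; apply: eq_Rintegral => r _.
    rewrite indicE; case: (boolP (_ \in _)); rewrite ?inE ?notin_setE /= in_itv/=.
      by move=> /andP[sr rt]; rewrite mul1r Kin.
    by move=> h; rewrite mul0r Kout// => -[_ sr rt]; apply: h; rewrite sr rt.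
  move=> h; rewrite mul0r /FF /Rintegral integral0_eq// => r _.
  by rewrite Kout// => -[s0 sr rt]; apply: h; rewrite s0 (le_trans sr).
have GGitg r : GG r = \1_(`[0, tau]%classic) r * itg (fun s => k (s, r)) 0 r.
  rewrite indicE; case: (boolP (_ \in _)); rewrite ?inE ?notin_setE /= in_itv/=.
    move=> /andP[r0 rt]; rewrite mul1r itgE; apply: eq_Rintegral => s _.
    rewrite indicE; case: (boolP (_ \in _)); rewrite ?inE ?notin_setE /= in_itv/=.
      by move=> /andP[s0 sr]; rewrite mul1r Kin.
    by move=> h; rewrite mul0r Kout// => -[s0 sr _]; apply: h; rewrite s0 sr.
  move=> h; rewrite mul0r /GG /Rintegral integral0_eq// => s _.
  by rewrite Kout// => -[s0 sr rt]; apply: h; rewrite rt (le_trans s0).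
have mI : measurable (`[0, tau]%classic : set (measurableTypeR R)) by exact: measurable_itv.
have conv_int (f g : R -> R) : (forall s, f s = \1_(`[0, tau]%classic) s * g s) ->
    mu.-integrable setT (EFin \o f) -> itgable g 0 tau.
  move=> fg If; apply/(integrable_mkcond _ mI); move: If; congr (integrable _ _ _).
  apply/funext => s; rewrite patchE /= fg indicE; case: ifP => _; first by rewrite mul1r.
  by rewrite mul0r.
have iF : mu.-integrable setT (EFin \o FF).
  rewrite (_ : EFin \o FF = fun s => (\int[mu]_r (K (s, r))%:E)%E); last by apply/funext.
  exact: (integrable_fubini_F iK).
have iG : mu.-integrable setT (EFin \o GG).
  rewrite (_ : EFin \o GG = fun r => (\int[mu]_s (K (s, r))%:E)%E); last by apply/funext.
  pose K2 (p : RR) := K (p.2, p.1).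
  have mK2E : measurable_fun setT (EFin \o K2).
    by apply/measurable_EFinP; apply: measurableT_comp => //; exact: measurable_swap.
  have fK2 : (\int[mu]_r \int[mu]_s `|(EFin \o K2) (r, s)| < +oo)%E.
    rewrite -(@fubini_tonelli _ _ (measurableTypeR R) (measurableTypeR R) R mu mu
      (abse \o (EFin \o K)))//; first exact: measurableT_comp.
    by move=> p; exact: abse_ge0.
  have iK2' := (@integrable12ltyP _ _ (measurableTypeR R) (measurableTypeR R) R mu mu
    (EFin \o K2) mK2E).2 fK2.
  exact: (integrable_fubini_F iK2').
split; [|exact: conv_int FFitg iF|exact: conv_int GGitg iG].
rewrite [LHS]itgE [RHS]itgE.
rewrite (_ : (fun x => _ * _) = FF); last by apply/funext => s; rewrite FFitg.
rewrite [in RHS](_ : (fun x => _ * _) = GG); last by apply/funext => r; rewrite GGitg.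
rewrite /Rintegral; congr fine; rewrite (eq_integral _ _ (fun s _ => FFE s)).
rewrite [RHS](eq_integral _ _ (fun r _ => GGE r)).
exact: (Fubini iK).
Qed.

End Triangle.

Lemma ae_itg (R : realType) (phi psi : R -> R) (a b : R) : itgable phi a b -> itgable psi a b ->
  {ae (@lebesgue_measure R), forall s, a <= s <= b -> phi s = psi s} ->
  itg phi a b = itg psi a b.
Proof.
move=> i1 i2 h; have FF := ae_filter_ringOfSetsType (@lebesgue_measure R); rewrite /itg /Rintegral; congr fine.
apply: ae_eq_integral; [exact: measurable_itv|exact: measurable_int i1|exact: measurable_int i2|].
by apply: filterS h => s hs /=; rewrite in_itv/= => /hs ->.
Qed.

Section RestrictedPettis.
Variables (R : realType) (k : RorC) (X : ipSpace R k).
Hypotheses (hX : hilbert X) (sX : separable X).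
Local Notation mu := (@lebesgue_measure R).
Implicit Types g : R -> X.

Lemma vrestr_itgable g z a b : vintegrable mu (vrestr `[a, b] g) ->
  itgable (fun s => rip (g s) z) a b.
Proof.
move=> ig; apply/integrable_mkcond => //.
have := vintegrable_rip hX sX z ig; congr (integrable _ _ _).
apply/funext => s; rewrite patchE /= /vrestr; case: asboolP => h.
  by rewrite mem_set.
by rewrite memNset// rip0l.
Qed.

Lemma rip_pettis_vrestr g z a b : vintegrable mu (vrestr `[a, b] g) ->
  rip (pettis mu (vrestr `[a, b] g)) z = itg (fun s => rip (g s) z) a b.
Proof.
move=> ig; rewrite (pettisE hX sX z ig) itgE; apply: eq_Rintegral => s _.
rewrite /vrestr indicE; case: asboolP => h; first by rewrite mem_set// mul1r.
by rewrite memNset// rip0l// mul0r.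
Qed.

Lemma vrestr_wmeas g (a b : R) : wmeas (g : measurableTypeR R -> X) ->
  wmeas (vrestr `[a, b] g : measurableTypeR R -> X).
Proof.
move=> mg; apply: (@wmeas_if _ _ _ _ _ (`[a, b]%classic : set (measurableTypeR R))) => //.
Qed.

Lemma vrestr_vintegrable g (a b : R) : vintegrable mu g -> vintegrable mu (vrestr `[a, b] g).
Proof.
move=> [mg fg]; apply: (vintegrable_le hX sX (T := measurableTypeR R) (mu := mu) (f := fun s => nrm (g s))) => //.
- exact: vrestr_wmeas.
- exact: measurable_nrm.
- by move=> s; rewrite /vrestr; case: asboolP => // _; rewrite nrm0// nrm_ge0.
Qed.

End RestrictedPettis.

(** * Convolution and primitive of a single path *)

Section PathConvolution.
Variables (R : realType) (k : RorC) (X : ipSpace R k).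
Hypotheses (hX : hilbert X) (sX : separable X).
Variables (S : R -> X -> X) (D : set X) (A : X -> X).
Hypothesis gS : generates D A S.
Local Notation mu := (@lebesgue_measure R).
Local Notation flow := (flow S).
Let hS : C0_semigroup S := gS.1.

Definition dconv (g : R -> X) (t : R) : X :=
  pettis mu (vrestr `[0, t] (fun s => flow (t - s) (g s))).

Definition prim (g : R -> X) (t : R) : X := pettis mu (vrestr `[0, t] g).

Variable g : R -> X.
Hypothesis ig : vintegrable mu g.

Let mg : wmeas (g : measurableTypeR R -> X) := ig.1.
Let mng : measurable_fun (setT : set (measurableTypeR R)) (fun s => nrm (g s)) :=
  measurable_nrm hX sX mg.

Lemma dconv_wmeas t : wmeas (fun s : measurableTypeR R => flow (t - s) (g s)).
Proof.
apply: (wmeas_flow hX hS (tau := fun s : measurableTypeR R => t - s) (xi := g)) => //.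
exact: measurable_funB.
Qed.

Lemma dconv_vintegrable t :
  vintegrable mu (vrestr `[0, t] (fun s => flow (t - s) (g s))).
Proof.
have [M M1 fM] := flow_bound hX hS t.
have M0 : 0 <= M by exact: le_trans M1.
apply: (vintegrable_le hX sX (T := measurableTypeR R) (mu := mu) (f := fun s => M * nrm (g s))).
- by apply: vrestr_wmeas => //; exact: dconv_wmeas.
- exact: measurable_funM.
- under eq_integral do rewrite EFinM.
  rewrite ge0_integralZl//; last 2 first.
  + exact/measurable_EFinP.
  + by move=> s _; rewrite lee_fin nrm_ge0.
  by rewrite lte_mul_pinfty// ig.2.
- move=> s; rewrite /vrestr; case: asboolP => [|_]; last by rewrite nrm0// mulr_ge0// nrm_ge0.
  by rewrite /= in_itv/= => /andP[s0 _]; apply: fM; rewrite gerBl.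
Qed.

Lemma dconv_rip t z : rip (dconv g t) z = itg (fun s => rip (flow (t - s) (g s)) z) 0 t.
Proof. exact: rip_pettis_vrestr (dconv_vintegrable t). Qed.

Lemma prim_rip t z : rip (prim g t) z = itg (fun s => rip (g s) z) 0 t.
Proof. by apply: rip_pettis_vrestr => //; exact: vrestr_vintegrable. Qed.

Lemma dconv_bound (Tm M : R) : 1 <= M -> (forall t x, t <= Tm -> nrm (flow t x) <= M * nrm x) ->
  forall t, t <= Tm -> nrm (dconv g t) <= M * fine (\int[mu]_s (nrm (g s))%:E)%E.
Proof.
move=> M1 fM t tT; have M0 : 0 <= M by exact: le_trans M1.
apply: (le_trans (nrm_pettis hX sX (dconv_vintegrable t))).
have f1 : (\int[mu]_s (nrm (g s))%:E)%E \is a fin_num.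
  by rewrite ge0_fin_numE ?ig.2//; apply: integral_ge0 => s _; rewrite lee_fin nrm_ge0.
have le1 : (\int[mu]_x (nrm (vrestr `[0, t]%classic (fun s => flow (t - s)%R (g s)) x))%:E <=
    M%:E * \int[mu]_s (nrm (g s))%:E)%E.
  rewrite -ge0_integralZl//; last 2 first.
  - exact/measurable_EFinP.
  - by move=> s _; rewrite lee_fin nrm_ge0.
  apply: ge0_le_integral => //.
  - by move=> s _; rewrite lee_fin nrm_ge0.
  - by apply/measurable_EFinP; apply: measurable_nrm => //; exact: (dconv_vintegrable t).1.
  - by apply: measurable_funeM; exact/measurable_EFinP.
  - move=> s _; rewrite -EFinM lee_fin /vrestr; case: asboolP => [|_]; last first.
      by rewrite nrm0// mulr_ge0// nrm_ge0.
    by rewrite /= in_itv/= => /andP[s0 _]; apply: fM; rewrite (le_trans _ tT)// gerBl.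
rewrite -[M]/(fine M%:E) -fineM// fine_le//; first last.
  by rewrite fin_numM.
rewrite ge0_fin_numE ?(dconv_vintegrable t).2//.
by apply: integral_ge0 => s _; rewrite lee_fin nrm_ge0.
Qed.

Lemma scaled_nrm_fin (c : R) : 0 <= c -> (\int[mu]_s (c * nrm (g s))%:E < +oo)%E.
Proof.
move=> c0; under eq_integral do rewrite EFinM.
rewrite ge0_integralZl//.
- by rewrite lte_mul_pinfty// ?lee_fin// ig.2.
- exact/measurable_EFinP.
- by move=> s _; rewrite lee_fin nrm_ge0.
Qed.

Lemma prim_itgable z tau : 0 <= tau -> itgable (fun t => rip (prim g t) z) 0 tau.
Proof.
move=> tau0; pose k1 (p : measurableTypeR R * measurableTypeR R) := rip (g p.1) z.
have mk1 : measurable_fun setT k1 := wmeas_comp (phi := fst) measurable_fst mg z.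
have mb : measurable_fun (setT : set (measurableTypeR R)) (fun s => nrm z * nrm (g s)).
  exact: measurable_funM.
have [||_ _] := itg_triangle mk1 mb (scaled_nrm_fin (nrm_ge0 z)) _ tau0.
- by move=> s; rewrite mulr_ge0// nrm_ge0.
- by move=> s r _ _ _; rewrite mulrC; exact: cauchy_schwarz.
by congr itgable; apply/funext => r; rewrite prim_rip.
Qed.

Lemma dconv_weak z v t : adjoint_graph D A z v -> 0 <= t ->
  itgable (fun r => rip (dconv g r) v) 0 t /\
  rip (dconv g t) z = itg (fun s => rip (g s) z) 0 t + itg (fun r => rip (dconv g r) v) 0 t.
Proof.
move=> zv t0; have [M M1 fM] := flow_bound hX hS t.
have M0 : 0 <= M by exact: le_trans M1.
pose kk (p : measurableTypeR R * measurableTypeR R) := rip (flow (p.2 - p.1) (g p.1)) v.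
pose b s := M * nrm v * nrm (g s).
have mkk : measurable_fun setT kk.
  apply: (wmeas_flow hX hS (tau := fun p : measurableTypeR R * measurableTypeR R => p.2 - p.1)
    (xi := fun p => g p.1)).
    by apply: measurable_funB; [exact: measurable_snd|exact: measurable_fst].
  exact: (wmeas_comp (phi := fst) measurable_fst mg).
have fb : (\int[mu]_s (b s)%:E < +oo)%E by apply: scaled_nrm_fin; rewrite mulr_ge0// nrm_ge0.
have b0 s : 0 <= b s by rewrite !mulr_ge0// nrm_ge0.
have kb s r : 0 <= s -> s <= r -> r <= t -> `|kk (s, r)| <= b s.
  move=> s0 sr rt; apply: (le_trans (cauchy_schwarz hX _ _)).
  rewrite /b mulrAC ler_wpM2r ?nrm_ge0//; apply: fM.
  by rewrite (le_trans _ rt)// gerBl.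
have mb : measurable_fun (setT : set (measurableTypeR R)) b by exact: measurable_funM.
have [e1 i1 i2] := itg_triangle mkk mb fb b0 t0 kb.
have e2 : (fun r => itg (fun s => kk (s, r)) 0 r) = fun r => rip (dconv g r) v.
  by apply/funext => r; rewrite dconv_rip.
rewrite e2 in e1 i2; split => //.
rewrite -e1 dconv_rip -itgD//; last first.
  by apply: vrestr_itgable => //; exact: vrestr_vintegrable.
apply: eq_itg => s /andP[s0 st].
by have := flow_weak_shift hX gS zv (g s) st; rewrite /kk /= => <-; rewrite [RHS]addrC subrK.
Qed.

(* Both sides of the hypothesis integrate to the same double integral over a
   triangle, except for the last term. *)
Lemma prim_uniqueness z tau : 0 <= tau ->
  {ae mu, forall t, 0 <= t <= tau -> itg (fun r => rip (flow r (g t)) z) 0 (tau - t) =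
     rip (flow (tau - t) (prim g t) - prim g t) z} ->
  itg (fun t => rip (prim g t) z) 0 tau = 0.
Proof.
move=> tau0 hyp; have [M M1 fM] := flow_bound hX hS tau.
have M0 : 0 <= M by exact: le_trans M1.
pose kk (p : measurableTypeR R * measurableTypeR R) := rip (flow (tau - p.2) (g p.1)) z.
pose b s := M * nrm z * nrm (g s).
have mkk : measurable_fun setT kk.
  apply: (wmeas_flow hX hS (tau := fun p : measurableTypeR R * measurableTypeR R => tau - p.2)
    (xi := fun p => g p.1)).
    by apply: measurable_funB => //; exact: measurable_snd.
  exact: (wmeas_comp (phi := fst) measurable_fst mg).
have fb : (\int[mu]_s (b s)%:E < +oo)%E by apply: scaled_nrm_fin; rewrite mulr_ge0// nrm_ge0.
have b0 s : 0 <= b s by rewrite !mulr_ge0// nrm_ge0.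
have kb s r : 0 <= s -> s <= r -> r <= tau -> `|kk (s, r)| <= b s.
  move=> s0 sr rt; apply: (le_trans (cauchy_schwarz hX _ _)).
  rewrite /b mulrAC ler_wpM2r ?nrm_ge0//; apply: fM.
  by rewrite gerBl (le_trans s0).
have mb : measurable_fun (setT : set (measurableTypeR R)) b by exact: measurable_funM.
have [e1 i1 i2] := itg_triangle mkk mb fb b0 tau0 kb.
have i3 := prim_itgable z tau0.
(* The rows of the triangle give, after a reflection, the left-hand side of the hypothesis; by [eR]
   its columns give the first term of the right-hand side. *)
have eL s : itg (fun r => kk (s, r)) s tau = itg (fun r => rip (flow r (g s)) z) 0 (tau - s).
  rewrite /kk /= (@itg_reflect _ (fun r => rip (flow r (g s)) z)); first by rewrite subrr.
  apply: (wmeas_flow hX hS (tau := fun r : measurableTypeR R => r) (xi := fun=> g s)) => //.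
have eR r : itg (fun s => kk (s, r)) 0 r = rip (flow (tau - r) (prim g r)) z.
  rewrite (rip_adjoint hX hX _ _ (flow_bounded hS _)) prim_rip.
  by apply: eq_itg => s _; rewrite /kk /= (rip_adjoint hX hX _ _ (flow_bounded hS _)).
rewrite (funext eR) in e1 i2; rewrite (funext eL) in e1 i1.
have : itg (fun s => itg (fun r => rip (flow r (g s)) z) 0 (tau - s)) 0 tau =
    itg (fun t => rip (flow (tau - t) (prim g t)) z - rip (prim g t) z) 0 tau.
  apply: ae_itg => //.
    have mI : measurable (`[0, tau]%classic : set (measurableTypeR R)) by exact: measurable_itv.
    have := integrableB mI i2 i3; congr (integrable _ _ _).
  have FF := ae_filter_ringOfSetsType mu.
  by apply: filterS hyp => t ht /ht ->; rewrite ripBl.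
by rewrite itgB// e1; lra.
Qed.

(** Dominated convergence of the restricted integrands: beyond [t] they are eventually 0, before [t]
    the orbit is continuous, and the point [t] itself is null. *)
Lemma dconv_vcvg (t : R) (u : nat -> R) (Tm : R) : (forall n, u n <= Tm) -> t <= Tm ->
  u @ \oo --> t -> vcvg (fun n => dconv g (u n)) (dconv g t).
Proof.
move=> uT tT ut; have [M M1 fM] := flow_bound hX hS Tm.
have M0 : 0 <= M by exact: le_trans M1.
pose K r := vrestr `[0, r] (fun s => flow (r - s) (g s)).
have Kb r s : r <= Tm -> nrm (K r s) <= M * nrm (g s).
  move=> rT; rewrite /K /vrestr; case: asboolP => [|_]; last first.
    by rewrite nrm0// mulr_ge0// nrm_ge0.
  by rewrite /= in_itv/= => /andP[s0 _]; apply: fM; rewrite (le_trans _ rT)// gerBl.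
have mK r : wmeas (K r : measurableTypeR R -> X) := (dconv_vintegrable r).1.
have FF := ae_filter_ringOfSetsType mu.
have net : {ae mu, forall s, s != t}.
  exists [set t]; split => //; first exact: lebesgue_measure_set1.
  by move=> s /= /negP; rewrite negbK => /eqP.
pose f_ n (s : measurableTypeR R) : \bar R := (nrm (K (u n) s - K t s))%:E.
pose h (s : measurableTypeR R) : \bar R := (2 * M * nrm (g s))%:E.
have mf n : measurable_fun setT (f_ n).
  by apply/measurable_EFinP; apply: measurable_nrm => //; apply: wmeasB => //; exact: mK.
have cf : {ae mu, forall s, setT s -> f_ ^~ s @ \oo --> (cst 0%E : measurableTypeR R -> \bar R) s}.
  apply: filterS net => s st _.
  suff : (fun n => nrm (K (u n) s - K t s)) @ \oo --> (0 : R).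
    by move=> c; apply/fine_cvgP; split; [exact: nearW|exact: c].
  have [s0|s0] := ltP s 0.
    have z r : K r s = 0.
      by rewrite /K /vrestr asboolF//= in_itv/= => /andP[]; rewrite leNgt s0.
    under eq_fun do rewrite !z subrr nrm0//.
    exact: cvg_cst.
  have [ts|] := ltP t s.
    have e0 : 0 < s - t by rewrite subr_gt0.
    move/cvgrPdist_lt : ut => /(_ _ e0) un.
    apply/cvgrPdist_lt => e ep; apply: filterS un => n /= un.
    have zt : K t s = 0.
      by rewrite /K /vrestr asboolF//= in_itv/= => /andP[_]; rewrite leNgt ts.
    have zn : K (u n) s = 0.
      rewrite /K /vrestr asboolF//= in_itv/= => /andP[_]; apply/negP; rewrite -ltNge.
      by move: un; rewrite ltr_norml => /andP[un _]; lra.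
    by rewrite zt zn subrr nrm0// subr0 normr0.
  rewrite le_eqVlt (negbTE st)/= => lst.
  have e0 : 0 < t - s by rewrite subr_gt0.
  have us : (fun n => u n - s) @ \oo --> t - s by apply: cvgB => //; exact: cvg_cst.
  have := flow_vcvg hX hS (g s) us => cv.
  move/cvgrPdist_lt : ut => /(_ _ e0) un.
  apply/cvgrPdist_lt => e ep; move/cvgrPdist_lt : cv => /(_ _ ep) cv.
  apply: filterS2 un cv => n /= un.
  have zt : K t s = flow (t - s) (g s).
    by rewrite /K /vrestr asboolT//= in_itv/= s0 ltW.
  have zn : K (u n) s = flow (u n - s) (g s).
    rewrite /K /vrestr asboolT//= in_itv/= s0/=.
    by move: un; rewrite ltr_norml => /andP[_ un]; lra.
  by rewrite zt zn.
have ih : mu.-integrable setT h.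
  apply/integrableP; split; first by apply/measurable_EFinP; exact: measurable_funM.
  under eq_integral do rewrite /h /= ger0_norm ?mulr_ge0 ?nrm_ge0//.
  by apply: scaled_nrm_fin; rewrite mulr_ge0.
have fh : {ae mu, forall s n, setT s -> (`|f_ n s| <= h s)%E}.
  apply: filterE => s n _; rewrite /f_ /h /= lee_fin ger0_norm ?nrm_ge0//.
  rewrite (le_trans (nrmD hX _ _))// nrmN//.
  have := Kb (u n) s (uT n); have := Kb t s tT.
  move: (nrm (K _ _)) (nrm (K t s)) (nrm (g s)) => x y q; lra.
have mc : measurable_fun (setT : set (measurableTypeR R)) (cst 0%E : measurableTypeR R -> \bar R).
  exact: measurable_cst.
have [_ _ I0] := dominated_convergence measurableT mf mc cf ih fh.
rewrite integral0 in I0.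
apply/cvgrPdist_lt => e ep.
have ep' : (0 < e%:E :> \bar R)%E by rewrite lte_fin.
apply: filterS (cvg_ereal_lt I0 ep') => n hn.
rewrite sub0r normrN ger0_norm ?nrm_ge0// -lte_fin; apply: le_lt_trans hn.
rewrite /dconv -(pettisB hX sX (dconv_vintegrable _) (dconv_vintegrable _)).
apply: EFin_nrm_pettis => //.
by apply: vintegrableB => //; exact: dconv_vintegrable.
Qed.

(** The means of a continuous function over short intervals to the left of [tau] vanish. A sequence
    of interval lengths is used because only countably many null sets can be discarded. *)
Lemma prim_left_zero z tau : 0 < tau ->
  itg (fun t => rip (prim g t) z) 0 tau = 0 ->
  (forall n : nat, n.+1%:R^-1 < tau ->
    itg (fun t => rip (prim g t) z) 0 (tau - n.+1%:R^-1) = 0) ->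
  rip (prim g tau) z = 0.
Proof.
move=> tau0 h0 hn.
pose psi t := rip (prim g t) z.
have ipsi : itgable psi 0 tau by apply: prim_itgable; exact: ltW.
have cpsi : psi x @[x --> tau^'-] --> psi tau.
  have iphi : mu.-integrable `[0, tau] (EFin \o (fun s => rip (g s) z)).
    by apply: vrestr_itgable => //; exact: vrestr_vintegrable.
  have /(continuous_within_itvP _ tau0) [_ _] := parameterized_integral_continuous (ltW tau0) iphi.
  have e x : parameterized_integral mu 0 x (fun s => rip (g s) z) = psi x by rewrite /psi prim_rip.
  by rewrite (funext e) e.
apply/eqP; rewrite -normr_le0; apply/ler_addgt0Pr => e e0; rewrite add0r.
move/cvgrPdist_le : cpsi => /(_ _ e0) [dl /= dl0 hdl].
have m0 : 0 < Num.min dl tau by rewrite lt_min dl0.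
have [n hm] := ltr_add_invr m0; rewrite add0r lt_min in hm.
have [n1 n2] := andP hm.
have p0 : 0 < n.+1%:R^-1 :> R by rewrite invr_gt0.
move: n1 n2 (hn n); move: p0; set c : R := n.+1%:R^-1 => p0 n1 n2 /(_ n2) hc.
have a0 : 0 <= tau - c by rewrite subr_ge0 ltW.
have at_ : tau - c <= tau by rewrite gerBl ltW.
have z1 : itg psi (tau - c) tau = 0.
  by have := itg_add a0 at_ ipsi; rewrite h0 hc add0r.
have i1 : itgable psi (tau - c) tau by apply: itgableW ipsi.
have := @itg_near_cst _ psi (tau - c) tau (psi tau) e at_ i1.
rewrite z1 sub0r normrN opprB addrCA subrr addr0 normrM (gtr0_norm p0) mulrC.
rewrite ler_pM2r//; apply => s /andP[s1 s2].
move: s2; rewrite le_eqVlt => /orP[/eqP ->|s2]; first by rewrite subrr normr0 ltW.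
rewrite distrC; apply: hdl => //=.
by rewrite ger0_norm ?subr_ge0 ?ltW//; lra.
Qed.

End PathConvolution.

(** * Versions of the forcing *)

Section RegularVersion.
Variables (R : realType) (k : RorC) (V : ipSpace R k).
Hypotheses (hV : hilbert V) (sV : separable V).
Variables (T T1 : R).
Hypotheses (T0 : 0 <= T) (TT1 : T <= T1).
Variables (d : measure_display) (Om : measurableType d) (N : set Om) (mN : measurable N).
Variables u u' : R -> Om -> V.
Hypothesis der : forall o, ~ N o -> forall t, 0 <= t <= T1 ->
  (fun h => nrm (ofR k h^-1 *: (u (t + h) o - u t o) - u' t o))
    @ within [set h | 0 <= t + h <= T1] 0^' --> (0 : R).
Hypothesis mu : forall t, 0 <= t -> t <= T -> wmeas (u t).

Lemma derivative_near o t (e : R) : ~ N o -> 0 <= t -> t <= T1 -> 0 < e ->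
  exists2 dl, 0 < dl & forall h, h != 0 -> `|h| < dl -> 0 <= t + h -> t + h <= T1 ->
    nrm (ofR k h^-1 *: (u (t + h) o - u t o) - u' t o) < e.
Proof.
move=> No t0 tT e0; have := der No (t := t); rewrite t0 tT => /(_ isT).
move=> /cvgrPdist_lt /(_ _ e0) [dl /= dl0 hdl]; exists dl => // h h0 hd th0 thT.
have := hdl h; rewrite /= sub0r normrN => /(_ hd h0); rewrite th0 thT => /(_ isT).
by rewrite sub0r normrN ger0_norm ?nrm_ge0.
Qed.

Lemma path_continuous o s (a : nat -> R) : ~ N o -> 0 <= s -> s <= T1 ->
  (forall n, 0 <= a n /\ a n <= T1) -> a @ \oo --> s ->
  vcvg (fun n => u (a n) o) (u s o).
Proof.
move=> No s0 sT ha as_; have [dl dl0 hdl] := derivative_near No s0 sT ltr01.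
apply/cvgrPdist_lt => e e0.
pose c : R := 1 + nrm (u' s o).
have c0 : 0 < c by rewrite ltr_pwDl// nrm_ge0.
have m0 : 0 < Num.min dl (e / c) by rewrite lt_min dl0 divr_gt0.
move/cvgrPdist_lt : as_ => /(_ _ m0); apply: filterS => n /=.
rewrite lt_min distrC => /andP[n1 n2].
rewrite sub0r normrN ger0_norm ?nrm_ge0//.
have [->|hne] := eqVneq (a n) s; first by rewrite subrr nrm0.
have h0 : a n - s != 0 by rewrite subr_eq0.
have [an0 anT] := ha n.
have sa : s + (a n - s) = a n by rewrite addrC subrK.
have := hdl _ h0 n1; rewrite sa => /(_ an0 anT) b.
have b2 : nrm (ofR k (a n - s)^-1 *: (u (a n) o - u s o)) < c.
  have := nrmD hV (ofR k (a n - s)^-1 *: (u (a n) o - u s o) - u' s o) (u' s o).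
  rewrite subrK => b3; apply: (le_lt_trans b3); rewrite /c ltrD2r; exact: b.
rewrite nrmZ// normfV in b2.
rewrite ltr_pdivrMl ?normr_gt0// in b2.
apply: (lt_trans b2); by rewrite -ltr_pdivlMr.
Qed.

(** The cut is at [T], while the derivative is controlled on [[0, T1]]: with an earlier time t in
    place of [T] and [F t] as sigma-algebra, the same construction yields progressive
    measurability. *)
Definition reg s o : V := if `[< (0 <= s <= T) /\ ~ N o >] then u s o else 0.
(* On (0, T] the derivative is a limit of backward difference quotients, and
   hence depends on the past only. *)
Definition reg' s o : V := if `[< (0 < s <= T) /\ ~ N o >] then u' s o else 0.

Lemma measurable_strip (i : interval R) :
  measurable [set p : measurableTypeR R * Om | [set` i] p.1 /\ ~ N p.2].
Proof.
rewrite (_ : [set _ | _] = fst @^-1` [set` i] `&` snd @^-1` (~` N)).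
  apply: measurableI.
    rewrite -[X in measurable X]setTI; apply: measurable_fst => //; exact: measurable_itv.
  rewrite -[X in measurable X]setTI; apply: measurable_snd => //; exact: measurableC.
by apply/seteqP; split.
Qed.

(** Off [N] the paths are continuous, so the values at lattice points approximate them. The points
    are taken to the left, which keeps them inside [[0, T]]. *)
Lemma reg_jmeas : jmeas reg.
Proof.
have n1 n : 0 < n.+1%:R :> R by rewrite ltr0n.
pose m n (p : measurableTypeR R * Om) := Num.truncn (pos p.1 * n.+1%:R).
pose t n (j : nat) : R := j%:R / n.+1%:R.
pose C := [set p : measurableTypeR R * Om | [set` `[0, T]] p.1 /\ ~ N p.2].
pose g n j (p : measurableTypeR R * Om) : V :=
  if `[< C p >] then (if t n j <= T then u (t n j) p.2 else 0) else 0.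
have mg n j : wmeas (g n j).
  apply: (@wmeas_if _ _ _ _ _ C); first exact: measurable_strip.
    case: (boolP (t n j <= T)) => h; last exact: wmeas_cst.
    apply: (wmeas_comp (phi := snd) (xi := u (t n j)) measurable_snd); apply: mu => //.
    by rewrite divr_ge0.
  exact: wmeas_cst.
apply: (wmeas_cvg hV (F := fun n p => g n (m n p) p)) => [n z|p].
  apply: (@measurable_nat_index _ _ _ (fun j p => rip (g n j p) z)) => j; first exact: mg.
  apply: measurable_truncn; last by move=> y; rewrite mulr_ge0// le_max lexx orbT.
  apply: measurable_funM => //; apply: measurable_maxr => //; exact: measurable_fst.
have [Cp|Cp] := pselect (C p); last first.
  rewrite /vcvg /reg asboolF; last first.
    by move=> [h1 h2]; apply: Cp; split => //=; rewrite in_itv.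
  rewrite (_ : (fun i => _) = fun=> 0); first exact: cvg_cst.
  by apply/funext => n; rewrite /g asboolF// subrr nrm0.
have [/= Cp1 Np] := Cp; move: (Cp1); rewrite /= in_itv/= => /andP[p0 pT].
rewrite /reg asboolT; last by rewrite p0 pT.
have pp : pos p.1 = p.1 by rewrite pos_id.
have tr n : 0 <= t n (m n p) /\ t n (m n p) <= p.1 /\ p.1 <= t n (m n p) + n.+1%:R^-1.
  have q0 : 0 <= pos p.1 * n.+1%:R by rewrite mulr_ge0// pos_ge0.
  have /andP[h1 h2] := truncn_itv q0; rewrite -/(m n p) pp in h1 h2.
  split; first by rewrite divr_ge0.
  split; first by rewrite /t ler_pdivrMr.
  rewrite /t -[X in _ + X]mul1r -mulrDl ler_pdivlMr// natr1.
  exact: ltW.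
rewrite (_ : (fun n => g n (m n p) p) = fun n => u (t n (m n p)) p.2); last first.
  apply/funext => n; rewrite /g asboolT//; have [_ [h _]] := tr n.
  by rewrite (le_trans h pT).
apply: path_continuous => //; first exact: le_trans TT1.
  move=> n; have [h0 [h _]] := tr n; split => //.
  by rewrite (le_trans h)// (le_trans pT).
apply/cvgrPdist_le => e e0; have [n0 hn0] := ltr_add_invr e0; rewrite add0r in hn0.
exists n0 => // n /= Nn; have [_ [h1 h2]] := tr n.
rewrite ger0_norm ?subr_ge0// lerBlDl (le_trans h2)// lerD2l.
by apply: ltW; apply: le_lt_trans hn0; rewrite lef_pV2 ?posrE// ler_nat ltnS.
Qed.

Lemma reg'_jmeas : jmeas reg'.
Proof.
pose C := [set p : measurableTypeR R * Om | [set` `]0, T]] p.1 /\ ~ N p.2].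
pose G n (p : measurableTypeR R * Om) : V := if `[< C p >] then
  ofR k n.+1%:R *: (reg p.1 p.2 - reg (p.1 - n.+1%:R^-1) p.2) else 0.
apply: (wmeas_cvg hV (F := G)) => [n|p].
  apply: (@wmeas_if _ _ _ _ _ C); first exact: measurable_strip.
    apply: (wmeasZ hV (r := fun=> n.+1%:R)) => //; apply: wmeasB => //; first exact: reg_jmeas.
    apply: (wmeas_comp (phi := fun p : measurableTypeR R * Om => (p.1 - n.+1%:R^-1, p.2))
      (xi := fun p : measurableTypeR R * Om => reg p.1 p.2)); last exact: reg_jmeas.
    apply/measurable_fun_pairP; split => /=; last exact: measurable_snd.
    by apply: measurable_funB => //; exact: measurable_fst.
  exact: wmeas_cst.
have [Cp|Cp] := pselect (C p); last first.
  rewrite /vcvg /reg' asboolF; last first.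
    by move=> [h1 h2]; apply: Cp; split => //=; rewrite in_itv.
  rewrite (_ : (fun i => _) = fun=> 0); first exact: cvg_cst.
  by apply/funext => n; rewrite /G asboolF// subrr nrm0.
have [/= Cp1 Np] := Cp; move: (Cp1); rewrite /= in_itv/= => /andP[p0 pT].
rewrite /reg' asboolT; last by rewrite p0 pT.
apply/cvgrPdist_lt => e e0.
have [dl dl0 hdl] := derivative_near Np (ltW p0) (le_trans pT TT1) e0.
have m0 : 0 < Num.min dl p.1 by rewrite lt_min dl0.
have [n0 hn0] := ltr_add_invr m0; rewrite add0r lt_min in hn0; have [n1 n2] := andP hn0.
exists n0 => // n /= Nn.
have nn : n.+1%:R^-1 <= n0.+1%:R^-1 :> R by rewrite lef_pV2 ?posrE// ler_nat ltnS.
have c0 : 0 < n.+1%:R^-1 :> R by rewrite invr_gt0.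
rewrite sub0r normrN ger0_norm ?nrm_ge0// /G asboolT// /reg asboolT; last first.
  by rewrite (ltW p0) pT.
have q0 : 0 <= p.1 - n.+1%:R^-1 by rewrite subr_ge0 (le_trans nn)// ltW.
have qT : p.1 - n.+1%:R^-1 <= T by rewrite (le_trans _ pT)// gerBl ltW.
rewrite asboolT; last by rewrite q0 qT.
have := hdl (- n.+1%:R^-1).
rewrite oppr_eq0 gt_eqF// normrN gtr0_norm// => /(_ isT (le_lt_trans nn n1) q0).
move=> /(_ (le_trans qT TT1)); rewrite invrN invrK ofRN scaleNr -scalerN opprB.
exact.
Qed.

Variables (X : ipSpace R k) (L1 L2 : V -> X).
Hypotheses (hX : hilbert X) (L1b : bounded_linear L1) (L2b : bounded_linear L2).

Definition forcing s o : X :=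
  if `[< (0 < s <= T) /\ ~ N o >] then L1 (u s o) - L2 (u' s o) else 0.

Lemma forcingE s o : forcing s o =
  if `[< (0 < s <= T) /\ ~ N o >] then L1 (reg s o) - L2 (reg' s o) else 0.
Proof.
rewrite /forcing; case: asboolP => // -[/andP[s0 sT] No].
by rewrite /reg /reg' !asboolT// ?s0 ?sT ?(ltW s0).
Qed.

Lemma forcing_jmeas : jmeas forcing.
Proof.
rewrite /jmeas (funext (fun p => forcingE p.1 p.2)).
rewrite (_ : (fun p => _) = fun p : measurableTypeR R * Om =>
  if `[< [set p : measurableTypeR R * Om | [set` `]0, T]] p.1 /\ ~ N p.2] p >]
  then L1 (reg p.1 p.2) - L2 (reg' p.1 p.2) else 0); last first.
  by apply/funext => p; congr (if asbool _ then _ else _); rewrite /= in_itv.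
apply: (@wmeas_if _ _ _ _ _ _); first exact: measurable_strip.
  apply: wmeasB => //; apply: wmeas_bounded_linear => //; [exact: reg_jmeas|exact: reg'_jmeas].
exact: wmeas_cst.
Qed.

End RegularVersion.

(** * The second moment of a Gaussian random element *)

Section Gaussian.
Variables (R : realType) (k : RorC) (V : ipSpace R k).
Hypotheses (hV : hilbert V) (sV : separable V).
Variables (d : measure_display) (Omega : measurableType d) (P : probability Omega R).

(** By Bessel's inequality finite sums of squared coordinates are dominated by the finite random
    variable [sqnrm (xi o)]; [gaussian_squares_bounded] then bounds the sums of squared means and
    variances uniformly, and Parseval's identity adds up the moments. *)
Lemma gaussian_sqint (xi : Omega -> V) : gaussian P xi -> sqint P xi.
Proof.
move=> [rx gx]; have mx : wmeas xi by exact/(random_elementP hV sV).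
split => //; have [[D e] /= onb] := separable_onb hV sV.
have [C hC] := gaussian_squares_bounded P (measurable_sqnrm hV sV mx).
pose e' i := if `[< D i >] then e i else 0.
have abs2E i o : `[< D i >] -> abs2 (ip (xi o) (e i)) =
    rip (xi o) (e' i) ^+ 2 + rip (xi o) (iK *: e' i) ^+ 2.
  by move=> Di; rewrite /e' Di /abs2 imK_ip.
have bessel (N : nat) o : \sum_(i < N | `[< D i >]) abs2 (ip (xi o) (e i)) <= sqnrm (xi o).
  have := parseval_series hV onb (xi o) => h.
  rewrite -lee_fin -h -sumEFin -(big_mkord (fun i => `[< D i >])
    (fun i => (abs2 (ip (xi o) (e i)))%:E)).
  apply: nneseries_lim_ge => i _ _; by rewrite lee_fin abs2_ge0.
have part (N : nat) (f : nat -> V) : (forall o, \sum_(i < N) rip (xi o) (f i) ^+ 2 <= sqnrm (xi o)) ->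
    (\sum_(i < N) \int[P]_o (rip (xi o) (f i) ^+ 2)%:E <= (16 * C)%:E)%E.
  move=> hf; have [ms hms] : exists ms : nat -> R * R, forall i,
      real_gaussian P (fun o => rip (xi o) (f i)) (ms i).1 (ms i).2.
    have h i : exists p : R * R, real_gaussian P (fun o => rip (xi o) (f i)) p.1 p.2.
      by have [m [s ms]] := gx (f i); exists (m, s).
    by have [ms hms] := choice h; exists ms.
  have := hC N (fun i o => rip (xi o) (f i)) (fun i => (ms i).1) (fun i => (ms i).2)
    (fun i => hms i) hf => h.
  apply: (@le_trans _ _ (\sum_(i < N) (16 * ((ms i).1 ^+ 2 + (ms i).2 ^+ 2))%:E)%E).
    by apply: lee_sum => i _; exact: gaussian_moment_le (hms i).
  by rewrite sumEFin lee_fin -mulr_sumr ler_pM2l.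
rewrite (L2sq_parseval hV P onb mx).
(* The bound 16 C, once for the real and once for the imaginary parts of the coordinates. *)
apply: (@le_lt_trans _ _ (32 * C)%:E); last by rewrite ltry.
apply: lime_le; first by apply: is_cvg_nneseries => i _ _; apply: integral_ge0 => o _;
  rewrite lee_fin abs2_ge0.
apply: nearW => N; rewrite big_mkord.
have sq_le (o : Omega) : \sum_(i < N) (rip (xi o) (e' i) ^+ 2 + rip (xi o) (iK *: e' i) ^+ 2) <= sqnrm (xi o).
  apply: le_trans (bessel N o); rewrite [leRHS]big_mkcond/=; apply: ler_sum => i _.
  case: ifPn => Di; first by rewrite abs2E.
  by rewrite /e' (negbTE Di) scaler0 rip0r// expr0n addr0.
have p1 := part N e' (fun o => le_trans (ler_sum _ (fun i _ => _)) (sq_le o)).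
have {}p1 : (\sum_(i < N) \int[P]_o (rip (xi o) (e' i) ^+ 2)%:E <= (16 * C)%:E)%E.
  by apply: p1 => o i; rewrite lerDl sqr_ge0.
have p2 : (\sum_(i < N) \int[P]_o (rip (xi o) (iK *: e' i) ^+ 2)%:E <= (16 * C)%:E)%E.
  apply: (part N (fun i => iK *: e' i)) => o; apply: le_trans (sq_le o).
  by apply: ler_sum => i _; rewrite lerDr sqr_ge0.
apply: (@le_trans _ _ (\sum_(i < N) (\int[P]_o (rip (xi o) (e' i) ^+ 2)%:E +
   \int[P]_o (rip (xi o) (iK *: e' i) ^+ 2)%:E))%E).
  rewrite big_mkcond/=; apply: lee_sum => i _; case: ifPn => Di.
    rewrite -ge0_integralD//.
    - by rewrite le_eqVlt; apply/orP; left; apply/eqP; apply: eq_integral => o _; rewrite abs2E.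
    - by move=> o _; rewrite lee_fin sqr_ge0.
    - by apply/measurable_EFinP; apply: measurable_funX; exact: mx.
    - by move=> o _; rewrite lee_fin sqr_ge0.
    - by apply/measurable_EFinP; apply: measurable_funX; exact: mx.
  by rewrite adde_ge0//; apply: integral_ge0 => o _; rewrite lee_fin sqr_ge0.
rewrite big_split/=; apply: (le_trans (leeD p1 p2)).
by rewrite -EFinD lee_fin; lra.
Qed.

End Gaussian.

(** * Uniqueness *)

Section Negligible.
Variables (R : realType) (k : RorC) (V : ipSpace R k).
Hypotheses (hV : hilbert V) (sV : separable V).
Variables (d : measure_display) (Omega : measurableType d) (P : probability Omega R).

Lemma sigma_random_element (G : set_system Omega) (xi : Omega -> V) : sigma_algebra setT G ->
  random_element G xi <-> @wmeas R k V _ (g_sigma_algebraType G) xi.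
Proof.
move=> sG; have e : @measurable _ (g_sigma_algebraType G) = G by exact: sigma_algebra_id.
split.
  by move=> h; apply/(wmeas_borel hV sV) => U bU; rewrite e; exact: h.
by move=> /(wmeas_borel hV sV) h U bU; rewrite -e; exact: h.
Qed.

Lemma sigma_measurable : sigma_algebra setT (@measurable _ Omega).
Proof.
split; first exact: measurable0.
  by move=> A mA; rewrite setTD; exact: measurableC.
by move=> A mA; exact: bigcup_measurable.
Qed.

(** The two differ on a null set, all of whose subsets belong to [G]. This is how measurability and
    adaptedness pass to modifications. *)
Lemma ae_random_element (G : set_system Omega) (xi eta : Omega -> V) :
  sigma_algebra setT G -> P.-negligible `<=` G -> {ae P, forall o, xi o = eta o} ->
  random_element G eta -> random_element G xi.
Proof.
move=> sG nG xe re U bU; pose A := ~` [set o | xi o = eta o].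
have nA : P.-negligible A by exact: xe.
have e : @measurable _ (g_sigma_algebraType G) = G by exact: sigma_algebra_id.
have GA : @measurable _ (g_sigma_algebraType G) A by rewrite e; exact: nG.
have GE : @measurable _ (g_sigma_algebraType G) (eta @^-1` U) by rewrite e; exact: re.
have GX : @measurable _ (g_sigma_algebraType G) (xi @^-1` U `&` A).
  rewrite e; apply: nG; case: nA => B [mB B0 AB]; exists B; split => //.
  by move=> o [_ Ao]; exact: AB.
suff -> : xi @^-1` U = (eta @^-1` U `&` ~` A) `|` (xi @^-1` U `&` A).
  by rewrite -e; apply: measurableU => //; apply: measurableI => //; exact: measurableC.
apply/seteqP; split=> o /=.
  move=> Uo; have [h|h] := pselect (xi o = eta o); last by right.
  by left; rewrite -h; split => //; rewrite /A /= => /(_ h).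
by move=> [[Uo /contrapT /= ->]|[]].
Qed.

End Negligible.

Lemma vintegrable_of_sq (R : realType) (k : RorC) (V : ipSpace R k) (T : R) (h : R -> V) :
  hilbert V -> separable V -> wmeas (h : measurableTypeR R -> V) ->
  (forall s, ~ (0 <= s <= T) -> h s = 0) ->
  (\int[@lebesgue_measure R]_(s in `[0%R, T]) (sqnrm (h s))%:E < +oo)%E ->
  vintegrable (@lebesgue_measure R) h.
Proof.
move=> hV sV mh h0 fh; split => //.
have mI : measurable (`[0, T]%classic : set (measurableTypeR R)) by exact: measurable_itv.
apply: (@le_lt_trans _ _ (\int[@lebesgue_measure R]_(s in `[0%R, T]) (1%:E + (sqnrm (h s))%:E))%E).
  rewrite [leRHS]integral_mkcond; apply: ge0_le_integral => //.
  - by move=> s _; rewrite lee_fin nrm_ge0.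
  - by apply/measurable_EFinP; exact: measurable_nrm.
  - apply/(measurable_restrictT _ mI); apply: emeasurable_funD => //.
    by apply: measurable_funTS; exact: emeasurable_sqnrm.
  - move=> s _; rewrite patchE; case: ifPn.
      rewrite -EFinD lee_fin -(nrm_sqr hV) => _; move: (nrm_ge0 (h s)).
      by move: (nrm (h s)) => x; nra.
    by rewrite notin_setE /= in_itv/= => /negP/negP sI; rewrite h0 ?nrm0//; exact/negP.
rewrite ge0_integralD//; last 2 first.
- by move=> s _; rewrite lee_fin sqnrm_ge0.
- by apply: measurable_funTS; exact: emeasurable_sqnrm.
rewrite lte_add_pinfty// integral_cst//= mul1e lebesgue_measure_itv/=.
by case: ifP => // _; rewrite -EFinB ltry.
Qed.

(** * Vanishing of the difference of two weak solutions *)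

Section Uniqueness.
Variables (R : realType) (k : RorC) (X : ipSpace R k).
Hypotheses (hX : hilbert X) (sX : separable X).
Variables (S : R -> X -> X) (Dom : set X) (A : X -> X).
Hypothesis gS : generates Dom A S.
Variables (d : measure_display) (Omega : measurableType d) (P : probability Omega R).
Local Notation mu := (@lebesgue_measure R).
Local Notation flow := (flow S).
Let hS : C0_semigroup S := gS.1.
Variables (T : R) (D : R -> Omega -> X).
Hypotheses (jD : jmeas D) (iD : forall o, vintegrable mu (D ^~ o)).
Hypothesis wD : forall z v, adjoint_graph Dom A z v -> forall t, 0 <= t -> t <= T ->
  {ae P, forall o, rip (D t o) z = itg (fun s => rip (D s o) v) 0 t}.
Local Notation RO := (measurableTypeR R * Omega)%type.
Local Notation prim o t := (prim (D ^~ o) t).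

Lemma prim_jmeas : wmeas (fun p : RO => prim p.2 p.1).
Proof.
pose G (q : measurableTypeR R * RO) : X :=
  if `[< [set q : measurableTypeR R * RO | 0 <= q.1 /\ 0 <= q.2.1 - q.1] q >] then D q.1 q.2.2 else 0.
have mG : wmeas G.
  apply: (@wmeas_if _ _ _ _ _ _).
  - rewrite (_ : [set _ | _] = fst @^-1` `[0, +oo[%classic `&`
        (fun q : measurableTypeR R * RO => q.2.1 - q.1) @^-1` `[0, +oo[%classic); last first.
      by apply/seteqP; split=> q /=; rewrite !in_itv/= !andbT.
    apply: measurableI; rewrite -[X in measurable X]setTI.
      by apply: measurable_fst.
    have mf : measurable_fun setT (fun q : measurableTypeR R * RO => q.2.1 - q.1).
      apply: measurable_funB; last exact: measurable_fst.
      by apply: measurableT_comp; [exact: measurable_fst|exact: measurable_snd].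
    exact: mf.
  - apply: (wmeas_comp (phi := fun q : measurableTypeR R * RO => (q.1, q.2.2))
      (xi := fun p : RO => D p.1 p.2)); last exact: jD.
    apply/measurable_fun_pairP; split => /=; first exact: measurable_fst.
    exact: (measurableT_comp measurable_snd measurable_snd).
  - exact: wmeas_cst.
have e (p : RO) : (fun s => G (s, p)) = vrestr `[0, p.1] (D ^~ p.2).
  apply/funext => s; rewrite /G /vrestr /=; congr (if asbool _ then _ else _).
  by apply/propext; rewrite in_itv/= subr_ge0; split => [[-> ->]|/andP[]].
have := @wmeas_pettis R _ _ (measurableTypeR R) RO mu k X hX sX G mG.
move=> h; have {}h := h _.
rewrite (_ : (fun p : RO => prim p.2 p.1) = fun p => pettis mu (fun s => G (s, p))).
  by apply: h => p; rewrite e; exact: vrestr_vintegrable.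
by apply/funext => p; rewrite e.
Qed.

(** The test vector depends on [t], and so does the null set on which the identity fails; [ae_swap]
    exchanges the quantifiers before [prim_uniqueness] is used path by path. *)
Lemma ae_prim_zero z tau : 0 <= tau -> tau <= T ->
  {ae P, forall o, itg (fun t => rip (prim o t) z) 0 tau = 0}.
Proof.
move=> tau0 tauT.
pose B := [set p : RO | `[0, tau]%classic p.1].
pose h (p : RO) : R := \1_(`[0, tau]%classic) p.1 *
  (itg (fun r => rip (flow r (D p.1 p.2)) z) 0 (tau - p.1) -
   rip (flow (tau - p.1) (prim p.2 p.1) - prim p.2 p.1) z).
have mh : measurable_fun setT h.
  apply: measurable_funM.
    by apply: measurableT_comp; [exact: measurable_indic|exact: measurable_fst].
  apply: measurable_funB; last first.
    apply: wmeasB => //; last exact: prim_jmeas.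
    apply: (wmeas_flow hX hS (tau := fun p : RO => tau - p.1) (xi := fun p : RO => prim p.2 p.1)).
      by apply: measurable_funB => //; exact: measurable_fst.
    exact: prim_jmeas.
  under eq_fun do rewrite itgE.
  pose K (q : measurableTypeR R * RO) : R := \1_(`[0, +oo[%classic) q.1 *
    \1_(`[0, +oo[%classic) (tau - q.2.1 - q.1) * rip (flow q.1 (D q.2.1 q.2.2)) z.
  have mK : measurable_fun setT K.
    apply: measurable_funM; last first.
      apply: (wmeas_flow hX hS (tau := fun q : measurableTypeR R * RO => q.1)
        (xi := fun q => D q.2.1 q.2.2)); first exact: measurable_fst.
      exact: (wmeas_comp (phi := snd) measurable_snd jD).
    apply: measurable_funM.
      by apply: measurableT_comp; [exact: measurable_indic|exact: measurable_fst].
    apply: measurableT_comp; first exact: measurable_indic.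
    apply: measurable_funB; last exact: measurable_fst.
    apply: measurable_funB => //.
    by apply: measurableT_comp; [exact: measurable_fst|exact: measurable_snd].
  have := @measurable_Rintegral_param R _ _ (measurableTypeR R) RO mu K mK.
  congr measurable_fun; apply/funext => p; apply: eq_Rintegral => r _.
  rewrite /K /= !indicE -natrM mulnb; congr (_%:R * _); congr nat_of_bool.
  apply/andP/idP; rewrite !inE/= !in_itv/= !andbT subr_ge0; first by move=> [-> ->].
  by move=> /andP[].
have hz t : {ae P, forall o, h (t, o) = 0}.
  have FF := ae_filter_ringOfSetsType P.
  have [/andP[t0 tt]|nt] := boolP (0 <= t <= tau); last first.
    apply: filterE => o; rewrite /h /= indicE memNset ?mul0r//= in_itv/=.
    exact/negP.
  have ht : 0 <= tau - t by rewrite subr_ge0.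
  have [zeta hzeta] := flow_integral_adjoint hX gS z ht.
  have ag := adjoint_graph_integral hX gS ht hzeta.
  have tT : t <= T by exact: le_trans tauT.
  apply: filterS (wD ag t0 tT) => o; rewrite hzeta => e.
  rewrite /h /= e -(prim_rip hX sX (iD o)).
  rewrite ripBr// -(rip_adjoint hX hX _ _ (flow_bounded hS _)) -ripBl// subrr mulr0.
  by [].
have := @ae_swap R _ _ (measurableTypeR R) Omega mu P h mh hz.
apply: filterS => o ho.
apply: (prim_uniqueness hX sX gS (iD o) tau0).
have FF := ae_filter_ringOfSetsType mu.
apply: filterS ho => t; rewrite /h /= => + /andP[t0 tt].
rewrite indicE mem_set/= ?in_itv/= ?t0// mul1r => /eqP.
by rewrite subr_eq0 => /eqP.
Qed.

Lemma ae_prim_rip_zero z tau : 0 <= tau -> tau <= T -> {ae P, forall o, rip (prim o tau) z = 0}.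
Proof.
rewrite le_eqVlt => /orP[/eqP <- _|tau0 tauT].
  have FF := ae_filter_ringOfSetsType P; apply: filterE => o.
  by rewrite (prim_rip hX sX (iD o)) /itg set_itv1 Rintegral_set1.
have h1 := ae_prim_zero z (ltW tau0) tauT.
have h2 : {ae P, forall o, forall n : nat, n.+1%:R^-1 < tau ->
    itg (fun t => rip (prim o t) z) 0 (tau - n.+1%:R^-1) = 0}.
  apply/ae_foralln => n; have [nt|nt] := ltP n.+1%:R^-1 tau; last first.
    have FF := ae_filter_ringOfSetsType P; exact: filterE.
  have c0 : 0 < n.+1%:R^-1 :> R by rewrite invr_gt0.
  have := @ae_prim_zero z (tau - n.+1%:R^-1).
  rewrite subr_ge0 (ltW nt) => /(_ isT) h0.
  have h : tau - n.+1%:R^-1 <= tau by rewrite gerBl ltW.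
  have {}h := h0 (le_trans h tauT).
  by apply: filterS h => o.
have FF := ae_filter_ringOfSetsType P.
apply: (filterS2 _ _ h1 h2) => o; exact: (prim_left_zero hX sX (iD o) tau0).
Qed.

(** Since the primitive vanishes, the identity with the test vector averaged over [0, 1/(n+1)] says
    that the mean of the orbit of [D t o] over this interval is orthogonal to [z]; letting n grow
    gives [rip (D t o) z = 0] for every [z]. A countable total family then leaves a single null
    set. *)
Lemma weak_zero t : 0 <= t -> t <= T -> {ae P, forall o, D t o = 0}.
Proof.
move=> t0 tT; have FF := ae_filter_ringOfSetsType P.
have key z : {ae P, forall o, rip (D t o) z = 0}.
  have hn (n : nat) : {ae P, forall o, itg (fun s => rip (flow s (D t o)) z) 0 n.+1%:R^-1 = 0}.
    have c0 : 0 <= n.+1%:R^-1 :> R by rewrite invr_ge0.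
    have [zeta hzeta] := flow_integral_adjoint hX gS z c0.
    have ag := adjoint_graph_integral hX gS c0 hzeta.
    have := ae_prim_rip_zero (adjoint (flow n.+1%:R^-1) z - z) t0 tT => h.
    apply: (filterS2 _ _ (wD ag t0 tT) h) => o; rewrite hzeta => ->.
    by rewrite (prim_rip hX sX (iD o)).
  have /ae_foralln := hn; apply: filterS => o ho.
  apply/eqP; rewrite -normr_le0; apply/ler_addgt0Pr => e e0; rewrite add0r.
  have := @flow_continuous _ _ _ hX _ hS (D t o) z 0 => /cvgrPdist_le /(_ _ e0) [dl /= dl0 hdl].
  have [n hd] := ltr_add_invr dl0; rewrite add0r in hd.
  have c0 : 0 < n.+1%:R^-1 :> R by rewrite invr_gt0.
  move: c0 hd (ho n); set c : R := n.+1%:R^-1 => c0 hd hc.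
  have := @itg_near_cst _ (fun s => rip (flow s (D t o)) z) 0 c (rip (D t o) z) e (ltW c0)
    (flow_itgable hX gS _ _ _ _).
  rewrite hc subr0 sub0r normrN normrM (gtr0_norm c0) mulrC ler_pM2r//; apply => s /andP[s0 sc].
  have := hdl s; rewrite /= sub0r normrN ger0_norm// (flow0 hS)// distrC.
  by apply; exact: le_lt_trans hd.
have [e te] := separable_total hX sX.
have h : {ae P, forall o, forall n : nat, rip (D t o) (e n) = 0 /\ rip (D t o) (iK *: e n) = 0}.
  apply/ae_foralln => n.
  by apply: (filterS2 _ _ (key (e n)) (key (iK *: e n))).
apply: filterS h => o ho; apply: te => n; have [h1 h2] := ho n.
by apply: scal_eq; rewrite ?reK0 ?imK0 ?imK_ip//.
Qed.

End Uniqueness.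

(* A process [g] with the measurability that integrals along paths and
   adaptedness of the solution require, indistinguishable on (0, T] from the
   forcing [f], whose derivative term need not have it. *)
Record regular_forcing (R : realType) (k : RorC) (X : ipSpace R k)
    (d : measure_display) (Omega : measurableType d) (P : probability Omega R)
    (F : R -> set_system Omega) (T : R) (f g : R -> Omega -> X) : Prop := {
  forcing_measurable : jmeas g ;
  forcing_progressive : forall t, 0 <= t -> t <= T ->
    @jmeas R k X _ (g_sigma_algebraType (F t)) (fun s o => if `[< s <= t >] then g s o else 0) ;
  forcing_support : forall s o, ~ (0 <= s <= T) -> g s o = 0 ;
  forcing_path : forall o,
    (\int[@lebesgue_measure R]_(s in `[0%R, T]) (sqnrm (g s o))%:E < +oo)%E ;
  forcing_moment : exists C, forall s, 0 <= s -> s <= T -> (L2sq P (g s) <= C%:E)%E ;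
  forcing_ae : {ae P, forall o, forall s, 0 < s <= T -> f s o = g s o} }.

(** * Construction of the regular version *)

Section Forcing.
Variables (R : realType) (k : RorC) (V X : ipSpace R k).
Hypotheses (hV : hilbert V) (sV : separable V) (hX : hilbert X) (sX : separable X).
Variables (d : measure_display) (Omega : measurableType d) (P : probability Omega R).
Variables (F : R -> set_system Omega) (T : R).
Hypotheses (uF : usual_filtration P F) (T0 : 0 < T).
Local Notation mu := (@lebesgue_measure R).

Lemma filtration_measurable t (E : set Omega) : 0 <= t ->
  @measurable _ (g_sigma_algebraType (F t)) E <-> F t E.
Proof.
move=> t0; have -> : @measurable _ (g_sigma_algebraType (F t)) = F t.
  by apply: sigma_algebra_id; exact: filtration_sigma uF _ t0.
by [].
Qed.

Lemma filtration_wmeas (W : ipSpace R k) s t (xi : Omega -> W) : hilbert W -> separable W ->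
  0 <= s -> s <= t -> random_element (F s) xi -> @wmeas R k W _ (g_sigma_algebraType (F t)) xi.
Proof.
move=> hW sW s0 st rx; apply/(wmeas_borel hW sW) => U bU.
apply/filtration_measurable; first exact: le_trans st.
by apply: (filtration_mono uF s0 st); exact: rx.
Qed.

Lemma filtration_wmeas_sub (W : ipSpace R k) t (xi : Omega -> W) : hilbert W -> separable W ->
  0 <= t -> @wmeas R k W _ (g_sigma_algebraType (F t)) xi -> wmeas xi.
Proof.
move=> hW sW t0 /(wmeas_borel hW sW) mx; apply/(wmeas_borel hW sW) => U bU.
by apply: (filtration_sub uF t0); apply/(filtration_measurable _ t0); exact: mx.
Qed.

Lemma negligible_cover (A : set Omega) : P.-negligible A ->
  exists N, [/\ A `<=` N, measurable N, P.-negligible N & forall t, 0 <= t -> F t N].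
Proof.
move=> [N [mN N0 AN]]; have nN : P.-negligible N by exists N; split.
exists N; split => // t t0; apply: (filtration_mono uF (lexx 0) t0).
exact: (filtration_null uF).
Qed.

Lemma L2sq_bounded_continuous (v : R -> Omega -> V) :
  (forall t, 0 <= t <= T -> (L2sq P (v t) < +oo)%E) ->
  {within `[0, T], continuous (fun t => fine (L2sq P (v t)))} ->
  exists2 C, 0 <= C & forall t, 0 <= t -> t <= T -> (L2sq P (v t) <= C%:E)%E.
Proof.
move=> fv cv; have [c cI hc] := EVT_max (ltW T0) cv.
exists (fine (L2sq P (v c))); first by rewrite fine_ge0//; exact: L2sq_ge0.
move=> t t0 tT; have tI : t \in `[0, T] by rewrite in_itv/= t0.
rewrite -(@fineK _ (L2sq P (v t))) ?lee_fin ?hc//.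
by rewrite ge0_fin_numE ?fv ?t0//; exact: L2sq_ge0.
Qed.

Lemma L2sq_ae_eq (W : ipSpace R k) (xi eta : Omega -> W) : hilbert W -> separable W ->
  wmeas xi -> wmeas eta -> {ae P, forall o, xi o = eta o} -> L2sq P xi = L2sq P eta.
Proof.
move=> hW sW mx me h; apply: ae_eq_integral => //; try exact: emeasurable_sqnrm.
have FF := ae_filter_ringOfSetsType P.
by apply: filterS h => o -> _.
Qed.

Variables (u u' : R -> Omega -> V) (L1 L2 : V -> X).
Hypotheses (cu : C2_process P F T u u') (L1b : bounded_linear L1) (L2b : bounded_linear L2).

Lemma forcing_exists : exists g, regular_forcing P F T (fun s o => L1 (u s o) - L2 (u' s o)) g.
Proof.
have [N0 [sN0 mN0 nN0 FN0]] := negligible_cover (C2_derivative cu).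
have mut t s : 0 <= t -> s <= T -> 0 <= s -> s <= t ->
    @wmeas R k V _ (g_sigma_algebraType (F t)) (u s).
  move=> t0 sT s0 st; apply: (filtration_wmeas hV sV s0 st).
  by apply: (C2_adapted cu); rewrite /= in_itv/= s0.
have mu0 s : 0 <= s -> s <= T -> wmeas (u s).
  by move=> s0 sT; apply: (filtration_wmeas_sub hV sV s0); exact: mut.
have der N : N0 `<=` N -> forall o, ~ N o -> forall t, 0 <= t <= T ->
    (fun h => nrm (ofR k h^-1 *: (u (t + h) o - u t o) - u' t o))
      @ within [set h | 0 <= t + h <= T] 0^' --> (0 : R).
  move=> NN o No; apply: contrapT => h; apply: No; apply: NN; exact: sN0.
pose g0 := forcing T N0 u u' L1 L2.
have jg0 : jmeas g0 := forcing_jmeas hV (lexx T) mN0 (der _ (@subset_refl _ _)) mu0 hX L1b L2b.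
have jr : jmeas (reg T N0 u) := reg_jmeas hV (lexx T) mN0 (der _ (@subset_refl _ _)) mu0.
have jr' : jmeas (reg' T N0 u') := reg'_jmeas hV (lexx T) mN0 (der _ (@subset_refl _ _)) mu0.
have FF := ae_filter_ringOfSetsType P.
have ne0 : {ae P, forall o, ~ N0 o} by apply: negligibleS nN0 => o /contrapT.
have er s : 0 <= s -> s <= T -> {ae P, forall o, u s o = reg T N0 u s o}.
  by move=> s0 sT; apply: filterS ne0 => o No; rewrite /reg asboolT// s0 sT.
have er' s : 0 < s -> s <= T -> {ae P, forall o, u' s o = reg' T N0 u' s o}.
  by move=> s0 sT; apply: filterS ne0 => o No; rewrite /reg' asboolT// s0 sT.
have mu's s : 0 < s -> s <= T -> wmeas (u' s).
  move=> s0 sT; apply/(random_elementP hV sV).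
  apply: (ae_random_element (sigma_measurable Omega) (filtration_complete uF) (er' s s0 sT)).
  by apply/(random_elementP hV sV); exact: jmeas_at jr'.
have fE (v : R -> Omega -> V) t : 'E_P[fun o => sqnrm (v t o)]%E = L2sq P (v t).
  by rewrite unlock.
have [C1 C10 hC1] : exists2 C, 0 <= C & forall t, 0 <= t -> t <= T -> (L2sq P (u t) <= C%:E)%E.
  apply: L2sq_bounded_continuous => [t tT|]; first by rewrite -fE; exact: C2_moment cu _ tT.
  by have := C2_continuous cu; under [X in continuous X]eq_fun do rewrite fE.
have [C2 C20 hC2] : exists2 C, 0 <= C & forall t, 0 <= t -> t <= T -> (L2sq P (u' t) <= C%:E)%E.
  apply: L2sq_bounded_continuous => [t tT|]; first by rewrite -fE; exact: C2_moment_derivative cu _ tT.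
  by have := C2_continuous_derivative cu; under [X in continuous X]eq_fun do rewrite fE.
have [_ [M1 hM1]] := L1b; have [_ [M2 hM2]] := L2b.
have bd (L : V -> X) M (v : R -> Omega -> V) C s : bounded_linear L -> wmeas (v s) -> 0 <= C ->
    (L2sq P (v s) <= C%:E)%E -> (forall x, nrm (L x) <= M * nrm x) ->
    (L2sq P (fun o => L (v s o)) <= (`|M| ^+ 2 * C)%:E)%E.
  move=> Lb mv C0 hC hM.
  apply: (@le_trans _ _ ((`|M| ^+ 2)%:E * L2sq P (v s))%E).
    apply: (L2sq_le_scale P hX sX hV sV) => //; first exact: wmeas_bounded_linear.
    by move=> o; apply: (le_trans (hM _)); rewrite ler_wpM2r ?nrm_ge0// ler_norm.
  by rewrite [leRHS]EFinM lee_wpmul2l// lee_fin sqr_ge0.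
pose C := 2 * (`|M1| ^+ 2 * C1) + 2 * (`|M2| ^+ 2 * C2).
have C0 : 0 <= C by rewrite /C addr_ge0// !mulr_ge0// sqr_ge0.
have b0 s : 0 <= s -> s <= T -> (L2sq P (g0 s) <= C%:E)%E.
  move=> s0 sT; have [s1|s1] := ltP 0 s; last first.
    rewrite L2sq_zero// => o; rewrite /g0 /forcing asboolF// => -[/andP[h _] _].
    by move: (lt_le_trans h s1); rewrite ltxx.
  have mL1 : wmeas (fun o => L1 (u s o)) by apply: wmeas_bounded_linear => //; exact: mu0.
  have mL2 : wmeas (fun o => L2 (u' s o)) by apply: wmeas_bounded_linear => //; exact: mu's.
  rewrite (@L2sq_ae_eq _ _ (fun o => L1 (u s o) - L2 (u' s o)))//; last 3 first.
  - exact: jmeas_at jg0.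
  - exact: wmeasB.
  - by apply: filterS ne0 => o No; rewrite /g0 /forcing asboolT// s1.
  have := L2sq_dist hX sX P mL1 (@wmeas_cst R k X _ Omega 0) mL2 => /le_trans; apply.
  have -> : (C%:E = 2%:E * (`|M1| ^+ 2 * C1)%:E + 2%:E * (`|M2| ^+ 2 * C2)%:E)%E.
    by rewrite -!EFinM -EFinD.
  apply: leeD; rewrite lee_wpmul2l//.
    by under [X in L2sq P X]eq_fun do rewrite subr0; apply: (bd L1 M1 u C1 s) => //; [exact: mu0|exact: hC1].
  rewrite [X in (X <= _)%E](_ : _ = L2sq P (fun o => L2 (u' s o))); last first.
    by apply: eq_integral => o _; rewrite sub0r sqnrmN.
  by apply: (bd L2 M2 u' C2 s) => //; [exact: mu's|exact: hC2].
(* The outcomes with a path of infinite energy form a null set; adding it to the exceptional set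
   makes [forcing_path] true for every outcome. *)
have [N1 [sN1 mN1 nN1 FN1]] := negligible_cover (ae_path_sqint hX sX (ltW T0) jg0 b0).
pose N := N0 `|` N1.
have mN : measurable N by exact: measurableU.
have NN : N0 `<=` N by move=> o ?; left.
have gE s o : forcing T N u u' L1 L2 s o = if `[< N1 o >] then 0 else g0 s o.
  rewrite /g0 /forcing; case: asboolP => [[h No]|h].
    by rewrite asboolF ?asboolT//; [split => // ?; apply: No; left|move=> ?; apply: No; right].
  case: asboolP => // n1; rewrite asboolF// => -[h1 n0]; apply: h; split => // -[] //.
have jg : jmeas (forcing T N u u' L1 L2) := forcing_jmeas hV (lexx T) mN (der _ NN) mu0 hX L1b L2b.
exists (forcing T N u u' L1 L2); split => //.
- move=> t t0 tT; pose Om := g_sigma_algebraType (F t).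
  have mNt : @measurable _ Om N.
    by apply: measurableU; apply/(filtration_measurable _ t0); [exact: FN0|exact: FN1].
  (* The same construction with horizon [t] on the sigma-algebra [F t], to which the exceptional set
     belongs by completeness. *)
  have h := @forcing_jmeas R k V hV t T tT _ Om N mNt u u' (der _ NN)
    (fun s s0 st => mut t s t0 (le_trans st tT) s0 st) X L1 L2 hX L1b L2b.
  rewrite (_ : (fun s o => _) = forcing t (N : set Om) u u' L1 L2); first exact: h.
  apply/funext => s; apply/funext => o; rewrite /forcing.
  case: asboolP => st; last by rewrite asboolF// => -[/andP[_ /st]].
  congr (if asbool _ then _ else _); apply/propext; rewrite st (le_trans st tT).
  by [].
- move=> s o h; rewrite /forcing asboolF// => -[/andP[h1 h2] _].
  by apply: h; rewrite (ltW h1).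
- move=> o; have [n1|n1] := pselect (N1 o).
    by under eq_integral do rewrite gE asboolT// /sqnrm ip0l// reK0; rewrite integral0.
  under eq_integral do rewrite gE asboolF//.
  by apply: contrapT => h; apply: n1; apply: sN1.
- exists C => s s0 sT; apply: (le_trans _ (b0 s s0 sT)).
  apply: ge0_le_integral => //.
  + by move=> o _; rewrite lee_fin sqnrm_ge0.
  + by apply: emeasurable_sqnrm => //; exact: jmeas_at jg.
  + by apply: emeasurable_sqnrm => //; exact: jmeas_at jg0.
  + by move=> o _; rewrite gE lee_fin; case: asboolP => // _; rewrite sqnrm0// sqnrm_ge0.
- have nN : P.-negligible N by exact: negligibleU.
  apply: negligibleS nN => o /= h; apply: contrapT => No; apply: h => s sT.
  by rewrite /forcing asboolT.
Qed.

End Forcing.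

(** * Existence *)

Section OffPoint.
Variables (R : realType) (k : RorC) (V : ipSpace R k).
Hypotheses (hV : hilbert V) (sV : separable V).
Local Notation mu := (@lebesgue_measure R).

Lemma ae_neq (p : R) : {ae mu, forall s, s <> p}.
Proof.
exists [set p]; split; [exact: measurable_set1|exact: lebesgue_measure_set1|].
by move=> s /= /contrapT.
Qed.

Lemma vintegrable_ae (h h' : R -> V) : vintegrable mu h ->
  wmeas (h' : measurableTypeR R -> V) -> {ae mu, forall s, h' s = h s} ->
  vintegrable mu h' /\ pettis mu h' = pettis mu h.
Proof.
move=> ih mh' e; have FF := ae_filter_ringOfSetsType mu.
have ih' : vintegrable mu h'.
  split => //; rewrite [X in (X < _)%E](_ : _ = \int[mu]_s (nrm (h s))%:E)%E; first exact: ih.2.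
  apply: ae_eq_integral => //.
  - by apply/measurable_EFinP; exact: (measurable_nrm hV sV mh').
  - by apply/measurable_EFinP; exact: (measurable_nrm hV sV ih.1).
  - by apply: filterS e => s -> _.
split => //; apply: (rip_inj hV) => z.
rewrite (pettisE hV sV z ih') (pettisE hV sV z ih) /Rintegral; congr fine.
apply: ae_eq_integral => //.
- by apply/measurable_EFinP; exact: mh'.
- by apply/measurable_EFinP; exact: ih.1.
- by apply: filterS e => s -> _.
Qed.

Lemma vintegrable_off_point (h h' : R -> V) (p : R) : vintegrable mu h ->
  (forall s, s <> p -> h' s = h s) -> vintegrable mu h' /\ pettis mu h' = pettis mu h.
Proof.
move=> ih e; have FF := ae_filter_ringOfSetsType mu.
apply: vintegrable_ae => //; last by apply: filterS (ae_neq p) => s; exact: e.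
rewrite (_ : h' = fun s => if `[< [set p] s >] then h' p else h s).
  apply: (wmeas_if (A := [set p] : set (measurableTypeR R))); last exact: ih.1.
  - exact: measurable_set1.
  - exact: wmeas_cst.
by apply/funext => s; case: asboolP => [->//|/e].
Qed.

(** The forcing and its version are known to agree on (0, t] only; measurability at the missing
    point is irrelevant because the integral is taken over the half-open interval. *)
Lemma itg_off_left (phi psi : R -> R) t : measurable_fun (`[0, t]%classic : set R) psi ->
  (forall s, 0 < s <= t -> phi s = psi s) -> itg phi 0 t = itg psi 0 t.
Proof.
move=> mp e; rewrite /itg /Rintegral; congr fine.
have mp' : measurable_fun (`]0, t]%classic : set R) psi.
  apply: measurable_funS mp; first exact: measurable_itv.
  by move=> s /=; rewrite !in_itv/= => /andP[/ltW -> ->].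
rewrite -!integral_itv_obnd_cbnd.
- by apply: eq_integral => s; rewrite inE/= in_itv/= => /e ->.
- exact/measurable_EFinP.
- apply/measurable_EFinP; apply: (eq_measurable_fun psi) mp' => s.
  by rewrite inE/= in_itv/= => /e.
Qed.

End OffPoint.

(** Cauchy-Schwarz on [[0, T]], obtained by integrating 2 y <= c + y^2 / c with c the mean x / T of
    the norm, for which c T equals x. *)
Lemma sqr_integral_nrm_le (R : realType) (k : RorC) (V : ipSpace R k) (T : R) (h : R -> V) :
  hilbert V -> separable V -> 0 < T -> wmeas (h : measurableTypeR R -> V) ->
  (forall s, ~ (0 <= s <= T) -> h s = 0) ->
  (\int[@lebesgue_measure R]_(s in `[0%R, T]) (sqnrm (h s))%:E < +oo)%E ->
  fine (\int[@lebesgue_measure R]_s (nrm (h s))%:E)%E ^+ 2 <=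
    T * fine (\int[@lebesgue_measure R]_(s in `[0%R, T]) (sqnrm (h s))%:E)%E.
Proof.
move=> hV sV T0 mh h0 fh; have [_ ih] := vintegrable_of_sq hV sV mh h0 fh.
have mI : measurable (`[0, T]%classic : set (measurableTypeR R)) by exact: measurable_itv.
have eI : (\int[@lebesgue_measure R]_s (nrm (h s))%:E =
           \int[@lebesgue_measure R]_(s in `[0%R, T]) (nrm (h s))%:E)%E.
  rewrite [RHS]integral_mkcond; apply: eq_integral => s _; rewrite patchE.
  by case: (boolP (s \in _)) => //; rewrite notin_setE /= in_itv/= => /h0 ->; rewrite nrm0.
rewrite eI in ih *.
have mn : measurable_fun (setT : set (measurableTypeR R)) (fun s => nrm (h s)).
  exact: measurable_nrm.
have ms : measurable_fun (setT : set (measurableTypeR R)) (fun s => (sqnrm (h s))%:E).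
  exact: emeasurable_sqnrm.
set x := fine (\int[_]_(s in _) (nrm _)%:E)%E; set J := fine _.
have J0 : 0 <= J by apply: fine_ge0; apply: integral_ge0 => s _; rewrite lee_fin sqnrm_ge0.
have x0 : 0 <= x by apply: fine_ge0; apply: integral_ge0 => s _; rewrite lee_fin nrm_ge0.
have young c : 0 < c -> 2 * x <= c * T + c^-1 * J.
  move=> c0; have ci0 : 0 < c^-1 by rewrite invr_gt0.
  have xE : (x%:E = \int[@lebesgue_measure R]_(s in `[0%R, T]) (nrm (h s))%:E)%E.
    by rewrite /x fineK// ge0_fin_numE//; apply: integral_ge0 => s _; rewrite lee_fin nrm_ge0.
  have JE : (J%:E = \int[@lebesgue_measure R]_(s in `[0%R, T]) (sqnrm (h s))%:E)%E.
    by rewrite /J fineK// ge0_fin_numE//; apply: integral_ge0 => s _; rewrite lee_fin sqnrm_ge0.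
  rewrite -lee_fin EFinM xE -ge0_integralZl//; last 2 first.
  - by apply/measurable_EFinP; exact: measurable_funTS.
  - by move=> s _; rewrite lee_fin nrm_ge0.
  apply: (@le_trans _ _ (\int[@lebesgue_measure R]_(s in `[0%R, T])
      (c%:E + c^-1%:E * (sqnrm (h s))%:E))%E).
    apply: ge0_le_integral => //.
    + by move=> s _; rewrite mule_ge0// lee_fin nrm_ge0.
    + by apply: measurable_funeM; apply/measurable_EFinP; exact: measurable_funTS.
    + apply: emeasurable_funD => //; apply: measurable_funeM.
      exact: measurable_funTS.
    + move=> s _; rewrite -!EFinM -EFinD lee_fin -(nrm_sqr hV).
      move: (nrm (h s)) => y; rewrite -subr_ge0.
      have -> : c + c^-1 * y ^+ 2 - 2 * y = c^-1 * (y - c) ^+ 2 by field; rewrite gt_eqF.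
      by rewrite mulr_ge0 ?sqr_ge0// ltW.
  rewrite ge0_integralD//; last 3 first.
  - by move=> s _; rewrite lee_fin ltW.
  - by move=> s _; rewrite mule_ge0// lee_fin ?sqnrm_ge0// ltW.
  - by apply: measurable_funeM; exact: measurable_funTS.
  rewrite ge0_integralZl//; last 3 first.
  - exact: measurable_funTS.
  - by move=> s _; rewrite lee_fin sqnrm_ge0.
  - by rewrite lee_fin ltW.
  rewrite -JE integral_cst//= lebesgue_measure_itv/= lte_fin T0 -EFinB subr0.
  by rewrite -!EFinM -EFinD lee_fin.
have [x1|x1] := ltP 0 x; last by rewrite (le_anti (introT andP (conj x1 x0))) expr0n/= mulr_ge0// ltW.
have := young (x / T) (divr_gt0 x1 T0).
rewrite divfK ?gt_eqF// invf_div => h1.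
have h2 : x <= T / x * J by lra.
by rewrite expr2 -ler_pdivlMr// mulrAC.
Qed.

Section ParametrizedConvolution.
Variables (R : realType) (k : RorC) (X : ipSpace R k).
Hypotheses (hX : hilbert X) (sX : separable X).
Variables (S : R -> X -> X) (Dom : set X) (A : X -> X).
Hypothesis gS : generates Dom A S.
Variables (d : measure_display) (Om : measurableType d) (h : R -> Om -> X).
Local Notation mu := (@lebesgue_measure R).
Hypotheses (jh : jmeas h) (ih : forall o, vintegrable mu (h ^~ o)).

Lemma dconv_jmeas : jmeas (fun t o => dconv S (h ^~ o) t).
Proof.
pose RO := (measurableTypeR R * Om)%type.
pose G (q : measurableTypeR R * RO) : X :=
  if `[< [set q : measurableTypeR R * RO | 0 <= q.1 /\ 0 <= q.2.1 - q.1] q >]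
  then flow S (q.2.1 - q.1) (h q.1 q.2.2) else 0.
have md : measurable_fun setT (fun q : measurableTypeR R * RO => q.2.1 - q.1).
  apply: measurable_funB; last exact: measurable_fst.
  by apply: measurableT_comp; [exact: measurable_fst|exact: measurable_snd].
have mG : wmeas G.
  apply: (@wmeas_if _ _ _ _ _ _).
  - rewrite (_ : [set _ | _] = fst @^-1` `[0, +oo[%classic `&`
        (fun q : measurableTypeR R * RO => q.2.1 - q.1) @^-1` `[0, +oo[%classic); last first.
      by apply/seteqP; split=> q /=; rewrite !in_itv/= !andbT.
    apply: measurableI; rewrite -[X in measurable X]setTI.
      by apply: measurable_fst.
    exact: md.
  - apply: (wmeas_flow hX gS.1 (tau := fun q : measurableTypeR R * RO => q.2.1 - q.1)
      (xi := fun q => h q.1 q.2.2)) => //.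
    apply: (wmeas_comp (phi := fun q : measurableTypeR R * RO => (q.1, q.2.2))
      (xi := fun p : RO => h p.1 p.2)); last exact: jh.
    apply/measurable_fun_pairP; split => /=; first exact: measurable_fst.
    exact: (measurableT_comp measurable_snd measurable_snd).
  - exact: wmeas_cst.
have e (p : RO) : (fun s => G (s, p)) =
    vrestr `[0, p.1] (fun s => flow S (p.1 - s) (h s p.2)).
  apply/funext => s; rewrite /G /vrestr /=; congr (if asbool _ then _ else _).
  by apply/propext; rewrite in_itv/= subr_ge0; split => [[-> ->]|/andP[]].
have := @wmeas_pettis R _ _ (measurableTypeR R) RO mu k X hX sX G mG.
move=> H; have {}H := H _.
rewrite /jmeas (_ : (fun p : RO => _) = fun p => pettis mu (fun s => G (s, p))).
  by apply: H => p; rewrite e; exact: (dconv_vintegrable hX sX gS (ih p.2)).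
by apply/funext => p; rewrite e.
Qed.

End ParametrizedConvolution.

Lemma itgableD (R : realType) (phi psi : R -> R) (a b : R) : itgable phi a b -> itgable psi a b ->
  itgable (fun s => phi s + psi s) a b.
Proof.
move=> i1 i2; rewrite /itgable (_ : _ \o _ = (fun s => (EFin \o phi) s + (EFin \o psi) s)%E)//.
by apply: integrableD => //; exact: measurable_itv.
Qed.

(** * The explicit solution process *)

Section Solution.
Variables (R : realType) (k : RorC) (Z X : ipSpace R k).
Hypotheses (hZ : hilbert Z) (sZ : separable Z) (hX : hilbert X) (sX : separable X).
Variables (d : measure_display) (Omega : measurableType d) (P : probability Omega R).
Variables (F : R -> set_system Omega) (Q : Z -> Z) (w : R -> Omega -> Z).
Hypotheses (uF : usual_filtration P F) (cQ : covariance_operator Q).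
Hypothesis wW : wiener_process P F Q w.
Variables (S : R -> X -> X) (Dom : set X) (A : X -> X) (H : Z -> X).
Hypotheses (gS : generates Dom A S) (Hb : bounded_linear H).
Variables (T : R) (f g : R -> Omega -> X) (X0 : Omega -> X).
Hypotheses (T0 : 0 < T) (fg : regular_forcing P F T f g).
Hypotheses (rX0 : random_element (F 0) X0) (fX0 : (L2sq P X0 < +oo)%E).
Local Notation mu := (@lebesgue_measure R).
Local Notation flow := (flow S).
Let hS : C0_semigroup S := gS.1.
Local Notation noise := (stoch_conv hZ sZ hX sX cQ wW hS Hb T0).

Definition drift t o : X := flow t (X0 o) + dconv S (g ^~ o) t.
Definition solution t o : X := drift t o + noise t o.

Let jg : jmeas g := forcing_measurable fg.

Let mX0 : wmeas X0.
Proof. by apply: (filtration_wmeas_sub uF hX sX (lexx 0)); exact: (filtration_wmeas uF hX sX (lexx 0) (lexx 0)). Qed.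

Lemma forcing_vintegrable o : vintegrable mu (g ^~ o).
Proof.
apply: (vintegrable_of_sq hX sX (T := T)); last exact: (forcing_path fg).
  exact: jmeas_path.
by move=> s; exact: (forcing_support fg).
Qed.

Lemma forcing_itgable o z a b : itgable (fun s => rip (g s o) z) a b.
Proof.
have mI : measurable (`[a, b]%classic : set (measurableTypeR R)) by exact: measurable_itv.
exact: integrableS measurableT mI (@subsetT _ _) (vintegrable_rip hX sX z (forcing_vintegrable o)).
Qed.

Lemma drift_jmeas : jmeas drift.
Proof.
apply: jmeasD => //; last exact: (dconv_jmeas hX sX gS jg forcing_vintegrable).
apply: (wmeas_flow hX hS (tau := fst) (xi := fun p : measurableTypeR R * Omega => X0 p.2)).
  exact: measurable_fst.
exact: (wmeas_comp (phi := snd) measurable_snd mX0).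
Qed.

Lemma solution_jmeas : jmeas solution.
Proof. by apply: jmeasD => //; [exact: drift_jmeas|exact: stoch_conv_jmeas]. Qed.

Lemma solution_adapted t : 0 <= t -> t <= T -> random_element (F t) (solution t).
Proof.
move=> t0 tT; apply/(sigma_random_element hX sX _ (filtration_sigma uF t0)).
pose Om := g_sigma_algebraType (F t).
apply: (@wmeasD _ _ _ hX _ Om); last exact: (stoch_conv_adapted hZ sZ hX sX uF).
apply: (@wmeasD _ _ _ hX _ Om).
  apply: (@wmeas_bounded_linear _ _ _ _ _ _ Om _ hX hX (flow_bounded hS t)).
  exact: (filtration_wmeas uF hX sX (lexx 0) t0).
pose gt s (o : Om) := if `[< s <= t >] then g s o else 0.
have jgt : @jmeas R k X _ Om gt := forcing_progressive fg t0 tT.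
have igt o : vintegrable mu (gt ^~ o).
  rewrite (_ : gt ^~ o = vrestr `[0, t] (g ^~ o)).
    by apply: vrestr_vintegrable => //; exact: forcing_vintegrable.
  apply/funext => s; rewrite /gt /vrestr /= in_itv/=; case: asboolP => st.
    case: asboolP => //; rewrite st andbT => /negP s0; apply: (forcing_support fg).
    by move=> /andP[h _]; rewrite h in s0.
  by rewrite asboolF// => /andP[_ /st].
rewrite (_ : (fun o => _) = fun o : Om => dconv S (gt ^~ o) t).
  exact: (@jmeas_at _ _ _ _ Om _ t (dconv_jmeas hX sX gS jgt igt)).
apply/funext => o; rewrite /dconv; congr pettis; apply/funext => s.
by rewrite /vrestr /gt /=; case: asboolP => //; rewrite in_itv/= => /andP[_ st]; rewrite asboolT.
Qed.

Local Notation energy o := (fine (\int[mu]_(s in `[0%R, T]) (sqnrm (g s o))%:E)%E).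

Lemma energy_ge0 o : 0 <= energy o.
Proof. by apply: fine_ge0; apply: integral_ge0 => s _; rewrite lee_fin sqnrm_ge0. Qed.

Lemma EFin_energy o : ((energy o)%:E = \int[mu]_(s in `[0%R, T]) (sqnrm (g s o))%:E)%E.
Proof.
rewrite fineK// ge0_fin_numE ?(forcing_path fg)//.
by apply: integral_ge0 => s _; rewrite lee_fin sqnrm_ge0.
Qed.

Lemma measurable_energy : measurable_fun setT (fun o => energy o).
Proof.
apply/measurable_EFinP; under [X in measurable_fun _ X]eq_fun do rewrite /= EFin_energy.
exact: (measurable_path_sqnrm hX sX).
Qed.

Lemma energy_moment : (\int[P]_o (energy o)%:E < +oo)%E.
Proof.
under eq_integral do rewrite EFin_energy.
rewrite (tonelli_path hX sX P 0 T jg); have [C hC] := forcing_moment fg.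
have C0 : 0 <= C by have := hC 0 (lexx _) (ltW T0); rewrite -lee_fin; apply: le_trans; exact: L2sq_ge0.
apply: le_lt_trans (integral_L2sq_le hX sX (ltW T0) jg C0 hC) _.
by rewrite ltry.
Qed.

(** The factor 2 splits the drift into its two terms, each of which costs the square of the bound of
    the semigroup; 1 + T covers the initial value and the factor [T] of [sqr_integral_nrm_le]. *)
Definition drift_const : R := 2 * (projT1 (cid2 (flow_bound hX hS T))) ^+ 2 * (1 + T).

Lemma drift_sqnrm t o : 0 <= t -> t <= T ->
  sqnrm (drift t o) <= drift_const * (sqnrm (X0 o) + energy o).
Proof.
move=> t0 tT; rewrite /drift_const; case: (cid2 _) => M M1 fM /=.
have M0 : 0 <= M by exact: le_trans M1.
apply: (le_trans (sqnrmD_le hX _ _)).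
have h1 : sqnrm (flow t (X0 o)) <= M ^+ 2 * sqnrm (X0 o).
  by rewrite -(nrm_sqr hX (X0 o)) -exprMn; apply: (sqnrm_le hX); exact: fM.
have h2 : sqnrm (dconv S (g ^~ o) t) <= M ^+ 2 * (T * energy o).
  apply: (@le_trans _ _ (M ^+ 2 * fine (\int[mu]_s (nrm (g s o))%:E)%E ^+ 2)).
    rewrite -exprMn; apply: (sqnrm_le hX).
    exact: (dconv_bound hX sX gS (forcing_vintegrable o) M1 fM tT).
  rewrite ler_wpM2l ?sqr_ge0//; apply: (sqr_integral_nrm_le hX sX T0).
  - exact: jmeas_path.
  - by move=> s; exact: (forcing_support fg).
  - exact: (forcing_path fg).
have := energy_ge0 o; have := sqnrm_ge0 hX (X0 o).
move: (M ^+ 2) (sqr_ge0 M) h1 h2 => m m0; move: (energy o) (sqnrm (X0 o)) => e x h1 h2 x0 e0.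
apply: (@le_trans _ _ (2 * (m * x) + 2 * (m * (T * e)))); first by lra.
have e1 : 0 <= m * x * T by rewrite !mulr_ge0// ltW.
have e2 : 0 <= m * e by rewrite mulr_ge0.
rewrite -subr_ge0 (_ : _ - _ = 2 * (m * x * T + m * e)); last by ring.
by rewrite mulr_ge0// addr_ge0.
Qed.

Lemma drift_const_ge0 : 0 <= drift_const.
Proof.
apply: mulr_ge0; first by rewrite mulr_ge0// sqr_ge0.
by rewrite addr_ge0// ltW.
Qed.

(** It does not depend on time and is integrable over the outcomes: it bounds the second moments of
    the drift and is the majorant for its mean-square continuity. *)
Let majorant o : R := drift_const * (sqnrm (X0 o) + energy o).

Let measurable_majorant : measurable_fun setT majorant.
Proof.
apply: measurable_funM => //; apply: measurable_funD; last exact: measurable_energy.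
exact: (measurable_sqnrm hX sX mX0).
Qed.

Let majorant_ge0 o : 0 <= majorant o.
Proof. by rewrite mulr_ge0 ?drift_const_ge0// addr_ge0 ?energy_ge0// sqnrm_ge0. Qed.

Let majorant_moment : (\int[P]_o (majorant o)%:E < +oo)%E.
Proof.
have mx : measurable_fun setT (fun o => (sqnrm (X0 o))%:E) by exact: emeasurable_sqnrm.
have me : measurable_fun setT (fun o => (energy o)%:E).
  by apply/measurable_EFinP; exact: measurable_energy.
under eq_integral do rewrite EFinM EFinD.
have e0 o : (0 <= (sqnrm (X0 o))%:E + (energy o)%:E)%E.
  by rewrite -EFinD lee_fin addr_ge0 ?energy_ge0// sqnrm_ge0.
rewrite ge0_integralZl//; last 2 first.
- exact: emeasurable_funD.
- by rewrite lee_fin drift_const_ge0.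
rewrite ge0_integralD//; last 2 first.
- by move=> o _; rewrite lee_fin sqnrm_ge0.
- by move=> o _; rewrite lee_fin energy_ge0.
rewrite lte_mul_pinfty ?lee_fin ?drift_const_ge0//.
by rewrite lte_add_pinfty//; exact: energy_moment.
Qed.

Lemma drift_wmeas t : wmeas (drift t).
Proof. exact: jmeas_at drift_jmeas. Qed.

Lemma noise_wmeas t : wmeas (noise t).
Proof. exact: stoch_conv_wmeas1. Qed.

Lemma solution_wmeas t : wmeas (solution t).
Proof. exact: jmeas_at solution_jmeas. Qed.

Lemma solution_bounded : exists C : R, forall t, 0 <= t -> t <= T ->
  (L2sq P (solution t) <= C%:E)%E.
Proof.
have [C hC] := stoch_conv_bounded hZ sZ hX sX uF cQ wW hS Hb T0.
have fm : (\int[P]_o (majorant o)%:E)%E \is a fin_num.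
  by rewrite ge0_fin_numE ?majorant_moment//; apply: integral_ge0 => o _; rewrite lee_fin.
exists (2 * fine (\int[P]_o (majorant o)%:E)%E + 2 * C) => t t0 tT.
apply: (le_trans (L2sqD_le hX sX P (drift_wmeas t) (noise_wmeas t))).
have -> : ((2 * fine (\int[P]_o (majorant o)%:E) + 2 * C)%:E =
  2%:E * (\int[P]_o (majorant o)%:E) + 2%:E * C%:E)%E.
  by rewrite -{2}(fineK fm) -!EFinM -EFinD.
apply: leeD; rewrite lee_wpmul2l//; last exact: hC.
apply: ge0_le_integral => //.
- by move=> o _; rewrite lee_fin sqnrm_ge0.
- by apply: emeasurable_sqnrm => //; exact: drift_wmeas.
- exact/measurable_EFinP.
- by move=> o _; rewrite lee_fin; exact: drift_sqnrm.
Qed.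

Lemma solution_path : {ae P, forall o,
  (\int[mu]_(s in `[0%R, T]) (sqnrm (solution s o))%:E < +oo)%E}.
Proof.
have [C hC] := solution_bounded.
exact: (ae_path_sqint hX sX (ltW T0) solution_jmeas hC).
Qed.

Lemma drift_continuous t (s : nat -> R) : 0 <= t -> t <= T ->
  (forall n, 0 <= s n /\ s n <= T) -> s @ \oo --> t ->
  (fun n => L2sq P (fun o => drift (s n) o - drift t o)) @ \oo --> 0%E.
Proof.
move=> t0 tT sT st.
have path o : (fun n => (sqnrm (drift (s n) o - drift t o))%:E) @ \oo --> (0 : \bar R).
  have hf := flow_vcvg hX hS (X0 o) st.
  have hd := dconv_vcvg hX sX gS (forcing_vintegrable o) (fun n => (sT n).2) tT st.
  apply: cvg_EFin; first exact: nearW.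
  have h : (fun n => nrm (drift (s n) o - drift t o)) @ \oo --> (0 : R).
    apply: (squeeze_cvgr (f := fun=> 0) (h := fun n => nrm (flow (s n) (X0 o) - flow t (X0 o)) +
      nrm (dconv S (g ^~ o) (s n) - dconv S (g ^~ o) t))).
    - apply: nearW => n; rewrite nrm_ge0/= /drift opprD addrACA; exact: nrmD.
    - exact: cvg_cst.
    - by rewrite -[X in _ --> X]addr0; exact: cvgD.
  rewrite [X in X @ _ --> _](_ : _ = fun n => nrm (drift (s n) o - drift t o) *
      nrm (drift (s n) o - drift t o)); last first.
    by apply/funext => n; rewrite -expr2 nrm_sqr.
  by rewrite -[X in _ --> X](mulr0 0); exact: cvgM.
have ms n : measurable_fun setT (fun o => (sqnrm (drift (s n) o - drift t o))%:E).
  by apply: emeasurable_sqnrm => //; apply: wmeasB => //; exact: drift_wmeas.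
have := @dominated_cvg _ _ _ P _ measurableT (fun n o => (sqnrm (drift (s n) o - drift t o))%:E)
  (cst 0%E) (fun o => (4 * majorant o)%:E) ms.
rewrite integral0; apply => //.
- apply/integrableP; split; first by apply/measurable_EFinP; exact: measurable_funM.
  rewrite (eq_integral (fun o => 4%:E * (majorant o)%:E)%E); last first.
    by move=> o _; rewrite -EFinM gee0_abs// lee_fin mulr_ge0.
  rewrite ge0_integralZl//; last 2 first.
  - exact/measurable_EFinP.
  - by move=> o _; rewrite lee_fin.
  by rewrite lte_mul_pinfty ?lee_fin.
- move=> n o _; rewrite gee0_abs ?lee_fin ?sqnrm_ge0//.
  have := drift_sqnrm o (sT n).1 (sT n).2; have := drift_sqnrm o t0 tT.
  rewrite -/(majorant o); have := sqnrmB_le hX (drift (s n) o) (drift t o).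
  by move: (majorant o) => mo; lra.
Qed.

(** The drift is handled by dominated convergence, which is sequential, so a failure at [t] is
    turned into a sequence of times; the noise has a uniform modulus. *)
Lemma solution_continuous t : 0 <= t -> t <= T ->
  (fun s => L2sq P (fun o => solution s o - solution t o)) @ within `[0, T] (nbhs t) --> 0%E.
Proof.
move=> t0 tT; apply: ge0_cvge0 => [s|e e0]; first exact: L2sq_ge0.
apply: contrapT => no.
have key n : exists s : R, [/\ 0 <= s, s <= T, `|t - s| < n.+1%:R^-1 &
    ~ (L2sq P (fun o => solution s o - solution t o)%R <= e%:E)%E].
  apply: contrapT => h; apply: no; rewrite /within/=; exists n.+1%:R^-1 => /=; first by rewrite invr_gt0.
  move=> s /= hs; rewrite in_itv/= => /andP[s0 sT]; apply: contrapT => hn.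
  by apply: h; exists s.
have [s hs] := choice key.
have st : s @ \oo --> t.
  apply/cvgrPdist_lt => r r0; have [n0 hn0] := ltr_add_invr r0; rewrite add0r in hn0.
  exists n0 => // n /= Nn; have [_ _ h _] := hs n.
  by apply: (lt_trans h); apply: le_lt_trans hn0; rewrite lef_pV2 ?posrE// ler_nat ltnS.
have sT n : 0 <= s n /\ s n <= T by have [] := hs n.
have e4 : 0 < e / 4 by rewrite divr_gt0.
have [eta eta0 heta] := stoch_conv_continuous hZ sZ hX sX uF cQ wW hS Hb T0 e4.
have hN n : `|t - s n| < eta -> (L2sq P (fun o => noise (s n) o - noise t o)%R <= (e / 4)%:E)%E.
  have [sn0 snT] := sT n; have [ts|ts] := leP t (s n) => h.
    by apply: heta => //; move: h; rewrite distrC ger0_norm ?subr_ge0.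
  rewrite (_ : L2sq P _ = L2sq P (fun o => noise t o - noise (s n) o)%R); last first.
    by apply: eq_integral => o _; rewrite sqnrmBC.
  apply: heta => //; first exact: ltW.
  by move: h; rewrite gtr0_norm ?subr_gt0.
have /cvgrPdist_lt /(_ _ eta0) [N1 _ hN1] := st.
have dc := drift_continuous t0 tT sT st.
have [N2 _ hN2] := cvg_ereal_lt dc (e4 : (0%:E < (e / 4)%:E)%E).
pose n := maxn N1 N2; have [_ _ _] := hs n; apply.
rewrite (_ : (fun o => solution (s n) o - solution t o) =
  fun o => (drift (s n) o - drift t o) + (noise (s n) o - noise t o)); last first.
  by apply/funext => o; rewrite /solution opprD addrACA.
have m1 : wmeas (fun o => drift (s n) o - drift t o) by apply: wmeasB => //; exact: drift_wmeas.
have m2 : wmeas (fun o => noise (s n) o - noise t o) by apply: wmeasB => //; exact: noise_wmeas.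
apply: (le_trans (L2sqD_le hX sX P m1 m2)).
have -> : (e%:E = 2%:E * (e / 4)%:E + 2%:E * (e / 4)%:E)%E by rewrite -!EFinM -EFinD; congr EFin; field.
apply: leeD; rewrite lee_wpmul2l//.
  by apply: ltW; apply: hN2 => /=; rewrite leq_maxr.
by apply: hN; apply: hN1 => /=; rewrite leq_maxl.
Qed.

Lemma drift_weak z v t o : adjoint_graph Dom A z v -> 0 <= t ->
  itgable (fun s => rip (drift s o) v) 0 t /\
  rip (drift t o) z = rip (X0 o) z + itg (fun s => rip (drift s o) v) 0 t +
    itg (fun s => rip (g s o) z) 0 t.
Proof.
move=> zv t0; have [i2 e2] := dconv_weak hX sX gS (forcing_vintegrable o) zv t0.
have e1 := flow_weak hX gS zv (X0 o) t0.
have i1 := flow_itgable hX gS (X0 o) v 0 t.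
have eD s : rip (drift s o) v = rip (flow s (X0 o)) v + rip (dconv S (g ^~ o) s) v.
  by rewrite /drift ripDl.
split; first by rewrite (funext eD); exact: itgableD.
rewrite (eq_itg (fun s _ => eD s)) itgD// /drift ripDl// e2.
by move: e1 => /eqP; rewrite subr_eq => /eqP ->; rewrite [LHS]addrACA [RHS]addrAC addrA; lra.
Qed.

Lemma solution_weak z v t : adjoint_graph Dom A z v -> 0 <= t -> t <= T ->
  {ae P, forall o, rip (solution t o) z = rip (X0 o) z +
    itg (fun s => rip (solution s o) v + rip (g s o) z) 0 t + rip (H (w t o)) z}.
Proof.
move=> zv t0 tT; have FF := ae_filter_ringOfSetsType P.
have h1 := stoch_conv_weak hZ sZ hX sX uF cQ wW hS Hb T0 gS zv t0 tT.
have h2 := stoch_conv_path hZ sZ hX sX uF cQ wW hS Hb T0.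
apply: (filterS2 _ _ h1 h2) => o {}h1 {}h2.
have [i1 e1] := drift_weak o zv t0.
have i2 : itgable (fun s => rip (noise s o) v) 0 t.
  apply: (path_itgable hX sX v _ h2 (lexx 0) tT).
  exact: jmeas_path (stoch_conv_jmeas hZ sZ hX sX cQ wW hS Hb T0).
have i3 := forcing_itgable o z 0 t.
rewrite (eq_itg (psi := fun s => (rip (drift s o) v + rip (noise s o) v) + rip (g s o) z)); last first.
  by move=> s _; rewrite ripDl.
rewrite !itgD//; last exact: itgableD.
by rewrite /solution ripDl// e1 h1; lra.
Qed.

(** The two integrands differ at most at the time 0. *)
Lemma forcing_dconv t o : (forall s, 0 < s <= T -> f s o = g s o) -> 0 <= t -> t <= T ->
  vintegrable mu (vrestr `[0, t] (fun s => S (t - s) (f s o))) /\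
  dconv S (g ^~ o) t = pettis mu (vrestr `[0, t] (fun s => S (t - s) (f s o))).
Proof.
move=> efg t0 tT; have [|h e] := vintegrable_off_point hX sX (p := 0)
  (h' := vrestr `[0, t] (fun s => S (t - s) (f s o)))
  (dconv_vintegrable hX sX gS (forcing_vintegrable o) t) _; last by split.
move=> s s0; rewrite /vrestr /= in_itv/=; case: asboolP => // /andP[s1 s2].
rewrite efg ?flowE ?subr_ge0// (le_trans s2 tT) lt_neqAle s1 !andbT eq_sym; exact/eqP.
Qed.

Lemma solution_mild t : 0 <= t -> t <= T ->
  stochastic_integral P Q w t (fun s z => S (t - s) (H z)) (noise t) /\
  {ae P, forall o, bochner_integral `[0, t] (fun s => S (t - s) (f s o)) (dconv S (g ^~ o) t)}.
Proof.
move=> t0 tT; split; first exact: (stoch_conv_integral hZ sZ hX sX uF).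
have FF := ae_filter_ringOfSetsType P; apply: filterS (forcing_ae fg) => o efg.
have [ih ->] := forcing_dconv efg t0 tT; apply: pettis_bochner => //.
by rewrite lebesgue_measure_itv/=; case: ifP => _; rewrite -?EFinB ltry.
Qed.

End Solution.

(** * Weak and mild solutions as modifications of one process *)

Section Solutions.
Variables (R : realType) (k : RorC) (Z X : ipSpace R k).
Hypotheses (hZ : hilbert Z) (sZ : separable Z) (hX : hilbert X) (sX : separable X).
Variables (d : measure_display) (Omega : measurableType d) (P : probability Omega R).
Variables (F : R -> set_system Omega) (Q : Z -> Z) (w : R -> Omega -> Z).
Hypotheses (uF : usual_filtration P F) (cQ : covariance_operator Q).
Hypothesis wW : wiener_process P F Q w.
Variables (S : R -> X -> X) (Dom : set X) (A : X -> X) (H : Z -> X).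
Hypotheses (gS : generates Dom A S) (Hb : bounded_linear H).
Variables (T : R) (f g : R -> Omega -> X) (X0 : Omega -> X).
Hypotheses (T0 : 0 < T) (fg : regular_forcing P F T f g).
Hypotheses (rX0 : random_element (F 0) X0) (fX0 : (L2sq P X0 < +oo)%E).
Local Notation mu := (@lebesgue_measure R).
Local Notation flow := (flow S).
Let hS : C0_semigroup S := gS.1.
Local Notation sol := (solution hZ sZ hX sX cQ wW gS Hb g X0 T0).
Local Notation noise := (stoch_conv hZ sZ hX sX cQ wW hS Hb T0).
Local Notation cut Y := (fun (s : R) (o : Omega) => vrestr `[0, T]%classic (Y ^~ o) s).

Lemma measurable_cut t : measurable (`[0, t]%classic : set (measurableTypeR R)).
Proof. exact: measurable_itv. Qed.

Lemma cut_finite t : (mu `[0%R, t] < +oo)%E.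
Proof. by rewrite lebesgue_measure_itv/=; case: ifP => _; rewrite -?EFinB ltry. Qed.

Let mI := measurable_cut T.
Let fI := cut_finite T.
Let FP := ae_filter_ringOfSetsType P.
Let Fmu := ae_filter_ringOfSetsType mu.
Implicit Types Y : R -> Omega -> X.

Lemma measurable_processP Y : measurable_process T Y <-> jmeas (cut Y).
Proof.
have mJ : measurable [set p : measurableTypeR R * Omega | `[0, T]%classic p.1].
  rewrite (_ : [set _ | _] = fst @^-1` `[0, T]%classic)//.
  by rewrite -[X in measurable X]setTI; apply: measurable_fst.
split.
  move=> mY; apply/(wmeas_borel hX sX) => U bU; have [U0|U0] := pselect (U 0).
    rewrite (_ : _ @^-1` U = [set p : measurableTypeR R * Omega | `[0, T]%classic p.1 /\ U (Y p.1 p.2)]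
      `|` ~` [set p : measurableTypeR R * Omega | `[0, T]%classic p.1]).
      by apply: measurableU; [exact: mY|exact: measurableC].
    apply/seteqP; split=> p; rewrite /preimage /vrestr /=.
      by case: asboolP => h; [left|right].
    by move=> [[h1 h2]|h]; [rewrite asboolT|rewrite asboolF].
  rewrite (_ : _ @^-1` U = [set p : measurableTypeR R * Omega | `[0, T]%classic p.1 /\ U (Y p.1 p.2)]).
    exact: mY.
  apply/seteqP; split=> p; rewrite /preimage /vrestr /=; first by case: asboolP.
  by move=> [h1 h2]; rewrite asboolT.
move=> /(wmeas_borel hX sX) jY U bU.
rewrite (_ : [set _ | _] = [set p : measurableTypeR R * Omega | `[0, T]%classic p.1] `&`
  (fun p : measurableTypeR R * Omega => cut Y p.1 p.2) @^-1` U).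
  by apply: measurableI => //; exact: jY.
by apply/seteqP; split=> p; rewrite /preimage /vrestr /= => -[h1]; rewrite asboolT.
Qed.

Lemma sol_measurable : measurable_process T sol.
Proof.
apply/measurable_processP.
exact: (jmeas_restr 0 T (solution_jmeas hZ sZ hX sX uF cQ wW gS Hb T0 fg rX0)).
Qed.

Lemma cut_id Y s o : 0 <= s -> s <= T -> cut Y s o = Y s o.
Proof. by move=> s0 sT; rewrite /vrestr asboolT//= in_itv/= s0. Qed.

Lemma cut_out Y s o : ~ (0 <= s <= T) -> cut Y s o = 0.
Proof. by move=> h; rewrite /vrestr asboolF//= in_itv. Qed.

Lemma integral_cut_sqnrm Y o : (\int[mu]_(s in `[0%R, T]) (sqnrm (Y s o))%:E =
  \int[mu]_(s in `[0%R, T]) (sqnrm (cut Y s o))%:E)%E.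
Proof.
by apply: eq_integral => s; rewrite inE/= in_itv/= => /andP[? ?]; rewrite cut_id.
Qed.

Definition real_weak Y := forall z v, adjoint_graph Dom A z v -> forall t, 0 <= t <= T ->
  {ae P, forall o, rip (Y t o) z = rip (X0 o) z +
    itg (fun s => rip (Y s o) v + rip (f s o) z) 0 t + rip (H (w t o)) z}.

(** The imaginary part of the identity for [z] is its real part for [iK *: z], which
    [adjoint_graph_iK] admits as a test vector. *)
Lemma real_weakP Y : (forall z v, adjoint_graph Dom A z v -> forall t, 0 <= t <= T ->
    {ae P, forall o, ip (Y t o) z = ip (X0 o) z +
      intK mu `[0, t] (fun s => ip (Y s o) v + ip (f s o) z) + ip (H (w t o)) z}) <->
  real_weak Y.
Proof.
split=> h z v zv t tT.
  apply: filterS (h z v zv t tT) => o e; rewrite /rip e !reKD reK_intK.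
  by congr (_ + _ + _); apply: eq_Rintegral => s _; rewrite reKD.
have h2 := h _ _ (adjoint_graph_iK hX zv) t tT.
apply: (filterS2 _ _ (h z v zv t tT) h2) => o e1 e2; apply: scal_eq.
  rewrite !reKD reK_intK -[LHS]/(rip _ _) e1.
  by congr (_ + _ + _); apply: eq_Rintegral => s _; rewrite reKD.
rewrite !imKD imK_intK !imK_ip// e2.
by congr (_ + _ + _); apply: eq_Rintegral => s _; rewrite imKD !imK_ip.
Qed.

(** Both notions of solution reduce to this one: a measurable process is a weak solution, or a mild
    one, exactly when it is a modification of [sol]. *)
Definition agrees Y := forall t, 0 <= t <= T -> {ae P, forall o, Y t o = sol t o}.

Lemma vintegrable_cut_rip (h : R -> X) v t : vintegrable mu (vrestr `[0, T] h) -> t <= T ->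
  itgable (fun s => rip (h s) v) 0 t.
Proof.
move=> ih tT; have mt : measurable (`[0, t]%classic : set (measurableTypeR R)) by exact: measurable_itv.
have := integrableS measurableT mt (@subsetT _ _) (vintegrable_rip hX sX v ih).
apply: eq_integrable => // s; rewrite inE/= in_itv/= => /andP[s0 st].
by rewrite /vrestr asboolT//= in_itv/= s0 (le_trans st).
Qed.

Lemma itg_forcing_swap (Y : R -> Omega -> X) z v t o : 0 <= t -> t <= T ->
  (forall s, 0 < s <= T -> f s o = g s o) -> itgable (fun s => rip (Y s o) v) 0 t ->
  itg (fun s => rip (Y s o) v + rip (f s o) z) 0 t =
  itg (fun s => rip (Y s o) v) 0 t + itg (fun s => rip (g s o) z) 0 t.
Proof.
move=> t0 tT efg iY; have ig := forcing_itgable hX sX fg o z 0 t.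
rewrite -itgD//; apply: itg_off_left.
  by have /measurable_int/measurable_EFinP := itgableD iY ig.
by move=> s /andP[s0 st]; rewrite efg// s0 (le_trans st).
Qed.

Lemma sol_path : {ae P, forall o, vintegrable mu (vrestr `[0, T] (sol ^~ o))}.
Proof.
have h := solution_path hZ sZ hX sX uF cQ wW gS Hb T0 fg rX0 fX0.
apply: filterS h => o ho.
apply: (vintegrable_of_sq hX sX (T := T)).
- by have := sol_measurable => /measurable_processP /jmeas_path; exact.
- by move=> s h; exact: cut_out.
- by rewrite -(integral_cut_sqnrm sol).
Qed.

Lemma sol_real_weak : real_weak sol.
Proof.
move=> z v zv t /andP[t0 tT].
have h1 := solution_weak hZ sZ hX sX uF cQ wW gS Hb X0 T0 fg zv t0 tT.
have h2 : {ae P, forall o, vintegrable mu (vrestr `[0, T] (sol ^~ o)) /\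
    forall s, 0 < s <= T -> f s o = g s o}.
  by apply: (filterS2 _ _ sol_path (forcing_ae fg)).
apply: (filterS2 _ _ h1 h2) => o -> [io efg]; congr (_ + _ + _).
have i1 := vintegrable_cut_rip v io tT.
by rewrite itg_forcing_swap// itgD//; exact: (forcing_itgable hX sX fg).
Qed.

Lemma weak_agrees Y : weak_solution P T Dom A H w f X0 Y -> agrees Y.
Proof.
move=> [/measurable_processP jY bY /real_weakP wY].
have jsol := (measurable_processP sol).1 sol_measurable.
have pY : {ae P, forall o, vintegrable mu (cut Y ^~ o)}.
  apply: filterS bY => o [v bv]; apply: (bochner_vintegrable hX sX mI fI _ bv).
  exact: jmeas_path jY.
have both : {ae P, forall o, vintegrable mu (cut Y ^~ o) /\ vintegrable mu (cut sol ^~ o)}.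
  by apply: (filterS2 _ _ pY sol_path).
have [N [sN mN nN FN]] := negligible_cover uF both.
have nN' : {ae P, forall o, ~ N o} by apply: negligibleS nN => o /contrapT.
have good o : ~ N o -> vintegrable mu (cut Y ^~ o) /\ vintegrable mu (cut sol ^~ o).
  by move=> No; apply: contrapT => h; apply: No; exact: sN.
(* The difference is set to 0 on the exceptional outcomes, because the uniqueness argument works
   with paths that are integrable for every outcome. *)
pose D s o := if `[< N o >] then 0 else cut Y s o - cut sol s o.
have jD : jmeas D.
  apply: (@wmeas_if _ _ _ _ _ [set p : measurableTypeR R * Omega | N p.2]).
  - rewrite (_ : [set _ | _] = snd @^-1` N)//.
    by rewrite -[X in measurable X]setTI; apply: measurable_snd.
  - exact: wmeas_cst.
  - exact: wmeasB.
have iD o : vintegrable mu (D ^~ o).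
  have [No|No] := pselect (N o).
    rewrite (_ : D ^~ o = cst 0); last by apply/funext => s; rewrite /D asboolT.
    split; first exact: wmeas_cst.
    by under eq_integral do rewrite nrm0//; rewrite integral0.
  rewrite (_ : D ^~ o = fun s => cut Y s o - cut sol s o); last by apply/funext => s; rewrite /D asboolF.
  by have [? ?] := good o No; exact: vintegrableB.
have wD z v : adjoint_graph Dom A z v -> forall t, 0 <= t -> t <= T ->
    {ae P, forall o, rip (D t o) z = itg (fun s => rip (D s o) v) 0 t}.
  move=> zv t t0 tT; have tI : 0 <= t <= T by rewrite t0.
  have h1 : {ae P, forall o, ~ N o /\ forall s, 0 < s <= T -> f s o = g s o}.
    by apply: (filterS2 _ _ nN' (forcing_ae fg)).
  apply: (filterS3 _ _ h1 (wY z v zv t tI) (sol_real_weak zv tI)) => o [No efg] e1 e2.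
  have [i1 i2] := good o No.
  have j1 := vintegrable_cut_rip v i1 tT; have j2 := vintegrable_cut_rip v i2 tT.
  rewrite itg_forcing_swap// in e1; rewrite itg_forcing_swap// in e2.
  have -> : itg (fun s => rip (D s o) v) 0 t =
      itg (fun s => rip (Y s o) v) 0 t - itg (fun s => rip (sol s o) v) 0 t.
    rewrite -itgB//; apply: eq_itg => s /andP[s0 st].
    by rewrite /D asboolF// !cut_id ?(le_trans st)// ripBl.
  by rewrite /D asboolF// !cut_id// ripBl// e1 e2; lra.
move=> t /andP[t0 tT]; have := weak_zero hX sX gS jD iD wD t0 tT => h.
apply: (filterS2 _ _ h nN') => o; rewrite /D => + No.
by rewrite asboolF// !cut_id// => /eqP; rewrite subr_eq0 => /eqP.
Qed.

Lemma sol_mild : mild_formula P T S H Q w f X0 sol.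
Proof.
move=> t /andP[t0 tT]; exists (noise t).
have [h1 h2] := solution_mild hZ sZ hX sX uF cQ wW gS Hb T0 fg t0 tT.
split => //; apply: filterS h2 => o bo; exists (dconv S (g ^~ o) t) => //.
by rewrite /solution /drift flowE.
Qed.

Lemma mild_agrees Y : mild_formula P T S H Q w f X0 Y -> agrees Y.
Proof.
move=> mY t tT; have [I [sI eI]] := mY t tT; have /andP[t0 tT'] := tT.
have [h1 h2] := solution_mild hZ sZ hX sX uF cQ wW gS Hb T0 fg t0 tT'.
have uI := stochastic_integral_unique hZ sZ hX sX uF cQ wW hS Hb t0 sI h1.
have mt : measurable (`[0, t]%classic : set (measurableTypeR R)) by exact: measurable_itv.
have ft : (mu `[0%R, t] < +oo)%E.
  by rewrite lebesgue_measure_itv/=; case: ifP => _; rewrite -?EFinB ltry.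
have h3 : {ae P, forall o, I o = noise t o /\ forall s, 0 < s <= T -> f s o = g s o}.
  by apply: (filterS2 _ _ uI (forcing_ae fg)).
apply: (filterS2 _ _ eI h3) => o [v bv ->] [-> efg].
have [ih e] := forcing_dconv hX sX gS fg efg t0 tT'.
by rewrite (bochner_pettis hX sX mt ft ih.1 bv) -e /solution /drift flowE.
Qed.

Section Agree.
Variable Y : R -> Omega -> X.
Hypotheses (mY : measurable_process T Y) (aY : agrees Y).

Let jY : jmeas (cut Y). Proof. exact/measurable_processP. Qed.

(** [ae_swap] for the squared norm of the difference; integrals along paths only see almost every
    time. *)
Lemma agrees_path :
  {ae P, forall o, {ae mu, forall s, cut Y s o = cut sol s o}}.
Proof.
have jsol := (measurable_processP sol).1 sol_measurable.
pose h (p : measurableTypeR R * Omega) : R := sqnrm (cut Y p.1 p.2 - cut sol p.1 p.2).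
have mh : measurable_fun setT h by apply: measurable_sqnrm => //; exact: wmeasB.
have hz s : {ae P, forall o, h (s, o) = 0}.
  have [sI|sI] := boolP (0 <= s <= T); last first.
    by apply: filterE => o; rewrite /h /= !cut_out ?subrr ?sqnrm0//; exact/negP.
  apply: filterS (aY sI) => o e; rewrite /h /=; have /andP[s0 sT] := sI.
  by rewrite !cut_id// e subrr sqnrm0.
have := @ae_swap R _ _ (measurableTypeR R) Omega mu P h mh hz.
apply: filterS => o; apply: filterS => s; rewrite /h /= => /(sqnrm_eq0 hX)/eqP.
by rewrite subr_eq0 => /eqP.
Qed.

Lemma agrees_vintegrable : {ae P, forall o, vintegrable mu (cut Y ^~ o) /\
  {ae mu, forall s, cut Y s o = cut sol s o}}.
Proof.
apply: (filterS2 _ _ agrees_path sol_path) => o e io; split => //.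
by have [] := vintegrable_ae hX sX io (jmeas_path o jY) e.
Qed.

Lemma agrees_weak : weak_solution P T Dom A H w f X0 Y.
Proof.
split => //.
  apply: filterS agrees_vintegrable => o [io _].
  by exists (pettis mu (cut Y ^~ o)); exact: pettis_bochner.
apply/real_weakP => z v zv t tT; have /andP[t0 tT'] := tT.
have h1 : {ae P, forall o, vintegrable mu (vrestr `[0, T] (sol ^~ o)) /\
    forall s, 0 < s <= T -> f s o = g s o}.
  by apply: (filterS2 _ _ sol_path (forcing_ae fg)).
have h2 : {ae P, forall o, Y t o = sol t o /\ rip (sol t o) z = rip (X0 o) z +
    itg (fun s => rip (sol s o) v + rip (f s o) z) 0 t + rip (H (w t o)) z}.
  by apply: (filterS2 _ _ (aY tT) (sol_real_weak zv tT)).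
apply: (filterS3 _ _ h1 h2 agrees_vintegrable) => o [is_ efg] [-> ->] [iY eY].
congr (_ + _ + _).
have j1 := vintegrable_cut_rip v iY tT'; have j2 := vintegrable_cut_rip v is_ tT'.
rewrite !itg_forcing_swap//; congr (_ + _); apply: ae_itg => //.
apply: (@filterS _ _ Fmu _ _ _ eY) => s + /andP[s0 st].
by rewrite !cut_id ?(le_trans st)// => ->.
Qed.

Lemma agrees_mild : mild_solution P F T S H Q w f X0 Y.
Proof.
have adY t : 0 <= t <= T -> random_element (F t) (Y t).
  move=> tT; have /andP[t0 tT'] := tT.
  apply: (ae_random_element (filtration_sigma uF t0) _ (aY tT)).
    apply: subset_trans (filtration_null uF) _; exact: (filtration_mono uF (lexx 0) t0).
  exact: (solution_adapted hZ sZ hX sX uF cQ wW gS Hb T0 fg rX0 t0 tT').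
have wY t : 0 <= t <= T -> wmeas (Y t).
  move=> tT; have /andP[t0 tT'] := tT.
  by apply: (filtration_wmeas_sub uF hX sX t0); exact: (filtration_wmeas uF hX sX t0 (lexx t) (adY t tT)).
have ws t : wmeas (sol t) := solution_wmeas hZ sZ hX sX uF cQ wW gS Hb T0 fg rX0 t.
have [C hC] := solution_bounded hZ sZ hX sX uF cQ wW gS Hb T0 fg rX0 fX0.
split.
- by split=> // t; rewrite /= in_itv/=; exact: adY.
- move=> t tT; have /andP[t0 tT'] := tT; rewrite unlock.
  rewrite [X in (X < _)%E](_ : _ = L2sq P (sol t)).
    by apply: (le_lt_trans (hC t t0 tT')); rewrite ltry.
  exact: (L2sq_ae_eq hX sX (wY t tT) (ws t) (aY tT)).
- move=> t tT; have /andP[t0 tT'] := tT.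
  have := solution_continuous hZ sZ hX sX uF cQ wW gS Hb T0 fg rX0 fX0 t0 tT'.
  apply: cvg_trans; apply: near_eq_cvg; rewrite /within/=; apply: (@filterE _ (nbhs t)) => s.
  rewrite in_itv/= => sT; rewrite unlock; apply: (L2sq_ae_eq hX sX).
  + by apply: wmeasB.
  + by apply: wmeasB => //; [exact: wY|exact: wY].
  + by apply: (filterS2 _ _ (aY tT) (aY sT)) => o -> ->.
- have h := solution_path hZ sZ hX sX uF cQ wW gS Hb T0 fg rX0 fX0.
  apply: (filterS2 _ _ h agrees_path) => o; rewrite !integral_cut_sqnrm => ho eo.
  rewrite (_ : integral _ _ _ = \int[mu]_(s in `[0%R, T]) (sqnrm (cut sol s o))%:E)%E//.
  apply: ae_eq_integral => //.
  + by apply: measurable_funTS; apply: emeasurable_sqnrm => //; exact: jmeas_path jY.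
  + apply: measurable_funTS; apply: emeasurable_sqnrm => //.
    by have := sol_measurable => /measurable_processP /jmeas_path; exact.
  + by apply: (@filterS _ _ Fmu _ _ _ eo) => s -> _.
- move=> t tT; have [I [sI eI]] := sol_mild tT; exists I; split => //.
  by apply: (filterS2 _ _ (aY tT) eI) => o -> .
Qed.

End Agree.

Lemma sol_agrees : agrees sol.
Proof. by move=> t _; exact: filterE. Qed.

Lemma weak_mild Y : weak_solution P T Dom A H w f X0 Y <-> mild_solution P F T S H Q w f X0 Y.
Proof.
split.
  by move=> wY; have [mY _ _] := wY; apply: agrees_mild => //; exact: weak_agrees.
by move=> [[mY _] _ _ _ hY]; apply: agrees_weak => //; exact: mild_agrees.
Qed.

Lemma weak_exists_unique : exists Y, [/\ weak_solution P T Dom A H w f X0 Y,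
  mild_formula P T S H Q w f X0 Y &
  forall Y', weak_solution P T Dom A H w f X0 Y' ->
    forall t, 0 <= t <= T -> {ae P, forall o, Y' t o = Y t o}].
Proof.
exists sol; split; first by apply: agrees_weak; [exact: sol_measurable|exact: sol_agrees].
  exact: sol_mild.
by move=> Y /weak_agrees.
Qed.

End Solutions.

(** * The energy space *)

Section ImaginaryUnit.
Variables (R : realType) (k : RorC).

(** Covers both fields: over the reals both sides are 0, over the complex numbers [imK iK] is 1. *)
Lemma imK_iK (x : scal R k) : imK x * imK (iK : scal R k) = imK x.
Proof. by rewrite /iK; case: k x => /= [x|[x1 x2]]; rewrite ?mul0r ?mulr1. Qed.

Lemma reK_iK : reK (iK : scal R k) = 0.
Proof. by rewrite /iK; case: k. Qed.

End ImaginaryUnit.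

(** * Euclidean spaces are separable Hilbert spaces *)

Section Euclidean.
Variables (R : realType) (k : RorC) (n : nat).
Local Notation K := (scal R k).
Local Notation E := (euclid R k n).
Implicit Types x y : E.

Local Notation entry x i := ((x : 'cV[K]_n) i 0).

Lemma euclid_rip x y :
  rip x y = \sum_(i < n) (reK (entry x i) * reK (entry y i) + imK (entry x i) * imK (entry y i)).
Proof.
rewrite /rip /= /euclid_ip reK_sum; apply: eq_bigr => i _.
by rewrite reKM reK_conj imK_conj mulrN opprK.
Qed.

Lemma entry_sqnrm x j : reK (entry x j) ^+ 2 + imK (entry x j) ^+ 2 <= sqnrm x.
Proof.
rewrite sqnrm_euclid (bigD1 j)//= lerDl sumr_ge0// => i _.
by rewrite addr_ge0// sqr_ge0.
Qed.

Lemma reK_entry_le x j : `|reK (entry x j)| <= nrm x.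
Proof.
rewrite -sqrtr_sqr; apply: ler_wsqrtr; apply: le_trans (entry_sqnrm x j).
by rewrite lerDl sqr_ge0.
Qed.

Lemma imK_entry_le x j : `|imK (entry x j)| <= nrm x.
Proof.
rewrite -sqrtr_sqr; apply: ler_wsqrtr; apply: le_trans (entry_sqnrm x j).
by rewrite lerDr sqr_ge0.
Qed.

Lemma euclid_complete (v : nat -> E) :
  (forall e : R, 0 < e -> exists N, forall i j,
     (N <= i)%N -> (N <= j)%N -> nrm (v i - v j) < e) ->
  exists l : E, (fun i => nrm (v i - l)) @ \oo --> (0 : R).
Proof.
move=> cv.
have lim (phi : E -> R) : (forall x y, `|phi x - phi y| <= nrm (x - y)) ->
    exists l : R, (fun i => phi (v i)) @ \oo --> l.
  move=> hphi; apply/cvg_ex; apply/cauchy_cvgP; apply: cauchy_exP => e e0.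
  have [N hN] := cv e e0; exists (phi (v N)), N => // i /= Ni.
  exact: le_lt_trans (hphi _ _) (hN _ _ (leqnn _) Ni).
have /choice[a ha] j : exists l : R, (fun i => reK (entry (v i) j)) @ \oo --> l.
  apply: (lim (fun x => reK (entry x j))) => x y; have := reK_entry_le (x - y) j.
  by rewrite !mxE reKD reKN.
have /choice[b hb] j : exists l : R, (fun i => imK (entry (v i) j)) @ \oo --> l.
  apply: (lim (fun x => imK (entry x j))) => x y; have := imK_entry_le (x - y) j.
  by rewrite !mxE imKD imKN.
pose l : 'cV[K]_n := \col_j (ofR k (a j) + ofR k (b j) * iK).
have rl j : reK (l j 0) = a j.
  by rewrite mxE reKD reK_ofR mulrC reK_iKM imK_ofR oppr0 addr0.
(* Passing to the limit in [imK_iK] shows that [b j] vanishes in the real case, as it must for [l]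
   to have this imaginary part. *)
have il j : imK (l j 0) = b j.
  have e : (fun i => imK (entry (v i) j)) @ \oo --> b j * imK (iK : K).
    by under eq_fun do rewrite -imK_iK; apply: cvgM => //; exact: cvg_cst.
  rewrite mxE imKD imK_ofR add0r imKM imK_ofR reK_ofR mul0r addr0.
  exact: (cvg_unique (@Rhausdorff R) e (hb j)).
clearbody l; have s0 : (fun i => sqnrm (v i - l)) @ \oo --> (0 : R).
  rewrite [X in X @ _ --> _](_ : _ = fun i => \sum_(j < n) ((reK (entry (v i) j) - a j) ^+ 2 +
      (imK (entry (v i) j) - b j) ^+ 2)); last first.
    apply/funext => i; rewrite sqnrm_euclid; apply: eq_bigr => j _.
    by rewrite !mxE !reKD !imKD !reKN !imKN rl il.
  rewrite [X in _ --> X](_ : 0 = \sum_(j < n) ((a j - a j) * (a j - a j) + (b j - b j) * (b j - b j))).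
    apply: cvg_big => [|j _]; first exact: add_continuous.
    under eq_fun do rewrite !expr2.
    apply: cvgD.
      by apply: cvgM; apply: cvgB => //; exact: cvg_cst.
    by apply: cvgM; apply: cvgB => //; exact: cvg_cst.
  by rewrite big1// => j _; rewrite !subrr mulr0 addr0.
by exists l; rewrite -[X in _ --> X](@sqrtr0 R); apply: continuous_cvg => //; exact: sqrt_continuous.
Qed.

Lemma euclid_hilbert : hilbert E.
Proof.
split.
- move=> c x y z; rewrite /= /euclid_ip mulr_sumr -big_split/=; apply: eq_bigr => i _.
  by rewrite !mxE mulrDl mulrA.
- move=> x y; rewrite /= /euclid_ip; apply: scal_eq.
    by rewrite reK_conj !reK_sum; apply: eq_bigr => i _; rewrite !reKM !reK_conj !imK_conj; ring.
  by rewrite imK_conj !imK_sum -sumrN; apply: eq_bigr => i _; rewrite !imKM !reK_conj !imK_conj; ring.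
- move=> x; rewrite -[reK _]/(sqnrm x) sqnrm_euclid sumr_ge0// => i _.
  by rewrite addr_ge0// sqr_ge0.
- move=> x x0; have s0 : sqnrm x = 0 by rewrite /sqnrm x0 reK0.
  apply/matrixP => i j; rewrite ord1 mxE; have := entry_sqnrm x i; rewrite s0.
  have := sqr_ge0 (reK (entry x i)); have := sqr_ge0 (imK (entry x i)).
  move=> h1 h2 h3; apply: scal_eq; rewrite ?reK0 ?imK0; apply/eqP; rewrite -sqrf_eq0; apply/eqP; lra.
- exact: euclid_complete.
Qed.

Lemma euclid_rip_delta x j : rip x (delta_mx j 0 : 'cV[K]_n) = reK (entry x j).
Proof.
rewrite euclid_rip (bigD1 j)//= big1 => [|i ij]; last first.
  by rewrite mxE (negPf ij)/= reK0 imK0 !mulr0 addr0.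
by rewrite mxE !eqxx/= -ofR1 reK_ofR imK_ofR mulr1 mulr0 !addr0.
Qed.

Lemma euclid_rip_idelta x j : rip x (iK *: (delta_mx j 0 : 'cV[K]_n)) = imK (entry x j).
Proof.
rewrite euclid_rip (bigD1 j)//= big1 => [|i ij]; last first.
  by rewrite !mxE (negPf ij)/= mulr0 reK0 imK0 !mulr0 addr0.
by rewrite !mxE !eqxx/= mulr1 reK_iK mulr0 add0r imK_iK addr0.
Qed.

Lemma euclid_separable : separable E.
Proof.
have tv : total (fun j : nat => (if insub j is Some i then (delta_mx i 0 : 'cV[K]_n) else 0) : E).
  move=> x h; apply/matrixP => i j; rewrite ord1 mxE; have := h (val i).
  rewrite valK => h0; apply: scal_eq.
    by rewrite -euclid_rip_delta /rip h0 !reK0.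
  by rewrite imK0 -euclid_rip_idelta -(imK_ip euclid_hilbert) h0 imK0.
exact: (onb_separable euclid_hilbert (gram_schmidt_onb euclid_hilbert tv)).
Qed.

Lemma wmeas_euclid d (T : measurableType d) (xi : T -> E) : wmeas xi <->
  forall i, measurable_fun setT (fun t => reK (entry (xi t) i)) /\
            measurable_fun setT (fun t => imK (entry (xi t) i)).
Proof.
split=> [mx i|mx z].
  split.
    by under eq_fun do rewrite -euclid_rip_delta; exact: mx.
  by under eq_fun do rewrite -euclid_rip_idelta; exact: mx.
under eq_fun do rewrite euclid_rip; apply: measurable_sum => i; have [m1 m2] := mx i.
by apply: measurable_funD; apply: measurable_funM.
Qed.

End Euclidean.

(** * Functions whose primitive vanishes at the rationals *)

Section VanishingPrimitive.
Variable R : realType.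
Local Notation mu := (@lebesgue_measure R).

(** Almost everywhere the primitive is differentiable with derivative [phi]. At such a point it is
    continuous, hence 0 like its values at nearby rationals, and difference quotients along
    increments ending at rationals force the derivative to be 0. *)
Lemma ae_zero_of_primitive (phi : R -> R) :
  mu.-integrable setT (EFin \o phi) ->
  (forall q : rat, Rintegral mu setT (fun z : R => (z <= ratr q)%R%:R * phi z) = 0) ->
  {ae mu, forall z, phi z = 0}.
Proof.
move=> iphi zq.
have iN (y : R) : mu.-integrable `]-oo, y] (EFin \o phi).
  have mN : measurable (`]-oo, y]%classic : set (measurableTypeR R)) by exact: measurable_itv.
  exact: integrableS measurableT mN (@subsetT _ _) iphi.
have lphi : locally_integrable setT phi.
  have := integrable_locally measurableT iphi.
  by rewrite (_ : phi \_ _ = phi)//; apply/funext => z; rewrite patchE in_setT.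
have := FTC1Ny iN lphi.
pose F (x : R) := (\int[mu]_(t in [set` `]-oo, x]]) phi t)%R.
have Fq (q : rat) : F (ratr q) = 0.
  rewrite /F Rintegral_mkcond -(zq q); apply: eq_Rintegral => z _; rewrite patchE.
  by case: (boolP (z \in _)); rewrite ?inE ?notin_setE /= in_itv/= => h; rewrite ?h ?(negbTE (introN idP h)) ?mul1r ?mul0r.
have FF := ae_filter_ringOfSetsType mu.
apply: filterS => x [dF Fx]; rewrite -Fx.
have cF : {for x, continuous F} by exact/differentiable_continuous/derivable1_diffP.
have Fx0 : F x = 0.
  apply/eqP; rewrite -normr_le0; apply/ler_addgt0Pr => e e0; rewrite add0r.
  move/cvgrPdist_lt : cF => /(_ e e0) [dl /= dl0 hdl].
  have [q] : exists q : rat, ratr q \in `]x, (x + dl)[ by apply: rat_in_itvoo; rewrite ltrDl.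
  rewrite in_itv/= => /andP[xq qx]; have := hdl (ratr q).
  rewrite /= distrC gtr0_norm ?subr_gt0// ltrBlDl => /(_ qx).
  by rewrite Fq subr0 => /ltW.
apply/eqP; apply: contrapT => /negP L0.
have Lp : 0 < `|derive1 F x| by rewrite normr_gt0.
move: dF => /cvg_ex[l hl]; have El : derive1 F x = l.
  by rewrite derive1E; apply/cvg_lim => //; exact: Rhausdorff.
rewrite El in Lp; move/cvgrPdist_lt : hl => /(_ _ Lp) [dl /= dl0 hdl].
have [q] : exists q : rat, ratr q \in `]x, (x + dl)[ by apply: rat_in_itvoo; rewrite ltrDl.
rewrite in_itv/= => /andP[xq qx]; have := hdl (ratr q - x).
rewrite /= sub0r normrN gtr0_norm ?subr_gt0// ltrBlDl => /(_ qx).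
rewrite subr_eq0 gt_eqF// => /(_ isT).
by rewrite /= [_ *: 1]mulr1 subrK -/(F _) -/(F _) Fq Fx0 subr0 scaler0 subr0 ltxx.
Qed.

End VanishingPrimitive.

(** * The weighted space is a separable Hilbert space *)

Section EnergySpace.
Variables (R : realType) (k : RorC) (a b : R) (n : nat) (m0 M0 : R).
Variable Hm : R -> 'M[scal R k]_n.
Hypothesis hE : energy_density a b m0 M0 Hm.
Local Notation K := (scal R k).
Local Notation E := (euclid R k n).
Local Notation I := (`[a, b]%classic : set R).
Local Notation mu := (@lebesgue_measure R).
Local Notation L2f := (@L2fun R k a b n).
Local Notation L2c := (@L2 R k a b n).
Let FF := ae_filter_ringOfSetsType mu.
Let eH : hilbert E := euclid_hilbert R k n.
Let sE : separable E := euclid_separable R k n.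
Implicit Types (f g : L2f) (x y : L2c).

Let mI : measurable (I : set (measurableTypeR R)) := measurable_itv `[a, b].

Lemma wmeas_vrestrP (v : R -> 'cV[K]_n) :
  (forall i, measurable_fun I (fun z => reK (v z i 0)) /\
             measurable_fun I (fun z => imK (v z i 0))) <->
  wmeas (vrestr I (v : R -> E) : measurableTypeR R -> E).
Proof.
have patch_entry (phi : E -> R) : phi 0 = 0 ->
    (fun z => phi (vrestr I (v : R -> E) z)) = (fun z => phi (v z)) \_ I.
  move=> p0; apply/funext => z; rewrite /vrestr patchE.
  case: asboolP => h; first by rewrite mem_set.
  by rewrite memNset.
have re0 i : reK (((0 : E) : 'cV[K]_n) i 0) = 0 by rewrite mxE reK0.
have im0 i : imK (((0 : E) : 'cV[K]_n) i 0) = 0 by rewrite mxE imK0.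
pose re i (w : E) := reK ((w : 'cV[K]_n) i 0); pose im i (w : E) := imK ((w : 'cV[K]_n) i 0).
split=> h.
  apply/wmeas_euclid => i; have [r1 r2] := h i; split.
    by rewrite (patch_entry (re i) (re0 i)); apply/(measurable_restrictT _ mI).
  by rewrite (patch_entry (im i) (im0 i)); apply/(measurable_restrictT _ mI).
move=> i; have [r1 r2] := (wmeas_euclid _).1 h i; split; apply/(measurable_restrictT _ mI).
  by rewrite -(patch_entry (re i) (re0 i)).
by rewrite -(patch_entry (im i) (im0 i)).
Qed.

Lemma sq_integrableP (v : R -> 'cV[K]_n) : square_integrable a b v <->
  sqint mu (vrestr I (v : R -> E) : measurableTypeR R -> E).
Proof.
rewrite /square_integrable /sqint /L2sq -(integral_vrestr _ _ (sqnrm0 eH)).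
by split=> -[/wmeas_vrestrP h1 h2].
Qed.

Definition res f : measurableTypeR R -> E := vrestr I (L2fun_val f : R -> E).

Lemma res_sqint f : sqint mu (res f).
Proof. by apply/sq_integrableP; case: f => f /= /asboolP. Qed.

Definition weighted f : R -> E := fun z => Hm z *m L2fun_val f z.

Let row_vec i : R -> E := fun z => (\col_j conjK (Hm z i j) : 'cV[K]_n).

Let row_vecE i z j : (row_vec i z : 'cV[K]_n) j 0 = conjK (Hm z i j).
Proof. by rewrite mxE. Qed.

(** An entry of the weighted vector as an inner product, so that its measurability and its size
    follow from [measurable_rip] and Cauchy-Schwarz. *)
Lemma weighted_row f i z : ip (L2fun_val f z : E) (row_vec i z) = (weighted f z : 'cV[K]_n) i 0.
Proof.
rewrite /= /euclid_ip /weighted mxE; apply: eq_bigr => j _.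
by rewrite mxE conjKK mulrC.
Qed.

Lemma wmeas_iK d (Om : measurableType d) (xi : Om -> E) : wmeas xi -> wmeas (fun o => iK *: xi o).
Proof.
move=> mx z; under eq_fun do rewrite rip_iK//.
by apply: measurableT_comp => //; exact: mx.
Qed.

Lemma weighted_sqint f : sqint mu (vrestr I (weighted f) : measurableTypeR R -> E).
Proof.
have mrow i : wmeas (vrestr I (row_vec i) : measurableTypeR R -> E).
  apply/wmeas_vrestrP => j; have [h1 h2] := energy_density_measurable hE i j; split.
    apply: (eq_measurable_fun _ _ h1) => z _; rewrite -reK_conj.
    exact: congr1 (esym (row_vecE i z j)).
  have h3 : measurable_fun I (fun z => - imK (Hm z i j)) by apply: measurableT_comp.
  apply: (eq_measurable_fun _ _ h3) => z _; rewrite -imK_conj.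
  exact: congr1 (esym (row_vecE i z j)).
have mf := (res_sqint f).1.
have mw : wmeas (vrestr I (weighted f) : measurableTypeR R -> E).
  apply/wmeas_vrestrP => i; split.
    apply: (eq_measurable_fun (fun z => rip (res f z) (vrestr I (row_vec i) z))).
      by move=> z /set_mem zI; rewrite /res /vrestr !asboolT// -weighted_row.
    by apply: measurable_funTS; apply: measurable_rip.
  apply: (eq_measurable_fun (fun z => rip (res f z) (iK *: vrestr I (row_vec i) z))).
    by move=> z /set_mem zI; rewrite /res /vrestr !asboolT// -imK_ip// -weighted_row.
  by apply: measurable_funTS; apply: measurable_rip => //; exact: wmeas_iK.
split => //; have [C hC] := energy_density_bounded hE.
have {}hC : {ae mu, forall z, forall i j, I z -> reK (Hm z i j) ^+ 2 + imK (Hm z i j) ^+ 2 <= C}.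
  by apply: filter_forall => i; apply: filter_forall => j; exact: hC.
(* Each of the n rows of the density has squared norm at most n C; the factor 2 is for the real and
   the imaginary part of the entry. *)
pose c : R := \sum_(i < n) 2 * (\sum_(j < n) C).
apply: (@le_lt_trans _ _ (\int[mu]_z (`|c|%:E * (sqnrm (res f z))%:E))%E).
  apply: ae_ge0_le_integral => //.
  - by move=> z _; rewrite lee_fin sqnrm_ge0.
  - exact: emeasurable_sqnrm.
  - by move=> z _; rewrite -EFinM lee_fin mulr_ge0// sqnrm_ge0.
  - by apply: measurable_funeM; exact: emeasurable_sqnrm.
  apply: (@filterS _ _ FF _ _ _ hC) => z hz _; rewrite -EFinM lee_fin /res /vrestr.
  case: asboolP => zI; last by rewrite !sqnrm0// mulr0.
  apply: (@le_trans _ _ (c * sqnrm (L2fun_val f z : E))); last first.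
    by rewrite ler_wpM2r ?ler_norm// sqnrm_ge0.
  rewrite sqnrm_euclid /c mulr_suml; apply: ler_sum => i _; rewrite -weighted_row.
  have rowC : sqnrm (row_vec i z) <= \sum_(j < n) C.
    by rewrite sqnrm_euclid; apply: ler_sum => j _; rewrite mxE reK_conj imK_conj sqrrN; exact: hz.
  have h1 := cauchy_schwarz_sq eH (L2fun_val f z : E) (row_vec i z).
  have h2 := cauchy_schwarz_sq eH (L2fun_val f z : E) (iK *: row_vec i z).
  rewrite (imK_ip eH) -[reK _]/(rip _ _); have s0 := sqnrm_ge0 eH (L2fun_val f z : E).
  have := ler_wpM2l s0 rowC; have := ler_wpM2l s0 (sqnrm_iK eH (row_vec i z)); lra.
rewrite ge0_integralZl//; last 2 first.
- by apply: emeasurable_sqnrm.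
- by move=> z _; rewrite lee_fin sqnrm_ge0.
by rewrite lte_mul_pinfty// ?lee_fin//; exact: (res_sqint f).2.
Qed.

(** The energy form on functions instead of classes. By [form_ae] it only depends on the classes, so
    that the axioms of an inner product are checked on functions. *)
Definition form f g : K := ofR k 2^-1 * intK mu I (fun z => ip (weighted f z) (L2fun_val g z : E)).

Lemma energy_ipE x y : energy_ip Hm x y = form (L2repr x) (L2repr y).
Proof.
rewrite /energy_ip /form; congr (_ * _); congr intK; apply/funext => z.
rewrite -mulmxA mxE /= /euclid_ip; apply: eq_bigr => i _.
by rewrite !mxE mulrC.
Qed.

Lemma form_itg f g : mu.-integrable I (EFin \o fun z => rip (weighted f z) (L2fun_val g z : E)).
Proof.
have := sqint_rip eH sE (weighted_sqint f) (res_sqint g).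
move=> /(integrableS measurableT mI (@subsetT _ _)); apply: eq_integrable => // z /set_mem zI.
by rewrite /res /vrestr /= !asboolT.
Qed.

Lemma reK_form f g :
  reK (form f g) = 2^-1 * Rintegral mu I (fun z => rip (weighted f z) (L2fun_val g z : E)).
Proof. by rewrite /form reKM reK_ofR imK_ofR mul0r subr0 reK_intK. Qed.

Lemma imK_form f g : imK (form f g) = reK (form f (iK *: g)).
Proof.
rewrite reK_form /form imKM reK_ofR imK_ofR mul0r addr0 imK_intK; congr (_ * _).
by apply: eq_Rintegral => z _; rewrite imK_ip.
Qed.

Lemma reK_form_ae f f' g g' : (L2fun_val f = L2fun_val f' %[ae mu in I]) ->
  (L2fun_val g = L2fun_val g' %[ae mu in I]) -> reK (form f g) = reK (form f' g').
Proof.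
move=> ef eg; rewrite !reK_form; congr (_ * fine _); apply: ae_eq_integral => //.
- exact: measurable_int (form_itg f g).
- exact: measurable_int (form_itg f' g').
by apply: (@filterS2 _ _ FF _ _ _ _ ef eg) => z hf hg zI; rewrite /weighted hf// hg.
Qed.

Lemma form_ae f f' g g' : (L2fun_val f = L2fun_val f' %[ae mu in I]) ->
  (L2fun_val g = L2fun_val g' %[ae mu in I]) -> form f g = form f' g'.
Proof.
move=> ef eg; apply: scal_eq; first exact: reK_form_ae.
rewrite !imK_form; apply: reK_form_ae => //; apply: (@filterS _ _ FF _ _ _ eg) => z hg zI.
by rewrite -[LHS]/(iK *: L2fun_val g z) hg.
Qed.

Lemma intK_linear (c : K) (phi psi : R -> K) :
  mu.-integrable I (EFin \o fun z => reK (phi z)) ->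
  mu.-integrable I (EFin \o fun z => imK (phi z)) ->
  mu.-integrable I (EFin \o fun z => reK (psi z)) ->
  mu.-integrable I (EFin \o fun z => imK (psi z)) ->
  intK mu I (fun z => c * phi z + psi z) = c * intK mu I phi + intK mu I psi.
Proof.
move=> ir ii jr ji.
have iZ r (h : R -> R) : mu.-integrable I (EFin \o h) -> mu.-integrable I (EFin \o fun z => r * h z).
  by move=> ih; exact: (integrableZl mI r ih).
have lin r q (h1 h2 h3 : R -> R) : mu.-integrable I (EFin \o h1) ->
    mu.-integrable I (EFin \o h2) -> mu.-integrable I (EFin \o h3) ->
    Rintegral mu I (fun z => r * h1 z + q * h2 z + h3 z) =
    r * Rintegral mu I h1 + q * Rintegral mu I h2 + Rintegral mu I h3.
  move=> i1 i2 i3; rewrite RintegralD//; last first.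
    by have := integrableD mI (iZ r _ i1) (iZ q _ i2); apply: eq_integrable.
  rewrite RintegralD//; [|exact: iZ|exact: iZ].
  by rewrite RintegralZl// RintegralZl.
apply: scal_eq.
  rewrite reKD reKM !reK_intK imK_intK -mulNr -lin//.
  by apply: eq_Rintegral => z _; rewrite reKD reKM mulNr.
rewrite imKD imKM !imK_intK reK_intK -lin//.
by apply: eq_Rintegral => z _; rewrite imKD imKM.
Qed.

Lemma form_linear (c : K) f f' g : form (c *: f + f') g = c * form f g + form f' g.
Proof.
have im h : mu.-integrable I (EFin \o fun z => imK (ip (weighted h z) (L2fun_val g z : E))).
  apply: eq_integrable (form_itg h (iK *: g)) => // z _.
  by rewrite [RHS]/comp imK_ip.
rewrite /form mulrCA -mulrDr -intK_linear; [|exact: form_itg|exact: im|exact: form_itg|exact: im].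
congr (_ * intK _ _ _); apply/funext => z.
by rewrite /weighted -[L2fun_val _ z]/(_ *: _ + _) mulmxDr -scalemxAr ipDl// ipZl.
Qed.

Lemma ip_weighted_sym z (v w : 'cV[K]_n) : (map_mx conjK (Hm z))^T = Hm z ->
  ip (Hm z *m v : E) (w : E) = ip (v : E) (Hm z *m w : E).
Proof.
move=> sz; rewrite /= /euclid_ip.
under eq_bigr do rewrite mxE mulr_suml; rewrite exchange_big/=; apply: eq_bigr => j _.
rewrite mxE (big_morph _ (@conjKD R k) (@conjK0 R k)) mulr_sumr; apply: eq_bigr => i _.
rewrite conjKM -{1}sz !mxE mulrA; congr (_ * _); exact: mulrC.
Qed.

Lemma reK_formC f g : reK (form f g) = reK (form g f).
Proof.
rewrite !reK_form; congr (_ * fine _); apply: ae_eq_integral => //.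
- exact: measurable_int (form_itg f g).
- exact: measurable_int (form_itg g f).
apply: (@filterS _ _ FF _ _ _ (energy_density_selfadjoint hE)) => z hz zI; congr EFin.
by rewrite /rip ip_weighted_sym; [rewrite ipC// reK_conj|exact: hz].
Qed.

Lemma reK_form_iK f g : reK (form (iK *: f) g) = - reK (form f (iK *: g)).
Proof.
rewrite -(addr0 (iK *: f)) form_linear reKD reK_iKM imK_form.
have -> : form 0 g = 0.
  by have := form_linear (-1) 0 0 g; rewrite scaler0 addr0 mulN1r addNr.
by rewrite reK0 addr0.
Qed.

Lemma form_conj f g : form g f = conjK (form f g).
Proof.
apply: scal_eq; first by rewrite reK_conj reK_formC.
by rewrite imK_conj !imK_form reK_formC reK_form_iK.
Qed.

Lemma mx_form z (v w : 'cV[K]_n) :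
  ((map_mx conjK w)^T *m Hm z *m v) 0 0 = ip (Hm z *m v : E) (w : E).
Proof.
rewrite -mulmxA mxE /= /euclid_ip; apply: eq_bigr => i _.
by rewrite !mxE mulrC.
Qed.

(** The energy norm is equivalent to the unweighted one, which is how definiteness and completeness
    are transferred; the 2 undoes the factor 1/2 of the form. *)
Lemma form_bounds f : (m0%:E * L2sq mu (res f) <= (2 * reK (form f f))%:E)%E /\
  ((2 * reK (form f f))%:E <= M0%:E * L2sq mu (res f))%E.
Proof.
pose W z := rip (vrestr I (weighted f) z) (res f z).
have iW : mu.-integrable setT (EFin \o W) := sqint_rip eH sE (weighted_sqint f) (res_sqint f).
have bW : {ae mu, forall z, m0 * sqnrm (res f z) <= W z <= M0 * sqnrm (res f z)}.
  apply: (@filterS _ _ FF _ _ _ (energy_density_coercive hE)) => z hz.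
  rewrite /W /res /vrestr; case: asboolP => zI; last by rewrite sqnrm0// rip0l// !mulr0 lexx.
  by have := hz zI (L2fun_val f z); rewrite mx_form.
have m00 := energy_density_m0 hE; have M00 := energy_density_M0 hE.
have s0 z := sqnrm_ge0 eH (res f z).
have mN : measurable_fun setT (fun z => (sqnrm (res f z))%:E).
  by apply: emeasurable_sqnrm => //; exact: (res_sqint f).1.
have mW : measurable_fun setT (fun z => `|W z|%:E).
  apply/measurable_EFinP; apply: measurableT_comp => //.
  by have /measurable_int/measurable_EFinP := iW.
have eW : (2 * reK (form f f))%:E = (\int[mu]_z `|W z|%:E)%E.
  rewrite reK_form mulrA divff// mul1r (_ : Rintegral _ _ _ = Rintegral mu setT W); last first.
    rewrite Rintegral_mkcond; apply: eq_Rintegral => z _; rewrite patchE /W /res /vrestr.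
    case: (boolP (z \in _)); first by move=> /set_mem h; rewrite !asboolT.
    by rewrite notin_setE => h; rewrite !asboolF// rip0l.
  rewrite /Rintegral fineK; last exact: integrable_fin_num.
  apply: ae_eq_integral => //; first exact: measurable_int iW.
  apply: (@filterS _ _ FF _ _ _ bW) => z /andP[h1 _] _; rewrite ger0_norm//.
  by apply: le_trans h1; rewrite mulr_ge0// ltW.
have cE (c : R) : 0 < c -> (c%:E * L2sq mu (res f) = \int[mu]_z (c * sqnrm (res f z))%:E)%E.
  move=> c0; rewrite /L2sq -ge0_integralZl//.
  - by move=> z _; rewrite lee_fin.
  - by rewrite lee_fin ltW.
have mc (c : R) : measurable_fun setT (fun z => (c * sqnrm (res f z))%:E).
  by under eq_fun do rewrite EFinM; exact: measurable_funeM.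
rewrite eW !cE//; split; apply: ae_ge0_le_integral => //.
- by move=> z _; rewrite lee_fin mulr_ge0// ltW.
- by apply: (@filterS _ _ FF _ _ _ bW) => z /andP[h _] _; rewrite lee_fin (le_trans h)// ler_norm.
- by move=> z _; rewrite lee_fin mulr_ge0// ltW.
apply: (@filterS _ _ FF _ _ _ bW) => z /andP[h1 h2] _; rewrite lee_fin ger0_norm//.
by apply: le_trans h1; rewrite mulr_ge0// ltW.
Qed.

Lemma L2repr_class f : L2fun_val (L2repr (L2class f)) = L2fun_val f %[ae mu in I].
Proof.
have /L2classP/asboolP := L2reprK (L2class f).
apply: (@filterS _ _ FF) => z h zI; apply/eqP; rewrite -subr_eq0; apply/eqP; exact: h.
Qed.

Lemma L2repr_linear (c : K) x y :
  L2fun_val (L2repr (c *: x + y)) = L2fun_val (c *: L2repr x + L2repr y) %[ae mu in I].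
Proof.
have e : c *: x + y = L2class (c *: L2repr x + L2repr y) by rewrite L2classD L2classZ !L2reprK.
by have := L2repr_class (c *: L2repr x + L2repr y); rewrite -e.
Qed.

Lemma L2repr_sub x y :
  L2fun_val (L2repr (x - y)) = L2fun_val (L2repr x - L2repr y) %[ae mu in I].
Proof.
have -> : x - y = -1 *: y + x by rewrite scaleN1r addrC.
have -> : L2repr x - L2repr y = -1 *: L2repr y + L2repr x by rewrite scaleN1r addrC.
exact: L2repr_linear.
Qed.

Lemma L2class0 : L2class (0 : L2f) = 0.
Proof. by apply: (addrI (L2class 0)); rewrite -L2classD !addr0. Qed.

Local Notation V := (energy_space a b Hm).

Lemma sqnrm_energy_sub (x y : V) :
  sqnrm (x - y) = reK (form (L2repr x - L2repr y) (L2repr x - L2repr y)).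
Proof. by rewrite /sqnrm /= energy_ipE; apply: reK_form_ae; exact: L2repr_sub. Qed.

Lemma sqnrm_energy_ge0 (x : V) : 0 <= sqnrm x.
Proof.
rewrite /sqnrm /= energy_ipE; have [h _] := form_bounds (L2repr x).
have := energy_density_m0 hE => m00; suff : 0 <= 2 * reK (form (L2repr x) (L2repr x)).
  by rewrite pmulr_rge0.
by rewrite -lee_fin; apply: le_trans h; rewrite mule_ge0 ?lee_fin ?(ltW m00)//; exact: L2sq_ge0.
Qed.

Lemma resB f g z : res (f - g) z = res f z - res g z.
Proof. by rewrite /res /vrestr; case: asboolP => // _; rewrite subrr. Qed.

Lemma form_eq0 f g : (weighted f = cst 0 %[ae mu in I]) -> form f g = 0.
Proof.
move=> w0; have re h : reK (form f h) = 0.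
  rewrite reK_form (_ : Rintegral _ _ _ = Rintegral mu I (cst 0)).
    by rewrite /Rintegral integral0 mulr0.
  congr fine; apply: ae_eq_integral => //; first exact: measurable_int (form_itg f h).
    by apply/measurable_EFinP; exact: measurable_cst.
  by apply: (@filterS _ _ FF _ _ _ w0) => z hz zI; rewrite hz// /cst rip0l.
by apply: scal_eq; rewrite ?imK_form re ?reK0 ?imK0.
Qed.

Lemma energy_eq0 (x : V) : ip x x = 0 -> x = 0.
Proof.
rewrite /= energy_ipE => f0; have [h _] := form_bounds (L2repr x).
rewrite f0 reK0 mulr0 in h; have m00 := energy_density_m0 hE.
have /L2sq0_ae e : L2sq mu (res (L2repr x)) = 0%E.
  apply/eqP; rewrite eq_le L2sq_ge0// andbT.
  by rewrite -(@lee_pmul2l _ m0%:E) ?lte_fin// mule0.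
have {}e := e eH sE (res_sqint _).1.
rewrite -(L2reprK x) -L2class0; apply/L2classP; rewrite subr0; apply/asboolP.
by apply: (@filterS _ _ FF _ _ _ e) => z + zI; rewrite /res /vrestr asboolT.
Qed.

(** Riesz-Fischer: by [form_bounds] the sequence is Cauchy for the unweighted norm, a subsequence
    with increments of order 8^-m has a limit by [L2sq_flim], and [form_bounds] carries the
    convergence back. *)
Lemma energy_complete (v : nat -> V) :
  (forall e : R, 0 < e -> exists N, forall i j,
     (N <= i)%N -> (N <= j)%N -> nrm (v i - v j) < e) ->
  exists l : V, (fun i => nrm (v i - l)) @ \oo --> (0 : R).
Proof.
move=> cv; have m00 := energy_density_m0 hE; have M00 := energy_density_M0 hE.
have e8 (i : nat) : 0 < 8^-1 ^+ i :> R by rewrite exprn_gt0.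
have hN (i : nat) : exists N, forall p q, (N <= p)%N -> (N <= q)%N ->
    (L2sq mu (fun z => res (L2repr (v p)) z - res (L2repr (v q)) z)%R <= (8^-1 ^+ i)%:E)%E.
  have c0 : 0 < m0 / 2 * 8^-1 ^+ i by rewrite !mulr_gt0.
  have [|N hN] := cv (Num.sqrt (m0 / 2 * 8^-1 ^+ i)); first by rewrite sqrtr_gt0.
  exists N => p q Np Nq; have := hN p q Np Nq.
  rewrite /nrm ltr_sqrt// sqnrm_energy_sub => lt.
  have [h _] := form_bounds (L2repr (v p) - L2repr (v q)).
  rewrite -(@lee_pmul2l _ m0%:E) ?lte_fin//.
  have -> : L2sq mu (fun z => res (L2repr (v p)) z - res (L2repr (v q)) z) =
      L2sq mu (res (L2repr (v p) - L2repr (v q))).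
    by apply: eq_integral => z _; rewrite resB.
  apply: (le_trans h); rewrite -EFinM lee_fin.
  move: lt; move: (8^-1 ^+ i) (reK _) => c r; lra.
have [N {}hN] := choice hN.
(* Partial sums of the thresholds: an index that is nondecreasing and beyond every threshold so
   far. *)
pose idx m := (\sum_(i < m.+1) N i)%N.
have idxN m : (N m <= idx m)%N by rewrite /idx big_ord_recr/= leq_addl.
have idxS m : (idx m <= idx m.+1)%N by rewrite /idx [leqRHS]big_ord_recr/= leq_addr.
pose G m := res (L2repr (v (idx m))).
have mG m : wmeas (G m) := (res_sqint _).1.
have dG m : (L2sq mu (fun z => G m.+1 z - G m z)%R <= (1 * 8^-1 ^+ m)%:E)%E.
  by rewrite mul1r; apply: hN => //; exact: leq_trans (idxS m).
pose l : measurableTypeR R -> E := flim G.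
have ml : wmeas l := wmeas_flim eH sE mG.
have Gl m : (L2sq mu (fun z => G m z - l z)%R <= (4 * 8^-1 ^+ m)%:E)%E.
  by have := L2sq_flim eH sE mG dG m; rewrite mulr1.
have sl : sqint mu l.
  rewrite (_ : l = fun z => G 0%N z - (G 0%N z - l z)); last first.
    by apply/funext => z; rewrite subKr.
  apply: sqintB => //; first exact: res_sqint.
  split; first exact: wmeasB.
  by apply: (le_lt_trans (Gl 0%N)); rewrite ltry.
have sql : square_integrable a b (l : R -> 'cV[K]_n).
  apply/sq_integrableP; split; first exact: vrestr_wmeas.
  apply: le_lt_trans sl.2; apply: ge0_le_integral => //.
  - by move=> z _; rewrite lee_fin sqnrm_ge0.
  - by apply: emeasurable_sqnrm => //; exact: vrestr_wmeas.
  - exact: emeasurable_sqnrm.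
  - by move=> z _; rewrite lee_fin /vrestr; case: asboolP => // _; rewrite sqnrm0// sqnrm_ge0.
have lP : (l : R -> 'cV[K]_n) \in @L2fun_pred R k a b n by exact/asboolP.
pose lf : L2f := MkL2fun lP.
exists (L2class lf : V).
(* [L2sq_dist] gives 2 + 2 * 4 = 10, and the factor 1/2 of the energy form leaves 5. *)
have near_l m p : (idx m <= p)%N -> sqnrm (v p - (L2class lf : V)) <= 5 * M0 * 8^-1 ^+ m.
  move=> mp; rewrite sqnrm_energy_sub.
  rewrite (@reK_form_ae _ (L2repr (v p) - lf) _ (L2repr (v p) - lf)); last 2 first.
  - by apply: (@filterS _ _ FF _ _ _ (L2repr_class lf)) => z h zI; congr (_ - _); exact: h.
  - by apply: (@filterS _ _ FF _ _ _ (L2repr_class lf)) => z h zI; congr (_ - _); exact: h.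
  have [_ h] := form_bounds (L2repr (v p) - lf).
  suff h2 : (L2sq mu (res (L2repr (v p) - lf)%R) <= (10 * 8^-1 ^+ m)%:E)%E.
    have := le_trans h (lee_wpmul2l _ h2).
    rewrite lee_fin (ltW M00) -EFinM lee_fin => /(_ isT).
    by move: (reK _) (8^-1 ^+ m) => r c; lra.
  apply: (@le_trans _ _ (L2sq mu (fun z => res (L2repr (v p)) z - l z))).
    apply: ge0_le_integral => //.
    - by move=> z _; rewrite lee_fin sqnrm_ge0.
    - by apply: emeasurable_sqnrm => //; exact: (res_sqint _).1.
    - by apply: emeasurable_sqnrm => //; apply: wmeasB => //; exact: (res_sqint _).1.
    - move=> z _; rewrite lee_fin resB /res /vrestr; case: asboolP => // _.
      by rewrite subrr sqnrm0// sqnrm_ge0.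
  apply: (le_trans (L2sq_dist eH sE mu (res_sqint _).1 (mG m) ml)).
  have -> : ((10 * 8^-1 ^+ m)%:E = 2%:E * (8^-1 ^+ m)%:E + 2%:E * (4 * 8^-1 ^+ m)%:E :> \bar R)%E.
    by rewrite -!EFinM -EFinD; congr EFin; move: (8^-1 ^+ m) => c; ring.
  apply: leeD; rewrite lee_wpmul2l//.
  by apply: hN; [exact: leq_trans mp|exact: idxN].
apply/cvgrPdist_lt => e e0.
have [|m hm] := @exp8_small R (5 * M0) (e ^+ 2) _ (exprn_gt0 2 e0); first by rewrite mulr_ge0// ltW.
exists (idx m) => // p /= mp; rewrite sub0r normrN ger0_norm ?nrm_ge0//.
rewrite -(gtr0_norm e0) -sqrtr_sqr /nrm ltr_sqrt ?exprn_gt0//.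
exact: le_lt_trans (near_l m p mp) hm.
Qed.

Lemma energy_hilbert : hilbert V.
Proof.
split.
- move=> c x y z; rewrite /= !energy_ipE -form_linear; apply: form_ae; first exact: L2repr_linear.
  by apply: (@filterE _ _ FF).
- by move=> x y; rewrite /= !energy_ipE form_conj.
- exact: sqnrm_energy_ge0.
- exact: energy_eq0.
- exact: energy_complete.
Qed.

Lemma cst_sqint (A : set R) (e : E) : measurable (A : set (measurableTypeR R)) ->
  square_integrable a b (fun z => if `[< A z >] then e : 'cV[K]_n else 0).
Proof.
move=> mA; apply/sq_integrableP.
have m1 : wmeas (fun z : measurableTypeR R => if `[< A z >] then e else 0).
  by apply: wmeas_if => //; exact: wmeas_cst.
split; first exact: vrestr_wmeas.
apply: (@le_lt_trans _ _ (\int[mu]_(z in I) (sqnrm e)%:E)%E); last first.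
  rewrite integral_cst//= lte_mul_pinfty// ?lee_fin ?sqnrm_ge0//.
  by rewrite lebesgue_measure_itv/=; case: ifP => _; rewrite -?EFinB ltry.
rewrite /L2sq -(integral_vrestr _ _ (sqnrm0 eH)); apply: ge0_le_integral => //.
- by move=> z _; rewrite lee_fin sqnrm_ge0.
- by apply: measurable_funTS; exact: emeasurable_sqnrm.
- by move=> z _; rewrite lee_fin; case: asboolP => // _; rewrite sqnrm0// sqnrm_ge0.
Qed.

Definition half_line (j : 'I_n) (q : rat) : R -> 'cV[K]_n :=
  fun z => if `[< [set s : R | s <= ratr q] z >] then delta_mx j 0 else 0.

Lemma half_line_L2 j q : half_line j q \in @L2fun_pred R k a b n.
Proof.
apply/asboolP; apply: (cst_sqint (delta_mx j 0 : 'cV[K]_n)).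
by rewrite (_ : [set s | _] = `]-oo, (ratr q : R)]%classic)//; apply/seteqP; split=> s; rewrite /= in_itv.
Qed.

Definition half_line_fun j q : L2f := MkL2fun (half_line_L2 j q).

(** The total family consists of the coordinate vectors times indicators of half-lines with rational
    endpoint. If [x] is orthogonal to it, the components of the weighted function have primitives
    vanishing at all rationals, so that function is 0 almost everywhere by [ae_zero_of_primitive];
    then [form] vanishes at [x] and definiteness gives [x = 0]. *)
Lemma energy_separable : separable V.
Proof.
pose e (i : nat) : V := if unpickle i is Some jq
  then L2class (half_line_fun (jq : 'I_n * rat).1 jq.2) else 0.
suff te : total e by exact: (onb_separable energy_hilbert (gram_schmidt_onb energy_hilbert te)).
move=> x hx; apply: energy_eq0; rewrite /= energy_ipE; apply: form_eq0.
have hq j q : form (L2repr x) (half_line_fun j q) = 0.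
  have := hx (pickle (j, q)); rewrite /e pickleK /= energy_ipE => <-.
  apply: form_ae; first exact: (@filterE _ _ FF).
  by apply: (@filterS _ _ FF _ _ _ (L2repr_class (half_line_fun j q))) => z h zI; rewrite h.
pose W := vrestr I (weighted (L2repr x)).
have sW : sqint mu (W : measurableTypeR R -> E) := weighted_sqint _.
have comp (phi : E -> R) (d : E) : (forall y : E, phi y = rip y d) ->
    (forall q : rat, Rintegral mu I (fun z => (z <= ratr q)%R%:R * phi (weighted (L2repr x) z)) = 0) ->
    {ae mu, forall z, phi (W z) = 0}.
  move=> phiE hphi; apply: ae_zero_of_primitive.
    have i1 : sqint mu (vrestr I (fun=> d) : measurableTypeR R -> E).
      apply/sq_integrableP; have := cst_sqint d (measurableT : measurable (setT : set (measurableTypeR R))).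
      by under [X in square_integrable _ _ X -> _]eq_fun do rewrite asboolT//.
    have := sqint_rip eH sE sW i1; apply: eq_integrable => // z _ /=; congr EFin.
    by rewrite phiE /W /vrestr; case: asboolP => // _; rewrite !rip0l.
  move=> q; rewrite -(hphi q) [RHS]Rintegral_mkcond; apply: eq_Rintegral => z _.
  rewrite patchE /W /vrestr; case: (boolP (z \in _)); first by move=> /set_mem zI; rewrite asboolT.
  by rewrite notin_setE => zI; rewrite asboolF// phiE rip0l// mulr0.
have re j : {ae mu, forall z, reK ((W z : 'cV[K]_n) j 0) = 0}.
  apply: (comp (fun y : E => reK ((y : 'cV[K]_n) j 0)) (delta_mx j 0 : 'cV[K]_n)).
    by move=> y; rewrite euclid_rip_delta.
  move=> q; have := congr1 (@reK R k) (hq j q); rewrite reK_form reK0 => /eqP.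
  rewrite mulf_eq0 invr_eq0 pnatr_eq0/= => /eqP h; rewrite -[RHS]h; apply: eq_Rintegral => z _.
  rewrite /= /half_line; case: asboolP => /= h1; first by rewrite h1 mul1r euclid_rip_delta.
  by rewrite (negbTE (introN idP h1)) mul0r rip0r.
have im j : {ae mu, forall z, imK ((W z : 'cV[K]_n) j 0) = 0}.
  apply: (comp (fun y : E => imK ((y : 'cV[K]_n) j 0)) (iK *: (delta_mx j 0 : 'cV[K]_n))).
    by move=> y; rewrite euclid_rip_idelta.
  move=> q; have := congr1 (@imK R k) (hq j q); rewrite imK_form reK_form imK0 => /eqP.
  rewrite mulf_eq0 invr_eq0 pnatr_eq0/= => /eqP h; rewrite -[RHS]h; apply: eq_Rintegral => z _.
  rewrite [RHS](_ : _ = rip (weighted (L2repr x) z) (iK *: (half_line j q z : E)))//.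
  rewrite /half_line; case: asboolP => /= h1.
    by rewrite h1 mul1r euclid_rip_idelta.
  by rewrite (negbTE (introN idP h1)) mul0r scaler0 rip0r.
have all : {ae mu, forall z, forall j, reK ((W z : 'cV[K]_n) j 0) = 0 /\ imK ((W z : 'cV[K]_n) j 0) = 0}.
  by apply: filter_forall => j; apply: (@filterS2 _ _ FF _ _ _ _ (re j) (im j)).
apply: (@filterS _ _ FF _ _ _ all) => z h zI; apply/matrixP => j i; rewrite ord1.
have := h j; rewrite /W /vrestr asboolT// => -[h1 h2].
by apply: scal_eq; rewrite ?h1 ?h2 mxE ?reK0 ?imK0.
Qed.

End EnergySpace.

Theorem theorem2p2 (R : realType) (k : RorC) (T a b : R) (n m p : nat)
  (m0 M0 : R) (Hm : R -> 'M[scal R k]_n)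
  (d : measure_display) (Omega : measurableType d) (P : probability Omega R)
  (F : R -> set_system Omega)
  (Z : ipSpace R k) (Q : Z -> Z) (w : R -> Omega -> Z)
  (H : Z -> energy_space a b Hm)
  (cA : unbounded_op (energy_space a b Hm) (energy_space a b Hm))
  (cB : unbounded_op (energy_space a b Hm) (euclid R k m))
  (cC : unbounded_op (energy_space a b Hm) (euclid R k p))
  (S : R -> energy_space a b Hm -> energy_space a b Hm)
  (B : euclid R k m -> energy_space a b Hm)
  (u u' : R -> Omega -> euclid R k m)
  (eps0 : Omega -> energy_space a b Hm) :
  0 < T -> a < b ->
  energy_density a b m0 M0 Hm ->
  usual_filtration P F ->
  BCO_system P F cA cB cC S B Q w H ->
  C2_process P F T u u' ->
  random_element (F 0) eps0 ->
  gaussian P eps0 ->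
  independent_of_process P eps0 w ->
  (forall omega, op_dom cA (eps0 omega)) ->
  {ae P, forall omega, u 0 omega = cB (eps0 omega)} ->
  let f := fun (t : R) (omega : Omega) => cA (B (u t omega)) - B (u' t omega) in
  let X0 := fun omega : Omega => eps0 omega - B (u 0 omega) in
  let weak := weak_solution P T (kernel_dom cA cB) cA H w f X0 in
  let mild := mild_solution P F T S H Q w f X0 in
  (exists X : R -> Omega -> energy_space a b Hm,
    [/\ weak X,
        mild_formula P T S H Q w f X0 X &
        forall Y, weak Y ->
          forall t, 0 <= t <= T -> {ae P, forall omega, Y t omega = X t omega}]) /\
  (forall Y : R -> Omega -> energy_space a b Hm, weak Y <-> mild Y).
Proof.
move=> T0 ab hE uF bco cu re ge _ _ _ f X0 weak mild.
have hX := energy_hilbert hE; have sX := energy_separable hE.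
have hV := euclid_hilbert R k m; have sV := euclid_separable R k m.
have hZ := BCO_hilbert bco; have sZ := BCO_separable bco.
have gS := BCO_generates bco; have Hb := BCO_noise bco.
have wW := BCO_wiener bco; have cQ := BCO_covariance bco.
have Bb := BCO_lift_bounded bco.
(* The forcing is a bounded operator applied to [u] minus another applied to [u'], namely the
   composite of [cA] with [B], and [B] itself. *)
have [g fg] := forcing_exists hV sV hX sX uF T0 cu (BCO_lift_op bco) Bb.
have ru : random_element (F 0) (u 0) by apply: (C2_adapted cu); rewrite /= in_itv/= lexx ltW.
have rX0 : random_element (F 0) X0.
  apply/(sigma_random_element hX sX _ (filtration_sigma uF (lexx 0))).
  apply: (@wmeasB _ _ _ hX _ (g_sigma_algebraType (F 0))).
    exact: (filtration_wmeas uF hX sX (lexx 0) (lexx 0) re).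
  apply: (@wmeas_bounded_linear _ _ _ _ _ _ (g_sigma_algebraType (F 0)) _ hV hX Bb).
  exact: (filtration_wmeas uF hV sV (lexx 0) (lexx 0) ru).
have fX0 : (L2sq P X0 < +oo)%E.
  apply: (sqintB hX sX (gaussian_sqint hX sX ge) _).2.
  apply: (sqint_bounded_linear hV sV hX sX Bb); split.
    by apply/(random_elementP hV sV) => U bU; exact: (filtration_sub uF (lexx 0)) (ru U bU).
  by have := C2_moment cu (t := 0); rewrite lexx ltW// unlock; exact.
split; first exact: (weak_exists_unique hZ sZ hX sX uF cQ wW gS Hb T0 fg rX0 fX0).
exact: (weak_mild hZ sZ hX sX uF cQ wW gS Hb T0 fg rX0 fX0).
Qed.
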